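(* Let $\alpha,\beta\in(-1,1)$, let $\gamma,\delta\in[0,\pi)$, and let $T_{\gamma,\delta,\alpha,\beta}$ be the self-adjoint realization of $\tau_{\alpha,\beta}$ in $L^2((-1,1);(1-x)^\alpha(1+x)^\beta dx)$ with domain $\{g\in\operatorname{dom}(T_{max,\alpha,\beta}) : \sin(\gamma)\widetilde g^{\,\prime}(-1)+\cos(\gamma)\widetilde g(-1)=0,\ \sin(\delta)\widetilde g^{\,\prime}(1)+\cos(\delta)\widetilde g(1)=0\}$. For $z\in\rho(T_{\gamma,\delta,\alpha,\beta})$ put $$Y_j(z)=\cos(\delta)\,\widetilde y_{j,\alpha,\beta,-1}(z,1)+\sin(\delta)\,\widetilde y_{j,\alpha,\beta,-1}^{\,\prime}(z,1),\qquad j=1,2.$$ Then the Weyl--Titchmarsh--Kodaira $m$-function of $T_{\gamma,\delta,\alpha,\beta}$ is $$m_{\gamma,\delta,\alpha,\beta}(z)=\begin{cases}\dfrac{\beta2^{\alpha+1}\cos(\gamma)Y_1(z)-\sin(\gamma)Y_2(z)}{\beta2^{\alpha+1}\sin(\gamma)Y_1(z)+\cos(\gamma)Y_2(z)}, & \beta\in(-1,0),\\[3mm] \dfrac{-2^{\alpha+1}\sin(\gamma)Y_1(z)+\cos(\gamma)Y_2(z)}{2^{\alpha+1}\cos(\gamma)Y_1(z)+\sin(\gamma)Y_2(z)}, & \beta=0,\\[3mm] \dfrac{\beta2^{\alpha+1}\sin(\gamma)Y_1(z)+\cos(\gamma)Y_2(z)}{-\beta2^{\alpha+1}\cos(\gamma)Y_1(z)+\sin(\gamma)Y_2(z)},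 & \beta\in(0,1),\end{cases}$$ for $z\in\rho(T_{\gamma,\delta,\alpha,\beta})$. The (necessarily simple) poles of $m_{\gamma,\delta,\alpha,\beta}$ occur precisely at the (necessarily simple) eigenvalues of $T_{\gamma,\delta,\alpha,\beta}$.
   Context: For $\alpha,\beta\in\mathbb{R}$ the Jacobi differential expression is $\tau_{\alpha,\beta}f(x)=-(1-x)^{-\alpha}(1+x)^{-\beta}\frac{d}{dx}\big[(1-x)^{\alpha+1}(1+x)^{\beta+1}f'(x)\big]$, $x\in(-1,1)$, with weight $r_{\alpha,\beta}(x)=(1-x)^\alpha(1+x)^\beta$, $p_{\alpha,\beta}(x)=(1-x)^{\alpha+1}(1+x)^{\beta+1}$ and quasi-derivative $f^{[1]}=p_{\alpha,\beta}f'$. The maximal operator $T_{max,\alpha,\beta}$ acts as $\tau_{\alpha,\beta}$ on all $f\in L^2((-1,1);r_{\alpha,\beta}dx)$ with $f,f^{[1]}$ locally absolutely continuous on $(-1,1)$ and $\tau_{\alpha,\beta}f\in L^2((-1,1);r_{\alpha,\beta}dx)$. For $\alpha,\beta\in(-1,1)$ the generalized boundary values of such $g$ (or of any $g$ lying locally in this domain near the endpoint) are: at $-1$: if $\beta\in(-1,0)$: $\widetilde g(-1)=g(-1)$, $\widetilde g^{\,\prime}(-1)=g^{[1]}(-1)$; if $\beta=0$: $\widetilde g(-1)=-2^{\alpha+1}\lim_{x\downarrow-1}g(x)/\ln((1+x)/2)$, $\widetilde g^{\,\prime}(-1)=\lim_{x\downarrow-1}[g(x)+\widetilde g(-1)2^{-\alpha-1}\ln((1+x)/2)]$;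 if $\beta\in(0,1)$: $\widetilde g(-1)=\beta2^{\alpha+1}\lim_{x\downarrow-1}(1+x)^\beta g(x)$, $\widetilde g^{\,\prime}(-1)=\lim_{x\downarrow-1}[g(x)-\widetilde g(-1)2^{-\alpha-1}\beta^{-1}(1+x)^{-\beta}]$; at $1$: if $\alpha\in(-1,0)$: $\widetilde g(1)=g(1)$, $\widetilde g^{\,\prime}(1)=g^{[1]}(1)$; if $\alpha=0$: $\widetilde g(1)=2^{\beta+1}\lim_{x\uparrow1}g(x)/\ln((1-x)/2)$, $\widetilde g^{\,\prime}(1)=\lim_{x\uparrow1}[g(x)-\widetilde g(1)2^{-\beta-1}\ln((1-x)/2)]$; if $\alpha\in(0,1)$: $\widetilde g(1)=-\alpha2^{\beta+1}\lim_{x\uparrow1}(1-x)^\alpha g(x)$, $\widetilde g^{\,\prime}(1)=\lim_{x\uparrow1}[g(x)+\widetilde g(1)2^{-\beta-1}\alpha^{-1}(1-x)^{-\alpha}]$. Weyl--Titchmarsh--Kodaira $m$-function: for $z\in\mathbb{C}$ let $\varphi_\gamma(z,\cdot),\vartheta_\gamma(z,\cdot)$ be the solutions of $\tau_{\alpha,\beta}u=zu$ with $\widetilde\varphi_\gamma(z,-1)=-\sin\gamma$, $\widetilde\varphi_\gamma^{\,\prime}(z,-1)=\cos\gamma$, $\widetilde\vartheta_\gamma(z,-1)=\cos\gamma$, $\widetilde\vartheta_\gamma^{\,\prime}(z,-1)=\sin\gamma$; $m_{\gamma,\delta,\alpha,\beta}(z)$ is the number such that $\vartheta_\gamma(z,\cdot)+m_{\gamma,\delta,\alpha,\beta}(z)\varphi_\gamma(z,\cdot)$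 satisfies the $\delta$-boundary condition at $1$, i.e. $m=-\frac{\cos\delta\,\widetilde\vartheta_\gamma(z,1)+\sin\delta\,\widetilde\vartheta_\gamma^{\,\prime}(z,1)}{\cos\delta\,\widetilde\varphi_\gamma(z,1)+\sin\delta\,\widetilde\varphi_\gamma^{\,\prime}(z,1)}$. Solutions: let $\sigma_{\alpha,\beta}(z)=[(1+\alpha+\beta)^2+4z]^{1/2}$, $a_{\mu,\nu,\pm\sigma}=(1+\mu+\nu\pm\sigma)/2$, ${}_2F_1$ the Gauss hypergeometric function, $(c)_n$ the Pochhammer symbol, $\psi=\Gamma'/\Gamma$, $\gamma_E=-\psi(1)$. Then $y_{1,\alpha,\beta,-1}(z,x)={}_2F_1(a_{\alpha,\beta,\sigma_{\alpha,\beta}(z)},a_{\alpha,\beta,-\sigma_{\alpha,\beta}(z)};1+\beta;(1+x)/2)$; for $\beta\neq0$, $y_{2,\alpha,\beta,-1}(z,x)=(1+x)^{-\beta}{}_2F_1(a_{\alpha,-\beta,\sigma_{\alpha,\beta}(z)},a_{\alpha,-\beta,-\sigma_{\alpha,\beta}(z)};1-\beta;(1+x)/2)$; for $\beta=0$, writing $a_\pm=a_{\alpha,0,\pm\sigma_{\alpha,0}(z)}$, $y_{2,\alpha,0,-1}(z,x)={}_2F_1(a_+,a_-;1;(1+x)/2)\ln((1+x)/2)+\sum_{n\ge1}\frac{(a_+)_n(a_-)_n}{2^n(n!)^2}(1+x)^n[\psi(a_++n)-\psi(a_+)+\psi(a_-+n)-\psi(a_-)-2\psi(n+1)-2\gamma_E]$.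 The quantities $\widetilde y_{j,\alpha,\beta,-1}(z,1)$, $\widetilde y_{j,\alpha,\beta,-1}^{\,\prime}(z,1)$ are the generalized boundary values at $1$ of these solutions. *)

(* Defs.v *)
From Stdlib Require Import Reals Factorial ClassicalEpsilon.
From Coquelicot Require Import Coquelicot.
From mathcomp Require all_boot all_algebra all_classical all_reals all_analysis.
From mathcomp Require Rstruct Rstruct_topology.

Set Implicit Arguments.
Unset Strict Implicit.

Local Open Scope R_scope.

Definition in11 (x : R) : Prop := -1 < x /\ x < 1.

Module MC.
Import mathcomp.boot.all_boot mathcomp.algebra.all_algebra
  mathcomp.classical.all_classical mathcomp.reals.all_reals
  mathcomp.analysis.all_analysis mathcomp.reals_stdlib.Rstruct
  mathcomp.analysis_stdlib.Rstruct_topology.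
Local Open Scope classical_set_scope.

Definition ae11 (P : R -> Prop) : Prop :=
  almost_everywhere (@lebesgue_measure R) (fun x => in11 x -> P x).

Definition meas (h : R -> R) : Prop :=
  measurable_fun [set: measurableTypeR R]
    (h : measurableTypeR R -> measurableTypeR R).

Definition integ11 (h : R -> R) : Prop :=
  (@lebesgue_measure R).-integrable [set x | in11 x] (fun x => (h x)%:E).
End MC.

Local Open Scope C_scope.

Definition r_ab (al be x : R) : R := (Rpower (1 - x) al * Rpower (1 + x) be)%R.
Definition p_ab (al be x : R) : R :=
  (Rpower (1 - x) (al + 1) * Rpower (1 + x) (be + 1))%R.

Definition L2w (al be : R) (f : R -> C) : Prop :=
  MC.meas (fun x => Re (f x)) /\ MC.meas (fun x => Im (f x)) /\
  MC.integ11 (fun x => (Cmod (f x) ^ 2 * r_ab al be x)%R).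

Definition ACloc (g : R -> C) : Prop :=
  forall a b : R, -1 < a -> a <= b -> b < 1 ->
  forall eps : R, 0 < eps -> exists del : R, 0 < del /\
    forall (n : nat) (s t : nat -> R),
      a <= s O ->
      (forall k, (k <= n)%nat -> s k <= t k) ->
      (forall k, (k < n)%nat -> t k <= s (S k)) ->
      t n <= b ->
      sum_n (fun k => t k - s k)%R n < del ->
      sum_n (fun k => Cmod (g (t k) - g (s k))) n < eps.

(** g together with its quasi-derivative G = g^[1] = p g': both locally
    absolutely continuous and g' = G/p a.e. on (-1,1). *)
Definition quasi (al be : R) (g G : R -> C) : Prop :=
  ACloc g /\ ACloc G /\
  MC.ae11 (fun x => is_derive g x (RtoC (/ p_ab al be x) * G x)).

(** g in dom(T_max) with quasi-derivative G and tau g = h (a.e.). *)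
Definition dom_max (al be : R) (g G h : R -> C) : Prop :=
  L2w al be g /\ quasi al be g G /\ L2w al be h /\
  MC.ae11 (fun x => is_derive G x (- (RtoC (r_ab al be x) * h x))).

Definition sol (al be : R) (z : C) (u U : R -> C) : Prop :=
  quasi al be u U /\
  MC.ae11 (fun x => is_derive U x (- (RtoC (r_ab al be x) * (z * u x)))).

(** Generalized boundary values at -1: gbvL al be g G a b means
    g~(-1) = a and g~'(-1) = b (the limits exist). *)
Definition gbvL (al be : R) (g G : R -> C) (a b : C) : Prop :=
  (be < 0 ->
     filterlim g (at_right (-1)) (locally a) /\
     filterlim G (at_right (-1)) (locally b)) /\
  (be = 0 ->
     filterlim (fun x => RtoC (- Rpower 2 (al + 1) / ln ((1 + x) / 2)) * g x)
       (at_right (-1)) (locally a) /\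
     filterlim (fun x => g x + a * RtoC (Rpower 2 (- al - 1) * ln ((1 + x) / 2)))
       (at_right (-1)) (locally b)) /\
  (0 < be ->
     filterlim (fun x => RtoC (be * Rpower 2 (al + 1) * Rpower (1 + x) be) * g x)
       (at_right (-1)) (locally a) /\
     filterlim (fun x => g x - a * RtoC (Rpower 2 (- al - 1) * / be
                                           * Rpower (1 + x) (- be)))
       (at_right (-1)) (locally b)).

Definition gbvR (al be : R) (g G : R -> C) (a b : C) : Prop :=
  (al < 0 ->
     filterlim g (at_left 1) (locally a) /\
     filterlim G (at_left 1) (locally b)) /\
  (al = 0 ->
     filterlim (fun x => RtoC (Rpower 2 (be + 1) / ln ((1 - x) / 2)) * g x)
       (at_left 1) (locally a) /\
     filterlim (fun x => g x - a * RtoC (Rpower 2 (- be - 1) * ln ((1 - x) / 2)))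
       (at_left 1) (locally b)) /\
  (0 < al ->
     filterlim (fun x => RtoC (- al * Rpower 2 (be + 1) * Rpower (1 - x) al) * g x)
       (at_left 1) (locally a) /\
     filterlim (fun x => g x + a * RtoC (Rpower 2 (- be - 1) * / al
                                           * Rpower (1 - x) (- al)))
       (at_left 1) (locally b)).

Definition dom_T (ga de al be : R) (g G h : R -> C) : Prop :=
  dom_max al be g G h /\
  (exists a b, gbvL al be g G a b /\ RtoC (sin ga) * b + RtoC (cos ga) * a = 0) /\
  (exists a b, gbvR al be g G a b /\ RtoC (sin de) * b + RtoC (cos de) * a = 0).

Definition in_resolvent (ga de al be : R) (z : C) : Prop :=
  (forall f, L2w al be f ->
     exists g G h, dom_T ga de al be g G h /\ MC.ae11 (fun x => h x - z * g x = f x)) /\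
  (forall g1 G1 h1 g2 G2 h2,
     dom_T ga de al be g1 G1 h1 -> dom_T ga de al be g2 G2 h2 ->
     MC.ae11 (fun x => h1 x - z * g1 x = h2 x - z * g2 x) ->
     MC.ae11 (fun x => g1 x = g2 x)).

Definition eigenfun (ga de al be : R) (z : C) (g G h : R -> C) : Prop :=
  dom_T ga de al be g G h /\ ~ MC.ae11 (fun x => g x = 0) /\
  MC.ae11 (fun x => h x = z * g x).

Definition is_eigenvalue (ga de al be : R) (z : C) : Prop :=
  exists g G h, eigenfun ga de al be z g G h.

Definition simple_eigenvalue (ga de al be : R) (z : C) : Prop :=
  is_eigenvalue ga de al be z /\
  forall g1 G1 h1 g2 G2 h2,
    eigenfun ga de al be z g1 G1 h1 -> eigenfun ga de al be z g2 G2 h2 ->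
    exists c : C, MC.ae11 (fun x => g2 x = c * g1 x).

Definition phi_spec (ga al be : R) (z : C) (u U : R -> C) : Prop :=
  sol al be z u U /\ gbvL al be u U (RtoC (- sin ga)) (RtoC (cos ga)).
Definition theta_spec (ga al be : R) (z : C) (u U : R -> C) : Prop :=
  sol al be z u U /\ gbvL al be u U (RtoC (cos ga)) (RtoC (sin ga)).

Definition is_m (ga de al be : R) (z m : C) : Prop :=
  (exists ph Ph th Th, phi_spec ga al be z ph Ph /\ theta_spec ga al be z th Th) /\
  forall ph Ph th Th, phi_spec ga al be z ph Ph -> theta_spec ga al be z th Th ->
    exists aph bph ath bth,
      gbvR al be ph Ph aph bph /\ gbvR al be th Th ath bth /\
      m = - (RtoC (cos de) * ath + RtoC (sin de) * bth)
          / (RtoC (cos de) * aph + RtoC (sin de) * bph).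

Definition m_fun (ga de al be : R) (z : C) : C :=
  epsilon (inhabits (RtoC 0)) (fun m => is_m ga de al be z m).

Definition is_pole (f : C -> C) (S : C -> Prop) (z0 : C) : Prop :=
  (exists eps : R, 0 < eps /\
     forall z, 0 < Cmod (z - z0) < eps -> S z /\ ex_derive f z) /\
  filterlim (fun z => Cmod (f z)) (locally' z0) (Rbar_locally p_infty).

Definition simple_pole (f : C -> C) (S : C -> Prop) (z0 : C) : Prop :=
  is_pole f S z0 /\
  exists l : C, l <> 0 /\ filterlim (fun z => (z - z0) * f z) (locally' z0) (locally l).

(** Principal complex square root. *)
Definition Csqrt (w : C) : C :=
  (sqrt ((Cmod w + Re w) / 2),
   (if Rlt_dec (Im w) 0 then -1 else 1) * sqrt ((Cmod w - Re w) / 2))%R.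

Fixpoint poch (c : C) (n : nat) : C :=
  match n with O => 1 | S k => poch c k * (c + RtoC (INR k)) end.
Fixpoint dpoch (c : C) (n : nat) : C :=
  match n with O => 0 | S k => dpoch c k * (c + RtoC (INR k)) + poch c k end.
Fixpoint harm (n : nat) : R :=
  match n with O => 0%R | S k => (harm k + / INR (S k))%R end.

Definition CSeries (u : nat -> C) : C :=
  (Series (fun n => Re (u n)), Series (fun n => Im (u n))).

Definition F21 (a b c : C) (w : R) : C :=
  CSeries (fun n => poch a n * poch b n / (poch c n * RtoC (INR (fact n)))
                    * RtoC (w ^ n)).

Definition sigma_ab (al be : R) (z : C) : C :=
  Csqrt (RtoC ((1 + al + be) ^ 2) + 4 * z).
Definition a_par (mu nu : R) (s : C) : C := (RtoC (1 + mu + nu) + s) / 2.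

Definition y1 (al be : R) (z : C) (x : R) : C :=
  F21 (a_par al be (sigma_ab al be z)) (a_par al be (- sigma_ab al be z))
      (RtoC (1 + be)) ((1 + x) / 2).

Definition y2 (al be : R) (z : C) (x : R) : C :=
  if Req_EM_T be 0 then
    let ap := a_par al 0 (sigma_ab al 0 z) in
    let am := a_par al 0 (- sigma_ab al 0 z) in
    let w := ((1 + x) / 2)%R in
    F21 ap am 1 w * RtoC (ln w) +
    CSeries (fun n =>
      (dpoch ap n * poch am n + poch ap n * dpoch am n
       - poch ap n * poch am n * RtoC (2 * harm n))
      / RtoC (INR (fact n) ^ 2) * RtoC (w ^ n))
  else
    RtoC (Rpower (1 + x) (- be)) *
    F21 (a_par al (- be) (sigma_ab al be z)) (a_par al (- be) (- sigma_ab al be z))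
        (RtoC (1 - be)) ((1 + x) / 2).

(* Main.v *)
Require Import Defs.
From Stdlib Require Import Reals Lra Lia Arith ZArith ClassicalEpsilon.
From Coquelicot Require Import Coquelicot.
From mathcomp Require all_boot all_order all_algebra all_classical all_reals all_analysis.
From mathcomp Require measurable_realfun.
From mathcomp Require Rstruct Rstruct_topology lra.

(* Near -1 a fundamental system of the equation is v1 = y1 and v2, a multiple of y2 normalized to have Wronskian
   W(v2,v1) = 1; reflecting x to -x gives the analogous system t1, t2 at 1. Wronskians of solutions are constant,
   so every locally absolutely continuous solution is a combination of v1, v2 (and of t1, t2), and its generalized
   boundary values are read off its coefficients. Hence m = -N/D, where D(z) and N(z) are the delta-boundary forms
   at 1 of phi(z) and theta(z), and both are combinations of Y1 and Y2.

   Variation of constants, with coefficients that vanish at the endpoints, solves tau g - z g = f for f in L^2;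
   adding a multiple of phi shows that z is in the resolvent set when D(z) <> 0, while phi(z) is an
   eigenfunction when D(z) = 0. Lagrange's identity between phi(z) and the solution chi(z0) satisfying the
   boundary condition at 1 shows that D and N are differentiable with D'(z0) = -int r phi(z0) chi(z0). If D(z0) = 0
   then z0 is real and phi(z0) is real and a multiple of chi(z0), so D'(z0) <> 0 and the zero is simple;
   N(z0) <> 0 because W(phi,theta) does not vanish. *)

(** * Lebesgue integration *)

(** Membership in the maximal domain gives only local absolute continuity and derivatives almost
    everywhere, so the link with calculus is a monotonicity theorem: a locally absolutely continuous
    function whose derivative is nonnegative almost everywhere is nondecreasing. Integrals over
    $(-1,1)$ are represented by primitives with limits at both endpoints, and integral estimates
    become comparisons of increments. For $\beta\ge0$ one basis solution is unbounded at $-1$, so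
    boundary terms are controlled by rates. The exponent [kap] is positive, at least $\beta$ and
    strictly below $(1+\beta)/2$: the majorant of all solutions is then square integrable, and its
    products with the vanishing factors still tend to zero. The series depend on the numerator
    parameters only through their sum and product, and the product is affine in $z$; the square root
    in $\sigma$ thus disappears, and Lipschitz bounds in $z$ pass from coefficients to solutions. In
    Lagrange's identity they leave a remainder $O(|z-z_0|^2)$, which is how differentiability in $z$
    is obtained. *)

Module Leb.
Import mathcomp.boot.all_boot mathcomp.order.all_order mathcomp.algebra.all_algebra
  mathcomp.classical.all_classical mathcomp.reals.all_reals
  mathcomp.analysis.all_analysis mathcomp.analysis.measurable_realfun mathcomp.reals_stdlib.Rstruct
  mathcomp.analysis_stdlib.Rstruct_topology mathcomp.algebra_tactics.lra.
Import Order.TTheory GRing.Theory Num.Theory numFieldNormedType.Exports.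
Local Open Scope classical_set_scope.
Local Open Scope ring_scope.

Section IndefiniteIntegral.
Variable K : realType.
Notation mu := (@lebesgue_measure K).
Variable f : K -> K.
Hypothesis intf : mu.-integrable [set: K] (EFin \o f).
Let F (x : K) := (\int[mu]_(y in `]-oo, x]) f y)%R.

Let intfS (A : set K) : measurable A -> mu.-integrable A (EFin \o f).
Proof. by move=> mA; exact: integrableS intf. Qed.

Let intfN (A : set K) : measurable A -> mu.-integrable A (EFin \o (fun x => `|f x|)).
Proof. by move=> mA; apply: integrable_norm; exact: intfS. Qed.

Lemma integral_increment_le (s t : K) : s <= t ->
  `|F t - F s| <= \int[mu]_(y in `]s, t]) `|f y|.
Proof.
move=> st; rewrite /F.
have -> : [set` `]-oo, t]] = [set` `]-oo, s]] `|` [set` `]s, t]] :> set K.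
  apply/seteqP; split => y /=; rewrite !in_itv/=.
    by move=> yt; have [ys|sy] := leP y s; [left|right; rewrite yt].
  by case=> [/le_trans->//|/andP[]//].
rewrite Rintegral_setU//.
- by rewrite addrAC subrr add0r le_normr_Rintegral//; exact: intfS.
- by apply: intfS; apply: measurableU.
- apply/disj_set2P; apply/seteqP; split => // y [] /=; rewrite !in_itv/=.
  by move=> ys /andP[sy _]; move: (lt_le_trans sy ys); rewrite ltxx.
Qed.

Lemma integral_bounded (x : K) : `|F x| <= \int[mu]_(y in [set: K]) `|f y|.
Proof.
rewrite /F; apply: le_trans.
  by apply: le_normr_Rintegral => //; exact: intfS.
rewrite /Rintegral; apply: fine_le.
- by apply: integrable_fin_num => //; exact: intfN.
- by apply: integrable_fin_num => //; exact: intfN.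
- apply: ge0_subset_integral => //.
  by have := intfN [set: K] measurableT => /integrableP[].
Qed.

(** Absolute continuity of the set function $A\mapsto\int_A|f|$, applied to the union of the
    intervals $]s_k,t_k]$, whose measure is the sum of their lengths. *)
Lemma indefinite_integral_ac (e : K) : 0 < e -> exists2 d : K, 0 < d &
  forall (n : nat) (s t : nat -> K),
    (forall k, (k <= n)%N -> s k <= t k) ->
    (forall k, (k < n)%N -> t k <= s k.+1) ->
    \sum_(0 <= k < n.+1) (t k - s k) < d ->
    \sum_(0 <= k < n.+1) `|F (t k) - F (s k)| < e.
Proof.
move=> e0; have [d [d0 Hd]] := integral_normr_continuous intf e0.
exists d => // n s t st ts sd.
(* [A m] is the union of the first [m+1] intervals. Its inclusion in $]-\infty,t_m]$ is carried
   through the induction to make the next interval disjoint from it. *)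
pose A := fix A m : set K := if m is m'.+1 then A m' `|` [set` `]s m, t m]] else [set` `]s 0%N, t 0%N]].
have HA m : (m <= n)%N -> [/\ measurable (A m), A m `<=` [set` `]-oo, t m]],
    mu (A m) = (\sum_(0 <= k < m.+1) (t k - s k))%:E &
    \sum_(0 <= k < m.+1) `|F (t k) - F (s k)| <= \int[mu]_(y in A m) `|f y|].
  elim: m => [|m IH] mn.
    split => //=.
    - by move=> y /=; rewrite !in_itv/= => /andP[].
    - rewrite big_nat1 lebesgue_measure_itv/= lte_fin.
      case: ltP => h; first by rewrite EFinB.
      have -> : t 0%N = s 0%N by apply/eqP; rewrite eq_le h st.
      by rewrite subrr.
    - by rewrite big_nat1 integral_increment_le// st.
  have [mA sA muA IA] := IH (ltnW mn).
  have dis : A m `&` [set` `]s m.+1, t m.+1]] = set0.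
    apply/seteqP; split => // y [] /sA /=; rewrite !in_itv/= => yt /andP[sy _].
    by move: (lt_le_trans sy (le_trans yt (ts _ mn))); rewrite ltxx.
  split => //=.
  - exact: measurableU.
  - move=> y [/sA/=|/=]; rewrite !in_itv/=; last by case/andP.
    by move=> /le_trans -> //; apply: (le_trans (ts _ mn)); exact: st.
  - rewrite measureU// [in RHS]big_nat_recr//= EFinD muA lebesgue_measure_itv/= lte_fin.
    congr (_ + _)%E; case: ltP => h; first by rewrite EFinB.
    have -> : t m.+1 = s m.+1 by apply/eqP; rewrite eq_le h st.
    by rewrite subrr.
  - rewrite big_nat_recr//= Rintegral_setU//.
    + by apply: lerD => //; apply: integral_increment_le; exact: st.
    + by apply: intfN; exact: measurableU.
    + exact/disj_set2P.
have [mA sA muA IA] := HA n (leqnn n).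
by apply: (le_lt_trans IA); apply: Hd => //; move: sd; rewrite -lte_fin -muA.
Qed.

(** Lebesgue differentiation, put as a linear approximation with explicit $\varepsilon$ and
    $\delta$: in this form it passes between the two notions of derivative in use. *)
Lemma indefinite_integral_derivable :
  {ae mu, forall x, forall e : K, 0 < e -> exists2 d : K, 0 < d &
     forall y, `|y - x| < d -> `|F y - F x - f x * (y - x)| <= e * `|y - x|}.
Proof.
have lf : locally_integrable [set: K] f.
  have := @integrable_locally K f [set: K] measurableT intf.
  by rewrite patch_setT.
have := FTC1Ny (fun y => intfS _ (measurable_itv _)) lf.
apply: filterS; first exact: (ae_filter_ringOfSetsType mu).
move=> x [dF Ff] e e0.
have : (F (h + x) - F x) / h @[h --> 0^'] --> f x.
  move: dF => /cvg_ex [l]/= Hl.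
  have E : (fun h => h^-1 *: (F (h *: 1 + x) - F x)) =
           (fun h => (F (h + x) - F x) / h).
    by apply/funext => h; rewrite [h *: 1]mulr1 [_ *: _]mulrC.
  rewrite -Ff /derive1.
  have E2 : (fun h => h^-1 *: (F (h + x) - F x)) =
           (fun h => (F (h + x) - F x) / h).
    by apply/funext => h; rewrite [_ *: _]mulrC.
  rewrite /F in E2; rewrite E2; apply/cvg_ex; exists l; rewrite -E.
  exact: Hl.
move/cvgrPdist_le => /(_ e e0); rewrite near_withinE => -[d /= d0 Hd].
exists d => // y yd.
have [->|yx] := eqVneq y x; first by rewrite !subrr mulr0 subrr normr0 mulr0.
have h0 : y - x != 0 by rewrite subr_eq0.
have := Hd (y - x); rewrite /ball_/= sub0r normrN => /(_ yd h0).
rewrite subrK => H.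
rewrite (_ : _ - _ - _ = - (f x - (F y - F x) / (y - x)) * (y - x)).
  by rewrite normrM normrN ler_wpM2r.
by rewrite mulNr mulrBl divfK// opprB.
Qed.

End IndefiniteIntegral.

Lemma linear_approx_is_derive (K : realType) (F : K -> K) (x l : K) :
  (forall e : K, 0 < e -> exists2 d : K, 0 < d &
     forall y, `|y - x| < d -> `|F y - F x - l * (y - x)| <= e * `|y - x|) ->
  @derive.is_derive _ K^o K^o x 1 F l.
Proof.
move=> H.
have Hl : h^-1 *: (F (h *: 1 + x) - F x) @[h --> 0^'] --> l.
  apply/cvgrPdist_le => e e0; have [d d0 Hd] := H e e0.
  rewrite near_withinE; exists d => //= h; rewrite /ball_/= sub0r normrN => hd h0.
  have := Hd (h + x); rewrite addrK => /(_ hd); rewrite [h *: 1]mulr1 => Hh.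
  have nh : 0 < `|h| by rewrite normr_gt0.
  rewrite -(ler_pM2r nh) -normrM mulrBl [_ *: _]mulrC divfK//.
  by rewrite distrC.
apply: DeriveDef; first by apply/cvg_ex; exists l.
by apply: cvg_lim => //.
Qed.

(** Monotone convergence along compact intervals exhausting $]a,b[$: on each of them the fundamental
    theorem of calculus gives $\int v=V(b-e_n)-V(a+e_n)\le2C$. *)
Lemma integrable_of_primitive (K : realType) (a b C : K) (h v V : K -> K) :
  a < b -> measurable_fun ([set` Interval (BRight a) (BLeft b)] : set (measurableTypeR K))
    (h : measurableTypeR K -> measurableTypeR K) -> {in Interval (BRight a) (BLeft b), forall x, `|h x| <= v x} ->
  {in Interval (BRight a) (BLeft b), forall x, {for x, continuous v}} ->
  {in Interval (BRight a) (BLeft b), forall x, @derive.is_derive _ K^o K^o x 1 V (v x)} ->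
  {in Interval (BRight a) (BLeft b), forall x, `|V x| <= C} ->
  (@lebesgue_measure K).-integrable [set` Interval (BRight a) (BLeft b)] (EFin \o h).
Proof.
move=> ab mh hv cv dV VC.
have v0 x : x \in Interval (BRight a) (BLeft b) -> 0 <= v x.
  by move=> /hv; apply: le_trans.
have mv : measurable_fun ([set` Interval (BRight a) (BLeft b)] : set (measurableTypeR K))
  (v : measurableTypeR K -> measurableTypeR K).
  apply: subspace_continuous_measurable_fun => //.
  by apply: continuous_in_subspaceT => x; rewrite inE; exact: cv.
have mD : measurable ([set` Interval (BRight a) (BLeft b)] : set (measurableTypeR K)).
  exact: measurable_itv.
apply: (@le_integrable _ _ _ _ _ mD _ (EFin \o v)).
- exact/measurable_EFinP.
- by move=> x xab /=; rewrite lee_fin; apply: le_trans (hv _ xab) (ler_norm _).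
apply/integrableP; split; first exact/measurable_EFinP.
apply: (@le_lt_trans _ _ (C + C)%:E); last exact: ltry.
have -> : (\int[lebesgue_measure]_(x in [set` Interval (BRight a) (BLeft b)]) `|(EFin \o v) x| =
           \int[lebesgue_measure]_(x in [set` Interval (BRight a) (BLeft b)]) (v x)%:E)%E.
  by apply: eq_integral => x; rewrite inE => xab; rewrite /= ger0_norm ?v0.
(* The shift by 3 gives $e_n<(b-a)/2$ for every $n$, so that none of the intervals $[a+e_n,b-e_n]$
   is degenerate. *)
pose e (n : nat) : K := (b - a) / n.+3%:R.
have e0 n : 0 < e n by rewrite divr_gt0 ?subr_gt0.
have e2 n : e n < (b - a) / 2.
  by rewrite ltr_pM2l ?subr_gt0// ltf_pV2 ?posrE// ltr_nat.
pose A n := [set` `[a + e n, b - e n]] : set K.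
have lA n : a + e n < b - e n by have := e2 n; lra.
have sA n x : x \in `[a + e n, b - e n] -> x \in Interval (BRight a) (BLeft b).
  by rewrite !in_itv/=; have := e0 n; lra.
have UA : \bigcup_n A n = [set` Interval (BRight a) (BLeft b)].
  apply/seteqP; split => [x [n _]|x]; first exact: sA.
  rewrite /= in_itv/= => /andP[ax xb].
  pose m := Num.min (x - a) (b - x).
  have m0 : 0 < m by rewrite lt_min !subr_gt0 ax.
  exists (Num.truncn ((b - a) / m)) => //.
  set n := Num.truncn _.
  have : e n <= m.
    rewrite /e ler_pdivrMr// -ler_pdivrMl// mulrC.
    apply: ltW; apply: (lt_le_trans (truncnS_gt _)).
    by rewrite ler_nat -/n ltnS; apply: leq_trans (leqnSn _).
  rewrite /A /= in_itv/= le_min => /andP[]; lra.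
rewrite -UA.
have cvgA : (\int[lebesgue_measure]_(x in A n) (v x)%:E @[n --> \oo] -->
   \int[lebesgue_measure]_(x in \bigcup_n A n) (v x)%:E)%E.
  apply: ge0_nondecreasing_set_cvg_integral.
  - move=> m n mn; rewrite /A; apply/subsetPset => x /=; rewrite !in_itv/=.
    have : e n <= e m.
      by rewrite ler_pM2l ?subr_gt0// lef_pV2 ?posrE// ler_nat !ltnS.
    lra.
  - by move=> n; exact: measurable_itv.
  - move=> n; apply/measurable_EFinP; apply: measurable_funS mv => // x; exact: sA.
  - by move=> n x xA; rewrite lee_fin; apply: v0; apply: sA xA.
rewrite -(cvg_lim _ cvgA)//; apply: lime_le; first by apply/cvg_ex; eexists; exact: cvgA.
apply: nearW => n.
have dVn x : x \in `[a + e n, b - e n] -> @derive.is_derive _ K^o K^o x 1 V (v x).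
  by move=> /sA; exact: dV.
have cVn x : x \in `[a + e n, b - e n] -> {for x, continuous V}.
  move=> /dVn dVx; apply: differentiable_continuous.
  by apply/derivable1_diffP; case: dVx.
rewrite (@continuous_FTC2 _ v V)//.
- rewrite lee_fin.
  have /VC : a + e n \in Interval (BRight a) (BLeft b) by apply: (sA n); rewrite in_itv/= lexx ltW.
  have /VC : b - e n \in Interval (BRight a) (BLeft b) by apply: (sA n); rewrite in_itv/= lexx ltW.
  rewrite !ler_norml => /andP[_ h1] /andP[h2 _]; lra.
- apply: continuous_in_subspaceT => x; rewrite inE => /sA; exact: cv.
- split.
  + move=> x xo; have : x \in `[a + e n, b - e n] by apply: subset_itv_oo_cc xo.
    by move=> /dVn [].
  + by apply: cvg_at_right_filter; apply: cVn; rewrite in_itv/= lexx ltW.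
  + by apply: cvg_at_left_filter; apply: cVn; rewrite in_itv/= lexx ltW.
- move=> x xo; have : x \in `[a + e n, b - e n] by apply: subset_itv_oo_cc xo.
  by move=> /dVn dx; rewrite derive1E; case: dx.
Qed.

(** Outer regularity encloses the null set in an open $U$ with $\mu(U)<d$; then
    $M(x)=\mu(U\cap{]-\infty,x]})$ grows with slope one near each point of $U$. This function pays
    for the exceptional points in the monotonicity theorem. *)
Lemma null_set_majorant (K : realType) (N : set K) :
  (@lebesgue_measure K).-negligible N -> forall d : K, 0 < d ->
  exists M : K -> K, [/\ {homo M : x y / x <= y}, forall x, 0 <= M x <= d &
    forall x, N x -> exists2 r : K, 0 < r &
      forall u w, x - r < u -> u <= w -> w < x + r -> w - u <= M w - M u].
Proof.
move=> [A [mA A0 NA]] d d0.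
have [|U [oU AU Ud]] := @lebesgue_regularity_outer K A d mA _ d0.
  exact: (eq_ind_r (fun x => x < +oo)%E (ltry 0) A0).
have mU : measurable U by exact: open_measurable.
have muU : (lebesgue_measure U < d%:E)%E.
  have -> : lebesgue_measure U = lebesgue_measure (U `\` A); last exact: Ud.
  have mUA : measurable (U `\` A) by exact: measurableD.
  rewrite -[LHS](congr1 lebesgue_measure (setDUK AU)) setUC measureU//; last by rewrite setDKI.
  by rewrite -[RHS]adde0; congr (_ + _)%E; exact: A0.
pose m x := lebesgue_measure (U `&` [set` `]-oo, x]]).
have mm x : measurable (U `&` [set` `]-oo, x]] : set K) by exact: measurableI.
have md x : (m x <= d%:E)%E.
  apply: (le_trans _ (ltW muU)); apply: le_measure; rewrite ?inE//; exact: mm.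
have mfin x : m x \is a fin_num.
  by rewrite ge0_fin_numE//; apply: le_lt_trans (md x) (ltry _).
exists (fun x => fine (m x)); split.
- move=> x y xy; apply: fine_le => //; apply: le_measure; rewrite ?inE//; try exact: mm.
  apply: setIS => z /=; rewrite !in_itv/= => /le_trans; exact.
- move=> x; apply/andP; split; first by apply: fine_ge0.
  by rewrite -lee_fin fineK; [exact: md|exact: mfin].
move=> x /NA/AU Ux.
have : nbhs x U by apply: open_nbhs_nbhs.
move=> /nbhs_ballP[r /= r0 rU]; exists r => // u w xu uw wx.
have -> : m w = (m u + (w - u)%:E)%E.
  have -> : (w - u)%:E = lebesgue_measure ([set` `]u, w]] : set K).
    rewrite lebesgue_measure_itv/= lte_fin; case: ltP => h; first by rewrite EFinB.
    have -> : w = u by apply/eqP; rewrite eq_le h uw.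
    by rewrite subrr.
  rewrite /m -measureU//.
    congr lebesgue_measure; apply/seteqP; split => z /=; rewrite !in_itv/=.
      by move=> [Uz zw]; have [zu|uz] := leP z u; [left|right; rewrite zw].
    move=> [[Uz zu]|/andP[uz zw]]; first by split => //; apply: le_trans uw.
    by split => //; apply: rU; rewrite /ball/= ltr_norml; lra.
  exact: mm.
  apply/seteqP; split => z //= [[_]]; rewrite !in_itv/= => zu /andP[uz _].
  by move: (le_lt_trans zu uz); rewrite ltxx.
by rewrite fineD//= addrAC subrr add0r.
Qed.

End Leb.

(** * Transfer to functions on the interval $(-1,1)$ *)

Module LebR.
Import mathcomp.boot.all_boot mathcomp.order.all_order mathcomp.algebra.all_algebra
  mathcomp.classical.all_classical mathcomp.reals.all_reals
  mathcomp.analysis.all_analysis mathcomp.analysis.measurable_realfun mathcomp.reals_stdlib.Rstruct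
  mathcomp.analysis_stdlib.Rstruct_topology mathcomp.algebra_tactics.lra.
Import Order.TTheory GRing.Theory Num.Theory numFieldNormedType.Exports.
Local Open Scope classical_set_scope.
Local Open Scope ring_scope.

Lemma in11_itv : [set x | in11 x] = [set` Interval (BRight (-1 : R)) (BLeft (1 : R))] :> set R.
Proof.
apply/seteqP; split => x /=; rewrite /in11 in_itv/=.
  by move=> [/RltP h1 /RltP h2]; apply/andP; split => //.
by move=> /andP[/RltP h1 /RltP h2]; split => //.
Qed.

(** Measurability on $(-1,1)$ alone: continuity of the weight and of the solutions is available only
    there. *)
Definition meas11 (h : R -> R) : Prop :=
  measurable_fun ([set x | in11 x] : set (measurableTypeR R))
    (h : measurableTypeR R -> measurableTypeR R).

Lemma measurable_in11 : measurable ([set x | in11 x] : set (measurableTypeR R)).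
Proof. by rewrite in11_itv; exact: measurable_itv. Qed.

Lemma meas11_meas h : MC.meas h -> meas11 h.
Proof. by move=> mh; apply: measurable_funS mh => //. Qed.

Lemma meas11D f g : meas11 f -> meas11 g -> meas11 (fun x => Rplus (f x) (g x)).
Proof. by move=> mf mg; exact: measurable_funD. Qed.

Lemma meas11M f g : meas11 f -> meas11 g -> meas11 (fun x => Rmult (f x) (g x)).
Proof. by move=> mf mg; exact: measurable_funM. Qed.

Lemma meas11_continuous h :
  (forall x, in11 x -> continuity_pt h x) -> meas11 h.
Proof.
move=> ch; rewrite /meas11 in11_itv.
apply: subspace_continuous_measurable_fun; first exact: measurable_itv.
apply: continuous_in_subspaceT => x; rewrite inE -in11_itv => /ch.
by move/continuity_pt_cvg.
Qed.

Lemma meas11_eq f g : (forall x, in11 x -> f x = g x) -> meas11 f -> meas11 g.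
Proof. by move=> fg mf; apply: (eq_measurable_fun _ _ mf) => x; rewrite inE => /fg. Qed.

(** [L2w] asks for measurability on the whole line; extension by zero provides it. *)
Lemma meas_extend0 h : meas11 h -> (forall x, ~ in11 x -> h x = R0) -> MC.meas h.
Proof.
move=> mh h0; rewrite /MC.meas.
have -> : [set: measurableTypeR R] = [set x | in11 x] `|` ~` [set x | in11 x] by rewrite setUv.
have mC : measurable (~` [set x | in11 x] : set (measurableTypeR R)).
  by apply: measurableC; exact: measurable_in11.
apply/(measurable_funU _ measurable_in11 mC); split; first exact: mh.
apply: (eq_measurable_fun (cst (0 : measurableTypeR R))); last exact: measurable_cst.
by move=> x; rewrite inE => /h0.
Qed.

Lemma measD f g : MC.meas f -> MC.meas g -> MC.meas (fun x => Rplus (f x) (g x)).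
Proof. by move=> mf mg; exact: measurable_funD. Qed.

Lemma ae11_all (P : R -> Prop) : (forall x, in11 x -> P x) -> MC.ae11 P.
Proof. by move=> HP; apply: aeW => x; exact: HP. Qed.

Lemma ae11_and (P Q : R -> Prop) : MC.ae11 P -> MC.ae11 Q -> MC.ae11 (fun x => P x /\ Q x).
Proof.
move=> HP HQ; have FF := ae_filter_ringOfSetsType (@lebesgue_measure R).
apply: (@filterS2 _ _ FF _ _ _ _ HP HQ) => x hP hQ i.
by split; [exact: hP|exact: hQ].
Qed.

Lemma ae11_impl (P Q : R -> Prop) :
  (forall x, in11 x -> P x -> Q x) -> MC.ae11 P -> MC.ae11 Q.
Proof.
move=> PQ HP; have FF := ae_filter_ringOfSetsType (@lebesgue_measure R).
by apply: (@filterS _ _ FF _ _ _ HP) => x hP i; apply: PQ => //; exact: hP.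
Qed.

Lemma ae11_majorant (P : R -> Prop) : MC.ae11 P -> forall d, Rlt 0 d ->
  exists M : R -> R, (forall x y, Rle x y -> Rle (M x) (M y)) /\
    (forall x, Rle 0 (M x) /\ Rle (M x) d) /\
    forall x, in11 x -> ~ P x -> exists r, Rlt 0 r /\
      forall u w, Rlt (Rminus x r) u -> Rle u w -> Rlt w (Rplus x r) ->
        Rle (Rminus w u) (Rminus (M w) (M u)).
Proof.
move=> HP d /RltP d0.
have [M [M1 M2 M3]] := @Leb.null_set_majorant R _ HP d d0.
exists M; split; first by move=> x y /RleP xy; apply/RleP; exact: M1.
split; first by move=> x; have /andP[/RleP h1 /RleP h2] := M2 x.
move=> x ix nP; have [|r /RltP r0 Hr] := M3 x.
  by move=> /= H; apply: nP; exact: H.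
exists r; split => // u w /RltP h1 /RleP h2 /RltP h3; apply/RleP; exact: Hr.
Qed.

Lemma integ11_of_primitive (h v V : R -> R) C : meas11 h ->
  (forall x, in11 x -> Rle (Rabs (h x)) (v x)) ->
  (forall x, in11 x -> continuity_pt v x) ->
  (forall x, in11 x -> @Derive.is_derive R_AbsRing R_NormedModule V x (v x)) ->
  (forall x, in11 x -> Rle (Rabs (V x)) C) ->
  MC.integ11 h.
Proof.
move=> mh hv cv dV VC.
have E x : (x \in Interval (BRight (-1 : R)) (BLeft (1 : R))) -> in11 x.
  by move=> xi; suff : [set x | in11 x] x by []; rewrite in11_itv.
rewrite /MC.integ11 in11_itv; apply: (@Leb.integrable_of_primitive _ _ _ C _ v V).
- exact: (lt_trans (ltrN10 _) ltr01).
- by move: mh; rewrite /meas11 in11_itv.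
- by move=> x /E /hv /RleP; rewrite RabsE.
- by move=> x /E /cv /continuity_pt_cvg.
- move=> x /E /dV /is_derive_Reals dVx; apply: Leb.linear_approx_is_derive => e /RltP e0.
  have [d Hd] := dVx e e0.
  exists (pos d); first by apply/RltP; exact: cond_pos.
  move=> y yd; have [->|yx] := eqVneq y x; first by rewrite !subrr mulr0 subrr normr0 mulr0.
  have h0 : y - x != 0 by rewrite subr_eq0.
  have := Hd (y - x) _ _; rewrite RabsE RplusE RminusE RdivE.
  have -> : x + (y - x) = y by rewrite addrC subrK.
  have yd' : Rlt (`|y - x|) d by apply/RltP.
  move=> /(_ (elimN eqP h0)); rewrite RabsE => /(_ yd') /RltP /ltW H.
  rewrite (_ : _ - _ - _ = ((V y - V x) / (y - x) - v x) * (y - x)).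
    by rewrite normrM ler_wpM2r.
  by rewrite mulrBl divfK.
- by move=> x /E /VC /RleP; rewrite RabsE.
Qed.

(** The primitive is the indefinite integral from $-\infty$ of [h] extended by zero, and it is
    bounded by the integral of $|h|$. Through it integrable functions enter the later estimates. *)
Lemma integ11_primitive (h : R -> R) : MC.integ11 h ->
  exists (H : R -> R) (C : R), (forall x, Rle (Rabs (H x)) C) /\
    ACloc (fun x => RtoC (H x)) /\ MC.ae11 (fun x => @Derive.is_derive R_AbsRing R_NormedModule H x (h x)).
Proof.
move=> ih.
pose f := (h \_ [set x | in11 x]) : R -> R.
have intf : (@lebesgue_measure R).-integrable [set: R] (EFin \o f).
  have := ih; rewrite /MC.integ11 => /(integrable_mkcond _ measurable_in11).1.
  by rewrite /f restrict_EFin.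
pose H x : R := (\int[@lebesgue_measure R]_(y in [set` `]-oo, x]]) f y)%R.
exists H, (\int[@lebesgue_measure R]_(y in [set: R]) `|f y|).
split; first by move=> x; apply/RleP; rewrite RabsE; exact: Leb.integral_bounded.
split.
  move=> a b _ _ _ e /RltP e0.
  have [d /RltP d0 Hd] := @Leb.indefinite_integral_ac R f intf e e0.
  exists d; split => // n s t _ st ts _.
  rewrite !sum_n_Reals !sum_f_R0E => /RltP sd; apply/RltP.
  have st' k : (k <= n)%N -> s k <= t k by move=> /ssrnat.leP kn; apply/RleP; exact: st.
  have ts' k : (k < n)%N -> t k <= s k.+1 by move=> /ssrnat.ltP kn; apply/RleP; exact: ts.
  have := Hd n s t st' ts' sd.
  congr (_ < _); apply: eq_bigr => k _.
  by rewrite -RtoC_minus Cmod_R RabsE.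
have FF := ae_filter_ringOfSetsType (@lebesgue_measure R).
apply: (@filterS _ _ FF _ _ _ (@Leb.indefinite_integral_derivable R f intf)) => x Hx ix.
have -> : h x = f x by rewrite /f patchE mem_set.
apply/is_derive_Reals => e /RltP e0.
(* Halving $\varepsilon$ turns the weak inequality of the approximation into the strict one of the
   derivative. *)
have e20 : 0 < e / 2 by rewrite divr_gt0.
have [d /RltP d0 Hd] := Hx _ e20.
exists (mkposreal d d0) => /= k k0 kd.
have := Hd (x + k); rewrite addrAC subrr add0r => H1.
have kd' : `|k| < d by apply/RltP; rewrite -RabsE.
have {}H1 := H1 kd'.
have nk : 0 < `|k| by rewrite normr_gt0; apply/eqP.
apply/RltP; rewrite RabsE RminusE RdivE.
rewrite -(ltr_pM2r nk) -normrM.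
rewrite (_ : _ * k = H (x + k) - H x - f x * k).
  by apply: (le_lt_trans H1); rewrite ltr_pM2r// ltr_pdivrMr// ltr_pMr// ltr1n.
by rewrite mulrBl divfK//; apply/eqP.
Qed.

Lemma integ11_le (h g : R -> R) : meas11 h -> MC.integ11 g ->
  (forall x, in11 x -> Rle (Rabs (h x)) (g x)) -> MC.integ11 h.
Proof.
move=> mh ig hg.
apply: (le_integrable measurable_in11 _ _ ig).
  by apply/measurable_EFinP.
move=> x /= /hg /RleP; rewrite RabsE => H.
by rewrite lee_fin; apply: (le_trans H); exact: ler_norm.
Qed.

Lemma integ11_plus (f g : R -> R) : MC.integ11 f -> MC.integ11 g ->
  MC.integ11 (fun x => Rplus (f x) (g x)).
Proof.
move=> i1 i2; rewrite /MC.integ11.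
have := @integrableD _ _ _ _ _ measurable_in11 _ _ i1 i2.
by [].
Qed.

Lemma integ11_scal (c : R) (f : R -> R) : MC.integ11 f ->
  MC.integ11 (fun x => Rmult c (f x)).
Proof.
move=> i1; rewrite /MC.integ11.
have := integrableZl measurable_in11 c i1.
by [].
Qed.

End LebR.

Local Open Scope R_scope.

(** * Complex limits and derivatives *)

Lemma Cmod_le_ReIm (z : C) : Cmod z <= Rabs (Re z) + Rabs (Im z).
Proof.
  replace z with (RtoC (Re z) + Ci * RtoC (Im z))%C at 1
    by (destruct z; unfold Ci, RtoC, Cplus, Cmult; simpl; f_equal; ring).
  eapply Rle_trans; [apply Cmod_triangle|].
  rewrite Cmod_mult, Cmod_Ci, !Cmod_R. lra.
Qed.

Lemma Rabs_Re_le_Cmod (z : C) : Rabs (Re z) <= Cmod z.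
Proof. apply re_le_Cmod. Qed.

Lemma Rabs_Im_le_Cmod (z : C) : Rabs (Im z) <= Cmod z.
Proof. eapply Rle_trans; [apply Rmax_r|apply (Rmax_Cmod z)]. Qed.

Lemma Cmod_minus_sym (a b : C) : Cmod (a - b) = Cmod (b - a).
Proof. rewrite <- Cmod_opp. f_equal. ring. Qed.

Lemma Cmod_triangle_minus (a b : C) : Cmod a - Cmod b <= Cmod (a - b).
Proof.
  assert (H := Cmod_triangle (a - b) b).
  replace (a - b + b)%C with a in H by ring. lra.
Qed.

(** Convergence measured by [Cmod] for an arbitrary family [F] of sets, so that one calculus serves
    one-sided limits on the real line and punctured neighbourhoods in the plane. *)
Definition Clim {T : Type} (F : (T -> Prop) -> Prop) (f : T -> C) (l : C) : Prop :=
  forall eps, 0 < eps -> F (fun x => Cmod (f x - l) < eps).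

Lemma Clim_filterlim {T} F {FF : Filter F} (f : T -> C) l :
  Clim F f l <-> filterlim f F (locally l).
Proof.
  split.
  - intros H P [eps HP]. unfold filtermap.
    apply filter_imp with (2 := H eps (cond_pos eps)).
    intros x Hx. apply HP. apply C_NormedModule_mixin_compat1. exact Hx.
  - intros H eps He.
    apply (H (fun y => Cmod (y - l) < eps)).
    (* The factor $\sqrt2$ compares the modulus with the product topology of $\mathbb C$. *)
    assert (Hs : 0 < sqrt 2) by (apply sqrt_lt_R0; lra).
    assert (Hd : 0 < eps / sqrt 2) by (apply Rdiv_lt_0_compat; lra).
    exists (mkposreal _ Hd). intros y Hy.
    apply C_NormedModule_mixin_compat2 in Hy. simpl in Hy.
    replace (sqrt 2 * (eps / sqrt 2)) with eps in Hy by (field; lra).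
    exact Hy.
Qed.

Lemma Cmod_limit_le {T} (F : (T -> Prop) -> Prop) {FF : ProperFilter F} (f : T -> C) l a B :
  Clim F f l -> F (fun x => Cmod (a - f x) <= B) -> Cmod (a - l) <= B.
Proof.
  intros H HB. apply Rnot_lt_le. intros h.
  assert (he : 0 < Cmod (a - l) - B) by lra.
  destruct (filter_ex _ (filter_and _ _ (H _ he) HB)) as [x [h1 h2]].
  assert (c := Cmod_triangle (a - f x) (f x - l)).
  replace (a - f x + (f x - l))%C with (a - l)%C in c by ring. lra.
Qed.

Section ComplexLimits.
Context {T : Type} (F : (T -> Prop) -> Prop) {FF : Filter F}.

Lemma Clim_ext_loc (f g : T -> C) l : F (fun x => f x = g x) -> Clim F f l -> Clim F g l.
Proof.
  intros E H eps He. generalize (filter_and _ _ E (H eps He)).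
  apply filter_imp. intros x [-> Hx]. exact Hx.
Qed.

Lemma Clim_ext (f g : T -> C) l : (forall x, f x = g x) -> Clim F f l -> Clim F g l.
Proof. intros E. apply Clim_ext_loc, filter_forall, E. Qed.

Lemma Clim_eq (f : T -> C) l m : Clim F f l -> l = m -> Clim F f m.
Proof. now intros H <-. Qed.

Lemma Clim_const l : Clim F (fun _ => l) l.
Proof.
  intros eps He. apply filter_forall. intros _.
  replace (l - l)%C with (RtoC 0) by ring. rewrite Cmod_0. exact He.
Qed.

Lemma Clim_plus f g l m : Clim F f l -> Clim F g m -> Clim F (fun x => f x + g x)%C (l + m)%C.
Proof.
  intros Hf Hg eps He.
  assert (He2 : 0 < eps / 2) by lra.
  generalize (filter_and _ _ (Hf _ He2) (Hg _ He2)).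
  apply filter_imp. intros x [H1 H2].
  replace (f x + g x - (l + m))%C with ((f x - l) + (g x - m))%C by ring.
  eapply Rle_lt_trans; [apply Cmod_triangle|lra].
Qed.

Lemma Clim_bounded f l : Clim F f l -> F (fun x => Cmod (f x) <= Cmod l + 1).
Proof.
  intros H. generalize (H 1 Rlt_0_1). apply filter_imp. intros x Hx.
  assert (h := Cmod_triangle_minus (f x) l). lra.
Qed.

Lemma Clim_mult_bounded f g B :
  F (fun x => Cmod (f x) <= B) -> Clim F g 0 -> Clim F (fun x => f x * g x)%C 0.
Proof.
  intros Hf Hg eps He.
  assert (HB : 0 < Rabs B + 1) by (assert (h := Rabs_pos B); lra).
  assert (He2 : 0 < eps / (Rabs B + 1)) by (apply Rdiv_lt_0_compat; lra).
  generalize (filter_and _ _ Hf (Hg _ He2)).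
  apply filter_imp. intros x [H1 H2].
  replace (f x * g x - 0)%C with (f x * (g x - 0))%C by ring.
  rewrite Cmod_mult.
  apply Rle_lt_trans with (Rabs B * Cmod (g x - 0)).
  - apply Rmult_le_compat_r; [apply Cmod_ge_0|]. assert (h := Rle_abs B). lra.
  - apply Rle_lt_trans with (Rabs B * (eps / (Rabs B + 1))).
    + apply Rmult_le_compat_l; [apply Rabs_pos|lra].
    + apply Rmult_lt_reg_r with (Rabs B + 1); [lra|].
      replace (Rabs B * (eps / (Rabs B + 1)) * (Rabs B + 1)) with (Rabs B * eps) by (field; lra).
      assert (h := Rabs_pos B). nra.
Qed.

Lemma Clim_mult f g l m : Clim F f l -> Clim F g m -> Clim F (fun x => f x * g x)%C (l * m)%C.
Proof.
  intros Hf Hg.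
  assert (Hg0 : Clim F (fun x => g x - m)%C 0).
  { replace (RtoC 0) with (m - m)%C by ring. apply Clim_plus; [exact Hg|apply Clim_const]. }
  assert (Hf0 : Clim F (fun x => f x - l)%C 0).
  { replace (RtoC 0) with (l - l)%C by ring. apply Clim_plus; [exact Hf|apply Clim_const]. }
  apply Clim_ext with (fun x => (f x * (g x - m) + (m * (f x - l) + l * m)))%C.
  { intros x. ring. }
  apply Clim_eq with (0 + (0 + l * m))%C; [|ring].
  apply Clim_plus; [|apply Clim_plus].
  - apply (Clim_mult_bounded f _ _ (Clim_bounded _ _ Hf) Hg0).
  - apply (Clim_mult_bounded (fun _ => m) _ (Cmod m)); [|exact Hf0].
    apply filter_forall. intros; lra.
  - apply Clim_const.
Qed.

Lemma Clim_scal c f l : Clim F f l -> Clim F (fun x => c * f x)%C (c * l)%C.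
Proof. intros H. apply Clim_mult; [apply Clim_const|exact H]. Qed.

Lemma Clim_opp f l : Clim F f l -> Clim F (fun x => - f x)%C (- l)%C.
Proof.
  intros H eps He. generalize (H eps He). apply filter_imp. intros x Hx.
  replace (- f x - - l)%C with (- (f x - l))%C by ring. rewrite Cmod_opp. exact Hx.
Qed.

Lemma Clim_minus f g l m : Clim F f l -> Clim F g m -> Clim F (fun x => f x - g x)%C (l - m)%C.
Proof. intros Hf Hg. apply Clim_plus; [exact Hf|apply Clim_opp, Hg]. Qed.

Lemma Clim_squeeze f (g : T -> R) l :
  F (fun x => Cmod (f x - l) <= g x) -> Clim F (fun x => RtoC (g x)) 0 -> Clim F f l.
Proof.
  intros Hf Hg eps He. generalize (filter_and _ _ Hf (Hg eps He)).
  apply filter_imp. intros x [H1 H2].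
  replace (RtoC (g x) - 0)%C with (RtoC (g x)) in H2 by ring.
  rewrite Cmod_R in H2. assert (h := Rle_abs (g x)). lra.
Qed.

Lemma Clim_inv (f : T -> C) (l : C) : l <> 0%C -> Clim F f l -> Clim F (fun x => / f x)%C (/ l)%C.
Proof.
  intros Hl Hf.
  assert (Pl : 0 < Cmod l) by (apply Cmod_gt_0; exact Hl).
  (* Near the limit $|f|\ge|l|/2$, hence $|1/f-1/l|\le2|f-l|/|l|^2$. *)
  apply Clim_squeeze with (fun x => (2 / (Cmod l * Cmod l)) * Cmod (f x - l)).
  - assert (Pl2 : 0 < Cmod l / 2) by lra.
    generalize (Hf _ Pl2). apply filter_imp. intros x Hx.
    assert (h : Cmod l / 2 <= Cmod (f x)).
    { assert (h := Cmod_triangle_minus l (f x)). rewrite Cmod_minus_sym in h. lra. }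
    assert (nf : f x <> 0%C) by (apply Cmod_gt_0; lra).
    replace (/ f x - / l)%C with ((l - f x) * (/ f x * / l))%C by (field; split; auto).
    rewrite !Cmod_mult, !Cmod_inv, Cmod_minus_sym, Rmult_comm by auto.
    apply Rmult_le_compat_r; [apply Cmod_ge_0|].
    rewrite <- Rinv_mult. unfold Rdiv. rewrite <- (Rinv_inv 2) at 1. rewrite <- Rinv_mult.
    apply Rinv_le_contravar; [nra|]. nra.
  - apply Clim_ext with (fun x => RtoC (2 / (Cmod l * Cmod l)) * RtoC (Cmod (f x - l)))%C.
    { intros x. now rewrite <- RtoC_mult. }
    replace (RtoC 0) with (RtoC (2 / (Cmod l * Cmod l)) * 0)%C by ring.
    apply Clim_scal. intros eps He. generalize (Hf eps He). apply filter_imp.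
    intros x Hx. replace (RtoC (Cmod (f x - l)) - 0)%C with (RtoC (Cmod (f x - l))) by ring.
    rewrite Cmod_R, Rabs_pos_eq; [exact Hx|apply Cmod_ge_0].
Qed.

Lemma Clim_Re_Im f l : Clim F f l <->
  Clim F (fun x => RtoC (Re (f x))) (RtoC (Re l)) /\
  Clim F (fun x => RtoC (Im (f x))) (RtoC (Im l)).
Proof.
  split.
  - intros H; split; intros eps He; generalize (H eps He); apply filter_imp; intros x Hx;
      rewrite <- RtoC_minus, Cmod_R.
    + apply Rle_lt_trans with (2 := Hx). apply (Rabs_Re_le_Cmod (f x - l)).
    + apply Rle_lt_trans with (2 := Hx). apply (Rabs_Im_le_Cmod (f x - l)).
  - intros [H1 H2]. apply Clim_ext with (fun x => RtoC (Re (f x)) + Ci * RtoC (Im (f x)))%C.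
    { intros x. destruct (f x). unfold Ci, RtoC, Cplus, Cmult; simpl; f_equal; ring. }
    replace l with (RtoC (Re l) + Ci * RtoC (Im l))%C
      by (destruct l; unfold Ci, RtoC, Cplus, Cmult; simpl; f_equal; ring).
    apply Clim_plus; [exact H1|apply Clim_scal, H2].
Qed.

Lemma Clim_conj f l : Clim F f l -> Clim F (fun x => Cconj (f x)) (Cconj l).
Proof.
  intros H eps He. generalize (H eps He). apply filter_imp. intros x Hx.
  rewrite <- Cminus_conj, Cmod_conj. exact Hx.
Qed.

End ComplexLimits.

Lemma Clim_unique {T} (F : (T -> Prop) -> Prop) {FF : ProperFilter F} (f : T -> C) l m :
  Clim F f l -> Clim F f m -> l = m.
Proof.
  intros H1 H2.
  destruct (Req_dec (Cmod (l - m)) 0) as [h|h].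
  - apply Cmod_eq_0 in h. replace l with (l - m + m)%C by ring. rewrite h. ring.
  - assert (hp : 0 < Cmod (l - m)) by (assert (a := Cmod_ge_0 (l - m)); lra).
    assert (hp2 : 0 < Cmod (l - m) / 2) by lra.
    destruct (filter_ex _ (filter_and _ _ (H1 _ hp2) (H2 _ hp2))) as [x [a b]].
    exfalso. assert (c := Cmod_triangle (l - f x) (f x - m)).
    replace (l - f x + (f x - m))%C with (l - m)%C in c by ring.
    rewrite (Cmod_minus_sym l (f x)) in c. lra.
Qed.

(** The derivative is a linear map into a product and splits along the two projections; the product
    rule and the estimates of increments reduce to real ones by it. *)
Lemma is_derive_ReIm (f : R -> C) x (l : C) :
  is_derive f x l <->
  is_derive (fun t => Re (f t)) x (Re l) /\ is_derive (fun t => Im (f t)) x (Im l).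
Proof.
  split.
  - intros H; split.
    + apply (filterdiff_comp' f (fun t : R * R => fst t) x (fun y => scal y l) (fun t => fst t) H).
      apply filterdiff_linear, is_linear_fst.
    + apply (filterdiff_comp' f (fun t : R * R => snd t) x (fun y => scal y l) (fun t => snd t) H).
      apply filterdiff_linear, is_linear_snd.
  - intros [H1 H2].
    set (id_lin := @is_linear_id R_AbsRing R_NormedModule).
    set (zero_lin := @is_linear_zero R_AbsRing R_NormedModule R_NormedModule).
    assert (L1 := is_linear_prod _ _ id_lin zero_lin).
    assert (L2 := is_linear_prod _ _ zero_lin id_lin).
    assert (K1 := filterdiff_comp' _ _ x _ _ H1 (filterdiff_linear _ L1)).
    assert (K2 := filterdiff_comp' _ _ x _ _ H2 (filterdiff_linear _ L2)).
    assert (K := filterdiff_plus_fct _ _ _ _ K1 K2).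
    eapply filterdiff_ext; [|eapply filterdiff_ext_lin; [exact K|]].
    + intros y. simpl. apply injective_projections; simpl.
      * unfold plus, zero; simpl. unfold Re. ring.
      * unfold plus, zero; simpl. unfold Im. ring.
    + intros y. apply injective_projections; simpl.
      * unfold plus, zero, scal; simpl. unfold mult; simpl. unfold Re. ring.
      * unfold plus, zero, scal; simpl. unfold mult; simpl. unfold Im. ring.
Qed.

Lemma dC_plus (f g : R -> C) x df dg : is_derive f x df -> is_derive g x dg ->
  is_derive (fun t => f t + g t)%C x (df + dg)%C.
Proof. intros H1 H2. exact (is_derive_plus f g x df dg H1 H2). Qed.

Lemma dC_opp (f : R -> C) x df : is_derive f x df -> is_derive (fun t => - f t)%C x (- df)%C.
Proof. intros H1. exact (is_derive_opp f x df H1). Qed.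

Lemma dC_minus (f g : R -> C) x df dg : is_derive f x df -> is_derive g x dg ->
  is_derive (fun t => f t - g t)%C x (df - dg)%C.
Proof. intros H1 H2. apply dC_plus; [exact H1|apply dC_opp, H2]. Qed.

Lemma dC_const (c : C) x : is_derive (fun _ : R => c) x (RtoC 0).
Proof. exact (is_derive_const (V := C_R_NormedModule) c x). Qed.

Lemma dC_eq (f : R -> C) x (l m : C) : is_derive f x l -> l = m -> is_derive f x m.
Proof. now intros H <-. Qed.

Lemma dC_mult (f g : R -> C) x df dg : is_derive f x df -> is_derive g x dg ->
  is_derive (fun t => f t * g t)%C x (df * g x + f x * dg)%C.
Proof.
  intros H1 H2. apply is_derive_ReIm in H1. apply is_derive_ReIm in H2.
  destruct H1 as [f1 f2], H2 as [g1 g2]. apply is_derive_ReIm. split.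
  - assert (a := is_derive_minus _ _ _ _ _ (Derive.is_derive_mult _ _ _ _ _ f1 g1)
                                        (Derive.is_derive_mult _ _ _ _ _ f2 g2)).
    replace (Re (df * g x + f x * dg)) with
      (minus (Re df * Re (g x) + Re (f x) * Re dg) (Im df * Im (g x) + Im (f x) * Im dg)); [exact a|].
    unfold minus, plus, opp; simpl. unfold Re, Im; simpl. ring.
  - assert (a := is_derive_plus _ _ _ _ _ (Derive.is_derive_mult _ _ _ _ _ f1 g2)
                                        (Derive.is_derive_mult _ _ _ _ _ f2 g1)).
    replace (Im (df * g x + f x * dg)) with
      (plus (Re df * Im (g x) + Re (f x) * Im dg) (Im df * Re (g x) + Im (f x) * Re dg)); [exact a|].
    unfold plus; simpl. unfold Re, Im; simpl. ring.
Qed.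

Lemma dC_scal c (f : R -> C) x df : is_derive f x df -> is_derive (fun t => c * f t)%C x (c * df)%C.
Proof.
  intros H. apply dC_eq with (1 := dC_mult _ _ _ _ _ (dC_const c x) H). ring.
Qed.

Lemma dC_RtoC (h : R -> R) x d : is_derive h x d -> is_derive (fun t => RtoC (h t)) x (RtoC d).
Proof.
  intros H. apply is_derive_ReIm. split; [exact H|].
  exact (is_derive_const (V := R_NormedModule) 0 x).
Qed.

Lemma dC_comp (f : R -> C) (g : R -> R) x l d : is_derive f (g x) l -> is_derive g x d ->
  is_derive (fun t => f (g t)) x (RtoC d * l)%C.
Proof. 
  intros Hf Hg. apply dC_eq with (1 := is_derive_comp f g x l d Hf Hg).
  destruct l. unfold scal; simpl. unfold prod_scal, scal; simpl. unfold mult; simpl.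
  unfold RtoC, Cmult; simpl. f_equal; ring.
Qed.

Lemma dC_conj (f : R -> C) x l : is_derive f x l -> is_derive (fun t => Cconj (f t)) x (Cconj l).
Proof.
  intros H. apply is_derive_ReIm in H. apply is_derive_ReIm. destruct H as [H1 H2].
  split; [exact H1|]. exact (is_derive_opp _ _ _ H2).
Qed.

Lemma dC_ext_in11 (f g : R -> C) x l : in11 x -> (forall t, in11 t -> f t = g t) ->
  is_derive f x l -> is_derive g x l.
Proof.
  intros [h1 h2] E. apply is_derive_ext_loc.
  assert (hp : 0 < Rmin (x + 1) (1 - x)) by (apply Rmin_pos; lra).
  exists (mkposreal _ hp). intros y Hy. apply E.
  assert (Hy' : Rabs (y - x) < Rmin (x + 1) (1 - x)) by exact Hy.
  assert (a := Rmin_l (x+1) (1-x)). assert (b := Rmin_r (x+1) (1-x)).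
  apply Rabs_def2 in Hy'. split; lra.
Qed.

Lemma in11_at_right : at_right (-1) in11.
Proof.
  exists (mkposreal 1 Rlt_0_1). intros y Hy Hlt.
  assert (Hy' : Rabs (y - -1) < 1) by exact Hy. apply Rabs_def2 in Hy'. split; lra.
Qed.

Lemma in10_at_right : at_right (-1) (fun x => -1 < x < 0).
Proof.
  exists (mkposreal 1 Rlt_0_1). intros y Hy Hlt.
  assert (Hy' : Rabs (y - -1) < 1) by exact Hy. apply Rabs_def2 in Hy'. lra.
Qed.

Lemma nondecreasing_of_derive (f d : R -> R) a b : a <= b ->
  (forall x, a <= x <= b -> is_derive f x (d x)) -> (forall x, a <= x <= b -> 0 <= d x) ->
  f a <= f b.
Proof.
  intros hab Hf Hd.
  destruct (MVT_gen f a b d) as [c [Hc E]].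
  - rewrite Rmin_left, Rmax_right by lra. intros x Hx. apply Hf. lra.
  - rewrite Rmin_left, Rmax_right by lra. intros x Hx.
    apply derivable_continuous_pt. exists (d x). apply is_derive_Reals, Hf, Hx.
  - rewrite Rmin_left, Rmax_right in Hc by lra.
    assert (0 <= d c) by (apply Hd; lra). nra.
Qed.

(** Real and imaginary parts $g$ are compared with $V$ separately, by monotonicity of $V\pm g$,
    which costs the factor 2. This plays the role of $|\int f'|\le\int|f'|$. *)
Lemma increment_le_of_derive (f df : R -> C) (V v : R -> R) a b : a <= b ->
  (forall x, a <= x <= b -> is_derive f x (df x)) -> (forall x, a <= x <= b -> is_derive V x (v x)) ->
  (forall x, a <= x <= b -> Cmod (df x) <= v x) ->
  Cmod (f b - f a) <= 2 * (V b - V a).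
Proof.
  intros hab Hf HV Hv.
  assert (K : forall g dg : R -> R, (forall x, a <= x <= b -> is_derive g x (dg x)) ->
     (forall x, a <= x <= b -> Rabs (dg x) <= v x) -> Rabs (g b - g a) <= V b - V a).
  { intros g dg Hg Hdg. apply Rabs_le. split.
    - assert (h : V a + g a <= V b + g b); [|lra].
      apply (nondecreasing_of_derive (fun x => V x + g x) (fun x => v x + dg x)); auto.
      + intros x Hx. exact (is_derive_plus V g x (v x) (dg x) (HV x Hx) (Hg x Hx)).
      + intros x Hx. assert (h := Hdg x Hx). apply Rabs_le_between in h. lra.
    - assert (h : V a - g a <= V b - g b); [|lra].
      apply (nondecreasing_of_derive (fun x => V x - g x) (fun x => v x - dg x)); auto.
      + intros x Hx. exact (is_derive_minus V g x (v x) (dg x) (HV x Hx) (Hg x Hx)).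
      + intros x Hx. assert (h := Hdg x Hx). apply Rabs_le_between in h. lra. }
  eapply Rle_trans; [apply Cmod_le_ReIm|].
  assert (h1 := K (fun t => Re (f t)) (fun t => Re (df t))
    (fun x Hx => proj1 (proj1 (is_derive_ReIm _ _ _) (Hf x Hx)))
    (fun x Hx => Rle_trans _ _ _ (Rabs_Re_le_Cmod _) (Hv x Hx))).
  assert (h2 := K (fun t => Im (f t)) (fun t => Im (df t))
    (fun x Hx => proj2 (proj1 (is_derive_ReIm _ _ _) (Hf x Hx)))
    (fun x Hx => Rle_trans _ _ _ (Rabs_Im_le_Cmod _) (Hv x Hx))).
  change (Re (f b - f a)) with (Re (f b) - Re (f a)).
  change (Im (f b - f a)) with (Im (f b) - Im (f a)). lra.
Qed.

Lemma constant_of_derive0 (f : R -> C) : (forall x, in11 x -> is_derive f x (RtoC 0)) ->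
  forall x y, in11 x -> in11 y -> f x = f y.
Proof.
  intros Hf.
  assert (K : forall a b, -1 < a -> a <= b -> b < 1 -> f b = f a).
  { intros a b ha hab hb.
    assert (h := increment_le_of_derive f (fun _ => RtoC 0) (fun _ => 0) (fun _ => 0) a b hab
      (fun x Hx => Hf x (conj (Rlt_le_trans _ _ _ ha (proj1 Hx)) (Rle_lt_trans _ _ _ (proj2 Hx) hb)))
      (fun x _ => is_derive_const (V := R_NormedModule) 0 x)
      (fun x _ => Req_le _ _ Cmod_0)).
    assert (h' : Cmod (f b - f a) = 0) by (assert (p := Cmod_ge_0 (f b - f a)); lra).
    apply Cmod_eq_0 in h'. replace (f b) with (f b - f a + f a)%C by ring. rewrite h'. ring. }
  intros x y [x1 x2] [y1 y2]. destruct (Rle_dec x y).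
  - symmetry. apply K; lra.
  - apply K; lra.
Qed.

Lemma nondecreasing_bounded_limits (V : R -> R) C :
  (forall a b, -1 < a -> a <= b -> b < 1 -> V a <= V b) ->
  (forall x, in11 x -> Rabs (V x) <= C) ->
  exists l m, Clim (at_right (-1)) (fun x => RtoC (V x)) (RtoC l) /\
    Clim (at_left 1) (fun x => RtoC (V x)) (RtoC m) /\
    forall x, in11 x -> l <= V x <= m.
Proof.
  intros HV HC.
  assert (K : forall W : R -> R, (forall a b, -1 < a -> a <= b -> b < 1 -> W a <= W b) ->
    (forall x, in11 x -> Rabs (W x) <= C) ->
    exists m, (forall eps, 0 < eps -> exists c, in11 c /\ forall x, c <= x < 1 -> Rabs (W x - m) < eps)
      /\ forall x, in11 x -> W x <= m).
  { intros W HW HWC.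
    destruct (completeness (fun y => exists x, in11 x /\ y = W x)) as [m [Hm1 Hm2]].
    - exists C. intros y [x [Hx ->]]. eapply Rle_trans; [apply Rle_abs|apply HWC, Hx].
    - exists (W 0). exists 0. split; [split; lra|reflexivity].
    - exists m. split.
      + intros eps He.
        destruct (classic (exists c, in11 c /\ m - eps < W c)) as [[c [Hc1 Hc2]]|N].
        * exists c. split; [exact Hc1|]. intros x Hx. destruct Hc1.
          assert (W x <= m) by (apply Hm1; exists x; split; [split; lra|reflexivity]).
          assert (W c <= W x) by (apply HW; lra). apply Rabs_def1; lra.
        * exfalso. assert (m <= m - eps); [|lra]. apply Hm2. intros y [x [Hx ->]].
          apply Rnot_lt_le. intros h. apply N. exists x. split; auto.
      + intros x Hx. apply Hm1. exists x. auto. }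
  destruct (K V HV HC) as [m [Hm1 Hm2]].
  (* The limit at $-1$ comes from the limit at $1$ of the reflected function $-V(-x)$, which is
     again nondecreasing. *)
  destruct (K (fun x => - V (- x))) as [l [Hl1 Hl2]].
  - intros a b h1 h2 h3. assert (V (-b) <= V (-a)) by (apply HV; lra). lra.
  - intros x [h1 h2]. rewrite Rabs_Ropp. apply HC. split; lra.
  - exists (- l), m. split; [|split].
    + intros eps He. destruct (Hl1 eps He) as [c [[c1 c2] Hc]].
      assert (hp : 0 < 1 - c) by lra. exists (mkposreal _ hp). intros y Hy Hlt.
      assert (Hy' : Rabs (y - -1) < 1 - c) by exact Hy. apply Rabs_def2 in Hy'.
      assert (h := Hc (- y) ltac:(lra)). rewrite Ropp_involutive in h.
      rewrite <- RtoC_minus, Cmod_R. rewrite <- Rabs_Ropp.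
      replace (- (V y - - l)) with (- V y - l) by ring. exact h.
    + intros eps He. destruct (Hm1 eps He) as [c [[c1 c2] Hc]].
      assert (hp : 0 < 1 - c) by lra. exists (mkposreal _ hp). intros y Hy Hlt.
      assert (Hy' : Rabs (y - 1) < 1 - c) by exact Hy. apply Rabs_def2 in Hy'.
      rewrite <- RtoC_minus, Cmod_R. apply Hc. lra.
    + intros x Hx. split; [|apply Hm2, Hx].
      destruct Hx. assert (h := Hl2 (- x) ltac:(split; lra)). rewrite Ropp_involutive in h. lra.
Qed.

(** $V$ is itself monotone and bounded, and so is $V+g$ for $g$ the real or the imaginary part of
    [f]; both converge at the endpoints, hence so does $g$. This is absolute convergence of an
    improper integral with a majorant. *)
Lemma limits_of_increment_le (f : R -> C) (V : R -> R) C :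
  (forall a b, -1 < a -> a <= b -> b < 1 -> Cmod (f b - f a) <= V b - V a) ->
  (forall x, in11 x -> Rabs (V x) <= C) ->
  exists l m, Clim (at_right (-1)) f l /\ Clim (at_left 1) f m.
Proof.
  intros Hf HC.
  assert (HV : forall a b, -1 < a -> a <= b -> b < 1 -> V a <= V b).
  { intros a b h1 h2 h3. assert (h := Hf a b h1 h2 h3). assert (p := Cmod_ge_0 (f b - f a)). lra. }
  destruct (nondecreasing_bounded_limits V C HV HC) as (lV & mV & HlV & HmV & _).
  assert (K : forall g : R -> R, (forall a b, -1 < a -> a <= b -> b < 1 -> Rabs (g b - g a) <= V b - V a) ->
    exists l m, Clim (at_right (-1)) (fun x => RtoC (g x)) l /\ Clim (at_left 1) (fun x => RtoC (g x)) m).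
  { intros g Hg.
    destruct (nondecreasing_bounded_limits (fun x => V x + g x) (C + (2 * C + Rabs (g 0)))) as (l & m & Hl & Hm & _).
    - intros a b h1 h2 h3. assert (h := Hg a b h1 h2 h3). apply Rabs_le_between in h. lra.
    - intros x Hx. eapply Rle_trans; [apply Rabs_triang|]. apply Rplus_le_compat; [apply HC, Hx|].
      assert (h0 := HC 0 ltac:(split; lra)). assert (hx := HC x Hx).
      apply Rabs_le_between in h0. apply Rabs_le_between in hx. destruct Hx.
      assert (h : Rabs (g x - g 0) <= 2 * C).
      { destruct (Rle_dec 0 x).
        - eapply Rle_trans; [apply Hg; lra|lra].
        - rewrite Rabs_minus_sym. eapply Rle_trans; [apply Hg; lra|lra]. }
      replace (g x) with ((g x - g 0) + g 0) by ring.
      eapply Rle_trans; [apply Rabs_triang|lra].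
    - exists (RtoC l - RtoC lV)%C, (RtoC m - RtoC mV)%C. split.
      + eapply Clim_ext; [apply Proper_StrongProper, at_right_proper_filter| |apply Clim_minus; [|exact Hl|exact HlV]]; try typeclasses eauto.
        intros x. simpl. rewrite RtoC_plus. ring.
      + eapply Clim_ext; [| |apply Clim_minus; [|exact Hm|exact HmV]]; try typeclasses eauto.
        intros x. simpl. rewrite RtoC_plus. ring. }
  destruct (K (fun x => Re (f x))) as (l1 & m1 & Hl1 & Hm1).
  { intros a b h1 h2 h3. eapply Rle_trans; [|apply Hf; eassumption]. apply (Rabs_Re_le_Cmod (f b - f a)). }
  destruct (K (fun x => Im (f x))) as (l2 & m2 & Hl2 & Hm2).
  { intros a b h1 h2 h3. eapply Rle_trans; [|apply Hf; eassumption]. apply (Rabs_Im_le_Cmod (f b - f a)). }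
  assert (E : forall z : Complex.C, (RtoC (Re z) + Ci * RtoC (Im z))%C = z)
    by (intros z; destruct z; unfold Ci, RtoC, Cplus, Cmult; simpl; f_equal; ring).
  exists (l1 + Ci * l2)%C, (m1 + Ci * m2)%C. split.
  - eapply Clim_ext; [|intros x; apply E|]; try typeclasses eauto.
    apply Clim_plus; [typeclasses eauto|exact Hl1|]. apply Clim_scal; [typeclasses eauto|exact Hl2].
  - eapply Clim_ext; [|intros x; apply E|]; try typeclasses eauto.
    apply Clim_plus; [typeclasses eauto|exact Hm1|]. apply Clim_scal; [typeclasses eauto|exact Hm2].
Qed.

(** * Locally absolutely continuous functions *)

(** A supremum argument in the style of Cousin's lemma: the hypothesis carries [P] across each point
    $x$, from $u\le x$ to $v\ge x$ nearby, so the supremum of the points satisfying [P] is reached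
    and cannot lie below $b$. *)
Lemma continuous_induction (P : R -> Prop) a b : a <= b -> P a ->
  (forall x, a <= x <= b -> exists r, 0 < r /\ forall u v, a <= u -> u <= x -> x <= v -> v <= b ->
     x - r < u -> v < x + r -> P u -> P v) -> P b.
Proof.
  intros hab Pa H.
  destruct (completeness (fun c => a <= c <= b /\ P c)) as [s [Hs1 Hs2]].
  - exists b. intros c [h _]. lra.
  - exists a. split; [lra|exact Pa].
  - assert (has : a <= s) by (apply Hs1; split; [lra|exact Pa]).
    assert (hsb : s <= b) by (apply Hs2; intros c [h _]; lra).
    destruct (H s (conj has hsb)) as [r [hr Hr]].
    destruct (classic (exists c, (a <= c <= b /\ P c) /\ s - r < c)) as [[c [[Hc Pc] hc]]|N].
    + assert (hcs : c <= s) by (apply Hs1; auto).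
      assert (Pv : forall v, s <= v -> v <= b -> v < s + r -> P v).
      { intros v h1 h2 h3. apply (Hr c v); try lra. exact Pc. }
      destruct (Rle_lt_dec (s + r / 2) b) as [h|h].
      * assert (Pq : P (s + r / 2)) by (apply Pv; lra).
        assert (s + r / 2 <= s); [apply Hs1; split; [lra|exact Pq]|lra].
      * apply Pv; lra.
    + exfalso. assert (s <= s - r); [|lra]. apply Hs2. intros c Hc.
      apply Rnot_lt_le. intros h. apply N. exists c. auto.
Qed.

(** Continuous induction along $[a,b]$, with a loss of slope $\varepsilon$ at points of nonnegative
    derivative. At an exceptional point an interval is added to a finite list instead;
    [ae11_majorant] keeps the total length of the list below the $\delta$ of absolute continuity, so
    the variation of [phi] over it stays below $\varepsilon$. *)
Lemma ac_nondecreasing (phi : R -> R) :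
  ACloc (fun x => RtoC (phi x)) ->
  forall a b, -1 < a -> a <= b -> b < 1 ->
  MC.ae11 (fun x => a <= x <= b -> exists d, 0 <= d /\ is_derive phi x d) ->
  phi a <= phi b.
Proof.
  intros HAC a b ha hab hb Hae.
  apply Rnot_lt_le. intros hlt.
  (* With this choice the total loss $\varepsilon(b-a)+\varepsilon$ is half of the assumed drop
     $\phi(a)-\phi(b)$. *)
  pose (eps := (phi a - phi b) / (2 * (b - a + 1))).
  assert (He : 0 < eps) by (apply Rdiv_lt_0_compat; lra).
  destruct (HAC a b ha hab hb eps He) as [del [Hdel HAC']].
  destruct (LebR.ae11_majorant _ Hae (del / 2) ltac:(lra)) as (M & M1 & M2 & M3).
  (* The list of intervals ends before [c], its length is paid by [M c], and [phi] has fallen below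
     [phi a] by at most the slope loss plus its variation over the list. *)
  pose (P := fun c => exists (n : nat) (s t : nat -> R), a <= s O /\
     (forall k, (k <= n)%nat -> s k <= t k) /\ (forall k, (k < n)%nat -> t k <= s (S k)) /\
     t n <= c /\ sum_n (fun k => t k - s k) n <= M c /\
     phi a - eps * (c - a) - sum_n (fun k => Cmod (RtoC (phi (t k)) - RtoC (phi (s k)))) n <= phi c).
  assert (Pb : P b).
  { apply (continuous_induction P a b hab).
    - exists O, (fun _ => a), (fun _ => a). rewrite !sum_O.
      replace (RtoC (phi a) - RtoC (phi a))%C with (RtoC 0) by ring. rewrite Cmod_0.
      destruct (M2 a). repeat split; intros; try lra; try lia.
    - intros x Hx.
      destruct (classic (a <= x <= b -> exists d, 0 <= d /\ is_derive phi x d)) as [Hgood|Hbad].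
      + destruct (Hgood Hx) as [d [hd Hd]]. apply is_derive_Reals in Hd. destruct (Hd eps He) as [r Hr].
        exists r. split; [apply cond_pos|].
        intros u v h1 h2 h3 h4 h5 h6 (n & s & t & p1 & p2 & p3 & p4 & p5 & p6).
        exists n, s, t. assert (M u <= M v) by (apply M1; lra).
        repeat split; auto; try lra.
        assert (hu : phi u - eps * (x - u) <= phi x).
        { destruct (Req_dec u x) as [->|hne]; [lra|].
          assert (h := Hr (u - x) ltac:(lra) ltac:(apply Rabs_def1; lra)).
          replace (x + (u - x)) with u in h by ring.
          apply Rabs_def2 in h. destruct h as [_ h].
          assert (h' : - eps < (phi u - phi x) / (u - x)) by lra.
          apply Ropp_lt_gt_contravar in h'. assert (hx : 0 < x - u) by lra.
          apply Rmult_lt_compat_r with (r := x - u) in h'; [|lra].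
          replace (- ((phi u - phi x) / (u - x)) * (x - u)) with (phi u - phi x) in h' by (field; lra).
          lra. }
        assert (hv : phi x - eps * (v - x) <= phi v).
        { destruct (Req_dec v x) as [->|hne]; [lra|].
          assert (h := Hr (v - x) ltac:(lra) ltac:(apply Rabs_def1; lra)).
          replace (x + (v - x)) with v in h by ring.
          apply Rabs_def2 in h. destruct h as [_ h].
          assert (h' : - eps < (phi v - phi x) / (v - x)) by lra.
          apply Rmult_lt_compat_r with (r := v - x) in h'; [|lra].
          replace ((phi v - phi x) / (v - x) * (v - x)) with (phi v - phi x) in h' by (field; lra).
          lra. }
        lra.
      + destruct (M3 x ltac:(split; lra) Hbad) as [r [hr Hr]].
        exists r. split; [exact hr|].
        intros u v h1 h2 h3 h4 h5 h6 (n & s & t & p1 & p2 & p3 & p4 & p5 & p6).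
        (* The list is extended by $[u,v]$; near the exceptional point the growth of [M] covers its
           length. *)
        pose (s' := fun k => if le_dec k n then s k else u).
        pose (t' := fun k => if le_dec k n then t k else v).
        assert (es : forall k, (k <= n)%nat -> s' k = s k)
          by (intros k hk; unfold s'; destruct (le_dec k n); [reflexivity|lia]).
        assert (et : forall k, (k <= n)%nat -> t' k = t k)
          by (intros k hk; unfold t'; destruct (le_dec k n); [reflexivity|lia]).
        assert (esn : s' (S n) = u) by (unfold s'; destruct (le_dec (S n) n); [lia|reflexivity]).
        assert (etn : t' (S n) = v) by (unfold t'; destruct (le_dec (S n) n); [lia|reflexivity]).
        exists (S n), s', t'.
        rewrite !sum_Sn, esn, etn.
        rewrite (sum_n_ext_loc (fun k => t' k - s' k) (fun k => t k - s k))
          by (intros k hk; rewrite es, et by exact hk; reflexivity).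
        rewrite (sum_n_ext_loc (fun k => Cmod (RtoC (phi (t' k)) - RtoC (phi (s' k))))
                               (fun k => Cmod (RtoC (phi (t k)) - RtoC (phi (s k)))))
          by (intros k hk; rewrite es, et by exact hk; reflexivity).
        assert (hM := Hr u v h5 ltac:(lra) h6).
        repeat split.
        * rewrite es by lia. exact p1.
        * intros k hk. destruct (le_dec k n) as [l|l].
          -- rewrite es, et by exact l. auto.
          -- replace k with (S n) by lia. rewrite esn, etn. lra.
        * intros k hk. rewrite et by lia. destruct (le_dec (S k) n) as [l|l].
          -- rewrite es by exact l. apply p3. lia.
          -- replace (S k) with (S n) by lia. rewrite esn. replace k with n by lia. exact p4.
        * lra.
        * unfold plus; simpl. lra.
        * unfold plus; simpl. rewrite <- RtoC_minus, Cmod_R.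
          assert (h := Rle_abs (- (phi v - phi u))). rewrite Rabs_Ropp in h.
          assert (eps * (u - a) <= eps * (v - a)) by (apply Rmult_le_compat_l; lra).
          lra. }
  destruct Pb as (n & s & t & p1 & p2 & p3 & p4 & p5 & p6).
  assert (h := HAC' n s t p1 p2 p3 p4 ltac:(destruct (M2 b); lra)). simpl in h.
  assert (E : eps * (b - a + 1) = (phi a - phi b) / 2) by (unfold eps; field; lra).
  lra.
Qed.

Lemma ACloc_continuous (f : R -> C) x : ACloc f -> in11 x ->
  forall eps, 0 < eps -> exists d, 0 < d /\ forall y, Rabs (y - x) < d -> Cmod (f y - f x) < eps.
Proof.
  intros H [h1 h2] eps He.
  destruct (H ((x - 1) / 2) ((x + 1) / 2) ltac:(lra) ltac:(lra) ltac:(lra) eps He) as [del [hd Hd]].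
  exists (Rmin del (Rmin ((x + 1) / 2) ((1 - x) / 2))).
  split; [repeat apply Rmin_pos; lra|].
  intros y Hy.
  assert (a1 := Rmin_l del (Rmin ((x + 1) / 2) ((1 - x) / 2))).
  assert (a2 := Rmin_r del (Rmin ((x + 1) / 2) ((1 - x) / 2))).
  assert (a3 := Rmin_l ((x + 1) / 2) ((1 - x) / 2)).
  assert (a4 := Rmin_r ((x + 1) / 2) ((1 - x) / 2)).
  apply Rabs_def2 in Hy.
  destruct (Rle_dec x y).
  - assert (h := Hd O (fun _ => x) (fun _ => y)). rewrite !sum_O in h.
    apply h; intros; try lra; try lia.
  - rewrite Cmod_minus_sym.
    assert (h := Hd O (fun _ => y) (fun _ => x)). rewrite !sum_O in h.
    apply h; intros; try lra; try lia.
Qed.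

Lemma ACloc_bounded (f : R -> C) a b : ACloc f -> -1 < a -> a <= b -> b < 1 ->
  exists B, 0 <= B /\ forall x, a <= x <= b -> Cmod (f x) <= B.
Proof.
  intros H ha hab hb.
  destruct (continuity_ab_maj (fun x => Cmod (f x)) a b hab) as [m [Hm _]].
  - intros c hc. apply continuity_pt_locally. intros eps.
    destruct (ACloc_continuous f c H ltac:(split; lra) eps (cond_pos eps)) as [d [hd Hd]].
    exists (mkposreal d hd). intros y Hy.
    assert (h := Hd y Hy).
    assert (t1 := Cmod_triangle_minus (f y) (f c)). assert (t2 := Cmod_triangle_minus (f c) (f y)).
    rewrite Cmod_minus_sym in t2. apply Rabs_def1; lra.
  - exists (Cmod (f m)). split; [apply Cmod_ge_0|exact Hm].
Qed.

(** Sums, products, real and imaginary parts and locally Lipschitz functions are all instances of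
    this comparison of increments. *)
Lemma ACloc_dominated (f g h : R -> C) :
  ACloc f -> ACloc g ->
  (forall a b, -1 < a -> a <= b -> b < 1 -> exists A, 0 <= A /\ forall s t, a <= s -> s <= t -> t <= b ->
     Cmod (h t - h s) <= A * (Cmod (f t - f s) + Cmod (g t - g s))) -> ACloc h.
Proof.
  intros Hf Hg Hh a b ha hab hb eps He.
  destruct (Hh a b ha hab hb) as [A [hA HA]].
  assert (He' : 0 < eps / (2 * (A + 1))) by (apply Rdiv_lt_0_compat; lra).
  destruct (Hf a b ha hab hb _ He') as [d1 [hd1 H1]].
  destruct (Hg a b ha hab hb _ He') as [d2 [hd2 H2]].
  exists (Rmin d1 d2). split; [apply Rmin_pos; lra|].
  intros n s t h0 hst hts htn hs.
  assert (hmono : forall k, (k <= n)%nat -> a <= s k /\ t k <= b).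
  { assert (h1 : forall k, (k <= n)%nat -> a <= s k).
    { induction k as [|k IH]; intros hk; [exact h0|].
      assert (a <= s k) by (apply IH; lia). assert (s k <= t k) by (apply hst; lia).
      assert (t k <= s (S k)) by (apply hts; lia). lra. }
    assert (h2 : forall j, (j <= n)%nat -> t (n - j)%nat <= b).
    { induction j as [|j IH]; intros hj.
      - replace (n - 0)%nat with n by lia. exact htn.
      - assert (t (n - j)%nat <= b) by (apply IH; lia).
        assert (s (n - j)%nat <= t (n - j)%nat) by (apply hst; lia).
        assert (e : t (n - S j)%nat <= s (S (n - S j))) by (apply hts; lia).
        replace (S (n - S j)) with (n - j)%nat in e by lia. lra. }
    intros k hk. split; [auto|]. replace k with (n - (n - k))%nat by lia. apply h2. lia. }
  assert (m1 := Rmin_l d1 d2). assert (m2 := Rmin_r d1 d2).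
  assert (K1 := H1 n s t h0 hst hts htn ltac:(lra)).
  assert (K2 := H2 n s t h0 hst hts htn ltac:(lra)).
  apply Rle_lt_trans with (sum_n (fun k => A * (Cmod (f (t k) - f (s k)) + Cmod (g (t k) - g (s k)))) n).
  - rewrite !sum_n_Reals. apply sum_Rle. intros k hk. destruct (hmono k hk). apply HA; auto.
  - assert (E : sum_n (fun k => A * (Cmod (f (t k) - f (s k)) + Cmod (g (t k) - g (s k)))) n =
      A * (sum_n (fun k => Cmod (f (t k) - f (s k))) n + sum_n (fun k => Cmod (g (t k) - g (s k))) n)).
    { rewrite (sum_n_mult_l (K := R_Ring) A (fun k => Cmod (f (t k) - f (s k)) + Cmod (g (t k) - g (s k)))).
      unfold mult; simpl. f_equal.
      exact (sum_n_plus (fun k => Cmod (f (t k) - f (s k))) (fun k => Cmod (g (t k) - g (s k))) n). }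
    rewrite E.
    set (X := sum_n (fun k => Cmod (f (t k) - f (s k))) n) in *.
    set (Y := sum_n (fun k => Cmod (g (t k) - g (s k))) n) in *.
    apply Rle_lt_trans with (A * (eps / (2 * (A + 1)) + eps / (2 * (A + 1)))).
    + apply Rmult_le_compat_l; lra.
    + apply Rmult_lt_reg_r with (A + 1); [lra|].
      replace (A * (eps / (2 * (A + 1)) + eps / (2 * (A + 1))) * (A + 1)) with (A * eps) by (field; lra).
      nra.
Qed.

Lemma ACloc_id : ACloc RtoC.
Proof.
  intros a b _ _ _ eps He. exists eps. split; [exact He|].
  intros n s t _ hst _ _ H.
  rewrite (sum_n_ext_loc _ (fun k => t k - s k)); [exact H|].
  intros k hk. rewrite <- RtoC_minus, Cmod_R. apply Rabs_pos_eq.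
  specialize (hst k hk). lra.
Qed.

Lemma ACloc_locally_lipschitz (f : R -> C) :
  (forall a b, -1 < a -> a <= b -> b < 1 -> exists L, 0 <= L /\
    forall s t, a <= s -> s <= t -> t <= b -> Cmod (f t - f s) <= L * (t - s)) -> ACloc f.
Proof.
  intros H. apply (ACloc_dominated RtoC RtoC); [apply ACloc_id|apply ACloc_id|].
  intros a b ha hab hb. destruct (H a b ha hab hb) as [L [hL HL]].
  exists L. split; [exact hL|]. intros s t h1 h2 h3.
  apply Rle_trans with (1 := HL s t h1 h2 h3).
  rewrite <- RtoC_minus, Cmod_R, Rabs_pos_eq by lra. nra.
Qed.

Lemma ACloc_plus f g : ACloc f -> ACloc g -> ACloc (fun x => f x + g x)%C.
Proof.
  intros Hf Hg. apply (ACloc_dominated f g); auto.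
  intros a b _ _ _. exists 1. split; [lra|]. intros s t _ _ _. rewrite Rmult_1_l.
  replace (f t + g t - (f s + g s))%C with ((f t - f s) + (g t - g s))%C by ring.
  apply Cmod_triangle.
Qed.

Lemma ACloc_mult f g : ACloc f -> ACloc g -> ACloc (fun x => f x * g x)%C.
Proof.
  intros Hf Hg. apply (ACloc_dominated f g); auto.
  intros a b ha hab hb.
  destruct (ACloc_bounded f a b Hf ha hab hb) as [A [hA HA]].
  destruct (ACloc_bounded g a b Hg ha hab hb) as [B [hB HB]].
  exists (A + B). split; [lra|]. intros s t h1 h2 h3.
  replace (f t * g t - f s * g s)%C with ((f t - f s) * g t + f s * (g t - g s))%C by ring.
  eapply Rle_trans; [apply Cmod_triangle|]. rewrite !Cmod_mult.
  assert (k1 := HA s ltac:(lra)). assert (k2 := HB t ltac:(lra)).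
  assert (p1 := Cmod_ge_0 (f t - f s)). assert (p2 := Cmod_ge_0 (g t - g s)).
  assert (p3 := Cmod_ge_0 (f s)). assert (p4 := Cmod_ge_0 (g t)). nra.
Qed.

Lemma ACloc_scal c f : ACloc f -> ACloc (fun x => c * f x)%C.
Proof.
  intros Hf. apply (ACloc_dominated f f); auto.
  intros a b _ _ _. exists (Cmod c). split; [apply Cmod_ge_0|]. intros s t _ _ _.
  replace (c * f t - c * f s)%C with (c * (f t - f s))%C by ring. rewrite Cmod_mult.
  assert (p1 := Cmod_ge_0 (f t - f s)). assert (p2 := Cmod_ge_0 c). nra.
Qed.

Lemma ACloc_opp f : ACloc f -> ACloc (fun x => - f x)%C.
Proof.
  intros Hf. apply (ACloc_dominated f f); auto.
  intros a b _ _ _. exists 1. split; [lra|]. intros s t _ _ _.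
  replace (- f t - - f s)%C with (- (f t - f s))%C by ring. rewrite Cmod_opp.
  assert (p1 := Cmod_ge_0 (f t - f s)). lra.
Qed.

Lemma ACloc_Re f : ACloc f -> ACloc (fun x => RtoC (Re (f x))).
Proof.
  intros Hf. apply (ACloc_dominated f f); auto.
  intros a b _ _ _. exists 1. split; [lra|]. intros s t _ _ _.
  rewrite <- RtoC_minus, Cmod_R. assert (p1 := Rabs_Re_le_Cmod (f t - f s)).
  change (Re (f t - f s)) with (Re (f t) - Re (f s)) in p1.
  assert (p2 := Cmod_ge_0 (f t - f s)). lra.
Qed.

Lemma ACloc_Im f : ACloc f -> ACloc (fun x => RtoC (Im (f x))).
Proof.
  intros Hf. apply (ACloc_dominated f f); auto.
  intros a b _ _ _. exists 1. split; [lra|]. intros s t _ _ _.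
  rewrite <- RtoC_minus, Cmod_R. assert (p1 := Rabs_Im_le_Cmod (f t - f s)).
  change (Im (f t - f s)) with (Im (f t) - Im (f s)) in p1.
  assert (p2 := Cmod_ge_0 (f t - f s)). lra.
Qed.

Lemma ACloc_eq f g : (forall x, in11 x -> f x = g x) -> ACloc f -> ACloc g.
Proof.
  intros E Hf. apply (ACloc_dominated f f); auto.
  intros a b ha hab hb. exists 1. split; [lra|]. intros s t h1 h2 h3.
  rewrite <- !E by (split; lra). assert (p2 := Cmod_ge_0 (f t - f s)). lra.
Qed.

Lemma ACloc_of_C1 (f df : R -> C) :
  (forall x, in11 x -> is_derive f x (df x)) ->
  (forall a b, -1 < a -> a <= b -> b < 1 -> exists B, forall x, a <= x <= b -> Cmod (df x) <= B) ->
  ACloc f.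
Proof.
  intros Hf Hb. apply ACloc_locally_lipschitz. intros a b ha hab hb.
  destruct (Hb a b ha hab hb) as [B HB].
  assert (hB : 0 <= B) by (apply Rle_trans with (2 := HB a ltac:(lra)); apply Cmod_ge_0).
  exists (2 * B). split; [lra|]. intros s t h1 h2 h3.
  assert (K : forall g dg : R -> R, (forall x, a <= x <= b -> is_derive g x (dg x)) ->
    (forall x, a <= x <= b -> Rabs (dg x) <= B) -> Rabs (g t - g s) <= B * (t - s)).
  { intros g dg Hg Hdg. destruct (MVT_gen g s t dg) as [c [Hc E]].
    - rewrite Rmin_left, Rmax_right by lra. intros x Hx. apply Hg. lra.
    - rewrite Rmin_left, Rmax_right by lra. intros x Hx.
      apply derivable_continuous_pt. exists (dg x). apply is_derive_Reals, Hg. lra.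
    - rewrite Rmin_left, Rmax_right in Hc by lra. rewrite E, Rabs_mult, (Rabs_pos_eq (t - s)) by lra.
      apply Rmult_le_compat_r; [lra|]. apply Hdg. lra. }
  eapply Rle_trans; [apply Cmod_le_ReIm|].
  assert (k1 := K (fun x => Re (f x)) (fun x => Re (df x))
    (fun x Hx => proj1 (proj1 (is_derive_ReIm _ _ _) (Hf x ltac:(split; lra))))
    (fun x Hx => Rle_trans _ _ _ (Rabs_Re_le_Cmod _) (HB x Hx))).
  assert (k2 := K (fun x => Im (f x)) (fun x => Im (df x))
    (fun x Hx => proj2 (proj1 (is_derive_ReIm _ _ _) (Hf x ltac:(split; lra))))
    (fun x Hx => Rle_trans _ _ _ (Rabs_Im_le_Cmod _) (HB x Hx))).
  change (Re (f t - f s)) with (Re (f t) - Re (f s)).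
  change (Im (f t - f s)) with (Im (f t) - Im (f s)). lra.
Qed.

(** As in the differentiable case, with [ac_nondecreasing] in place of the mean value theorem. *)
Lemma ac_increment_le (f df : R -> C) (V v : R -> R) a b :
  ACloc f -> ACloc (fun x => RtoC (V x)) ->
  MC.ae11 (fun x => is_derive f x (df x)) -> MC.ae11 (fun x => is_derive V x (v x)) ->
  -1 < a -> a <= b -> b < 1 ->
  MC.ae11 (fun x => a <= x <= b -> Cmod (df x) <= v x) ->
  Cmod (f b - f a) <= 2 * (V b - V a).
Proof.
  intros Af AV Df DV ha hab hb Hv.
  assert (K : forall g dg : R -> R, ACloc (fun x => RtoC (g x)) ->
     MC.ae11 (fun x => is_derive g x (dg x)) ->
     MC.ae11 (fun x => a <= x <= b -> Rabs (dg x) <= v x) -> Rabs (g b - g a) <= V b - V a).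
  { intros g dg Ag Hg Hdg.
    assert (Hall := LebR.ae11_and _ _ DV (LebR.ae11_and _ _ Hg Hdg)).
    apply Rabs_le. split.
    - assert (h : V a + g a <= V b + g b); [|lra].
      apply (ac_nondecreasing (fun x => V x + g x)); auto.
      + apply ACloc_eq with (fun x => RtoC (V x) + RtoC (g x))%C; [|apply ACloc_plus; auto].
        intros x _. now rewrite RtoC_plus.
      + apply LebR.ae11_impl with (2 := Hall). intros x _ (d1 & d2 & d3) hx.
        exists (v x + dg x). split.
        * assert (h := d3 hx). apply Rabs_le_between in h. lra.
        * exact (is_derive_plus V g x (v x) (dg x) d1 d2).
    - assert (h : V a - g a <= V b - g b); [|lra].
      apply (ac_nondecreasing (fun x => V x - g x)); auto.
      + apply ACloc_eq with (fun x => RtoC (V x) + - RtoC (g x))%C;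
          [|apply ACloc_plus; [auto|apply ACloc_opp; auto]].
        intros x _. now rewrite RtoC_minus.
      + apply LebR.ae11_impl with (2 := Hall). intros x _ (d1 & d2 & d3) hx.
        exists (v x - dg x). split.
        * assert (h := d3 hx). apply Rabs_le_between in h. lra.
        * exact (is_derive_minus V g x (v x) (dg x) d1 d2). }
  eapply Rle_trans; [apply Cmod_le_ReIm|].
  assert (h1 : Rabs (Re (f b) - Re (f a)) <= V b - V a).
  { apply (K (fun t => Re (f t)) (fun t => Re (df t)) (ACloc_Re f Af)).
    - apply LebR.ae11_impl with (2 := Df). intros x _ h. apply is_derive_ReIm in h. apply h.
    - apply LebR.ae11_impl with (2 := Hv). intros x _ h hx.
      apply Rle_trans with (2 := h hx). apply Rabs_Re_le_Cmod. }
  assert (h2 : Rabs (Im (f b) - Im (f a)) <= V b - V a).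
  { apply (K (fun t => Im (f t)) (fun t => Im (df t)) (ACloc_Im f Af)).
    - apply LebR.ae11_impl with (2 := Df). intros x _ h. apply is_derive_ReIm in h. apply h.
    - apply LebR.ae11_impl with (2 := Hv). intros x _ h hx.
      apply Rle_trans with (2 := h hx). apply Rabs_Im_le_Cmod. }
  change (Re (f b - f a)) with (Re (f b) - Re (f a)).
  change (Im (f b - f a)) with (Im (f b) - Im (f a)). lra.
Qed.

Lemma ac_constant (f : R -> C) : ACloc f -> MC.ae11 (fun x => is_derive f x (RtoC 0)) ->
  forall x y, in11 x -> in11 y -> f x = f y.
Proof.
  intros Af Df.
  assert (K : forall a b, -1 < a -> a <= b -> b < 1 -> f b = f a).
  { intros a b ha hab hb.
    assert (h := ac_increment_le f (fun _ => RtoC 0) (fun _ => 0) (fun _ => 0) a b Af).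
    assert (h' : Cmod (f b - f a) <= 2 * (0 - 0)).
    { apply h; auto.
      - apply ACloc_locally_lipschitz. intros. exists 0. split; [lra|]. intros.
        replace (RtoC 0 - RtoC 0)%C with (RtoC 0) by ring. rewrite Cmod_0. lra.
      - apply LebR.ae11_all. intros x _. exact (is_derive_const (V := R_NormedModule) 0 x).
      - apply LebR.ae11_all. intros x _ _. rewrite Cmod_0. lra. }
    assert (h0 : Cmod (f b - f a) = 0) by (assert (p := Cmod_ge_0 (f b - f a)); lra).
    apply Cmod_eq_0 in h0. replace (f b) with (f b - f a + f a)%C by ring. rewrite h0. ring. }
  intros x y [x1 x2] [y1 y2]. destruct (Rle_dec x y).
  - symmetry. apply K; lra.
  - apply K; lra.
Qed.

(** * Hypergeometric series *)

(** Majorant of the ratio of consecutive hypergeometric coefficients, where [s] and [M] bound the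
    sum and the product of the numerator parameters. It tends to 1, so the coefficients grow at most
    like $\rho^n$ for every $\rho>1$. *)
Definition rec_ratio (s M cc : R) (n : nat) : R :=
  (INR n ^ 2 + s * INR n + M) / ((INR n + cc) * (INR n + 1)).

Lemma eventually_nonincreasing_bounded (y : nat -> R) N :
  (forall n, (N <= n)%nat -> y (S n) <= y n) -> exists K, 0 <= K /\ forall n, y n <= K.
Proof.
  intros H.
  assert (K1 : exists K, 0 <= K /\ forall n, (n <= N)%nat -> y n <= K).
  { clear H. induction N as [|N [K [hK HK]]].
    - exists (Rmax 0 (y O)). split; [apply Rmax_l|]. intros n hn. replace n with O by lia. apply Rmax_r.
    - exists (Rmax K (y (S N))). split; [eapply Rle_trans; [exact hK|apply Rmax_l]|].
      intros n hn. destruct (le_lt_eq_dec n (S N) hn) as [l| ->]; [|apply Rmax_r].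
      eapply Rle_trans; [apply HK; lia|apply Rmax_l]. }
  destruct K1 as [K [hK HK]]. exists K. split; [exact hK|].
  assert (H2 : forall j, y (N + j)%nat <= K).
  { induction j as [|j IH]; [apply HK; lia|].
    replace (N + S j)%nat with (S (N + j)) by lia.
    apply Rle_trans with (y (N + j)%nat); [apply H; lia|exact IH]. }
  intros n. destruct (le_lt_dec n N) as [l|l]; [apply HK, l|].
  replace n with (N + (n - N))%nat by lia. apply H2.
Qed.

Lemma rec_ratio_eventually_le s M cc rho : 0 <= s -> 0 <= M -> 0 < cc -> 1 < rho ->
  exists N, forall n, (N <= n)%nat -> rec_ratio s M cc n <= rho.
Proof.
  intros hs hM hc hr.
  destruct (archimed ((s + M) / (rho - 1) + 1)) as [h _].
  assert (h0 : 0 <= (s + M) / (rho - 1)) by (apply Rdiv_le_0_compat; lra).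
  exists (Z.to_nat (up ((s + M) / (rho - 1) + 1))). intros n hn.
  assert (hn' : (s + M) / (rho - 1) + 1 <= INR n).
  { apply le_INR in hn. rewrite INR_IZR_INZ, Z2Nat.id in hn; [lra|].
    apply le_IZR. lra. }
  assert (h1 : s + M <= (rho - 1) * INR n).
  { apply Rle_trans with ((rho - 1) * ((s + M) / (rho - 1))); [right; field; lra|].
    apply Rmult_le_compat_l; lra. }
  unfold rec_ratio. assert (hn1 : 1 <= INR n) by lra.
  apply Rle_div_l; [nra|].
  assert (s * INR n + M <= (rho - 1) * INR n * INR n) by nra.
  assert (0 <= rho * (cc + 1) * INR n) by (apply Rmult_le_pos; nra).
  assert (0 <= rho * cc) by nra. nra.
Qed.

Lemma rec_ratio_nonneg s M cc n : 0 <= s -> 0 <= M -> 0 < cc -> 0 <= rec_ratio s M cc n.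
Proof.
  intros hs hM hc. assert (h := pos_INR n). unfold rec_ratio.
  apply Rdiv_le_0_compat; nra.
Qed.

(** Every such [x] is dominated by the solution [m] of the recurrence with equality. From the index
    where the ratio is at most $\rho$, the quotient $m_n/\rho^n$ grows only by the source terms,
    which are summable since $\rho_0<\rho$. *)
Lemma recurrence_geometric_bound s M T cc rho0 rho X0 :
  0 <= s -> 0 <= M -> 0 < cc -> 1 < rho0 -> rho0 < rho -> 0 <= T -> 0 <= X0 ->
  exists K, 0 <= K /\ forall x : nat -> R, x O <= X0 ->
    (forall n, x (S n) <= x n * rec_ratio s M cc n + T * rho0 ^ n) ->
    forall n, x n <= K * rho ^ n.
Proof.
  intros hs hM hc hr0 hr hT hX.
  pose (m := fix m n := match n with O => X0 | S k => m k * rec_ratio s M cc k + T * rho0 ^ k end).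
  assert (m0 : forall n, 0 <= m n).
  { induction n as [|n IH]; [exact hX|]. simpl.
    assert (h := rec_ratio_nonneg s M cc n hs hM hc).
    assert (p : 0 < rho0 ^ n) by (apply pow_lt; lra). nra. }
  pose (th := rho0 / rho).
  assert (hth : 0 < th < 1).
  { unfold th. split; [apply Rdiv_lt_0_compat; lra|]. apply Rlt_div_l; lra. }
  (* The second term is the sum of the source contributions still to come, which makes [y]
     eventually nonincreasing. *)
  pose (y := fun n => m n / rho ^ n + T / rho * th ^ n / (1 - th)).
  destruct (rec_ratio_eventually_le s M cc rho hs hM hc ltac:(lra)) as [N HN].
  destruct (eventually_nonincreasing_bounded y N) as [K [hK HK]].
  { intros n hn. unfold y.
    assert (pn : 0 < rho ^ n) by (apply pow_lt; lra).
    assert (E : m (S n) / rho ^ S n <= m n / rho ^ n + T / rho * th ^ n).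
    { change (m (S n)) with (m n * rec_ratio s M cc n + T * rho0 ^ n).
      apply Rle_trans with ((m n * rho + T * rho0 ^ n) / rho ^ S n).
      - apply Rmult_le_compat_r; [left; apply Rinv_0_lt_compat, pow_lt; lra|].
        assert (h := HN n hn). assert (h' := m0 n). nra.
      - right. unfold th. simpl. unfold Rdiv. rewrite !Rpow_mult_distr, pow_inv.
        field. lra. }
    replace (T / rho * th ^ S n / (1 - th)) with
      (T / rho * th ^ n / (1 - th) - T / rho * th ^ n) by (simpl; field; lra).
    lra. }
  exists K. split; [exact hK|].
  intros x hx0 hx n.
  assert (hxm : forall n, x n <= m n).
  { intros j. induction j as [|k IH]; [exact hx0|]. simpl. eapply Rle_trans; [apply hx|].
    assert (h := rec_ratio_nonneg s M cc k hs hM hc). nra. }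
  assert (pn : 0 < rho ^ n) by (apply pow_lt; lra).
  assert (h := HK n). unfold y in h.
  assert (h2 : 0 <= T / rho * th ^ n / (1 - th)).
  { apply Rdiv_le_0_compat; [|lra]. apply Rmult_le_pos; [apply Rdiv_le_0_compat; lra|apply pow_le; lra]. }
  assert (h3 : m n / rho ^ n <= K) by lra.
  apply Rle_div_l in h3; [|exact pn]. assert (h4 := hxm n). lra.
Qed.

(* Coefficient families with subexponential growth, locally uniformly in the parameter,
   and locally Lipschitz in the parameter with the same growth. *)
Definition nice (f : C -> nat -> C) : Prop :=
  forall M rho, 1 < rho -> exists K, 0 <= K /\ forall q q1, Cmod q <= M -> Cmod q1 <= M ->
    forall n, Cmod (f q n) <= K * rho ^ n /\ Cmod (f q n - f q1 n) <= K * Cmod (q - q1) * rho ^ n.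

Lemma nice_plus f g : nice f -> nice g -> nice (fun q n => f q n + g q n)%C.
Proof.
  intros Hf Hg M rho hr. destruct (Hf M rho hr) as [K [hK HK]]. destruct (Hg M rho hr) as [L [hL HL]].
  exists (K + L). split; [lra|]. intros q q1 h h1 n.
  destruct (HK q q1 h h1 n) as [a b]. destruct (HL q q1 h h1 n) as [c d]. split.
  - eapply Rle_trans; [apply Cmod_triangle|]. lra.
  - replace (f q n + g q n - (f q1 n + g q1 n))%C with ((f q n - f q1 n) + (g q n - g q1 n))%C by ring.
    eapply Rle_trans; [apply Cmod_triangle|]. lra.
Qed.

Lemma nice_mulr (b : nat -> R) B f : (forall n, Rabs (b n) <= B) -> nice f ->
  nice (fun q n => RtoC (b n) * f q n)%C.
Proof.
  intros Hb Hf M rho hr. destruct (Hf M rho hr) as [K [hK HK]].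
  assert (hB : 0 <= B) by (apply Rle_trans with (2 := Hb O); apply Rabs_pos).
  exists (B * K). split; [nra|]. intros q q1 h h1 n.
  destruct (HK q q1 h h1 n) as [a c].
  assert (E : (RtoC (b n) * f q n - RtoC (b n) * f q1 n = RtoC (b n) * (f q n - f q1 n))%C) by ring.
  rewrite E, !Cmod_mult, !Cmod_R. assert (p := Rabs_pos (b n)). specialize (Hb n).
  assert (p1 := Cmod_ge_0 (f q n)). assert (p2 := Cmod_ge_0 (f q n - f q1 n)). split.
  - rewrite Rmult_assoc. apply Rmult_le_compat; auto.
  - replace (B * K * Cmod (q - q1) * rho ^ n) with (B * (K * Cmod (q - q1) * rho ^ n)) by ring.
    apply Rmult_le_compat; auto.
Qed.

Lemma nice_shift f : nice f -> nice (fun q n => f q (S n)).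
Proof.
  intros Hf M rho hr. destruct (Hf M rho hr) as [K [hK HK]].
  exists (K * rho). split; [nra|]. intros q q1 h h1 n.
  destruct (HK q q1 h h1 (S n)) as [a b]. simpl in a, b. split; [lra|].
  eapply Rle_trans; [exact b|right; ring].
Qed.

Definition cder (a : nat -> C) (n : nat) : C := (RtoC (INR (S n)) * a (S n))%C.

Lemma nice_cder f : nice f -> nice (fun q => cder (f q)).
Proof.
  intros Hf M rho hr.
  pose (r := (rho - 1) / 2). assert (hr0 : 0 < r) by (unfold r; lra).
  assert (h1 : 1 < (1 + rho) / 2) by lra.
  destruct (Hf M _ h1) as [K [hK HK]].
  assert (hth : (1 + rho) / 2 < rho) by lra.
  pose (d := rho / ((1 + rho) / 2) - 1).
  assert (hd : 0 < d).
  { unfold d. assert (1 < rho / ((1 + rho) / 2)); [|lra]. apply Rlt_div_r; lra. }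
  (* The factor $n+1$ is absorbed by Bernoulli's inequality $(1+d)^n\ge1+nd$ on passing from the
     rate $(1+\rho)/2$ to $\rho$. *)
  assert (Hn : forall n, INR (S n) * ((1 + rho) / 2) ^ S n <= (1 + / d) * ((1 + rho) / 2) * rho ^ n).
  { intros n.
    assert (E : rho ^ n = (1 + d) ^ n * ((1 + rho) / 2) ^ n).
    { rewrite <- Rpow_mult_distr. f_equal. unfold d. field. lra. }
    assert (B := poly n d hd).
    assert (p : 0 < ((1 + rho) / 2) ^ n) by (apply pow_lt; lra).
    assert (c : INR (S n) <= (1 + / d) * (1 + d) ^ n).
    { rewrite S_INR. assert (hid : 0 < / d) by (apply Rinv_0_lt_compat; lra).
      assert (e : / d * d = 1) by (field; lra).
      assert (h0 := pos_INR n).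
      assert ((1 + / d) * (1 + INR n * d) <= (1 + / d) * (1 + d) ^ n) by (apply Rmult_le_compat_l; lra).
      assert (e2 : (1 + / d) * (1 + INR n * d) = 1 + INR n * d + / d + INR n * (/ d * d)) by ring.
      rewrite e in e2. assert (0 <= INR n * d) by nra. lra. }
    rewrite E. simpl pow.
    replace ((1 + / d) * ((1 + rho) / 2) * ((1 + d) ^ n * ((1 + rho) / 2) ^ n)) with
      (((1 + / d) * (1 + d) ^ n) * ((1 + rho) / 2 * ((1 + rho) / 2) ^ n)) by ring.
    apply Rmult_le_compat_r; [nra|exact c]. }
  exists (K * ((1 + / d) * ((1 + rho) / 2))).
  assert (hid : 0 < / d) by (apply Rinv_0_lt_compat; lra).
  split; [apply Rmult_le_pos; nra|]. intros q q1 hq hq1 n.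
  destruct (HK q q1 hq hq1 (S n)) as [a b]. unfold cder.
  assert (E : (RtoC (INR (S n)) * f q (S n) - RtoC (INR (S n)) * f q1 (S n) =
    RtoC (INR (S n)) * (f q (S n) - f q1 (S n)))%C) by ring.
  rewrite E, !Cmod_mult, !Cmod_R, (Rabs_pos_eq (INR (S n))) by apply pos_INR.
  specialize (Hn n). assert (hS := pos_INR (S n)).
  assert (Hq := Cmod_ge_0 (q - q1)). split.
  - apply Rle_trans with (K * (INR (S n) * ((1 + rho) / 2) ^ S n)).
    + eapply Rle_trans; [apply Rmult_le_compat_l; [exact hS|exact a]|right; ring].
    + rewrite Rmult_assoc. apply Rmult_le_compat_l; lra.
  - apply Rle_trans with (K * Cmod (q - q1) * (INR (S n) * ((1 + rho) / 2) ^ S n)).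
    + eapply Rle_trans; [apply Rmult_le_compat_l; [exact hS|exact b]|right; ring].
    + replace (K * ((1 + / d) * ((1 + rho) / 2)) * Cmod (q - q1) * rho ^ n) with
        (K * Cmod (q - q1) * ((1 + / d) * ((1 + rho) / 2) * rho ^ n)) by ring.
      apply Rmult_le_compat_l; [nra|exact Hn].
Qed.

(** The modulus of the difference of two solutions, divided by $|q-q_1|$, obeys a recurrence
    inequality with the same ratio and a new source, bounded through the growth of the solution at
    $q_1$. The rates $r_0<r_1<\rho$ serve the source, the solutions and their differences. *)
Lemma nice_recurrence (s cc : R) (x0 : C) (f x : C -> nat -> C) : 0 < cc -> nice f ->
  (forall q, x q O = x0) ->
  (forall q n, x q (S n) = x q n * ((RtoC (INR n ^ 2 + s * INR n) + q)
                 * RtoC (/ ((INR n + cc) * (INR n + 1)))) + f q n)%C ->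
  nice x.
Proof.
  intros hc Hf Hx0 Hx M rho hr.
  pose (r0 := 1 + (rho - 1) / 3). pose (r1 := 1 + 2 * (rho - 1) / 3).
  destruct (Hf (Rabs M) r0 ltac:(unfold r0; lra)) as [K0 [hK0 HK0]].
  assert (hs := Rabs_pos s). assert (hM := Rabs_pos M).
  destruct (recurrence_geometric_bound (Rabs s) (Rabs M) K0 cc r0 r1 (Cmod x0)) as [K1 [hK1 HK1]];
    try (unfold r0, r1; lra); try apply Cmod_ge_0.
  assert (hcc : 0 < / cc) by (apply Rinv_0_lt_compat; lra).
  destruct (recurrence_geometric_bound (Rabs s) (Rabs M) (K1 / cc + K0) cc r1 rho 0) as [K2 [hK2 HK2]];
    try (unfold r0, r1; lra).
  { unfold Rdiv. nra. }
  assert (Hden : forall n, 0 < (INR n + cc) * (INR n + 1)).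
  { intros n. assert (h := pos_INR n). nra. }
  assert (HM : forall q, Cmod q <= M -> Cmod q <= Rabs M).
  { intros q h. apply Rle_trans with (1 := h). apply Rle_abs. }
  assert (Hrat : forall q n, Cmod q <= M ->
    Cmod ((RtoC (INR n ^ 2 + s * INR n) + q) * RtoC (/ ((INR n + cc) * (INR n + 1))))
      <= rec_ratio (Rabs s) (Rabs M) cc n).
  { intros q n hq. rewrite Cmod_mult, (Cmod_R (/ _)), Rabs_pos_eq
      by (left; apply Rinv_0_lt_compat, Hden).
    apply Rmult_le_compat_r; [left; apply Rinv_0_lt_compat, Hden|].
    eapply Rle_trans; [apply Cmod_triangle|]. apply Rplus_le_compat; [|apply HM, hq].
    rewrite Cmod_R. assert (h := pos_INR n).
    eapply Rle_trans; [apply Rabs_triang|].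
    rewrite Rabs_mult, (Rabs_pos_eq (INR n ^ 2)), (Rabs_pos_eq (INR n)) by nra. lra. }
  assert (Hb : forall q, Cmod q <= M -> forall n, Cmod (x q n) <= K1 * r1 ^ n).
  { intros q hq. apply HK1.
    - rewrite Hx0. lra.
    - intros n. rewrite Hx. eapply Rle_trans; [apply Cmod_triangle|].
      apply Rplus_le_compat; [|apply (HK0 q q); auto].
      rewrite Cmod_mult. apply Rmult_le_compat_l; [apply Cmod_ge_0|auto]. }
  exists (K1 + K2). split; [lra|]. intros q q1 hq hq1 n.
  assert (hr1 : forall n, r0 ^ n <= r1 ^ n) by (intros k; apply pow_incr; unfold r0, r1; lra).
  assert (hr2 : forall n, r1 ^ n <= rho ^ n) by (intros k; apply pow_incr; unfold r1; lra).
  assert (hpn : 0 <= rho ^ n) by (apply pow_le; lra).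
  split.
  - eapply Rle_trans; [apply Hb, hq|]. specialize (hr2 n). nra.
  - destruct (classic (q = q1)) as [-> |hne].
    + replace (x q1 n - x q1 n)%C with (RtoC 0) by ring. rewrite Cmod_0.
      apply Rmult_le_pos; [apply Rmult_le_pos; [lra|apply Cmod_ge_0]|exact hpn].
    + assert (hd : 0 < Cmod (q - q1)).
      { apply Cmod_gt_0. intros h. apply hne. replace q with (q - q1 + q1)%C by ring. rewrite h. ring. }
      assert (E : Cmod (x q n - x q1 n) / Cmod (q - q1) <= K2 * rho ^ n).
      { apply (HK2 (fun n => Cmod (x q n - x q1 n) / Cmod (q - q1))).
        - rewrite !Hx0. replace (x0 - x0)%C with (RtoC 0) by ring. rewrite Cmod_0. unfold Rdiv. lra.
        - intros k. rewrite !Hx.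
          set (A := (RtoC (INR k ^ 2 + s * INR k) + q)%C).
          set (c := RtoC (/ ((INR k + cc) * (INR k + 1)))).
          replace (x q k * (A * c) + f q k -
            (x q1 k * ((RtoC (INR k ^ 2 + s * INR k) + q1) * c) + f q1 k))%C
            with ((x q k - x q1 k) * (A * c) + (x q1 k * c * (q - q1) + (f q k - f q1 k)))%C
            by (unfold A; ring).
          apply Rle_div_l; [exact hd|].
          eapply Rle_trans; [apply Cmod_triangle|].
          rewrite Rmult_plus_distr_r. apply Rplus_le_compat.
          + rewrite Cmod_mult.
            replace (Cmod (x q k - x q1 k) / Cmod (q - q1) * rec_ratio (Rabs s) (Rabs M) cc k * Cmod (q - q1))
              with (Cmod (x q k - x q1 k) * rec_ratio (Rabs s) (Rabs M) cc k) by (field; lra).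
            apply Rmult_le_compat_l; [apply Cmod_ge_0|]. apply Hrat, hq.
          + eapply Rle_trans; [apply Cmod_triangle|].
            replace ((K1 / cc + K0) * r1 ^ k * Cmod (q - q1)) with
              (K1 * r1 ^ k * / cc * Cmod (q - q1) + K0 * Cmod (q - q1) * r1 ^ k)
              by (unfold Rdiv; ring).
            apply Rplus_le_compat.
            * rewrite !Cmod_mult. apply Rmult_le_compat_r; [lra|].
              apply Rmult_le_compat; try apply Cmod_ge_0; [apply Hb, hq1|].
              unfold c. rewrite Cmod_R, Rabs_pos_eq by (left; apply Rinv_0_lt_compat, Hden).
              apply Rinv_le_contravar; [exact hc|]. assert (h := pos_INR k). nra.
            * eapply Rle_trans; [apply (HK0 q q1); auto|].
              apply Rmult_le_compat_l; [nra|apply hr1]. }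
      apply (Rle_div_l _ _ _ hd) in E.
      apply Rle_trans with (1 := E).
      replace (K2 * rho ^ n * Cmod (q - q1)) with (K2 * (Cmod (q - q1) * rho ^ n)) by ring.
      replace ((K1 + K2) * Cmod (q - q1) * rho ^ n) with ((K1 + K2) * (Cmod (q - q1) * rho ^ n)) by ring.
      apply Rmult_le_compat_r; [nra|lra].
Qed.

Definition CPS (a : nat -> C) (w : R) : C :=
  (PSeries (fun n => Re (a n)) w, PSeries (fun n => Im (a n)) w).

(** Radius of convergence at least 1, in a form stable under termwise operations. *)
Definition subexp (a : nat -> C) : Prop :=
  forall rho, 1 < rho -> exists K, forall n, Cmod (a n) <= K * rho ^ n.

Lemma nice_subexp f q : nice f -> subexp (f q).
Proof.
  intros H rho hr. destruct (H (Cmod q) rho hr) as [K [_ HK]]. exists K. intros n.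
  apply (HK q q); lra.
Qed.

Lemma subexp_cder a : subexp a -> subexp (cder a).
Proof.
  intros H. apply (nice_subexp (fun _ => cder a) (RtoC 0)). apply (nice_cder (fun _ => a)).
  intros M rho hr. destruct (H rho hr) as [K HK]. exists K. split.
  - assert (h := HK O). simpl in h. assert (p := Cmod_ge_0 (a O)). lra.
  - intros q q1 _ _ n. split; [apply HK|].
    replace (a n - a n)%C with (RtoC 0) by ring. rewrite Cmod_0.
    apply Rmult_le_pos; [apply Rmult_le_pos; [|apply Cmod_ge_0]|apply pow_le; lra].
    assert (h := HK O). simpl in h. assert (p := Cmod_ge_0 (a O)). lra.
Qed.

Lemma subexp_CV (x : nat -> R) w :
  (forall rho, 1 < rho -> exists K, forall n, Rabs (x n) <= K * rho ^ n) ->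
  Rabs w < 1 -> Rbar_lt (Rabs w) (CV_radius x).
Proof.
  intros H hw.
  pose (rho := 2 / (1 + Rabs w)). assert (hp := Rabs_pos w).
  assert (hr : 1 < rho) by (unfold rho; apply Rlt_div_r; lra).
  destruct (H rho hr) as [K HK].
  apply Rbar_lt_le_trans with (Finite (/ rho)).
  - simpl. unfold rho. rewrite Rinv_div. lra.
  - apply CV_radius_bounded. exists K. intros n.
    assert (p : 0 < rho ^ n) by (apply pow_lt; lra).
    rewrite Rabs_mult, pow_inv, (Rabs_pos_eq (/ _)) by (left; apply Rinv_0_lt_compat; exact p).
    apply Rmult_le_reg_r with (rho ^ n); [exact p|].
    rewrite Rmult_assoc, Rinv_l, Rmult_1_r by lra. apply HK.
Qed.

Lemma subexp_CV_Re a w : subexp a -> Rabs w < 1 ->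
  Rbar_lt (Rabs w) (CV_radius (fun n => Re (a n))).
Proof.
  intros H. apply subexp_CV. intros rho hr. destruct (H rho hr) as [K HK]. exists K.
  intros n. apply Rle_trans with (2 := HK n). apply Rabs_Re_le_Cmod.
Qed.

Lemma subexp_CV_Im a w : subexp a -> Rabs w < 1 ->
  Rbar_lt (Rabs w) (CV_radius (fun n => Im (a n))).
Proof.
  intros H. apply subexp_CV. intros rho hr. destruct (H rho hr) as [K HK]. exists K.
  intros n. apply Rle_trans with (2 := HK n). apply Rabs_Im_le_Cmod.
Qed.

Lemma CPS_ext a b w : (forall n, a n = b n) -> CPS a w = CPS b w.
Proof. intros E. unfold CPS. f_equal; apply PSeries_ext; intros n; now rewrite E. Qed.

Lemma CPS_plus a b w : subexp a -> subexp b -> Rabs w < 1 ->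
  CPS (fun n => a n + b n)%C w = (CPS a w + CPS b w)%C.
Proof.
  intros Ha Hb hw. unfold CPS, Cplus; simpl. f_equal.
  - rewrite <- PSeries_plus by (apply CV_radius_inside; apply subexp_CV_Re; assumption). reflexivity.
  - rewrite <- PSeries_plus by (apply CV_radius_inside; apply subexp_CV_Im; assumption). reflexivity.
Qed.

Lemma CPS_scal c a w : subexp a -> Rabs w < 1 ->
  CPS (fun n => c * a n)%C w = (c * CPS a w)%C.
Proof.
  intros Ha hw.
  assert (e1 := CV_radius_inside _ _ (subexp_CV_Re a w Ha hw)).
  assert (e2 := CV_radius_inside _ _ (subexp_CV_Im a w Ha hw)).
  assert (s1 : forall (k : R) (b : nat -> R), ex_pseries b w -> ex_pseries (PS_scal k b) w).
  { intros k b hb. apply ex_pseries_scal; [apply Rmult_comm|exact hb]. }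
  unfold CPS, Cmult; simpl. f_equal.
  - rewrite <- !PSeries_scal, <- PSeries_minus by (apply s1; assumption). apply PSeries_ext.
    intros n. reflexivity.
  - rewrite <- !PSeries_scal, <- PSeries_plus by (apply s1; assumption). apply PSeries_ext.
    intros n. reflexivity.
Qed.

Lemma CPS_derive a w : subexp a -> Rabs w < 1 -> is_derive (CPS a) w (CPS (cder a) w).
Proof.
  intros H hw. apply is_derive_ReIm. split.
  - assert (h := is_derive_PSeries _ _ (subexp_CV_Re a w H hw)).
    replace (Re (CPS (cder a) w)) with (PSeries (PS_derive (fun n => Re (a n))) w); [exact h|].
    apply PSeries_ext. intros n. unfold PS_derive, cder, Re, Cmult, RtoC; simpl. ring.
  - assert (h := is_derive_PSeries _ _ (subexp_CV_Im a w H hw)).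
    replace (Im (CPS (cder a) w)) with (PSeries (PS_derive (fun n => Im (a n))) w); [exact h|].
    apply PSeries_ext. intros n. unfold PS_derive, cder, Im, Cmult, RtoC; simpl. ring.
Qed.

Lemma CPS_decr a w : subexp a -> Rabs w < 1 ->
  CPS a w = (a O + RtoC w * CPS (fun n => a (S n)) w)%C.
Proof.
  intros H hw. unfold CPS.
  rewrite (PSeries_decr_1 _ _ (CV_radius_inside _ _ (subexp_CV_Re a w H hw))).
  rewrite (PSeries_decr_1 _ _ (CV_radius_inside _ _ (subexp_CV_Im a w H hw))).
  unfold Cplus, Cmult, RtoC, Re, Im; simpl. f_equal; unfold PS_decr_1; ring.
Qed.

Lemma PSeries_bound (x : nat -> R) K rho w : 0 <= K -> 0 < rho -> 0 <= w -> rho * w < 1 ->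
  (forall n, Rabs (x n) <= K * rho ^ n) -> Rabs (PSeries x w) <= K / (1 - rho * w).
Proof.
  intros hK hr hw hrw Hx.
  assert (p : 0 <= rho * w) by nra.
  assert (G : is_series (fun n => K * (rho * w) ^ n) (K * / (1 - rho * w))).
  { apply (is_series_scal (K := R_AbsRing) (V := R_NormedModule) K (fun n => (rho * w) ^ n) (/ (1 - rho * w))).
    apply is_series_geom. rewrite Rabs_pos_eq; lra. }
  assert (B : forall n, 0 <= Rabs (x n * w ^ n) <= K * (rho * w) ^ n).
  { intros n. split; [apply Rabs_pos|].
    rewrite Rabs_mult, (Rabs_pos_eq (w ^ n)), Rpow_mult_distr by (apply pow_le; lra).
    rewrite <- Rmult_assoc. apply Rmult_le_compat_r; [apply pow_le; lra|apply Hx]. }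
  unfold PSeries.
  apply Rle_trans with (Series (fun n => Rabs (x n * w ^ n))).
  - apply Series_Rabs. apply (ex_series_le (V := R_CompleteNormedModule) _ (fun n => K * (rho * w) ^ n)).
    + intros n. change (norm (Rabs (x n * w ^ n))) with (Rabs (Rabs (x n * w ^ n))).
      rewrite Rabs_Rabsolu. apply B.
    + exists (K * / (1 - rho * w)). exact G.
  - apply Rle_trans with (Series (fun n => K * (rho * w) ^ n)).
    + apply Series_le; [exact B|]. exists (K * / (1 - rho * w)). exact G.
    + rewrite (is_series_unique _ _ G). unfold Rdiv. lra.
Qed.

Lemma CPS_bound a K w : 0 <= K -> 0 <= w <= 1 / 2 ->
  (forall n, Cmod (a n) <= K * (3 / 2) ^ n) -> Cmod (CPS a w) <= 8 * K.
Proof.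
  intros hK hw Ha.
  assert (B : forall x : nat -> R, (forall n, Rabs (x n) <= Cmod (a n)) -> Rabs (PSeries x w) <= 4 * K).
  (* Here $\rho w\le3/4$, so the geometric series is at most 4; the two components together give
     8. *)
  { intros x Hx. eapply Rle_trans; [apply (PSeries_bound x K (3 / 2)); try lra|].
    - intros n. eapply Rle_trans; [apply Hx|apply Ha].
    - apply Rle_div_l; nra. }
  eapply Rle_trans; [apply Cmod_le_ReIm|].
  assert (h1 := B (fun n => Re (a n)) (fun n => Rabs_Re_le_Cmod _)).
  assert (h2 := B (fun n => Im (a n)) (fun n => Rabs_Im_le_Cmod _)).
  unfold CPS, Re, Im in *; simpl in *. lra.
Qed.

Lemma nice_CPS f M : nice f -> exists K, 0 <= K /\ forall q q1 w, Cmod q <= M -> Cmod q1 <= M ->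
  0 <= w <= 1 / 2 ->
  Cmod (CPS (f q) w) <= K /\ Cmod (CPS (f q) w - CPS (f q1) w) <= K * Cmod (q - q1).
Proof.
  intros Hf. destruct (Hf M (3 / 2) ltac:(lra)) as [K [hK HK]].
  exists (8 * K). split; [lra|]. intros q q1 w hq hq1 hw. split.
  - apply CPS_bound; auto. intros n. apply (HK q q); auto.
  - assert (hw1 : Rabs w < 1) by (rewrite Rabs_pos_eq; lra).
    assert (E : (CPS (f q) w - CPS (f q1) w = CPS (fun n => f q n + (-1) * f q1 n) w)%C).
    { rewrite CPS_plus, CPS_scal; auto; try apply nice_subexp; auto; [ring|].
      intros rho hr. destruct (nice_subexp f q1 Hf rho hr) as [L HL]. exists L. intros n.
      rewrite Cmod_mult, <- Cmod_opp. replace (- (-1))%C with (RtoC 1) by ring. rewrite Cmod_1, Rmult_1_l. auto. }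
    rewrite E. replace (8 * K * Cmod (q - q1)) with (8 * (K * Cmod (q - q1))) by ring.
    apply CPS_bound; auto; [assert (p := Cmod_ge_0 (q - q1)); nra|].
    intros n. replace (f q n + -1 * f q1 n)%C with (f q n - f q1 n)%C by ring. apply HK; auto.
Qed.

(** Comparison of coefficients. The zeroth order term $qx$ is left in the source [t]: for complex
    $q$ it mixes real and imaginary parts, while the operator on the left is real and acts on each
    separately. *)
Lemma PSeries_hypergeometric (x t : nat -> R) s c w :
  (forall n, (INR n + 1) * (INR n + c) * x (S n) = (INR n ^ 2 + s * INR n) * x n + t n) ->
  Rbar_lt (Rabs w) (CV_radius x) ->
  w * (1 - w) * PSeries (PS_derive (PS_derive x)) w + (c - (s + 1) * w) * PSeries (PS_derive x) w
  = PSeries t w.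
Proof.
  intros H hw.
  assert (e0 := CV_radius_inside _ _ hw).
  assert (e1 : ex_pseries (PS_derive x) w)
    by (apply CV_radius_inside; rewrite CV_radius_derive; exact hw).
  assert (e2 : ex_pseries (PS_derive (PS_derive x)) w)
    by (apply CV_radius_inside; rewrite !CV_radius_derive; exact hw).
  assert (i2 := ex_pseries_incr_1 _ _ e2). assert (i1 := ex_pseries_incr_1 _ _ e1).
  assert (ii2 := ex_pseries_incr_1 _ _ i2).
  assert (s1 : forall (k : R) (b : nat -> R), ex_pseries b w -> ex_pseries (PS_scal k b) w).
  { intros k b hb. apply ex_pseries_scal; [apply Rmult_comm|exact hb]. }
  pose (A1 := PS_incr_1 (PS_derive (PS_derive x))).
  pose (A2 := PS_scal (-1) (PS_incr_1 A1)).
  pose (A3 := PS_scal c (PS_derive x)).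
  pose (A4 := PS_scal (- (s + 1)) (PS_incr_1 (PS_derive x))).
  assert (h2 : ex_pseries A2 w) by (apply s1; exact ii2).
  assert (h3 : ex_pseries A3 w) by (apply s1; exact e1).
  assert (h4 : ex_pseries A4 w) by (apply s1; exact i1).
  rewrite (PSeries_ext t (PS_plus (PS_plus A1 A2) (PS_plus A3 A4))).
  - rewrite (PSeries_plus (PS_plus A1 A2) (PS_plus A3 A4)) by (apply ex_pseries_plus; assumption).
    rewrite (PSeries_plus A1 A2 w i2 h2), (PSeries_plus A3 A4 w h3 h4).
    assert (E2 : PSeries A2 w = -1 * (w * (w * PSeries (PS_derive (PS_derive x)) w))).
    { unfold A2. rewrite PSeries_scal. rewrite (PSeries_incr_1 A1). unfold A1. rewrite PSeries_incr_1. reflexivity. }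
    assert (E1 : PSeries A1 w = w * PSeries (PS_derive (PS_derive x)) w) by apply PSeries_incr_1.
    assert (E3 : PSeries A3 w = c * PSeries (PS_derive x) w) by apply PSeries_scal.
    assert (E4 : PSeries A4 w = - (s + 1) * (w * PSeries (PS_derive x) w)).
    { unfold A4. rewrite PSeries_scal. rewrite PSeries_incr_1. reflexivity. }
    rewrite E1, E2, E3, E4. ring.
  - intros n. assert (h := H n).
    replace (t n) with ((INR n + 1) * (INR n + c) * x (S n) - (INR n ^ 2 + s * INR n) * x n) by lra.
    unfold A1, A2, A3, A4. clear.
    destruct n as [|[|n]]; unfold PS_plus, PS_scal, PS_incr_1, PS_derive, plus, scal, zero;
      cbn -[INR pow]; unfold mult; cbn -[INR pow]; rewrite ?S_INR, ?INR_0; try ring.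
    unfold PS_derive. rewrite !S_INR. ring.
Qed.

Lemma CPS_hypergeometric (x t : nat -> C) s c w : subexp x -> Rabs w < 1 ->
  (forall n, RtoC ((INR n + 1) * (INR n + c)) * x (S n) = RtoC (INR n ^ 2 + s * INR n) * x n + t n)%C ->
  (RtoC (w * (1 - w)) * CPS (cder (cder x)) w + RtoC (c - (s + 1) * w) * CPS (cder x) w = CPS t w)%C.
Proof.
  intros Hx hw H.
  assert (dR : forall n, Re (cder (cder x) n) = PS_derive (PS_derive (fun n => Re (x n))) n).
  { intros n. unfold PS_derive, cder, Re, Cmult, RtoC; simpl. ring. }
  assert (dI : forall n, Im (cder (cder x) n) = PS_derive (PS_derive (fun n => Im (x n))) n).
  { intros n. unfold PS_derive, cder, Im, Cmult, RtoC; simpl. ring. }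
  assert (d1R : forall n, Re (cder x n) = PS_derive (fun n => Re (x n)) n).
  { intros n. unfold PS_derive, cder, Re, Cmult, RtoC; simpl. ring. }
  assert (d1I : forall n, Im (cder x n) = PS_derive (fun n => Im (x n)) n).
  { intros n. unfold PS_derive, cder, Im, Cmult, RtoC; simpl. ring. }
  unfold CPS.
  rewrite (PSeries_ext _ _ w dR), (PSeries_ext _ _ w dI), (PSeries_ext _ _ w d1R), (PSeries_ext _ _ w d1I).
  rewrite <- (PSeries_hypergeometric (fun n => Re (x n)) (fun n => Re (t n)) s c w).
  - rewrite <- (PSeries_hypergeometric (fun n => Im (x n)) (fun n => Im (t n)) s c w).
    + unfold Cplus, Cmult, RtoC; simpl. f_equal; ring.
    + intros n. assert (h := f_equal Im (H n)). unfold Im, Cplus, Cmult, RtoC in *; simpl in *. lra.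
    + apply subexp_CV_Im; auto.
  - intros n. assert (h := f_equal Re (H n)). unfold Re, Cplus, Cmult, RtoC in *; simpl in *. lra.
  - apply subexp_CV_Re; auto.
Qed.

Section Coefficients.
Variables (s : R).

(** Coefficients of ${}_2F_1(a,b;cc;\cdot)$ written through $s=a+b$ and $q=ab$, since
    $(n+a)(n+b)=n^2+sn+q$. The summand 0 gives the shape expected by [nice_recurrence]. *)
Fixpoint hc (cc : R) (q : C) (n : nat) : C :=
  match n with
  | O => 1
  | S k => hc cc q k * ((RtoC (INR k ^ 2 + s * INR k) + q) * RtoC (/ ((INR k + cc) * (INR k + 1)))) + 0
  end.

(** Frobenius' method in the logarithmic case. With $R(n)=(n^2+sn+q)/(n+1)^2$ the coefficients
    [hc 1] satisfy $c_{n+1}=R(n)c_n$; these are their derivatives in the exponent,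
    $d_{n+1}=R(n)d_n+R'(n)c_n$, where part of $R'(n)c_n$ is written through $c_{n+1}$. *)
Fixpoint hd (q : C) (n : nat) : C :=
  match n with
  | O => 0
  | S k => hd q k * ((RtoC (INR k ^ 2 + s * INR k) + q) * RtoC (/ ((INR k + 1) * (INR k + 1)))) +
      (RtoC ((2 * INR k + s) / (INR k + 1) ^ 2) * hc 1 q k
        + RtoC (- (2 / (INR k + 1))) * hc 1 q (S k))
  end.

Lemma nice_hc cc : 0 < cc -> nice (hc cc).
Proof.
  intros h. apply (nice_recurrence s cc 1 (fun _ _ => RtoC 0)); auto.
  intros M rho hr. exists 0. split; [lra|]. intros q q1 _ _ n.
  replace (RtoC 0 - RtoC 0)%C with (RtoC 0) by ring. rewrite Cmod_0. lra.
Qed.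

Lemma nice_hd : nice hd.
Proof.
  apply (nice_recurrence s 1 0 (fun q k => RtoC ((2 * INR k + s) / (INR k + 1) ^ 2) * hc 1 q k
        + RtoC (- (2 / (INR k + 1))) * hc 1 q (S k))%C); auto; [lra|].
  assert (h1 := nice_hc 1 Rlt_0_1).
  apply nice_plus.
  - apply (nice_mulr _ (2 + Rabs s)); [|exact h1]. intros n. assert (p := pos_INR n).
    unfold Rdiv. rewrite Rabs_mult, (Rabs_pos_eq (/ _)) by (left; apply Rinv_0_lt_compat, pow_lt; lra).
    apply Rle_div_l; [apply pow_lt; lra|].
    eapply Rle_trans; [apply Rabs_triang|]. rewrite Rabs_pos_eq by lra.
    assert (q := Rabs_pos s). nra.
  - apply (nice_mulr _ 2 (fun q k => hc 1 q (S k))); [|apply nice_shift, h1]. intros n. assert (p := pos_INR n).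
    rewrite Rabs_Ropp, Rabs_pos_eq by (apply Rdiv_le_0_compat; lra).
    apply Rle_div_l; lra.
Qed.

Lemma hc_recurrence cc q n : 0 < cc ->
  (RtoC ((INR n + 1) * (INR n + cc)) * hc cc q (S n)
   = (RtoC (INR n ^ 2 + s * INR n) + q) * hc cc q n)%C.
Proof.
  intros h. assert (p := pos_INR n).
  change (hc cc q (S n)) with
    (hc cc q n * ((RtoC (INR n ^ 2 + s * INR n) + q) * RtoC (/ ((INR n + cc) * (INR n + 1)))) + 0)%C.
  assert (E : (RtoC ((INR n + 1) * (INR n + cc)) * RtoC (/ ((INR n + cc) * (INR n + 1))) = 1)%C).
  { rewrite <- RtoC_mult. f_equal. field. lra. }
  set (A := (RtoC (INR n ^ 2 + s * INR n) + q)%C).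
  set (D := RtoC ((INR n + 1) * (INR n + cc))) in *.
  set (D' := RtoC (/ _)) in *.
  replace (D * (hc cc q n * (A * D') + 0))%C with (D * D' * (A * hc cc q n))%C by ring.
  rewrite E. ring.
Qed.

Lemma hd_recurrence q n :
  (RtoC ((INR n + 1) * (INR n + 1)) * hd q (S n)
   = (RtoC (INR n ^ 2 + s * INR n) + q) * hd q n
     + RtoC (2 * INR n + s) * hc 1 q n - RtoC (2 * (INR n + 1)) * hc 1 q (S n))%C.
Proof.
  assert (p := pos_INR n).
  change (hd q (S n)) with
    (hd q n * ((RtoC (INR n ^ 2 + s * INR n) + q) * RtoC (/ ((INR n + 1) * (INR n + 1)))) +
      (RtoC ((2 * INR n + s) / (INR n + 1) ^ 2) * hc 1 q n
        + RtoC (- (2 / (INR n + 1))) * hc 1 q (S n)))%C.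
  assert (E1 : (RtoC ((INR n + 1) * (INR n + 1)) * RtoC (/ ((INR n + 1) * (INR n + 1))) = 1)%C).
  { rewrite <- RtoC_mult. f_equal. field. lra. }
  assert (E2 : (RtoC ((INR n + 1) * (INR n + 1)) * RtoC ((2 * INR n + s) / (INR n + 1) ^ 2)
    = RtoC (2 * INR n + s))%C).
  { rewrite <- RtoC_mult. f_equal. field. lra. }
  assert (E3 : (RtoC ((INR n + 1) * (INR n + 1)) * RtoC (- (2 / (INR n + 1)))
    = - RtoC (2 * (INR n + 1)))%C).
  { rewrite <- RtoC_mult, <- RtoC_opp. f_equal. field. lra. }
  set (A := (RtoC (INR n ^ 2 + s * INR n) + q)%C).
  set (D := RtoC ((INR n + 1) * (INR n + 1))) in *.
  set (D1 := RtoC (/ _)) in *. set (D2 := RtoC (_ / _)) in *. set (D3 := RtoC (- _)) in *.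
  set (c0 := hc 1 q n). set (c1 := hc 1 q (S n)). set (d0 := hd q n).
  replace (D * (d0 * (A * D1) + (D2 * c0 + D3 * c1)))%C with
    (D * D1 * (A * d0) + (D * D2) * c0 + (D * D3) * c1)%C by ring.
  rewrite E1, E2, E3. ring.
Qed.

Lemma hc_ode cc q w : 0 < cc -> Rabs w < 1 ->
  (RtoC (w * (1 - w)) * CPS (cder (cder (hc cc q))) w
   + RtoC (cc - (s + 1) * w) * CPS (cder (hc cc q)) w = q * CPS (hc cc q) w)%C.
Proof.
  intros hcc hw. assert (hx := nice_subexp (hc cc) q (nice_hc cc hcc)).
  rewrite <- (CPS_scal q (hc cc q)) by auto. apply CPS_hypergeometric; auto.
  intros n. rewrite hc_recurrence by auto. ring.
Qed.

(** On $F\ln w$ the hypergeometric operator yields $2(1-w)F'-sF$ besides $\ln w$ times its value on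
    $F$. The source here is the negative of that, so $F\ln w+D$ solves the homogeneous equation. *)
Lemma hd_ode q w : Rabs w < 1 ->
  (RtoC (w * (1 - w)) * CPS (cder (cder (hd q))) w
   + RtoC (1 - (s + 1) * w) * CPS (cder (hd q)) w
   = q * CPS (hd q) w + RtoC s * CPS (hc 1 q) w + 2 * (RtoC w - 1) * CPS (cder (hc 1 q)) w)%C.
Proof.
  intros hw. assert (hx := nice_subexp (hc 1) q (nice_hc 1 Rlt_0_1)).
  assert (hy := nice_subexp hd q nice_hd).
  assert (hx1 := subexp_cder _ hx).
  (* The coefficients $nc_n$ are those of $wF'$. *)
  pose (dx := fun n => (RtoC (INR n) * hc 1 q n)%C).
  assert (Edx : CPS dx w = (RtoC w * CPS (cder (hc 1 q)) w)%C).
  { unfold CPS. rewrite (PSeries_ext (fun n => Re (dx n)) (PS_incr_1 (fun n => Re (cder (hc 1 q) n)))).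
    - rewrite (PSeries_ext (fun n => Im (dx n)) (PS_incr_1 (fun n => Im (cder (hc 1 q) n)))).
      + rewrite !PSeries_incr_1. unfold Cmult, RtoC; simpl. f_equal; ring.
      + intros [|n]; unfold dx, cder, PS_incr_1, Im, Cmult, RtoC, zero; simpl; ring.
    - intros [|n]; unfold dx, cder, PS_incr_1, Re, Cmult, RtoC, zero; simpl; ring. }
  assert (hdx : subexp dx).
  { intros rho hr. destruct (subexp_cder _ hx rho hr) as [K HK].
    exists (Rabs K). intros n. destruct n as [|n].
    - unfold dx. simpl. rewrite Cmult_0_l, Cmod_0. assert (h := Rabs_pos K). lra.
    - apply Rle_trans with (K * rho ^ n); [apply HK|]. simpl.
      assert (p : 0 < rho ^ n) by (apply pow_lt; lra).
      assert (h := Rle_abs K). assert (h' := Rabs_pos K). 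
      apply Rle_trans with (Rabs K * rho ^ n); [nra|].
      apply Rmult_le_compat_l; [exact h'|]. nra. }
  assert (sc : forall c a, subexp a -> subexp (fun n => c * a n)%C).
  { intros c a Ha rho hr. destruct (Ha rho hr) as [K HK]. exists (Cmod c * K). intros n.
    rewrite Cmod_mult, Rmult_assoc. apply Rmult_le_compat_l; [apply Cmod_ge_0|apply HK]. }
  assert (pl : forall a b, subexp a -> subexp b -> subexp (fun n => a n + b n)%C).
  { intros a b Ha Hb rho hr. destruct (Ha rho hr) as [K HK]. destruct (Hb rho hr) as [L HL].
    exists (K + L). intros n. eapply Rle_trans; [apply Cmod_triangle|].
    assert (h1 := HK n). assert (h2 := HL n). lra. }
  rewrite (CPS_hypergeometric (hd q)
    (fun n => (q * hd q n + RtoC s * hc 1 q n) + (2 * dx n + (- (2)) * cder (hc 1 q) n))%C s 1 w); auto.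
  - rewrite (CPS_plus (fun n => q * hd q n + RtoC s * hc 1 q n)%C (fun n => 2 * dx n + (- (2)) * cder (hc 1 q) n)%C);
      auto.
    rewrite (CPS_plus (fun n => q * hd q n)%C (fun n => RtoC s * hc 1 q n)%C); auto.
    rewrite (CPS_plus (fun n => 2 * dx n)%C (fun n => (- (2)) * cder (hc 1 q) n)%C); auto.
    rewrite !CPS_scal, Edx; auto. ring.
  - intros n. unfold cder, dx. rewrite hd_recurrence, S_INR.
    repeat (rewrite RtoC_plus || rewrite RtoC_mult). ring.
Qed.

End Coefficients.

Lemma nice_affine f (a : C) : nice f -> nice (fun z => f (a - z)%C).
Proof.
  intros H M rho hr. destruct (H (Cmod a + M) rho hr) as [K [hK HK]].
  exists K. split; [exact hK|]. intros q q1 hq hq1 n.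
  assert (B : forall q, Cmod q <= M -> Cmod (a - q) <= Cmod a + M).
  { intros u hu. eapply Rle_trans; [apply Cmod_triangle|]. rewrite Cmod_opp. lra. }
  destruct (HK (a - q)%C (a - q1)%C (B q hq) (B q1 hq1) n) as [h1 h2].
  replace (a - q - (a - q1))%C with (- (q - q1))%C in h2 by ring. rewrite Cmod_opp in h2. auto.
Qed.

Lemma CPS_sub_head_le f a0 M : nice f -> (forall q, f q O = a0) ->
  exists K, 0 <= K /\ forall q w, Cmod q <= M -> 0 <= w <= 1 / 2 -> Cmod (CPS (f q) w - a0) <= K * w.
Proof.
  intros Hf H0. destruct (nice_CPS _ M (nice_shift f Hf)) as [K [hK HK]].
  exists K. split; [exact hK|]. intros q w hq hw.
  rewrite (CPS_decr (f q)), H0; [|apply nice_subexp, Hf|rewrite Rabs_pos_eq; lra].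
  replace (a0 + RtoC w * CPS (fun n => f q (S n)) w - a0)%C with (CPS (fun n => f q (S n)) w * RtoC w)%C by ring.
  rewrite Cmod_mult, Cmod_R, Rabs_pos_eq by lra. apply Rmult_le_compat_r; [lra|].
  apply (HK q q); auto.
Qed.

(** * Identification with the hypergeometric solutions of the statement *)

Lemma CSeries_CPS (u : nat -> C) w : CSeries (fun n => u n * RtoC (w ^ n))%C = CPS u w.
Proof.
  unfold CSeries, CPS, PSeries. f_equal; apply Series_ext; intros n;
    unfold Re, Im, Cmult, RtoC; simpl; ring.
Qed.

Lemma RtoC_neq0 (r : R) : r <> 0 -> RtoC r <> RtoC 0.
Proof. intros h e. apply h. now apply RtoC_inj. Qed.

Ltac nonzero := apply Rgt_not_eq; first [apply pow_lt; lra | nra].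

Lemma poch_pos cc n : 0 < cc -> exists r, 0 < r /\ poch (RtoC cc) n = RtoC r.
Proof.
  intros h. induction n as [|n [r [hr E]]].
  - exists 1. split; [lra|reflexivity].
  - exists (r * (cc + INR n)). assert (p := pos_INR n). split; [nra|].
    simpl. rewrite E, RtoC_mult, RtoC_plus. reflexivity.
Qed.

Lemma fact_neq0C n : RtoC (INR (fact n)) <> RtoC 0.
Proof. apply RtoC_neq0, INR_fact_neq_0. Qed.

Lemma hc_poch (s cc : R) (a b q : C) n : 0 < cc -> (a + b)%C = RtoC s -> (a * b)%C = q ->
  (poch a n * poch b n / (poch (RtoC cc) n * RtoC (INR (fact n))))%C = hc s cc q n.
Proof.
  intros h Hs Hq. induction n as [|n IH].
  - simpl. replace (RtoC (INR 1)) with (RtoC 1) by (simpl; reflexivity). field.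
  - change (hc s cc q (S n)) with
      (hc s cc q n * ((RtoC (INR n ^ 2 + s * INR n) + q) * RtoC (/ ((INR n + cc) * (INR n + 1)))) + 0)%C.
    rewrite <- IH. destruct (poch_pos cc n h) as [r [hr E]].
    assert (p := pos_INR n).
    change (fact (S n)) with (S n * fact n)%nat. rewrite mult_INR, S_INR. simpl poch. rewrite E.
    assert (n1 : RtoC r <> RtoC 0) by (apply RtoC_neq0; lra).
    assert (n2 := fact_neq0C n).
    assert (n3 : RtoC (INR n + cc) <> RtoC 0) by (apply RtoC_neq0; lra).
    assert (n4 : RtoC (INR n + 1) <> RtoC 0) by (apply RtoC_neq0; lra).
    assert (n5 : (RtoC cc + RtoC (INR n))%C <> RtoC 0) by (rewrite <- RtoC_plus; apply RtoC_neq0; lra).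
    assert (EE : ((a + RtoC (INR n)) * (b + RtoC (INR n)) = RtoC (INR n ^ 2 + s * INR n) + q)%C).
    { rewrite <- Hq. simpl pow. rewrite Rmult_1_r. repeat (rewrite RtoC_plus || rewrite RtoC_mult).
      rewrite <- Hs. ring. }
    rewrite <- EE. rewrite RtoC_inv, !RtoC_mult by nonzero.
    replace (RtoC (INR n + cc)) with (RtoC cc + RtoC (INR n))%C in * by (rewrite RtoC_plus; ring).
    field. repeat split; auto.
Qed.

(** Where [poch c n] is nonzero, [dpoch c n] divided by it is $\psi(c+n)-\psi(c)$, and the harmonic
    term comes from differentiating $1/(n!)^2$; the product rule therefore reproduces the recurrence
    for the derivative in the exponent. *)
Lemma hd_dpoch (s : R) (a b q : C) n : (a + b)%C = RtoC s -> (a * b)%C = q ->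
  ((dpoch a n * poch b n + poch a n * dpoch b n - poch a n * poch b n * RtoC (2 * harm n))
      / RtoC (INR (fact n) ^ 2))%C = hd s q n.
Proof.
  intros Hs Hq. induction n as [|n IH].
  - simpl. replace (RtoC (2 * 0)) with (RtoC 0) by (f_equal; ring). 
    unfold Cdiv. ring.
  - assert (p := pos_INR n).
    assert (n4 : RtoC (INR n + 1) <> RtoC 0) by (apply RtoC_neq0; lra).
    assert (n2 := fact_neq0C n).
    assert (EE : ((a + RtoC (INR n)) * (b + RtoC (INR n)) = RtoC (INR n ^ 2 + s * INR n) + q)%C).
    { rewrite <- Hq. simpl pow. rewrite Rmult_1_r. repeat (rewrite RtoC_plus || rewrite RtoC_mult).
      rewrite <- Hs. ring. }
    assert (E0 : hc s 1 q n = (poch a n * poch b n / RtoC (INR (fact n) ^ 2))%C).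
    { rewrite <- (hc_poch s 1 a b q n Rlt_0_1 Hs Hq). 
      assert (Ep : forall m, poch (RtoC 1) m = RtoC (INR (fact m))).
      { induction m as [|m IHm]; [reflexivity|]. change (fact (S m)) with (S m * fact m)%nat.
        rewrite mult_INR, S_INR. simpl poch. rewrite IHm, RtoC_mult, RtoC_plus. ring. }
      rewrite Ep. simpl pow. rewrite Rmult_1_r, RtoC_mult. reflexivity. }
    assert (E1 : hc s 1 q (S n) = (hc s 1 q n * ((a + RtoC (INR n)) * (b + RtoC (INR n)))
                    * (/ (RtoC (INR n + 1) * RtoC (INR n + 1))))%C).
    { rewrite EE.
      change (hc s 1 q (S n)) with
        (hc s 1 q n * ((RtoC (INR n ^ 2 + s * INR n) + q) * RtoC (/ ((INR n + 1) * (INR n + 1)))) + 0)%C.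
      rewrite RtoC_inv, RtoC_mult by nonzero. ring. }
    change (hd s q (S n)) with
      (hd s q n * ((RtoC (INR n ^ 2 + s * INR n) + q) * RtoC (/ ((INR n + 1) * (INR n + 1)))) +
        (RtoC ((2 * INR n + s) / (INR n + 1) ^ 2) * hc s 1 q n
          + RtoC (- (2 / (INR n + 1))) * hc s 1 q (S n)))%C.
    rewrite E1, E0, <- IH, <- EE.
    change (fact (S n)) with (S n * fact n)%nat. rewrite mult_INR, S_INR.
    change (harm (S n)) with (harm n + / INR (S n)). rewrite S_INR.
    replace (RtoC ((2 * INR n + s) / (INR n + 1) ^ 2))%C with
      (((a + RtoC (INR n)) + (b + RtoC (INR n))) * / (RtoC (INR n + 1) * RtoC (INR n + 1)))%C.
    2:{ unfold Rdiv. rewrite RtoC_mult, RtoC_inv by nonzero. simpl pow. rewrite Rmult_1_r, (RtoC_mult (INR n + 1)), (RtoC_plus (2 * INR n) s), (RtoC_mult 2 (INR n)), <- Hs. ring. }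
    rewrite RtoC_inv by nonzero.
    replace (RtoC (- (2 / (INR n + 1)))) with (- (2 * / RtoC (INR n + 1)))%C
      by (rewrite RtoC_opp; unfold Rdiv; rewrite RtoC_mult, RtoC_inv by nonzero; reflexivity).
    replace (RtoC (2 * (harm n + / (INR n + 1)))) with (2 * (RtoC (harm n) + / RtoC (INR n + 1)))%C
      by (rewrite RtoC_mult, (RtoC_plus (harm n)), RtoC_inv by nonzero; reflexivity).
    rewrite !RtoC_pow, !RtoC_mult.
    simpl dpoch. simpl poch.
    set (N1 := RtoC (INR n + 1)) in *. set (f := RtoC (INR (fact n))) in *.
    set (An := (a + RtoC (INR n))%C). set (Bn := (b + RtoC (INR n))%C).
    simpl Cpow. field. split; auto.
Qed.

Lemma Csqrt_sqr (w : C) : (Csqrt w * Csqrt w = w)%C.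
Proof.
  destruct w as [x y].
  assert (hx : Rabs x <= Cmod (x, y)) by apply (Rabs_Re_le_Cmod (x, y)).
  assert (hC : Cmod (x, y) * Cmod (x, y) = x * x + y * y).
  { unfold Cmod. simpl. rewrite sqrt_sqrt; [ring|nra]. }
  apply Rabs_le_between in hx.
  set (m := Cmod (x, y)) in *.
  assert (p1 : 0 <= (m + x) / 2) by lra. assert (p2 : 0 <= (m - x) / 2) by lra.
  assert (S1 := sqrt_sqrt _ p1). assert (S2 := sqrt_sqrt _ p2).
  assert (S3 : sqrt ((m + x) / 2) * sqrt ((m - x) / 2) = Rabs y / 2).
  { rewrite <- sqrt_mult by assumption.
    replace ((m + x) / 2 * ((m - x) / 2)) with (Rsqr (Rabs y / 2)).
    - apply sqrt_Rsqr. assert (h := Rabs_pos y). lra.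
    - unfold Rsqr. replace (Rabs y / 2 * (Rabs y / 2)) with ((Rabs y * Rabs y) / 4) by field.
      rewrite <- Rabs_mult, Rabs_pos_eq by nra. nra. }
  unfold Csqrt. fold m. unfold Re, Im, Cmult; simpl.
  set (u := sqrt ((m + x) / 2)) in *. set (v := sqrt ((m - x) / 2)) in *.
  destruct (Rlt_dec y 0) as [hy|hy].
  - rewrite Rabs_left in S3 by exact hy. f_equal; nra.
  - rewrite Rabs_pos_eq in S3 by lra. f_equal; nra.
Qed.

Lemma a_par_sum mu nu s : (a_par mu nu s + a_par mu nu (- s))%C = RtoC (1 + mu + nu).
Proof. unfold a_par. field. Qed.

(** The two factors are conjugate in $\sigma$, so $\sigma$ enters through
    $\sigma^2=(1+\alpha+\beta)^2+4z$, and the product is affine in $z$. *)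
Lemma a_par_prod al be mu nu z :
  (a_par mu nu (sigma_ab al be z) * a_par mu nu (- sigma_ab al be z))%C
  = (RtoC (((1 + mu + nu) ^ 2 - (1 + al + be) ^ 2) / 4) - z)%C.
Proof.
  unfold a_par. assert (h := Csqrt_sqr (RtoC ((1 + al + be) ^ 2) + 4 * z)%C).
  fold (sigma_ab al be z) in h. set (sg := sigma_ab al be z) in *.
  replace ((RtoC (1 + mu + nu) + sg) / 2 * ((RtoC (1 + mu + nu) + - sg) / 2))%C with
    ((RtoC (1 + mu + nu) * RtoC (1 + mu + nu) - sg * sg) / 4)%C.
  - rewrite h. unfold Rdiv. rewrite RtoC_mult, RtoC_minus, RtoC_inv, !RtoC_pow by lra. simpl Cpow. field.
  - replace (RtoC 4) with (2 * 2)%C by (rewrite <- RtoC_mult; f_equal; ring). field.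
Qed.

(** Coefficients for $y_1$, for the nonlogarithmic $y_2$ and for the series beside the logarithm.
    The last arguments are the products of the parameters from [a_par_prod]: $-z$ for $\nu=\beta$
    and $-\beta(1+\alpha)-z$ for $\nu=-\beta$. *)
Definition FA (al be : R) (z : C) : nat -> C := hc (1 + al + be) (1 + be) (0 - z)%C.
Definition FB (al be : R) (z : C) : nat -> C :=
  hc (1 + al - be) (1 - be) (RtoC (- (be * (1 + al))) - z)%C.
Definition FD (al : R) (z : C) : nat -> C := hd (1 + al) (0 - z)%C.

Lemma y1_CPS al be z x : -1 < be -> y1 al be z x = CPS (FA al be z) ((1 + x) / 2).
Proof.
  intros h. unfold y1, F21. rewrite CSeries_CPS. apply CPS_ext. intros n.
  apply hc_poch; [lra|apply a_par_sum|]. rewrite a_par_prod. f_equal. f_equal. field.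
Qed.

Lemma y2_CPS al be z x : be <> 0 -> be < 1 ->
  y2 al be z x = (RtoC (Rpower (1 + x) (- be)) * CPS (FB al be z) ((1 + x) / 2))%C.
Proof.
  intros h0 h. unfold y2. destruct (Req_EM_T be 0) as [e|_]; [contradiction|].
  f_equal. unfold F21. rewrite CSeries_CPS. apply CPS_ext. intros n.
  apply hc_poch; [lra|rewrite a_par_sum; f_equal; ring|]. rewrite a_par_prod. f_equal. f_equal. field.
Qed.

Lemma y2_log_CPS al z x :
  y2 al 0 z x = (CPS (FA al 0 z) ((1 + x) / 2) * RtoC (ln ((1 + x) / 2)) + CPS (FD al z) ((1 + x) / 2))%C.
Proof.
  unfold y2. destruct (Req_EM_T 0 0) as [_|e]; [|contradiction]. cbv zeta.
  f_equal.
  - f_equal. unfold F21. rewrite CSeries_CPS. apply CPS_ext. intros n.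
    unfold FA. replace (1 + 0) with 1 by ring.
    apply hc_poch; [lra|apply a_par_sum|]. rewrite a_par_prod. f_equal. f_equal. field.
  - rewrite CSeries_CPS. apply CPS_ext. intros n. unfold FD.
    apply hd_dpoch; [rewrite a_par_sum; f_equal; ring|]. rewrite a_par_prod. f_equal. f_equal. field.
Qed.

Lemma nice_FA al be : -1 < be -> nice (FA al be).
Proof. intros h. apply (nice_affine (hc _ _)), nice_hc. lra. Qed.
Lemma nice_FB al be : be < 1 -> nice (FB al be).
Proof. intros h. apply (nice_affine (hc _ _)), nice_hc. lra. Qed.
Lemma nice_FD al : nice (FD al).
Proof. apply (nice_affine (hd _)), nice_hd. Qed.

(** * The fundamental system at -1 *)

Lemma Rpower_pos x y : 0 < Rpower x y.
Proof. apply exp_pos. Qed.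

Lemma Rpower_base_1 y : Rpower 1 y = 1.
Proof. unfold Rpower. rewrite ln_1, Rmult_0_r. apply exp_0. Qed.

Lemma Rpower_decr t a b : 0 < t <= 1 -> a <= b -> Rpower t b <= Rpower t a.
Proof.
  intros [h1 h2] hab. unfold Rpower.
  assert (hl : ln t <= 0).
  { rewrite <- ln_1. destruct h2 as [h2|h2]; [left; apply ln_increasing; lra|right; now rewrite h2]. }
  destruct (Req_dec (b * ln t) (a * ln t)) as [e|e]; [rewrite e; lra|].
  left. apply exp_increasing. nra.
Qed.

Lemma Rpower_ge_1 t b : 0 < t <= 1 -> b <= 0 -> 1 <= Rpower t b.
Proof. intros h hb. rewrite <- (Rpower_O t) by lra. apply Rpower_decr; auto. Qed.

Lemma Rpower_S x y : 0 < x -> Rpower x (y + 1) = Rpower x y * x.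
Proof. intros h. rewrite Rpower_plus, Rpower_1; auto. Qed.

Lemma Rabs_ln_le t s : 0 < t <= 1 -> 0 < s -> Rabs (ln t) <= Rpower t (- s) / s.
Proof.
  intros [h1 h2] hs.
  assert (hl : ln t <= 0).
  { rewrite <- ln_1. destruct h2 as [h2|h2]; [left; apply ln_increasing; lra|right; now rewrite h2]. }
  rewrite Rabs_left1 by exact hl. apply Rle_div_r; [exact hs|].
  unfold Rpower. assert (h := exp_ineq1_le (- s * ln t)). lra.
Qed.

Lemma Rpower_exp_bounded a b t : 0 < a -> a <= t <= b -> forall y, Rpower t y <= Rpower a y + Rpower b y.
Proof.
  intros ha ht y. assert (p1 := Rpower_pos a y). assert (p2 := Rpower_pos b y).
  destruct (Rle_dec 0 y) as [h|h].
  - assert (Rpower t y <= Rpower b y); [|lra]. apply Rle_Rpower_l; lra.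
  - assert (e : forall u, Rpower u y = / Rpower u (- y)).
    { intros u. rewrite <- Rpower_Ropp, Ropp_involutive. reflexivity. }
    assert (Rpower t y <= Rpower a y); [|lra]. rewrite !e. apply Rinv_le_contravar; [apply Rpower_pos|].
    apply Rle_Rpower_l; lra.
Qed.

Lemma derive_pow_add b x : -1 < x ->
  is_derive (fun t => Rpower (1 + t) b) x (b * Rpower (1 + x) b / (1 + x)).
Proof. intros h. unfold Rpower. auto_derive; [lra|]. field. lra. Qed.

Lemma derive_pow_sub a x : x < 1 ->
  is_derive (fun t => Rpower (1 - t) a) x (- a * Rpower (1 - x) a / (1 - x)).
Proof. intros h. unfold Rpower. auto_derive; [lra|]. unfold Rminus. field. lra. Qed.

Lemma derive_half x : is_derive (fun t => (1 + t) / 2) x (1 / 2).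
Proof. auto_derive; [trivial|]. lra. Qed.

Lemma derive_ln_half x : -1 < x -> is_derive (fun t => ln ((1 + t) / 2)) x (/ (1 + x)).
Proof. intros h. auto_derive; [lra|]. field. lra. Qed.

Lemma lim_right_of_continuous (f : R -> R) : continuity_pt f (-1) ->
  Clim (at_right (-1)) (fun x => RtoC (f x)) (RtoC (f (-1))).
Proof.
  intros H eps He.
  destruct (proj1 (continuity_pt_locally f (-1)) H (mkposreal eps He)) as [d Hd]. exists d. intros y Hy _.
  rewrite <- RtoC_minus, Cmod_R. apply (Hd y Hy).
Qed.

Lemma lim_pow_add s : 0 < s -> Clim (at_right (-1)) (fun x => RtoC (Rpower (1 + x) s)) 0.
Proof.
  intros hs eps He. exists (mkposreal (Rpower eps (/ s)) (Rpower_pos _ _)). intros y Hy Hlt.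
  assert (Hy' : Rabs (y - -1) < Rpower eps (/ s)) by exact Hy. apply Rabs_def2 in Hy'.
  replace (RtoC (Rpower (1 + y) s) - 0)%C with (RtoC (Rpower (1 + y) s)) by ring.
  rewrite Cmod_R, Rabs_pos_eq by (left; apply Rpower_pos).
  apply Rlt_le_trans with (Rpower (Rpower eps (/ s)) s).
  - apply Rlt_Rpower_l; lra.
  - rewrite Rpower_mult, Rinv_l, Rpower_1 by lra. lra.
Qed.

Lemma Clim_pow_squeeze (f : R -> C) l K s : 0 < s ->
  (forall x, -1 < x < 0 -> Cmod (f x - l) <= K * Rpower (1 + x) s) -> Clim (at_right (-1)) f l.
Proof.
  intros hs H.
  apply Clim_squeeze with (fun x => K * Rpower (1 + x) s); [typeclasses eauto| |].
  - generalize in10_at_right. apply filter_imp. exact H.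
  - apply Clim_ext with (fun x => RtoC K * RtoC (Rpower (1 + x) s))%C; [typeclasses eauto| |].
    + intros x. now rewrite RtoC_mult.
    + apply Clim_eq with (RtoC K * 0)%C; [|ring]. apply Clim_scal; [typeclasses eauto|].
      apply lim_pow_add, hs.
Qed.

(** Solutions with derivatives everywhere on $(-1,1)$. The explicit series are of this kind, and by
    [sol_representation] every solution in the almost everywhere sense agrees on $(-1,1)$ with one
    of them. *)
Definition csol (al be : R) (z : C) (u U : R -> C) : Prop :=
  forall x, in11 x -> is_derive u x (RtoC (/ p_ab al be x) * U x)%C /\
    is_derive U x (- (RtoC (r_ab al be x) * (z * u x)))%C.

Definition v1 (al be : R) (z : C) (x : R) : C := CPS (FA al be z) ((1 + x) / 2).
Definition V1 (al be : R) (z : C) (x : R) : C :=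
  (RtoC (p_ab al be x / 2) * CPS (cder (FA al be z)) ((1 + x) / 2))%C.

(** The constant makes the quasi-derivative tend to $-1$ at $-1$. It is also the constant in the
    definition of the generalized boundary values, so coefficients and boundary values agree up to
    order and sign. *)
Definition v2 (al be : R) (z : C) (x : R) : C :=
  if Req_EM_T be 0 then
    (RtoC (- / Rpower 2 (al + 1))
     * (RtoC (ln ((1 + x) / 2)) * CPS (FA al 0 z) ((1 + x) / 2) + CPS (FD al z) ((1 + x) / 2)))%C
  else
    (RtoC (/ (be * Rpower 2 (al + 1)) * Rpower (1 + x) (- be)) * CPS (FB al be z) ((1 + x) / 2))%C.

(** This is $p\,v_2'$ with the factor $(1+x)^{\beta+1}$ of $p$ cancelled against the singularity of
    $v_2'$, so that the limit at $-1$ can be read off. *)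
Definition V2 (al be : R) (z : C) (x : R) : C :=
  if Req_EM_T be 0 then
    (RtoC (- / Rpower 2 (al + 1) * Rpower (1 - x) (al + 1))
     * (RtoC ((1 + x) / 2) * (RtoC (ln ((1 + x) / 2)) * CPS (cder (FA al 0 z)) ((1 + x) / 2)
                              + CPS (cder (FD al z)) ((1 + x) / 2))
        + CPS (FA al 0 z) ((1 + x) / 2)))%C
  else
    (RtoC (/ (be * Rpower 2 (al + 1)) * Rpower (1 - x) (al + 1))
     * (RtoC (- be) * CPS (FB al be z) ((1 + x) / 2)
        + RtoC ((1 + x) / 2) * CPS (cder (FB al be z)) ((1 + x) / 2)))%C.

(* The singular part of [v2] at [-1]. *)
Definition omega (al be x : R) : R :=
  if Req_EM_T be 0 then - / Rpower 2 (al + 1) * ln ((1 + x) / 2)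
  else / (be * Rpower 2 (al + 1)) * Rpower (1 + x) (- be).

Lemma p_ab_factor al be x : in11 x -> p_ab al be x = r_ab al be x * ((1 - x) * (1 + x)).
Proof. intros [h1 h2]. unfold p_ab, r_ab. rewrite !Rpower_S by lra. ring. Qed.

Lemma p_ab_pos al be x : 0 < p_ab al be x.
Proof. apply Rmult_lt_0_compat; apply Rpower_pos. Qed.

Lemma r_ab_pos al be x : 0 < r_ab al be x.
Proof. apply Rmult_lt_0_compat; apply Rpower_pos. Qed.

Lemma p_ab_derive al be x : in11 x ->
  is_derive (p_ab al be) x (r_ab al be x * (- (al + 1) * (1 + x) + (be + 1) * (1 - x))).
Proof.
  intros [h1 h2]. unfold p_ab, r_ab.
  replace (Rpower (1 - x) al * Rpower (1 + x) be * (- (al + 1) * (1 + x) + (be + 1) * (1 - x))) with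
    ((- (al + 1) * Rpower (1 - x) (al + 1) / (1 - x)) * Rpower (1 + x) (be + 1)
     + Rpower (1 - x) (al + 1) * ((be + 1) * Rpower (1 + x) (be + 1) / (1 + x))).
  - apply (Derive.is_derive_mult (fun t => Rpower (1 - t) (al + 1)) (fun t => Rpower (1 + t) (be + 1))).
    + apply derive_pow_sub, h2.
    + apply derive_pow_add, h1.
  - rewrite !Rpower_S by lra. field. lra.
Qed.

Lemma half_in_unit x : in11 x -> Rabs ((1 + x) / 2) < 1.
Proof. intros [h1 h2]. apply Rabs_def1; lra. Qed.

Lemma CPS_half_derive a x : subexp a -> in11 x ->
  is_derive (fun t => CPS a ((1 + t) / 2)) x (RtoC (1 / 2) * CPS (cder a) ((1 + x) / 2))%C.
Proof.
  intros Ha Hx. apply (dC_comp (CPS a) (fun t => (1 + t) / 2)).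
  - apply CPS_derive; [exact Ha|apply half_in_unit, Hx].
  - apply derive_half.
Qed.

Lemma RtoC_mult_eq (a b c : R) : a * b = c -> (RtoC a * RtoC b)%C = RtoC c.
Proof. intros <-. now rewrite RtoC_mult. Qed.

Lemma csol_v1 al be z : -1 < be -> csol al be z (v1 al be z) (V1 al be z).
Proof.
  intros hb x Hx.
  assert (Ha := nice_subexp _ z (nice_FA al be hb)).
  assert (hp := p_ab_pos al be x). assert (hx := Hx). destruct hx as [h1 h2].
  split.
  - apply dC_eq with (1 := CPS_half_derive _ x Ha Hx).
    unfold V1. rewrite Cmult_assoc, (RtoC_mult_eq _ _ (1 / 2)); [reflexivity|field; lra].
  - unfold V1.
    eapply dC_eq.
    + apply dC_mult.
      * apply dC_RtoC. apply (is_derive_ext (fun t => / 2 * p_ab al be t)); [intros t; simpl; field|].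
        apply is_derive_scal. apply p_ab_derive, Hx.
      * apply CPS_half_derive; [apply subexp_cder, Ha|exact Hx].
    (* With $w=(1+x)/2$ and $(1-x)(1+x)=4w(1-w)$ the expression $(pu')'/r$ is the hypergeometric
       operator with $c=1+\beta$ and $s=1+\alpha+\beta$, and $q=-z$. *)
    + assert (ode := hc_ode (1 + al + be) (1 + be) (0 - z)%C ((1 + x) / 2) ltac:(lra) (half_in_unit x Hx)).
      fold (FA al be z) in ode. unfold v1.
      set (F := CPS (FA al be z) ((1 + x) / 2)) in *.
      set (F1 := CPS (cder (FA al be z)) ((1 + x) / 2)) in *.
      set (F2 := CPS (cder (cder (FA al be z))) ((1 + x) / 2)) in *.
      replace (- (RtoC (r_ab al be x) * (z * F)))%C with (RtoC (r_ab al be x) * ((0 - z) * F))%C by ring.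
      rewrite <- ode, Cmult_plus_distr_l, !Cmult_assoc, !(fun a b => RtoC_mult_eq a b _ eq_refl).
      rewrite Cplus_comm. f_equal; f_equal; f_equal.
      * rewrite p_ab_factor by exact Hx. field.
      * simpl. field.
Qed.

Lemma csol_v2 al be z : -1 < be < 1 -> csol al be z (v2 al be z) (V2 al be z).
Proof.
  intros hb x Hx. assert (hx := Hx). destruct hx as [h1 h2].
  assert (hc2 := Rpower_pos 2 (al + 1)).
  assert (hw : (1 + x) / 2 <> 0) by lra.
  assert (pA := Rpower_pos (1 - x) al). assert (pB := Rpower_pos (1 + x) be).
  unfold v2, V2. destruct (Req_EM_T be 0) as [e|e].
  - subst be.
    assert (Ha := nice_subexp _ z (nice_FA al 0 ltac:(lra))).
    assert (Hd := nice_subexp _ z (nice_FD al)).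
    assert (odeF := hc_ode (1 + al + 0) (1 + 0) (0 - z)%C ((1 + x) / 2) ltac:(lra) (half_in_unit x Hx)).
    assert (odeD := hd_ode (1 + al) (0 - z)%C ((1 + x) / 2) (half_in_unit x Hx)).
    fold (FA al 0 z) in odeF. fold (FD al z) in odeD.
    replace (hc (1 + al) 1 (0 - z)%C) with (FA al 0 z) in odeD by (unfold FA; f_equal; ring).
    set (w := (1 + x) / 2) in *.
    assert (dL := dC_RtoC _ _ _ (derive_ln_half x h1)).
    assert (dF := CPS_half_derive _ x Ha Hx). assert (dD := CPS_half_derive _ x Hd Hx).
    assert (dF' := CPS_half_derive _ x (subexp_cder _ Ha) Hx).
    assert (dD' := CPS_half_derive _ x (subexp_cder _ Hd) Hx).
    fold w in dF, dD, dF', dD'.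
    set (F := CPS (FA al 0 z) w) in *. set (F1 := CPS (cder (FA al 0 z)) w) in *.
    set (F2 := CPS (cder (cder (FA al 0 z))) w) in *.
    set (D := CPS (FD al z) w) in *. set (D1 := CPS (cder (FD al z)) w) in *.
    set (D2 := CPS (cder (cder (FD al z))) w) in *.
    set (k := - / Rpower 2 (al + 1)).
    assert (Ew : (1 + x) = 2 * w) by (unfold w; field).
    assert (Em : (1 - x) = 2 * (1 - w)) by (unfold w; field).
    assert (pw : 0 < w) by lra. assert (pw1 : 0 < 1 - w) by lra.
    assert (nw : RtoC w <> RtoC 0) by (apply RtoC_neq0; lra).
    assert (nw1 : RtoC (1 - w) <> RtoC 0) by (apply RtoC_neq0; lra).
    split.
    + eapply dC_eq; [apply dC_scal, dC_plus; [apply dC_mult; [exact dL|exact dF]|exact dD]|].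
      cbv beta. fold w. fold F. 
      assert (Ep : (RtoC (/ p_ab al 0 x) * RtoC (k * Rpower (1 - x) (al + 1)) = RtoC k * RtoC (/ (2 * w)))%C).
      { rewrite <- !RtoC_mult. f_equal. unfold p_ab. rewrite (Rplus_0_l 1), Rpower_1 by lra. rewrite Ew.
        field. split; [lra|]. apply Rgt_not_eq, Rpower_pos. }
      assert (Ep' : forall Y : C, (RtoC (/ p_ab al 0 x) * (RtoC (k * Rpower (1 - x) (al + 1)) * Y)
        = RtoC k * RtoC (/ (2 * w)) * Y)%C) by (intros Y; rewrite Cmult_assoc, Ep; reflexivity).
      rewrite Ep', Ew.
      rewrite RtoC_inv, RtoC_mult by lra. unfold Rdiv. rewrite Rmult_1_l, (RtoC_inv 2) by lra.
      assert (n2 : RtoC 2 <> RtoC 0) by (apply RtoC_neq0; lra).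
      field. auto.
    + eapply dC_eq.
      * apply dC_mult.
        -- apply dC_RtoC. apply (is_derive_scal (fun t => Rpower (1 - t) (al + 1))). apply derive_pow_sub, h2.
        -- apply dC_plus; [|exact dF]. apply dC_mult; [apply dC_RtoC, derive_half|].
           apply dC_plus; [apply dC_mult; [exact dL|exact dF']|exact dD'].
      * cbv beta. fold w. fold F. fold F1. fold D1.
        assert (Er : r_ab al 0 x = Rpower (1 - x) al).
        { unfold r_ab. rewrite Rpower_O by lra. ring. }
        rewrite Er, !Rpower_S, Ew by lra. set (A := Rpower (1 - x) al) in *. rewrite !Em.
        replace (- (RtoC A * (z * (RtoC k * (RtoC (ln w) * F + D)))))%C with
          (RtoC A * RtoC k * (RtoC (ln w) * ((0 - z) * F) + (0 - z) * D))%C by ring.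
        (* The two differential equations eliminate $z$; an identity between $F$, $D$, their
           derivatives and $\ln w$ remains. *)
        replace ((0 - z) * D)%C with
          ((RtoC (w * (1 - w)) * D2 + RtoC (1 - (1 + al + 1) * w) * D1)
           - RtoC (1 + al) * F - 2 * (RtoC w - 1) * F1)%C by (rewrite odeD; ring).
        rewrite <- odeF.
        replace (- (al + 1) * (A * (2 * (1 - w))) / (2 * (1 - w))) with (- (al + 1) * A) by (field; lra).
        unfold Rdiv. rewrite RtoC_inv by lra.
        repeat (rewrite RtoC_plus || rewrite RtoC_mult || rewrite RtoC_minus || rewrite RtoC_opp).
        rewrite (RtoC_inv 2) by lra.
        assert (n2 : RtoC 2 <> RtoC 0) by (apply RtoC_neq0; lra).
        field. auto.
  - assert (Hb := nice_subexp _ z (nice_FB al be (proj2 hb))).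
    assert (ode := hc_ode (1 + al - be) (1 - be) (RtoC (- (be * (1 + al))) - z)%C ((1 + x) / 2) ltac:(lra) (half_in_unit x Hx)).
    fold (FB al be z) in ode.
    assert (dF := CPS_half_derive _ x Hb Hx).
    assert (dF' := CPS_half_derive _ x (subexp_cder _ Hb) Hx).
    set (w := (1 + x) / 2) in *.
    set (F := CPS (FB al be z) w) in *. set (F1 := CPS (cder (FB al be z)) w) in *.
    set (F2 := CPS (cder (cder (FB al be z))) w) in *.
    set (k := / (be * Rpower 2 (al + 1))).
    assert (Ew : (1 + x) = 2 * w) by (unfold w; field).
    assert (Em : (1 - x) = 2 * (1 - w)) by (unfold w; field).
    assert (pw : 0 < w) by lra. assert (pw1 : 0 < 1 - w) by lra.
    assert (EB : Rpower (1 + x) (- be) = / Rpower (1 + x) be) by apply Rpower_Ropp.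
    split.
    + eapply dC_eq.
      * apply dC_mult; [|exact dF]. apply dC_RtoC. apply (is_derive_scal (fun t => Rpower (1 + t) (- be))).
        apply derive_pow_add, h1.
      * cbv beta. fold w. fold F. unfold p_ab.
        rewrite !Rpower_S, EB by lra. set (A := Rpower (1 - x) al) in *. set (B := Rpower (1 + x) be) in *.
        assert (Ep : forall Y : C, (RtoC (/ (A * (1 - x) * (B * (1 + x)))) * (RtoC (k * (A * (1 - x))) * Y)
          = RtoC (k * / B * / (2 * w)) * Y)%C).
        { intros Y. rewrite Cmult_assoc, (RtoC_mult_eq _ _ (k * / B * / (2 * w))); [reflexivity|].
          rewrite Ew. field. repeat split; lra. }
        rewrite Ep.
        rewrite Cmult_plus_distr_l, !Cmult_assoc, !(fun a b => RtoC_mult_eq a b _ eq_refl).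
        f_equal; f_equal; f_equal; rewrite ?Ew; simpl; field; repeat split; lra.
    + eapply dC_eq.
      * apply dC_mult.
        -- apply dC_RtoC. apply (is_derive_scal (fun t => Rpower (1 - t) (al + 1))). apply derive_pow_sub, h2.
        -- apply dC_plus; [apply dC_scal, dF|]. apply dC_mult; [apply dC_RtoC, derive_half|exact dF'].
      * cbv beta. fold w. fold F. fold F1. unfold r_ab. rewrite EB.
        rewrite !Rpower_S by lra. set (A := Rpower (1 - x) al) in *. set (B := Rpower (1 + x) be) in *.
        (* The product $-\beta(1+\alpha)-z$ of the parameters of [FB] is split off. The term
           $\beta(1+\alpha)F$ added back matches the one produced by differentiating
           $(1-x)^{\alpha+1}$ in [V2]. *)
        replace (- (RtoC (A * B) * (z * (RtoC (k * / B) * F))))%C with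
          (RtoC (A * B) * RtoC (k * / B) * (((RtoC (- (be * (1 + al))) - z) * F) + RtoC (be * (1 + al)) * F))%C
          by (rewrite RtoC_opp; ring).
        rewrite <- ode.
        rewrite (RtoC_mult_eq (A * B) _ (k * A)) by (field; lra).
        replace (- (al + 1) * (A * (1 - x)) / (1 - x)) with (- (al + 1) * A) by (field; lra).
        rewrite Em. unfold Rdiv.
        repeat (rewrite RtoC_plus || rewrite RtoC_mult || rewrite RtoC_minus || rewrite RtoC_opp).
        rewrite (RtoC_inv 2) by lra.
        assert (n2 : RtoC 2 <> RtoC 0) by (apply RtoC_neq0; lra).
        field.
Qed.

(* An exponent with [(1+x)^-kap] square integrable for the weight and dominating all solutions
   near [-1]; the strict bound by [(1+be)/2] is what makes boundary terms vanish. *)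
Definition kap (be : R) : R := (Rmax be 0 + (1 + be) / 2) / 2.

Lemma kap_props be : -1 < be < 1 -> 0 < kap be /\ be <= kap be /\ kap be < (1 + be) / 2.
Proof.
  intros h. unfold kap, Rmax. destruct (Rle_dec be 0); lra.
Qed.

Definition wtL (be x : R) : R := Rpower (1 + x) (- kap be).

Lemma wtL_pos be x : 0 < wtL be x.
Proof. apply Rpower_pos. Qed.

Lemma wtL_ge1 be x : -1 < be < 1 -> -1 < x <= 0 -> 1 <= wtL be x.
Proof. intros hb hx. apply Rpower_ge_1; [lra|]. destruct (kap_props be hb). lra. Qed.

Lemma Cmod_minus_0 (a : C) : Cmod (a - 0) = Cmod a.
Proof. f_equal. ring. Qed.

Lemma half_bounds x : -1 < x <= 0 -> 0 <= (1 + x) / 2 <= 1 / 2.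
Proof. lra. Qed.

Lemma Rabs_ln_half_le x s : -1 < x <= 0 -> 0 < s ->
  Rabs (ln ((1 + x) / 2)) <= (Rpower (/ 2) (- s) / s) * Rpower (1 + x) (- s).
Proof.
  intros hx hs. eapply Rle_trans; [apply (Rabs_ln_le _ s); lra|].
  replace ((1 + x) / 2) with ((1 + x) * / 2) by field.
  rewrite <- Rpower_mult_distr by lra. right. field. lra.
Qed.

Lemma nonlog_le_wtL be x : -1 < be < 1 -> -1 < x <= 0 -> Rpower (1 + x) (- be) <= wtL be x.
Proof. intros hb hx. apply Rpower_decr; [lra|]. destruct (kap_props be hb). lra. Qed.

(** For $w\le1/2$ the series are bounded and Lipschitz uniformly for $|z|\le M$; the factor
    $(1+x)^{-\beta}$ or the logarithm is dominated by [wtL], the logarithm because [kap 0] is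
    positive. *)
Lemma basis_bound al be M : -1 < be < 1 -> exists K, 0 <= K /\
  forall z z1 x, Cmod z <= M -> Cmod z1 <= M -> -1 < x <= 0 ->
  (Cmod (v1 al be z x) <= K /\ Cmod (v1 al be z x - v1 al be z1 x) <= K * Cmod (z - z1)) /\
  (Cmod (v2 al be z x) <= K * wtL be x /\
   Cmod (v2 al be z x - v2 al be z1 x) <= K * Cmod (z - z1) * wtL be x).
Proof.
  intros hb.
  destruct (nice_CPS _ M (nice_FA al be (proj1 hb))) as [K1 [hK1 HK1]].
  assert (H2 : exists K, 0 <= K /\
    forall z z1 x, Cmod z <= M -> Cmod z1 <= M -> -1 < x <= 0 ->
     (Cmod (v2 al be z x) <= K * wtL be x /\
      Cmod (v2 al be z x - v2 al be z1 x) <= K * Cmod (z - z1) * wtL be x)).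
  { unfold v2. destruct (Req_EM_T be 0) as [e|e].
    - subst be. destruct (nice_CPS _ M (nice_FD al)) as [K2 [hK2 HK2]].
      destruct (kap_props 0 hb) as [k1 [k2 k3]].
      set (c := - / Rpower 2 (al + 1)).
      set (L := Rpower (/ 2) (- kap 0) / kap 0).
      assert (hL : 0 <= L) by (apply Rdiv_le_0_compat; [left; apply Rpower_pos|lra]).
      exists (Rabs c * (L * K1 + K2)).
      assert (hc := Rabs_pos c).
      split; [apply Rmult_le_pos; nra|]. intros z z1 x hz hz1 hx.
      assert (hw := wtL_ge1 0 x hb hx).
      assert (hln : Rabs (ln ((1 + x) / 2)) <= L * wtL 0 x) by (apply Rabs_ln_half_le; auto).
      assert (hlp := Rabs_pos (ln ((1 + x) / 2))).
      destruct (HK1 z z1 ((1 + x) / 2) hz hz1 (half_bounds x hx)) as [a1 a2].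
      destruct (HK2 z z1 ((1 + x) / 2) hz hz1 (half_bounds x hx)) as [b1 b2].
      set (l := ln ((1 + x) / 2)) in *. set (w := wtL 0 x) in *.
      assert (hd := Cmod_ge_0 (z - z1)).
      split.
      + rewrite Cmod_mult, Cmod_R, Rmult_assoc. apply Rmult_le_compat_l; [exact hc|].
        eapply Rle_trans; [apply Cmod_triangle|]. rewrite Cmod_mult, Cmod_R.
        assert (p := Cmod_ge_0 (CPS (FA al 0 z) ((1 + x) / 2))).
        assert (Rabs l * Cmod (CPS (FA al 0 z) ((1 + x) / 2)) <= L * w * K1)
          by (apply Rmult_le_compat; auto).
        assert (K2 <= K2 * w) by nra. lra.
      + match goal with |- Cmod (?k * (?a * ?b + ?d) - ?k * (?a * ?b' + ?d')) <= _ =>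
          replace (k * (a * b + d) - k * (a * b' + d'))%C with (k * (a * (b - b') + (d - d')))%C by ring end.
        rewrite Cmod_mult, Cmod_R.
        replace (Rabs c * (L * K1 + K2) * Cmod (z - z1) * w) with
          (Rabs c * ((L * w) * (K1 * Cmod (z - z1)) + K2 * Cmod (z - z1) * w)) by ring.
        apply Rmult_le_compat_l; [exact hc|].
        eapply Rle_trans; [apply Cmod_triangle|]. rewrite Cmod_mult, Cmod_R.
        apply Rplus_le_compat.
        * apply Rmult_le_compat; auto. apply Cmod_ge_0.
        * apply Rle_trans with (1 := b2).
          assert (0 <= K2 * Cmod (z - z1)) by (apply Rmult_le_pos; lra). nra.
    - destruct (nice_CPS _ M (nice_FB al be (proj2 hb))) as [K2 [hK2 HK2]].
      set (c := / (be * Rpower 2 (al + 1))).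
      exists (Rabs c * K2). assert (hc := Rabs_pos c).
      split; [nra|]. intros z z1 x hz hz1 hx.
      destruct (HK2 z z1 ((1 + x) / 2) hz hz1 (half_bounds x hx)) as [b1 b2].
      assert (hw := nonlog_le_wtL be x hb hx). assert (hp := Rpower_pos (1 + x) (- be)).
      assert (hcw : Rabs (c * Rpower (1 + x) (- be)) <= Rabs c * wtL be x).
      { rewrite Rabs_mult, (Rabs_pos_eq (Rpower _ _)) by lra. apply Rmult_le_compat_l; auto. }
      split.
      + rewrite Cmod_mult, Cmod_R.
        replace (Rabs c * K2 * wtL be x) with (Rabs c * wtL be x * K2) by ring.
        apply Rmult_le_compat; auto; [apply Rabs_pos|apply Cmod_ge_0].
      + match goal with |- Cmod (?k * ?b - ?k * ?b') <= _ =>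
          replace (k * b - k * b')%C with (k * (b - b'))%C by ring end.
        rewrite Cmod_mult, Cmod_R.
        replace (Rabs c * K2 * Cmod (z - z1) * wtL be x) with (Rabs c * wtL be x * (K2 * Cmod (z - z1))) by ring.
        apply Rmult_le_compat; auto; [apply Rabs_pos|apply Cmod_ge_0]. }
  destruct H2 as [K2 [hK2 HK2]].
  exists (K1 + K2). split; [lra|]. intros z z1 x hz hz1 hx.
  destruct (HK1 z z1 ((1 + x) / 2) hz hz1 (half_bounds x hx)) as [a1 a2].
  destruct (HK2 z z1 x hz hz1 hx) as [b1 b2].
  assert (hd := Cmod_ge_0 (z - z1)). assert (hw := wtL_pos be x).
  unfold v1. repeat split.
  - lra.
  - eapply Rle_trans; [exact a2|]. nra.
  - eapply Rle_trans; [exact b1|]. nra.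
  - eapply Rle_trans; [exact b2|]. assert (0 <= Cmod (z - z1) * wtL be x) by nra. nra.
Qed.

Lemma Cmod_scaled_bound (r : R) (a b : C) K d : Cmod a <= K /\ Cmod (a - b) <= K * d ->
  Cmod (RtoC r * a) <= Rabs r * K /\ Cmod (RtoC r * a - RtoC r * b) <= Rabs r * K * d.
Proof.
  intros [h1 h2]. assert (hr := Rabs_pos r).
  replace (RtoC r * a - RtoC r * b)%C with (RtoC r * (a - b))%C by ring.
  rewrite !Cmod_mult, Cmod_R, Rmult_assoc. split; apply Rmult_le_compat_l; auto.
Qed.

Lemma Cmod_sum_bound (a b a' b' : C) K L d : Cmod a <= K /\ Cmod (a - b) <= K * d ->
  Cmod a' <= L /\ Cmod (a' - b') <= L * d ->
  Cmod (a + a') <= K + L /\ Cmod (a + a' - (b + b')) <= (K + L) * d.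
Proof.
  intros [h1 h2] [h3 h4]. split.
  - eapply Rle_trans; [apply Cmod_triangle|lra].
  - replace (a + a' - (b + b'))%C with ((a - b) + (a' - b'))%C by ring.
    eapply Rle_trans; [apply Cmod_triangle|lra].
Qed.

(** The point 0 is where the Wronskians defining the connection coefficients between the two
    endpoints are evaluated. *)
Lemma basis_quasi_bound0 al be M : -1 < be < 1 -> exists K, 0 <= K /\
  forall z z1, Cmod z <= M -> Cmod z1 <= M ->
  (Cmod (V1 al be z 0) <= K /\ Cmod (V1 al be z 0 - V1 al be z1 0) <= K * Cmod (z - z1)) /\
  (Cmod (V2 al be z 0) <= K /\ Cmod (V2 al be z 0 - V2 al be z1 0) <= K * Cmod (z - z1)).
Proof.
  intros hb.
  assert (hw : 0 <= (1 + 0) / 2 <= 1 / 2) by lra.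
  destruct (nice_CPS _ M (nice_cder _ (nice_FA al be (proj1 hb)))) as [K1 [hK1 HK1]].
  assert (H1 : exists K, 0 <= K /\ forall z z1, Cmod z <= M -> Cmod z1 <= M ->
    Cmod (V1 al be z 0) <= K /\ Cmod (V1 al be z 0 - V1 al be z1 0) <= K * Cmod (z - z1)).
  { exists (Rabs (p_ab al be 0 / 2) * K1). split; [apply Rmult_le_pos; [apply Rabs_pos|auto]|].
    intros z z1 hz hz1. apply Cmod_scaled_bound, HK1; auto. }
  assert (H2 : exists K, 0 <= K /\ forall z z1, Cmod z <= M -> Cmod z1 <= M ->
    Cmod (V2 al be z 0) <= K /\ Cmod (V2 al be z 0 - V2 al be z1 0) <= K * Cmod (z - z1)).
  { unfold V2. destruct (Req_EM_T be 0) as [e|e].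
    - subst be. destruct (nice_CPS _ M (nice_cder _ (nice_FD al))) as [K2 [hK2 HK2]].
      destruct (nice_CPS _ M (nice_FA al 0 (proj1 hb))) as [K0 [hK0 HK0]].
      eexists. split; [|intros z z1 hz hz1;
        exact (Cmod_scaled_bound _ _ _ _ _ (Cmod_sum_bound _ _ _ _ _ _ _
          (Cmod_scaled_bound _ _ _ _ _ (Cmod_sum_bound _ _ _ _ _ _ _
            (Cmod_scaled_bound _ _ _ _ _ (HK1 z z1 _ hz hz1 hw)) (HK2 z z1 _ hz hz1 hw)))
          (HK0 z z1 _ hz hz1 hw)))].
      repeat (apply Rmult_le_pos || apply Rplus_le_le_0_compat); try apply Rabs_pos; auto.
    - destruct (nice_CPS _ M (nice_FB al be (proj2 hb))) as [K2 [hK2 HK2]].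
      destruct (nice_CPS _ M (nice_cder _ (nice_FB al be (proj2 hb)))) as [K3 [hK3 HK3]].
      eexists. split; [|intros z z1 hz hz1;
        exact (Cmod_scaled_bound _ _ _ _ _ (Cmod_sum_bound _ _ _ _ _ _ _
          (Cmod_scaled_bound _ _ _ _ _ (HK2 z z1 _ hz hz1 hw))
          (Cmod_scaled_bound _ _ _ _ _ (HK3 z z1 _ hz hz1 hw))))].
      repeat (apply Rmult_le_pos || apply Rplus_le_le_0_compat); try apply Rabs_pos; auto. }
  destruct H1 as [L1 [hL1 HL1]]. destruct H2 as [L2 [hL2 HL2]].
  exists (L1 + L2). split; [lra|]. intros z z1 hz hz1.
  destruct (HL1 z z1 hz hz1). destruct (HL2 z z1 hz hz1). assert (hd := Cmod_ge_0 (z - z1)).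
  repeat split; try lra; nra.
Qed.

Lemma omega_le_wtL al be : -1 < be < 1 -> exists K, 0 <= K /\
  forall x, -1 < x <= 0 -> Rabs (omega al be x) <= K * wtL be x.
Proof.
  intros hb. destruct (kap_props be hb) as [k1 [k2 k3]].
  assert (hc := Rpower_pos 2 (al + 1)).
  unfold omega. destruct (Req_EM_T be 0) as [e|e].
  - exists (Rabs (- / Rpower 2 (al + 1)) * (Rpower (/ 2) (- kap be) / kap be)).
    split; [apply Rmult_le_pos; [apply Rabs_pos|apply Rdiv_le_0_compat; [left; apply Rpower_pos|lra]]|].
    intros x hx. rewrite Rabs_mult, Rmult_assoc. apply Rmult_le_compat_l; [apply Rabs_pos|].
    apply Rabs_ln_half_le; auto.
  - exists (Rabs (/ (be * Rpower 2 (al + 1)))). split; [apply Rabs_pos|].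
    intros x hx. rewrite Rabs_mult, (Rabs_pos_eq (Rpower _ _)) by (left; apply Rpower_pos).
    apply Rmult_le_compat_l; [apply Rabs_pos|]. apply nonlog_le_wtL; auto.
Qed.

Lemma lim_v1 al be z : -1 < be -> Clim (at_right (-1)) (v1 al be z) 1.
Proof.
  intros hb.
  destruct (CPS_sub_head_le _ 1 (Cmod z) (nice_FA al be hb) (fun _ => eq_refl)) as [K [hK HK]].
  apply (Clim_pow_squeeze _ _ (K / 2) 1 Rlt_0_1). intros x hx.
  rewrite Rpower_1 by lra.
  eapply Rle_trans; [apply HK; [lra|apply half_bounds; lra]|]. right. field.
Qed.

Lemma lim_CPS_half f z : nice f -> Clim (at_right (-1)) (fun x => CPS (f z) ((1 + x) / 2)) (f z O).
Proof.
  intros hf.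
  destruct (CPS_sub_head_le (fun _ => f z) (f z O) (Cmod z)) as [K [hK HK]]; [|reflexivity|].
  { intros M rho hr. destruct (hf (Cmod z) rho hr) as [K [hK HK]]. exists K. split; [auto|].
    intros q q1 _ _ n. split; [apply (HK z z); lra|].
    replace (f z n - f z n)%C with (RtoC 0) by ring. rewrite Cmod_0.
    apply Rmult_le_pos; [apply Rmult_le_pos; [auto|apply Cmod_ge_0]|apply pow_le; lra]. }
  apply (Clim_pow_squeeze _ _ (K / 2) 1 Rlt_0_1). intros x hx.
  rewrite Rpower_1 by lra.
  eapply Rle_trans; [apply (HK z); [lra|apply half_bounds; lra]|]. right. field.
Qed.

Lemma lim_pow_sub a : Clim (at_right (-1)) (fun x => RtoC (Rpower (1 - x) a)) (RtoC (Rpower 2 a)).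
Proof.
  replace (Rpower 2 a) with (Rpower (1 - -1) a) by (f_equal; ring).
  apply (lim_right_of_continuous (fun x => Rpower (1 - x) a)).
  apply derivable_continuous_pt. exists (- a * Rpower (1 - -1) a / (1 - -1)).
  apply is_derive_Reals, derive_pow_sub. lra.
Qed.

Lemma lim_half : Clim (at_right (-1)) (fun x => RtoC ((1 + x) / 2)) 0.
Proof.
  apply (Clim_pow_squeeze _ _ (1 / 2) 1 Rlt_0_1). intros x hx. rewrite Rpower_1 by lra.
  rewrite Cmod_minus_0.
  rewrite Cmod_R, Rabs_pos_eq; lra.
Qed.

Lemma half_ln_le x : -1 < x < 0 ->
  Rabs ((1 + x) / 2 * ln ((1 + x) / 2)) <= Rpower (/ 2) (- (1 / 2)) * Rpower (1 + x) (1 / 2).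
Proof.
  intros hx. rewrite Rabs_mult, (Rabs_pos_eq ((1 + x) / 2)) by lra.
  assert (h := Rabs_ln_half_le x (1 / 2) ltac:(lra) ltac:(lra)).
  replace (Rpower (1 + x) (1 / 2)) with (Rpower (1 + x) (- (1 / 2)) * (1 + x))
    by (rewrite <- Rpower_S by lra; f_equal; lra).
  assert (p := Rpower_pos (/ 2) (- (1 / 2))). assert (p2 := Rpower_pos (1 + x) (- (1 / 2))).
  apply Rle_trans with ((1 + x) / 2 * (Rpower (/ 2) (- (1 / 2)) / (1 / 2) * Rpower (1 + x) (- (1 / 2)))).
  - apply Rmult_le_compat_l; lra.
  - right. field.
Qed.

Lemma lim_half_ln : Clim (at_right (-1)) (fun x => RtoC ((1 + x) / 2 * ln ((1 + x) / 2))) 0.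
Proof.
  apply (Clim_pow_squeeze _ _ (Rpower (/ 2) (- (1 / 2))) (1 / 2) ltac:(lra)). intros x hx.
  rewrite Cmod_minus_0.
  rewrite Cmod_R. apply half_ln_le, hx.
Qed.

Lemma lim_V1 al be z : -1 < be -> Clim (at_right (-1)) (V1 al be z) 0.
Proof.
  intros hb. unfold V1.
  apply Clim_ext with (fun x => RtoC (/ 2) * RtoC (Rpower (1 - x) (al + 1)) * CPS (cder (FA al be z)) ((1 + x) / 2)
    * RtoC (Rpower (1 + x) (be + 1)))%C; [typeclasses eauto| |].
  - intros x. unfold p_ab.
    replace (Rpower (1 - x) (al + 1) * Rpower (1 + x) (be + 1) / 2) with
      (/ 2 * Rpower (1 - x) (al + 1) * Rpower (1 + x) (be + 1)) by field.
    rewrite !RtoC_mult. ring.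
  - eapply Clim_eq; [apply Clim_mult; [typeclasses eauto| |apply (lim_pow_add (be + 1)); lra]|].
    + apply Clim_mult; [typeclasses eauto|apply Clim_scal; [typeclasses eauto|apply lim_pow_sub]|].
      apply (lim_CPS_half (fun z => cder (FA al be z)) z). apply nice_cder, nice_FA, hb.
    + ring.
Qed.

(** The series differ from their value at 0 by $O(1+x)$, which outweighs the logarithm and, as
    $\beta<1$, the power $(1+x)^{-\beta}$. *)
Lemma lim_v2 al be z : -1 < be < 1 ->
  Clim (at_right (-1)) (fun x => v2 al be z x - RtoC (omega al be x))%C 0.
Proof.
  intros hb. unfold v2, omega. destruct (Req_EM_T be 0) as [e|e].
  - subst be. set (c := - / Rpower 2 (al + 1)).
    destruct (CPS_sub_head_le _ 1 (Cmod z) (nice_FA al 0 ltac:(lra)) (fun _ => eq_refl)) as [K [hK HK]].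
    apply Clim_ext_loc with (fun x => RtoC c * (RtoC (ln ((1 + x) / 2)) * (CPS (FA al 0 z) ((1 + x) / 2) - 1)
       + CPS (FD al z) ((1 + x) / 2)))%C; [typeclasses eauto| |].
    + apply filter_forall. intros x. rewrite (RtoC_mult c). ring.
    + apply Clim_eq with (RtoC c * (0 + 0))%C; [|ring]. apply Clim_scal; [typeclasses eauto|].
      apply Clim_plus; [typeclasses eauto| |apply (lim_CPS_half (FD al) z (nice_FD al))].
      apply (Clim_pow_squeeze _ _ (K * Rpower (/ 2) (- (1 / 2))) (1 / 2) ltac:(lra)). intros x hx.
      rewrite Cmod_minus_0.
      rewrite Cmod_mult, Cmod_R.
      assert (h := HK z ((1 + x) / 2) ltac:(lra) (half_bounds x ltac:(lra))).
      apply Rle_trans with (Rabs (ln ((1 + x) / 2)) * (K * ((1 + x) / 2))).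
      * apply Rmult_le_compat_l; [apply Rabs_pos|exact h].
      * assert (h2 := half_ln_le x hx). rewrite Rabs_mult, (Rabs_pos_eq ((1 + x) / 2)) in h2 by lra.
        nra.
  - set (c := / (be * Rpower 2 (al + 1))).
    destruct (CPS_sub_head_le _ 1 (Cmod z) (nice_FB al be ltac:(lra)) (fun _ => eq_refl)) as [K [hK HK]].
    apply (Clim_pow_squeeze _ _ (Rabs c * K / 2) (1 - be) ltac:(lra)). intros x hx.
    rewrite Cmod_minus_0.
    match goal with |- Cmod (?a * ?b - ?d) <= _ => replace (a * b - d)%C with (a * (b - 1))%C by ring end.
    rewrite Cmod_mult, Cmod_R, Rabs_mult, (Rabs_pos_eq (Rpower _ _)) by (left; apply Rpower_pos).
    assert (h := HK z ((1 + x) / 2) ltac:(lra) (half_bounds x ltac:(lra))).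
    replace (1 - be) with (- be + 1) by ring. rewrite Rpower_S by lra.
    assert (p := Rpower_pos (1 + x) (- be)). assert (q := Rabs_pos c).
    apply Rle_trans with (Rabs c * Rpower (1 + x) (- be) * (K * ((1 + x) / 2))).
    + apply Rmult_le_compat_l; [nra|exact h].
    + right. field.
Qed.

Lemma lim_V2 al be z : -1 < be < 1 -> Clim (at_right (-1)) (V2 al be z) (- (1))%C.
Proof.
  intros hb. assert (hc := Rpower_pos 2 (al + 1)). unfold V2. destruct (Req_EM_T be 0) as [e|e].
  - subst be. set (c := - / Rpower 2 (al + 1)).
    apply Clim_ext with (fun x => RtoC c * RtoC (Rpower (1 - x) (al + 1)) *
      (RtoC ((1 + x) / 2 * ln ((1 + x) / 2)) * CPS (cder (FA al 0 z)) ((1 + x) / 2)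
       + RtoC ((1 + x) / 2) * CPS (cder (FD al z)) ((1 + x) / 2)
       + CPS (FA al 0 z) ((1 + x) / 2)))%C; [typeclasses eauto| |].
    + intros x. rewrite !(RtoC_mult c), (RtoC_mult _ (ln _)). ring.
    + eapply Clim_eq.
      * apply Clim_mult; [typeclasses eauto|apply Clim_scal; [typeclasses eauto|apply lim_pow_sub]|].
        apply Clim_plus; [typeclasses eauto|apply Clim_plus; [typeclasses eauto| |]|].
        -- apply Clim_mult; [typeclasses eauto|apply lim_half_ln|].
           apply (lim_CPS_half (fun z => cder (FA al 0 z)) z). apply nice_cder, nice_FA. lra.
        -- apply Clim_mult; [typeclasses eauto|apply lim_half|].
           apply (lim_CPS_half (fun z => cder (FD al z)) z). apply nice_cder, nice_FD.
        -- apply (lim_CPS_half (FA al 0) z). apply nice_FA. lra.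
      * change (FA al 0 z O) with (RtoC 1).
        rewrite (RtoC_mult_eq _ _ (-1)) by (unfold c; field; lra).
        replace (RtoC (-1)) with (- (1))%C by (rewrite <- RtoC_opp; reflexivity). ring.
  - set (c := / (be * Rpower 2 (al + 1))).
    apply Clim_ext with (fun x => RtoC c * RtoC (Rpower (1 - x) (al + 1)) *
      (RtoC (- be) * CPS (FB al be z) ((1 + x) / 2)
       + RtoC ((1 + x) / 2) * CPS (cder (FB al be z)) ((1 + x) / 2)))%C; [typeclasses eauto| |].
    + intros x. rewrite !(RtoC_mult c). ring.
    + eapply Clim_eq.
      * apply Clim_mult; [typeclasses eauto|apply Clim_scal; [typeclasses eauto|apply lim_pow_sub]|].
        apply Clim_plus; [typeclasses eauto| |].
        -- apply Clim_scal; [typeclasses eauto|]. apply (lim_CPS_half (FB al be) z). apply nice_FB. lra.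
        -- apply Clim_mult; [typeclasses eauto|apply lim_half|].
           apply (lim_CPS_half (fun z => cder (FB al be z)) z). apply nice_cder, nice_FB. lra.
      * change (FB al be z O) with (RtoC 1).
        replace (RtoC c * RtoC (Rpower 2 (al + 1)) * (RtoC (- be) * 1 + 0 * cder (FB al be z) 0))%C
          with (RtoC c * RtoC (Rpower 2 (al + 1)) * RtoC (- be))%C by ring.
        rewrite <- !RtoC_mult, <- RtoC_opp. f_equal. unfold c. field. lra.
Qed.

(** * Wronskians and the coefficients at $-1$ *)

Definition Wr (u U v V : R -> C) (x : R) : C := (u x * V x - U x * v x)%C.

Lemma Wr_derive al be z z' u U v V x : csol al be z u U -> csol al be z' v V -> in11 x ->
  is_derive (Wr u U v V) x ((z - z') * (RtoC (r_ab al be x) * (u x * v x)))%C.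
Proof.
  intros Hu Hv Hx. destruct (Hu x Hx) as [u1 u2]. destruct (Hv x Hx) as [w1 w2].
  eapply dC_eq; [apply dC_minus; apply dC_mult; eassumption|]. ring.
Qed.

Lemma at_right_proper : ProperFilter (at_right (-1)).
Proof. apply at_right_proper_filter. Qed.

Lemma r_ab_le_left al be x : -1 < x <= 0 -> r_ab al be x <= (1 + Rpower 2 al) * Rpower (1 + x) be.
Proof.
  intros hx. unfold r_ab. apply Rmult_le_compat_r; [left; apply Rpower_pos|].
  rewrite <- (Rpower_base_1 al) at 2. apply Rpower_exp_bounded; lra.
Qed.

(* Since [|u'| <= C (1+x)^(s-1)] is integrable at [-1], [u] approaches its limit at rate [(1+x)^s]. *)
Lemma limit_rate (f df : R -> C) l C s : 0 < s -> 0 <= C ->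
  (forall x, -1 < x <= 0 -> is_derive f x (df x)) ->
  (forall x, -1 < x <= 0 -> Cmod (df x) <= C * Rpower (1 + x) (s - 1)) ->
  Clim (at_right (-1)) f l ->
  forall x, -1 < x <= 0 -> Cmod (f x - l) <= 2 * (C / s) * Rpower (1 + x) s.
Proof.
  intros hs hC Hf Hd Hl x hx.
  apply (@Cmod_limit_le _ (at_right (-1)) at_right_proper f); [exact Hl|].
  assert (hp : 0 < x + 1) by lra.
  exists (mkposreal _ hp). intros y Hy Hlt.
  assert (Hy' : Rabs (y - -1) < x + 1) by exact Hy. apply Rabs_def2 in Hy'.
  eapply Rle_trans; [apply (increment_le_of_derive f df
    (fun t => C / s * Rpower (1 + t) s) (fun t => C * Rpower (1 + t) (s - 1)) y x)|].
  - lra.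
  - intros t ht. apply Hf. lra.
  - intros t ht. replace (C * Rpower (1 + t) (s - 1)) with (C / s * (s * Rpower (1 + t) s / (1 + t))).
    + apply is_derive_scal. apply derive_pow_add. lra.
    + replace (Rpower (1 + t) s) with (Rpower (1 + t) (s - 1) * (1 + t))
        by (rewrite <- Rpower_S by lra; f_equal; ring). field. lra.
  - intros t ht. apply Hd. lra.
  - assert (p := Rpower_pos (1 + y) s). assert (q : 0 <= C / s) by (apply Rdiv_le_0_compat; lra). nra.
Qed.

(** Write $\kappa$ for [kap be]. Then $|U'|=r|z||u|\le C(1+x)^{\beta-\kappa}$, and integration
    raises the exponent by one. *)
Lemma csol_limit_rate al be z u U l K : -1 < be < 1 -> csol al be z u U -> 0 <= K ->
  (forall x, -1 < x <= 0 -> Cmod (u x) <= K * wtL be x) ->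
  Clim (at_right (-1)) U l ->
  exists L, 0 <= L /\ forall x, -1 < x <= 0 -> Cmod (U x - l) <= L * Rpower (1 + x) (1 + be - kap be).
Proof.
  intros hb Hu hK HK Hl. destruct (kap_props be hb) as [k1 [k2 k3]].
  assert (pal := Rpower_pos 2 al). assert (hz := Cmod_ge_0 z).
  pose (C := (1 + Rpower 2 al) * (Cmod z * K)).
  assert (hC : 0 <= C) by (apply Rmult_le_pos; [lra|apply Rmult_le_pos; lra]).
  exists (2 * (C / (1 + be - kap be))). split.
  { apply Rmult_le_pos; [lra|]. apply Rdiv_le_0_compat; lra. }
  intros x hx.
  apply (limit_rate U (fun x => - (RtoC (r_ab al be x) * (z * u x)))%C); auto; try lra.
  - intros t ht. apply (Hu t). split; lra.
  - intros t ht. rewrite Cmod_opp, !Cmod_mult, Cmod_R, Rabs_pos_eq by (left; apply r_ab_pos).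
    replace (1 + be - kap be - 1) with (be + - kap be) by ring. rewrite Rpower_plus. fold (wtL be t).
    replace (C * (Rpower (1 + t) be * wtL be t)) with
      (((1 + Rpower 2 al) * Rpower (1 + t) be) * (Cmod z * (K * wtL be t))) by (unfold C; ring).
    apply Rmult_le_compat; [left; apply r_ab_pos|apply Rmult_le_pos; [lra|apply Cmod_ge_0]
      |apply r_ab_le_left, ht|]. apply Rmult_le_compat_l; auto.
Qed.

Lemma v1_bound al be z : -1 < be < 1 -> exists K, 0 <= K /\
  forall x, -1 < x <= 0 -> Cmod (v1 al be z x) <= K /\ Cmod (v2 al be z x) <= K * wtL be x.
Proof.
  intros hb. destruct (basis_bound al be (Cmod z) hb) as [K [hK HK]].
  exists K. split; [auto|]. intros x hx. destruct (HK z z x ltac:(lra) ltac:(lra) hx) as [[a _] [b _]]. auto.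
Qed.

(** Weight times rate is $(1+x)^{1+\beta-2\kappa}$ with $\kappa$ the value of [kap be], and the
    exponent is positive since $\kappa<(1+\beta)/2$. *)
Lemma Clim_wt_rate be (f : R -> C) L : -1 < be < 1 ->
  (forall x, -1 < x <= 0 -> Cmod (f x) <= L * wtL be x * Rpower (1 + x) (1 + be - kap be)) ->
  Clim (at_right (-1)) f 0.
Proof.
  intros hb H. destruct (kap_props be hb) as [k1 [k2 k3]].
  apply (Clim_pow_squeeze _ _ L (1 + be - 2 * kap be)); [lra|]. intros x hx.
  rewrite Cmod_minus_0. eapply Rle_trans; [apply H; lra|].
  unfold wtL. rewrite Rmult_assoc, <- Rpower_plus. right. f_equal. f_equal. ring.
Qed.

Lemma omega_mult_lim al be (f : R -> C) L : -1 < be < 1 -> 0 <= L ->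
  (forall x, -1 < x <= 0 -> Cmod (f x) <= L * Rpower (1 + x) (1 + be - kap be)) ->
  Clim (at_right (-1)) (fun x => RtoC (omega al be x) * f x)%C 0.
Proof.
  intros hb hL H. destruct (omega_le_wtL al be hb) as [K [hK HK]].
  apply (Clim_wt_rate be _ (K * L) hb). intros x hx.
  rewrite Cmod_mult, Cmod_R.
  replace (K * L * wtL be x * Rpower (1 + x) (1 + be - kap be)) with
    (K * wtL be x * (L * Rpower (1 + x) (1 + be - kap be))) by ring.
  apply Rmult_le_compat; [apply Rabs_pos|apply Cmod_ge_0|auto|auto].
Qed.

Lemma omega_V1 al be z : -1 < be < 1 ->
  Clim (at_right (-1)) (fun x => RtoC (omega al be x) * V1 al be z x)%C 0.
Proof.
  intros hb. destruct (v1_bound al be z hb) as [K [hK HK]].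
  destruct (csol_limit_rate al be z _ _ 0 K hb (csol_v1 al be z (proj1 hb)) hK) as [L [hL HL]].
  - intros x hx. destruct (HK x hx) as [h _]. assert (w := wtL_ge1 be x hb hx). nra.
  - apply lim_V1. lra.
  - apply (omega_mult_lim al be _ L hb hL). intros x hx. rewrite <- Cmod_minus_0. auto.
Qed.

Lemma omega_V2 al be z : -1 < be < 1 ->
  Clim (at_right (-1)) (fun x => RtoC (omega al be x) * (V2 al be z x + 1))%C 0.
Proof.
  intros hb. destruct (v1_bound al be z hb) as [K [hK HK]].
  destruct (csol_limit_rate al be z _ _ (- (1))%C K hb (csol_v2 al be z hb) hK) as [L [hL HL]].
  - intros x hx. apply HK, hx.
  - apply lim_V2, hb.
  - apply (omega_mult_lim al be _ L hb hL). intros x hx.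
    replace (V2 al be z x + 1)%C with (V2 al be z x - - (1))%C by ring. auto.
Qed.

(* The boundary behaviour at [-1] of [A v1 + B v2]. *)
Definition asyL (al be : R) (u U : R -> C) (A B : C) : Prop :=
  Clim (at_right (-1)) (fun x => u x - (A + B * RtoC (omega al be x)))%C 0 /\
  Clim (at_right (-1)) U (- B)%C /\
  Clim (at_right (-1)) (fun x => RtoC (omega al be x) * (U x + B))%C 0.

Definition comb (A B : C) (f g : R -> C) (x : R) : C := (A * f x + B * g x)%C.

Lemma asyL_comb al be z A B : -1 < be < 1 ->
  asyL al be (comb A B (v1 al be z) (v2 al be z)) (comb A B (V1 al be z) (V2 al be z)) A B.
Proof.
  intros hb. assert (PF := at_right_proper). unfold asyL, comb. repeat split.
  - apply Clim_ext with (fun x => A * (v1 al be z x - 1) + B * (v2 al be z x - RtoC (omega al be x)))%C;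
      [typeclasses eauto|intros x; ring|].
    eapply Clim_eq; [apply Clim_plus; [typeclasses eauto| |]; apply Clim_scal; try typeclasses eauto;
      [apply Clim_minus; [typeclasses eauto|apply lim_v1; lra|apply Clim_const; typeclasses eauto]
      |apply lim_v2, hb]|]. ring.
  - eapply Clim_eq; [apply Clim_plus; [typeclasses eauto| |]; apply Clim_scal; try typeclasses eauto;
      [apply lim_V1; lra|apply lim_V2, hb]|]. ring.
  - apply Clim_ext with (fun x => A * (RtoC (omega al be x) * V1 al be z x)
       + B * (RtoC (omega al be x) * (V2 al be z x + 1)))%C; [typeclasses eauto|intros x; ring|].
    eapply Clim_eq; [apply Clim_plus; [typeclasses eauto| |]; apply Clim_scal; try typeclasses eauto;
      [apply omega_V1, hb|apply omega_V2, hb]|]. ring.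
Qed.

(** For $\beta\ge0$ the products $uV$ and $Uv$ need not converge separately. Their divergent parts
    are both $-BB'\omega$ and cancel; the errors vanish by the third clause of [asyL]. *)
Lemma Wr_lim al be u U v V A B A' B' : asyL al be u U A B -> asyL al be v V A' B' ->
  Clim (at_right (-1)) (Wr u U v V) (A' * B - A * B')%C.
Proof.
  intros (u1 & u2 & u3) (w1 & w2 & w3). assert (PF := at_right_proper). unfold Wr.
  set (om := fun x => RtoC (omega al be x)).
  apply Clim_ext with (fun x => (u x - (A + B * om x)) * V x + A * V x + B * (om x * (V x + B'))
     - (v x - (A' + B' * om x)) * U x - A' * U x - B' * (om x * (U x + B)))%C;
    [typeclasses eauto|intros x; unfold om; ring|].
  eapply Clim_eq.
  - repeat first [apply Clim_minus; [typeclasses eauto| |] | apply Clim_plus; [typeclasses eauto| |]].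
    + apply Clim_mult; [typeclasses eauto|exact u1|exact w2].
    + apply Clim_scal; [typeclasses eauto|exact w2].
    + apply Clim_scal; [typeclasses eauto|exact w3].
    + apply Clim_mult; [typeclasses eauto|exact w1|exact u2].
    + apply Clim_scal; [typeclasses eauto|exact u2].
    + apply Clim_scal; [typeclasses eauto|exact u3].
  - ring.
Qed.

Lemma comb_csol al be z u U v V A B : csol al be z u U -> csol al be z v V ->
  csol al be z (comb A B u v) (comb A B U V).
Proof.
  intros Hu Hv x Hx. destruct (Hu x Hx) as [u1 u2]. destruct (Hv x Hx) as [w1 w2]. split.
  - eapply dC_eq; [apply dC_plus; apply dC_scal; eassumption|]. unfold comb. ring.
  - eapply dC_eq; [apply dC_plus; apply dC_scal; eassumption|]. unfold comb. ring.
Qed.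

Lemma comb_1_0 (f g : R -> C) x : comb 1 0 f g x = f x.
Proof. unfold comb. ring. Qed.
Lemma comb_0_1 (f g : R -> C) x : comb 0 1 f g x = g x.
Proof. unfold comb. ring. Qed.

Lemma Wr_const al be z u U v V l : csol al be z u U -> csol al be z v V ->
  Clim (at_right (-1)) (Wr u U v V) l -> forall x, in11 x -> Wr u U v V x = l.
Proof.
  intros Hu Hv Hl x Hx. assert (PF := at_right_proper).
  apply (Clim_unique (at_right (-1)) (Wr u U v V)); [|exact Hl].
  apply Clim_ext_loc with (fun _ => Wr u U v V x); [typeclasses eauto| |apply Clim_const; typeclasses eauto].
  generalize in11_at_right. apply filter_imp. intros y Hy.
  apply (constant_of_derive0 (Wr u U v V)); auto. intros t Ht.
  eapply dC_eq; [apply (Wr_derive al be z z); eassumption|]. ring.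
Qed.

(** The Wronskian is constant, so it equals its limit at $-1$, computed from the coefficients
    $(0,1)$ and $(1,0)$. *)
Lemma Wr_basis al be z : -1 < be < 1 -> forall x, in11 x ->
  Wr (v2 al be z) (V2 al be z) (v1 al be z) (V1 al be z) x = 1.
Proof.
  intros hb.
  assert (a2 := asyL_comb al be z 0 1 hb). assert (a1 := asyL_comb al be z 1 0 hb).
  assert (h := Wr_lim _ _ _ _ _ _ _ _ _ _ a2 a1).
  apply (Wr_const al be z _ _ _ _ _ (csol_v2 al be z hb) (csol_v1 al be z (proj1 hb))).
  apply Clim_eq with (1 * 1 - 0 * 0)%C; [|ring].
  refine (Clim_ext _ _ _ _ _ h).
  intros x. unfold Wr. rewrite !comb_0_1, !comb_1_0. reflexivity.
Qed.

Lemma csol_continuous_bounded al be z u U a b : csol al be z u U -> -1 < a -> a <= b -> b < 1 ->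
  exists B, 0 <= B /\ forall x, a <= x <= b -> Cmod (u x) <= B /\ Cmod (U x) <= B.
Proof.
  intros H ha hab hb.
  assert (K : forall f : R -> C, (forall x, in11 x -> exists l, is_derive f x l) ->
     exists B, 0 <= B /\ forall x, a <= x <= b -> Cmod (f x) <= B).
  { intros f Hf.
    destruct (continuity_ab_maj (fun x => Rabs (Re (f x)) + Rabs (Im (f x))) a b hab) as [m [Hm _]].
    - intros c hc. destruct (Hf c ltac:(split; lra)) as [l Hl]. apply is_derive_ReIm in Hl. destruct Hl as [h1 h2].
      apply is_derive_Reals in h1. apply is_derive_Reals in h2.
      apply continuity_pt_plus; apply (continuity_pt_comp _ Rabs); try apply Rcontinuity_abs.
      + apply derivable_continuous_pt. eexists; exact h1.
      + apply derivable_continuous_pt. eexists; exact h2.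
    - exists (Rabs (Re (f m)) + Rabs (Im (f m))). split.
      + assert (p := Rabs_pos (Re (f m))). assert (q := Rabs_pos (Im (f m))). lra.
      + intros x hx. eapply Rle_trans; [apply Cmod_le_ReIm|apply (Hm x hx)]. }
  destruct (K u (fun x hx => ex_intro _ _ (proj1 (H x hx)))) as [B1 [h1 H1]].
  destruct (K U (fun x hx => ex_intro _ _ (proj2 (H x hx)))) as [B2 [h2 H2]].
  exists (B1 + B2). split; [lra|]. intros x hx. specialize (H1 x hx). specialize (H2 x hx). lra.
Qed.

Lemma p_ab_inv_bounded al be a b : -1 < a -> a <= b -> b < 1 ->
  exists B, 0 <= B /\ forall x, a <= x <= b -> Rabs (/ p_ab al be x) <= B /\ Rabs (r_ab al be x) <= B.
Proof.
  intros ha hab hb.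
  assert (K : forall f : R -> R, (forall x, in11 x -> continuity_pt f x) -> (forall x, in11 x -> 0 < f x) ->
     exists B, 0 <= B /\ forall x, a <= x <= b -> Rabs (f x) <= B).
  { intros f Hf Pf. destruct (continuity_ab_maj f a b hab) as [m [Hm hm]].
    - intros c hc. apply Hf. split; lra.
    - exists (f m). split; [left; apply Pf; split; lra|]. intros x hx.
      rewrite Rabs_pos_eq; [apply Hm, hx|left; apply Pf; split; lra]. }
  assert (cp : forall s x, in11 x -> continuity_pt (fun x => Rpower (1 - x) s) x).
  { intros s x [h1 h2]. apply derivable_continuous_pt. eexists.
    apply is_derive_Reals, derive_pow_sub, h2. }
  assert (cq : forall s x, in11 x -> continuity_pt (fun x => Rpower (1 + x) s) x).
  { intros s x [h1 h2]. apply derivable_continuous_pt. eexists.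
    apply is_derive_Reals, derive_pow_add, h1. }
  destruct (K (fun x => / p_ab al be x)) as [B1 [h1 H1]].
  - intros x hx. apply continuity_pt_inv; [|apply Rgt_not_eq, p_ab_pos].
    apply (continuity_pt_mult _ _ x (cp (al + 1) x hx) (cq (be + 1) x hx)).
  - intros x hx. apply Rinv_0_lt_compat, p_ab_pos.
  - destruct (K (r_ab al be)) as [B2 [h2 H2]].
    + intros x hx. apply (continuity_pt_mult _ _ x (cp al x hx) (cq be x hx)).
    + intros x hx. apply r_ab_pos.
    + exists (B1 + B2). split; [lra|]. intros x hx. specialize (H1 x hx). specialize (H2 x hx). lra.
Qed.

Lemma csol_ACloc al be z u U : csol al be z u U -> ACloc u /\ ACloc U.
Proof.
  intros H. split.
  - apply (ACloc_of_C1 u (fun x => RtoC (/ p_ab al be x) * U x)%C); [intros x hx; exact (proj1 (H x hx))|].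
    intros a b ha hab hb. destruct (csol_continuous_bounded al be z u U a b H ha hab hb) as [B [hB HB]].
    destruct (p_ab_inv_bounded al be a b ha hab hb) as [L [hL HL]].
    exists (L * B). intros x hx. rewrite Cmod_mult, Cmod_R.
    apply Rmult_le_compat; [apply Rabs_pos|apply Cmod_ge_0|apply HL, hx|apply HB, hx].
  - apply (ACloc_of_C1 U (fun x => - (RtoC (r_ab al be x) * (z * u x)))%C); [intros x hx; exact (proj2 (H x hx))|].
    intros a b ha hab hb. destruct (csol_continuous_bounded al be z u U a b H ha hab hb) as [B [hB HB]].
    destruct (p_ab_inv_bounded al be a b ha hab hb) as [L [hL HL]].
    exists (L * (Cmod z * B)). intros x hx. rewrite Cmod_opp, !Cmod_mult, Cmod_R.
    apply Rmult_le_compat; [apply Rabs_pos|apply Rmult_le_pos; apply Cmod_ge_0|apply HL, hx|].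
    apply Rmult_le_compat_l; [apply Cmod_ge_0|apply HB, hx].
Qed.

Lemma csol_sol al be z u U : csol al be z u U -> sol al be z u U.
Proof.
  intros H. destruct (csol_ACloc _ _ _ _ _ H). split; [split; [|split]|]; auto;
    apply LebR.ae11_all; intros x hx; [exact (proj1 (H x hx))|exact (proj2 (H x hx))].
Qed.

Lemma sol_Wr_const al be z u U v V : sol al be z u U -> csol al be z v V ->
  exists k, forall x, in11 x -> Wr u U v V x = k.
Proof.
  intros [[Au [AU Du]] DU] Hv. destruct (csol_ACloc _ _ _ _ _ Hv) as [Av AV].
  exists (Wr u U v V 0). intros x hx. apply (ac_constant (Wr u U v V)); auto; [| |split; lra].
  - apply ACloc_plus; [apply ACloc_mult; auto|apply ACloc_opp, ACloc_mult; auto].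
  - apply LebR.ae11_impl with (2 := LebR.ae11_and _ _ Du DU). intros t ht [d1 d2].
    destruct (Hv t ht) as [w1 w2].
    eapply dC_eq; [apply dC_minus; apply dC_mult; eassumption|]. ring.
Qed.

(** Cramer's rule with the constant Wronskians of [u] with [a] and with [b]. This is what upgrades
    solutions in the almost everywhere sense to the explicit ones. *)
Lemma sol_representation al be z u U a A b B k : sol al be z u U ->
  csol al be z a A -> csol al be z b B -> k <> RtoC 0 -> (forall x, in11 x -> Wr b B a A x = k) ->
  exists c d, forall x, in11 x -> u x = comb c d a b x /\ U x = comb c d A B x.
Proof.
  intros Hu Ha Hb hk Hk.
  destruct (sol_Wr_const al be z u U a A Hu Ha) as [w1 H1].
  destruct (sol_Wr_const al be z u U b B Hu Hb) as [w2 H2].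
  exists (- w2 / k)%C, (w1 / k)%C. intros x hx. specialize (H1 x hx). specialize (H2 x hx). specialize (Hk x hx).
  unfold Wr, comb in *. rewrite <- H1, <- H2. rewrite <- Hk in *. split; field; auto.
Qed.

(* Passage from the coefficients of [v1] and [v2] to the generalized boundary values at [-1]. *)
Definition bvL0 (be : R) (A B : C) : C := if Rlt_dec be 0 then A else B.
Definition bvL1 (be : R) (A B : C) : C := if Rlt_dec be 0 then (- B)%C else A.

Lemma lim_omega_neg al be : be < 0 -> Clim (at_right (-1)) (fun x => RtoC (omega al be x)) 0.
Proof.
  intros h. unfold omega. destruct (Req_EM_T be 0) as [e|_]; [lra|].
  set (c := / (be * Rpower 2 (al + 1))).
  apply (Clim_pow_squeeze _ _ (Rabs c) (- be)); [lra|]. intros x hx.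
  rewrite Cmod_minus_0, Cmod_R, Rabs_mult, (Rabs_pos_eq (Rpower _ _)) by (left; apply Rpower_pos). lra.
Qed.

Lemma lim_inv_ln : Clim (at_right (-1)) (fun x => RtoC (/ ln ((1 + x) / 2))) 0.
Proof.
  intros eps He.
  assert (hp : 0 < Rmin 1 (2 * exp (- (2 / eps)))) by (apply Rmin_pos; [lra|]; assert (h := exp_pos (- (2 / eps))); lra).
  exists (mkposreal _ hp). intros y Hy Hlt.
  assert (Hy' : Rabs (y - -1) < Rmin 1 (2 * exp (- (2 / eps)))) by exact Hy.
  assert (m1 := Rmin_l 1 (2 * exp (- (2 / eps)))). assert (m2 := Rmin_r 1 (2 * exp (- (2 / eps)))).
  apply Rabs_def2 in Hy'.
  assert (hl : ln ((1 + y) / 2) < - (2 / eps)).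
  { rewrite <- (ln_exp (- (2 / eps))). apply ln_increasing; lra. }
  assert (h2 : 0 < 2 / eps) by (apply Rdiv_lt_0_compat; lra).
  rewrite Cmod_minus_0, Cmod_R, Rabs_inv, Rabs_left by lra.
  apply Rlt_le_trans with (/ (2 / eps)).
  - apply Rinv_lt_contravar; [apply Rmult_lt_0_compat|]; lra.
  - rewrite Rinv_div. lra.
Qed.

(** For $\beta\ge0$ the coefficient of [omega] is $\widetilde g(-1)$ and the constant term is
    $\widetilde g^{\,\prime}(-1)$. For $\beta<0$ [omega] tends to 0, so the value is $A$ and the
    quasi-derivative is $-B$. *)
Lemma gbvL_of_asymptotics al be u U A B :
  Clim (at_right (-1)) (fun x => u x - (A + B * RtoC (omega al be x)))%C 0 ->
  Clim (at_right (-1)) U (- B)%C -> gbvL al be u U (bvL0 be A B) (bvL1 be A B).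
Proof.
  intros Hu HU. assert (PF := at_right_proper). assert (FF : Filter (at_right (-1))) by typeclasses eauto.
  assert (hc := Rpower_pos 2 (al + 1)).
  unfold gbvL, bvL0, bvL1. split; [|split]; intros hbe.
  - destruct (Rlt_dec be 0) as [_|n]; [|lra]. split; apply Clim_filterlim; auto.
    apply Clim_ext with (fun x => (u x - (A + B * RtoC (omega al be x))) + (A + B * RtoC (omega al be x)))%C; auto.
    { intros x; ring. }
    eapply Clim_eq; [apply Clim_plus; [auto|exact Hu|]; apply Clim_plus; [auto|apply Clim_const; auto|];
      apply Clim_scal; [auto|apply lim_omega_neg, hbe]|]. ring.
  - destruct (Rlt_dec be 0) as [n|_]; [lra|].
    assert (Eom : forall x, omega al be x = - / Rpower 2 (al + 1) * ln ((1 + x) / 2))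
      by (intros x; unfold omega; destruct (Req_EM_T be 0); [reflexivity|contradiction]).
    split; apply Clim_filterlim; auto.
    + apply Clim_ext_loc with (fun x => (RtoC (- Rpower 2 (al + 1)) * RtoC (/ ln ((1 + x) / 2)))
         * ((u x - (A + B * RtoC (omega al be x))) + A) + B)%C; auto.
      * generalize in10_at_right. apply filter_imp. intros x hx. rewrite Eom.
        assert (hl : ln ((1 + x) / 2) < 0) by (rewrite <- ln_1; apply ln_increasing; lra).
        unfold Rdiv at 3. rewrite !RtoC_mult, !RtoC_opp, !RtoC_inv by lra.
        assert (n1 : RtoC (ln ((1 + x) / 2)) <> RtoC 0) by (apply RtoC_neq0; lra).
        assert (n2 : RtoC (Rpower 2 (al + 1)) <> RtoC 0) by (apply RtoC_neq0; lra).
        field. auto.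
      * eapply Clim_eq; [apply Clim_plus; [auto| |apply Clim_const; auto]; apply Clim_mult;
          [auto|apply Clim_scal; [auto|apply lim_inv_ln]|apply Clim_plus; [auto|exact Hu|apply Clim_const; auto]]|].
        ring.
    + apply Clim_ext with (fun x => (u x - (A + B * RtoC (omega al be x))) + A)%C; auto.
      * intros x. rewrite Eom. replace (- al - 1) with (- (al + 1)) by ring. rewrite (Rpower_Ropp 2 (al + 1)).
        rewrite !RtoC_mult, RtoC_opp. ring.
      * eapply Clim_eq; [apply Clim_plus; [auto|exact Hu|apply Clim_const; auto]|]. ring.
  - destruct (Rlt_dec be 0) as [n|_]; [lra|].
    assert (Eom : forall x, omega al be x = / (be * Rpower 2 (al + 1)) * Rpower (1 + x) (- be))
      by (intros x; unfold omega; destruct (Req_EM_T be 0); [lra|reflexivity]).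
    split; apply Clim_filterlim; auto.
    + apply Clim_ext with (fun x => (RtoC (be * Rpower 2 (al + 1)) * RtoC (Rpower (1 + x) be))
         * ((u x - (A + B * RtoC (omega al be x))) + A) + B)%C; auto.
      * intros x. rewrite Eom. rewrite Rpower_Ropp. assert (hp := Rpower_pos (1 + x) be).
        rewrite !RtoC_mult, !RtoC_inv, !RtoC_mult by nra.
        assert (n0 : RtoC be <> RtoC 0) by (apply RtoC_neq0; lra).
        assert (n1 : RtoC (Rpower (1 + x) be) <> RtoC 0) by (apply RtoC_neq0; lra).
        assert (n2 : RtoC (Rpower 2 (al + 1)) <> RtoC 0) by (apply RtoC_neq0; lra).
        field. auto.
      * eapply Clim_eq; [apply Clim_plus; [auto| |apply Clim_const; auto]; apply Clim_mult;
          [auto|apply Clim_scal; [auto|apply lim_pow_add, hbe]|apply Clim_plus; [auto|exact Hu|apply Clim_const; auto]]|].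
        ring.
    + apply Clim_ext with (fun x => (u x - (A + B * RtoC (omega al be x))) + A)%C; auto.
      * intros x. rewrite Eom. replace (- al - 1) with (- (al + 1)) by ring. rewrite (Rpower_Ropp 2 (al + 1)).
        rewrite Rinv_mult, !RtoC_mult. ring.
      * eapply Clim_eq; [apply Clim_plus; [auto|exact Hu|apply Clim_const; auto]|]. ring.
Qed.

(** For $\beta\ge0$ the limit defining the second value involves the first one, which is therefore
    identified beforehand. *)
Lemma gbvL_unique al be u U a b a' b' : gbvL al be u U a b -> gbvL al be u U a' b' -> a = a' /\ b = b'.
Proof.
  intros (n1 & n2 & n3) (m1 & m2 & m3). assert (PF := at_right_proper).
  assert (K : forall (f : R -> C) (x y : C), filterlim f (at_right (-1)) (locally x) -> filterlim f (at_right (-1)) (locally y)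
    -> x = y).
  { intros f x y h1 h2. apply (Clim_unique (at_right (-1)) f); apply Clim_filterlim; auto; typeclasses eauto. }
  destruct (total_order_T be 0) as [[h|h]|h].
  - destruct (n1 h) as [a1 b1]. destruct (m1 h) as [a2 b2]. split; eapply K; eauto.
  - destruct (n2 h) as [a1 b1]. destruct (m2 h) as [a2 b2].
    assert (e : a = a') by (eapply K; eauto). subst a'. split; [auto|]. eapply K; eauto.
  - destruct (n3 h) as [a1 b1]. destruct (m3 h) as [a2 b2].
    assert (e : a = a') by (eapply K; eauto). subst a'. split; [auto|]. eapply K; eauto.
Qed.

(** * The fundamental system at 1 *)

Lemma at_left_reflect (P : R -> Prop) : at_left 1 P <-> at_right (-1) (fun x => P (- x)).
Proof.
  split; intros [d Hd]; exists d; intros y Hy Hlt.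
  - apply Hd; [|lra]. change (Rabs (- y - 1) < d). rewrite <- Rabs_Ropp.
    replace (- (- y - 1)) with (y - -1) by ring. exact Hy.
  - rewrite <- (Ropp_involutive y). apply Hd; [|lra]. change (Rabs (- y - -1) < d). rewrite <- Rabs_Ropp.
    replace (- (- y - -1)) with (y - 1) by ring. exact Hy.
Qed.

Lemma Clim_reflect (f : R -> C) l :
  Clim (at_left 1) f l <-> Clim (at_right (-1)) (fun x => f (- x)) l.
Proof.
  split; intros H eps He.
  - apply (at_left_reflect (fun x => Cmod (f x - l) < eps)), H, He.
  - apply (at_left_reflect (fun x => Cmod (f x - l) < eps)), H, He.
Qed.

Lemma at_left_proper : ProperFilter (at_left 1).
Proof. apply at_left_proper_filter. Qed.

Lemma p_ab_reflect al be x : p_ab be al (- x) = p_ab al be x.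
Proof.
  unfold p_ab. rewrite Rmult_comm. f_equal; f_equal; ring.
Qed.

Lemma r_ab_reflect al be x : r_ab be al (- x) = r_ab al be x.
Proof.
  unfold r_ab. rewrite Rmult_comm. f_equal; f_equal; ring.
Qed.

Lemma in11_opp x : in11 x -> in11 (- x).
Proof. intros [h1 h2]. split; lra. Qed.

Lemma derive_reflect (f : R -> C) x l : is_derive f (- x) l -> is_derive (fun t => f (- t)%R) x (- l)%C.
Proof.
  intros H. eapply dC_eq.
  - apply (dC_comp f (fun t => - t) x l (-1) H). auto_derive; [trivial|ring].
  - replace (RtoC (-1)) with (- (1))%C by (rewrite <- RtoC_opp; reflexivity). ring.
Qed.

(** Reflection exchanges the two exponents and reverses the sign of the derivative, whence the sign
    of the quasi-derivative. *)
Lemma csol_reflect al be z u U : csol be al z u U ->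
  csol al be z (fun x => u (- x)) (fun x => - U (- x)%R)%C.
Proof.
  intros H x Hx. destruct (H (- x) (in11_opp x Hx)) as [h1 h2]. split.
  - eapply dC_eq; [apply derive_reflect, h1|]. rewrite p_ab_reflect. ring.
  - eapply dC_eq; [apply dC_opp, derive_reflect, h2|]. rewrite r_ab_reflect. ring.
Qed.

Definition t1 al be z x := v1 be al z (- x).
Definition T1 al be z x := (- V1 be al z (- x)%R)%C.
Definition t2 al be z x := v2 be al z (- x).
Definition T2 al be z x := (- V2 be al z (- x)%R)%C.

Lemma csol_t1 al be z : -1 < al -> csol al be z (t1 al be z) (T1 al be z).
Proof. intros h. apply csol_reflect, csol_v1, h. Qed.

Lemma csol_t2 al be z : -1 < al < 1 -> csol al be z (t2 al be z) (T2 al be z).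
Proof. intros h. apply csol_reflect, csol_v2, h. Qed.

(** The sign reversal of both quasi-derivatives turns the value 1 at the reflected point into
    $-1$. *)
Lemma Wr_right_basis al be z : -1 < al < 1 -> forall x, in11 x ->
  Wr (t2 al be z) (T2 al be z) (t1 al be z) (T1 al be z) x = (- (1))%C.
Proof.
  intros h x Hx. assert (e := Wr_basis be al z h (- x) (in11_opp x Hx)).
  unfold Wr, t1, t2, T1, T2 in *. rewrite <- e. ring.
Qed.

Lemma sol_rep_left al be z u U : -1 < be < 1 -> sol al be z u U -> exists A B, forall x, in11 x ->
  u x = comb A B (v1 al be z) (v2 al be z) x /\ U x = comb A B (V1 al be z) (V2 al be z) x.
Proof.
  intros h Hu. apply (sol_representation al be z u U _ _ _ _ 1 Hu (csol_v1 al be z (proj1 h)) (csol_v2 al be z h)).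
  - apply RtoC_neq0. lra.
  - apply Wr_basis, h.
Qed.

Lemma sol_rep_right al be z u U : -1 < al < 1 -> sol al be z u U -> exists A B, forall x, in11 x ->
  u x = comb A B (t1 al be z) (t2 al be z) x /\ U x = comb A B (T1 al be z) (T2 al be z) x.
Proof.
  intros h Hu. apply (sol_representation al be z u U _ _ _ _ (- (1))%C Hu (csol_t1 al be z (proj1 h)) (csol_t2 al be z h)).
  - rewrite <- RtoC_opp. apply RtoC_neq0. lra.
  - apply Wr_right_basis, h.
Qed.

Lemma filterlim_reflect (s : C) (f g : R -> C) l m : (s * s = 1)%C ->
  (forall x, g x = s * f (- x)%R)%C -> m = (s * l)%C ->
  filterlim f (at_left 1) (locally l) <-> filterlim g (at_right (-1)) (locally m).
Proof.
  intros hs hg ->.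
  assert (F1 : Filter (at_right (-1))) by (assert (h := at_right_proper); typeclasses eauto).
  assert (F2 : Filter (at_left 1)) by (assert (h := at_left_proper); typeclasses eauto).
  rewrite <- !Clim_filterlim by assumption. rewrite Clim_reflect. split; intros H.
  - apply Clim_ext with (fun x => s * f (- x)%R)%C; auto. apply Clim_scal; auto.
  - apply Clim_ext with (fun x => s * g x)%C; auto.
    + intros x. rewrite hg, Cmult_assoc, hs. ring.
    + apply Clim_eq with (s * (s * l))%C; [apply Clim_scal; auto|]. rewrite Cmult_assoc, hs. ring.
Qed.

(* Generalized boundary values at [1] from those at [-1] of the reflected function: the sign is
   [1] for [al < 0] and [-1] otherwise. *)
Definition sgnR (al : R) : C := if Rlt_dec al 0 then RtoC 1 else (- (1))%C.

Lemma sgnR_sqr al : (sgnR al * sgnR al = 1)%C.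
Proof. unfold sgnR. destruct (Rlt_dec al 0); ring. Qed.

(** For $\alpha\ge0$ the singular parts at $1$ are normalized with the sign opposite to that at
    $-1$, which affects the first value; for $\alpha<0$ it is the quasi-derivative that changes
    sign. *)
Lemma gbvR_reflect al be u U a b :
  gbvR al be u U a b <->
  gbvL be al (fun x => u (- x)) (fun x => - U (- x)%R)%C (sgnR al * a)%C (- sgnR al * b)%C.
Proof.
  assert (E : forall t, 1 - - t = 1 + t) by (intros t; ring).
  assert (n1 : (- (1) * - (1) = 1)%C) by ring.
  assert (n0 : (1 * 1 = 1)%C) by ring.
  unfold gbvR, gbvL, sgnR. split; intros (h1 & h2 & h3); (split; [|split]); intros hal.
  - destruct (Rlt_dec al 0); [|lra]. destruct (h1 hal) as [p q]. split.
    + revert p. apply (filterlim_reflect 1); auto. intros x. ring.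
    + revert q. apply (filterlim_reflect (- (1))%C); auto. intros x. ring.
  - destruct (Rlt_dec al 0); [lra|]. destruct (h2 hal) as [p q]. split.
    + revert p. apply (filterlim_reflect (- (1))%C); auto.
      intros x. rewrite E, Rdiv_opp_l, RtoC_opp. ring.
    + revert q. apply (filterlim_reflect 1); auto.
      * intros x. rewrite E. ring.
      * ring.
  - destruct (Rlt_dec al 0); [lra|]. destruct (h3 hal) as [p q]. split.
    + revert p. apply (filterlim_reflect (- (1))%C); auto.
      intros x. rewrite E, !RtoC_mult, RtoC_opp. ring.
    + revert q. apply (filterlim_reflect 1); auto.
      * intros x. rewrite E. ring.
      * ring.
  - destruct (Rlt_dec al 0); [|lra]. destruct (h1 hal) as [p q]. split.
    + revert p. apply (filterlim_reflect 1); auto. intros x. ring.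
    + revert q. apply (filterlim_reflect (- (1))%C); auto. intros x. ring.
  - destruct (Rlt_dec al 0); [lra|]. destruct (h2 hal) as [p q]. split.
    + revert p. apply (filterlim_reflect (- (1))%C); auto.
      intros x. rewrite E, Rdiv_opp_l, RtoC_opp. ring.
    + revert q. apply (filterlim_reflect 1); auto.
      * intros x. rewrite E. ring.
      * ring.
  - destruct (Rlt_dec al 0); [lra|]. destruct (h3 hal) as [p q]. split.
    + revert p. apply (filterlim_reflect (- (1))%C); auto.
      intros x. rewrite E, !RtoC_mult, RtoC_opp. ring.
    + revert q. apply (filterlim_reflect 1); auto.
      * intros x. rewrite E. ring.
      * ring.
Qed.

(* Passage from the coefficients of [t1] and [t2] to the generalized boundary values at [1]. *)
Definition bvR0 (al : R) (A B : C) : C := (sgnR al * bvL0 al A B)%C.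
Definition bvR1 (al : R) (A B : C) : C := (- sgnR al * bvL1 al A B)%C.

Lemma gbvR_of_asymptotics al be u U A B :
  Clim (at_right (-1)) (fun x => u (- x)%R - (A + B * RtoC (omega be al x)))%C 0 ->
  Clim (at_right (-1)) (fun x => - U (- x)%R)%C (- B)%C -> gbvR al be u U (bvR0 al A B) (bvR1 al A B).
Proof.
  intros Hu HU. apply gbvR_reflect. assert (s := sgnR_sqr al).
  assert (e0 : (sgnR al * bvR0 al A B)%C = bvL0 al A B) by (unfold bvR0; rewrite Cmult_assoc, s; ring).
  assert (e1 : (- sgnR al * bvR1 al A B)%C = bvL1 al A B).
  { unfold bvR1. replace (- sgnR al * (- sgnR al * bvL1 al A B))%C with (sgnR al * sgnR al * bvL1 al A B)%C by ring.
    rewrite s. ring. }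
  rewrite e0, e1. apply gbvL_of_asymptotics; assumption.
Qed.

Lemma gbvR_unique al be u U a b a' b' : gbvR al be u U a b -> gbvR al be u U a' b' -> a = a' /\ b = b'.
Proof.
  intros h h'. apply (proj1 (gbvR_reflect _ _ _ _ _ _)) in h. apply (proj1 (gbvR_reflect _ _ _ _ _ _)) in h'.
  destruct (gbvL_unique _ _ _ _ _ _ _ _ h h') as [e1 e2]. assert (s := sgnR_sqr al). split.
  - replace a with (sgnR al * sgnR al * a)%C by (rewrite s; ring). rewrite <- Cmult_assoc, e1, Cmult_assoc, s. ring.
  - replace b with (sgnR al * sgnR al * b)%C by (rewrite s; ring).
    replace (sgnR al * sgnR al * b)%C with (- sgnR al * (- sgnR al * b))%C by ring. rewrite e2.
    replace (- sgnR al * (- sgnR al * b'))%C with (sgnR al * sgnR al * b')%C by ring. rewrite s. ring.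
Qed.

Lemma gbvL_ext al be u U v V a b : (forall x, in11 x -> u x = v x /\ U x = V x) ->
  gbvL al be u U a b -> gbvL al be v V a b.
Proof.
  intros E. assert (FF : Filter (at_right (-1))) by (assert (h := at_right_proper); typeclasses eauto).
  assert (Eu : at_right (-1) (fun x => u x = v x)) by (generalize in11_at_right; apply filter_imp; intros x hx; apply E, hx).
  assert (EU : at_right (-1) (fun x => U x = V x)) by (generalize in11_at_right; apply filter_imp; intros x hx; apply E, hx).
  intros (h1 & h2 & h3). split; [|split]; intros hb.
  - destruct (h1 hb) as [p q]. split; [apply (filterlim_ext_loc _ _ Eu p)|apply (filterlim_ext_loc _ _ EU q)].
  - destruct (h2 hb) as [p q]. split.
    + apply (filterlim_ext_loc _ _ (filter_imp _ _ (fun x e => f_equal _ e) Eu) p).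
    + apply (filterlim_ext_loc _ _ (filter_imp _ _ (fun x e => f_equal (fun y => y + _)%C e) Eu) q).
  - destruct (h3 hb) as [p q]. split.
    + apply (filterlim_ext_loc _ _ (filter_imp _ _ (fun x e => f_equal _ e) Eu) p).
    + apply (filterlim_ext_loc _ _ (filter_imp _ _ (fun x e => f_equal (fun y => y - _)%C e) Eu) q).
Qed.

Lemma gbvR_ext al be u U v V a b : (forall x, in11 x -> u x = v x /\ U x = V x) ->
  gbvR al be u U a b -> gbvR al be v V a b.
Proof.
  intros E h. apply gbvR_reflect. apply (proj1 (gbvR_reflect _ _ _ _ _ _)) in h. revert h. apply gbvL_ext.
  intros x hx. destruct (E (- x) (in11_opp x hx)) as [-> ->]. auto.
Qed.

Lemma gbvL_comb al be z A B : -1 < be < 1 ->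
  gbvL al be (comb A B (v1 al be z) (v2 al be z)) (comb A B (V1 al be z) (V2 al be z)) (bvL0 be A B) (bvL1 be A B).
Proof. intros hb. destruct (asyL_comb al be z A B hb) as (h1 & h2 & _). apply gbvL_of_asymptotics; assumption. Qed.

Lemma asyL_comb_right al be z A B : -1 < al < 1 ->
  asyL be al (fun x => comb A B (t1 al be z) (t2 al be z) (- x))
    (fun x => - comb A B (T1 al be z) (T2 al be z) (- x)%R)%C A B.
Proof.
  intros ha. destruct (asyL_comb be al z A B ha) as (h1 & h2 & h3).
  assert (FF : Filter (at_right (-1))) by (assert (h := at_right_proper); typeclasses eauto).
  assert (e1 : forall x, comb A B (v1 be al z) (v2 be al z) x = comb A B (t1 al be z) (t2 al be z) (- x))
    by (intros x; unfold comb, t1, t2; rewrite Ropp_involutive; reflexivity).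
  assert (e2 : forall x, comb A B (V1 be al z) (V2 be al z) x = (- comb A B (T1 al be z) (T2 al be z) (- x)%R)%C)
    by (intros x; unfold comb, T1, T2; rewrite Ropp_involutive; ring).
  split; [|split].
  - apply (Clim_ext _ _ _ _ (fun x => f_equal (fun y => y - _)%C (e1 x)) h1).
  - apply (Clim_ext _ _ _ _ e2 h2).
  - apply (Clim_ext _ _ _ _ (fun x => f_equal (fun y => _ * (y + _))%C (e2 x)) h3).
Qed.

Lemma gbvR_comb al be z A B : -1 < al < 1 ->
  gbvR al be (comb A B (t1 al be z) (t2 al be z)) (comb A B (T1 al be z) (T2 al be z)) (bvR0 al A B) (bvR1 al A B).
Proof. intros ha. destruct (asyL_comb_right al be z A B ha) as (h1 & h2 & _). apply gbvR_of_asymptotics; assumption. Qed.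

Lemma Wr_lim_right al be u U v V A B A' B' :
  asyL be al (fun x => u (- x)) (fun x => - U (- x)%R)%C A B ->
  asyL be al (fun x => v (- x)) (fun x => - V (- x)%R)%C A' B' ->
  Clim (at_left 1) (Wr u U v V) (A * B' - A' * B)%C.
Proof.
  intros Hu Hv. apply Clim_reflect.
  assert (FF : Filter (at_right (-1))) by (assert (h := at_right_proper); typeclasses eauto).
  assert (h := Wr_lim _ _ _ _ _ _ _ _ _ _ Hu Hv).
  apply Clim_opp in h; auto. apply Clim_eq with (- (A' * B - A * B'))%C; [|ring].
  revert h. apply Clim_ext; auto. intros x. unfold Wr. ring.
Qed.

Lemma asyL_unique al be u U A B A' B' : asyL al be u U A B -> asyL al be u U A' B' -> A = A' /\ B = B'.
Proof.
  intros (h1 & h2 & _) (k1 & k2 & _). assert (PF := at_right_proper).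
  assert (e : B = B').
  { assert (e := Clim_unique _ _ _ _ h2 k2). replace B with (- - B)%C by ring. rewrite e. ring. }
  subst B'. split; [|reflexivity].
  assert (FF : Filter (at_right (-1))) by typeclasses eauto.
  assert (h := Clim_minus _ _ _ _ _ k1 h1).
  apply (Clim_unique (at_right (-1)) (fun _ => A)); [apply Clim_const; auto|].
  assert (k := Clim_plus _ _ _ _ _ h (Clim_const (at_right (-1)) A')).
  apply Clim_eq with (0 - 0 + A')%C; [|ring].
  revert k. apply Clim_ext; auto. intros x. ring.
Qed.

(* Families bounded by a multiple of the weight [w] on [S] and Lipschitz in the parameter with
   respect to the same weight, uniformly for [|z| <= M]. *)
Definition LB (M : R) (S : R -> Prop) (w : R -> R) (F : C -> R -> C) : Prop :=
  exists K, 0 <= K /\ forall z z1 x, Cmod z <= M -> Cmod z1 <= M -> S x ->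
    Cmod (F z x) <= K * w x /\ Cmod (F z x - F z1 x) <= K * Cmod (z - z1) * w x.

Lemma LB_plus M S w F G : LB M S w F -> LB M S w G -> LB M S w (fun z x => F z x + G z x)%C.
Proof.
  intros [K [hK HK]] [L [hL HL]]. exists (K + L). split; [lra|]. intros z z1 x hz hz1 hx.
  destruct (HK z z1 x hz hz1 hx) as [a b]. destruct (HL z z1 x hz hz1 hx) as [c d]. split.
  - eapply Rle_trans; [apply Cmod_triangle|]. lra.
  - replace (F z x + G z x - (F z1 x + G z1 x))%C with ((F z x - F z1 x) + (G z x - G z1 x))%C by ring.
    eapply Rle_trans; [apply Cmod_triangle|]. lra.
Qed.

Lemma LB_mult M S w w' F G : LB M S w F -> LB M S w' G ->
  LB M S (fun x => w x * w' x) (fun z x => F z x * G z x)%C.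
Proof.
  intros [K [hK HK]] [L [hL HL]]. exists (2 * K * L).
  split; [apply Rmult_le_pos; lra|]. intros z z1 x hz hz1 hx.
  destruct (HK z z1 x hz hz1 hx) as [a b]. destruct (HL z z1 x hz hz1 hx) as [c d].
  destruct (HK z1 z1 x hz1 hz1 hx) as [a' _].
  assert (p1 := Cmod_ge_0 (F z x)). assert (p2 := Cmod_ge_0 (G z x)). assert (p3 := Cmod_ge_0 (F z1 x)).
  assert (p4 := Cmod_ge_0 (F z x - F z1 x)). assert (p5 := Cmod_ge_0 (G z x - G z1 x)).
  split.
  - rewrite Cmod_mult. assert (h : Cmod (F z x) * Cmod (G z x) <= K * w x * (L * w' x)) by (apply Rmult_le_compat; auto).
    assert (0 <= K * w x * (L * w' x)) by (apply Rle_trans with (2 := h); apply Rmult_le_pos; auto).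
    replace (2 * K * L * (w x * w' x)) with (2 * (K * w x * (L * w' x))) by ring. lra.
  - replace (F z x * G z x - F z1 x * G z1 x)%C with ((F z x - F z1 x) * G z x + F z1 x * (G z x - G z1 x))%C by ring.
    eapply Rle_trans; [apply Cmod_triangle|]. rewrite !Cmod_mult.
    assert (h1 : Cmod (F z x - F z1 x) * Cmod (G z x) <= K * Cmod (z - z1) * w x * (L * w' x))
      by (apply Rmult_le_compat; auto).
    assert (h2 : Cmod (F z1 x) * Cmod (G z x - G z1 x) <= K * w x * (L * Cmod (z - z1) * w' x))
      by (apply Rmult_le_compat; auto).
    replace (2 * K * L * Cmod (z - z1) * (w x * w' x)) with
      (K * Cmod (z - z1) * w x * (L * w' x) + K * w x * (L * Cmod (z - z1) * w' x)) by ring. lra.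
Qed.

Lemma LB_const M S c : LB M S (fun _ => 1) (fun _ _ => c).
Proof.
  exists (Cmod c). split; [apply Cmod_ge_0|]. intros z z1 x _ _ _. split; [lra|].
  replace (c - c)%C with (RtoC 0) by ring. rewrite Cmod_0, Rmult_1_r.
  apply Rmult_le_pos; apply Cmod_ge_0.
Qed.

Lemma LB_weight M S w w' F : (forall x, S x -> 0 <= w x <= w' x) -> LB M S w F -> LB M S w' F.
Proof.
  intros hw [K [hK HK]]. exists K. split; [exact hK|]. intros z z1 x hz hz1 hx.
  destruct (HK z z1 x hz hz1 hx) as [a b]. destruct (hw x hx).
  assert (p := Cmod_ge_0 (z - z1)). split.
  - apply Rle_trans with (1 := a). apply Rmult_le_compat_l; lra.
  - apply Rle_trans with (1 := b). apply Rmult_le_compat_l; [apply Rmult_le_pos; lra|lra].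
Qed.

Lemma LB_ext M S w F G : (forall z x, S x -> F z x = G z x) -> LB M S w F -> LB M S w G.
Proof.
  intros E [K [hK HK]]. exists K. split; [exact hK|]. intros z z1 x hz hz1 hx.
  rewrite <- !E by exact hx. auto.
Qed.

(** * Solutions and their parameter dependence *)

(** The sum of the endpoint weights dominates every solution on the whole interval up to a constant,
    and its square times $r$ is integrable. *)
Definition wt (al be x : R) : R := wtL be x + wtL al (- x).

Lemma wt_ge_left al be x : wtL be x <= wt al be x.
Proof. unfold wt. assert (h := wtL_pos al (- x)). lra. Qed.

Lemma wt_ge_right al be x : wtL al (- x) <= wt al be x.
Proof. unfold wt. assert (h := wtL_pos be x). lra. Qed.

Lemma wt_ge1 al be x : -1 < al < 1 -> -1 < be < 1 -> in11 x -> 1 <= wt al be x.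
Proof.
  intros ha hb [h1 h2]. destruct (Rle_dec x 0) as [h|h].
  - assert (k := wtL_ge1 be x hb ltac:(lra)). assert (p := wt_ge_left al be x). lra.
  - assert (k := wtL_ge1 al (- x) ha ltac:(lra)). assert (p := wt_ge_right al be x). lra.
Qed.

(** The coefficients at $-1$ stay fixed while $z$ varies; this treats $\varphi_\gamma$ and
    $\vartheta_\gamma$ at once. *)
Definition phiS (al be : R) (A B z : C) : R -> C := comb A B (v1 al be z) (v2 al be z).
Definition PhiS (al be : R) (A B z : C) : R -> C := comb A B (V1 al be z) (V2 al be z).

(** Connection coefficients from the basis at $-1$ to the basis at $1$, by Cramer's rule. The
    Wronskians are constant and are evaluated at 0, where both bases are controlled in $z$. *)
Definition coefR1 (al be : R) (A B z : C) : C := Wr (phiS al be A B z) (PhiS al be A B z) (t2 al be z) (T2 al be z) 0.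
Definition coefR2 (al be : R) (A B z : C) : C := (- Wr (phiS al be A B z) (PhiS al be A B z) (t1 al be z) (T1 al be z) 0)%C.

Lemma csol_phiS al be A B z : -1 < be < 1 -> csol al be z (phiS al be A B z) (PhiS al be A B z).
Proof. intros hb. apply comb_csol; [apply csol_v1; lra|apply csol_v2, hb]. Qed.

Lemma phiS_right al be A B z : -1 < al < 1 -> -1 < be < 1 -> forall x, in11 x ->
  phiS al be A B z x = comb (coefR1 al be A B z) (coefR2 al be A B z) (t1 al be z) (t2 al be z) x /\
  PhiS al be A B z x = comb (coefR1 al be A B z) (coefR2 al be A B z) (T1 al be z) (T2 al be z) x.
Proof.
  intros ha hb x hx. assert (Hp := csol_sol _ _ _ _ _ (csol_phiS al be A B z hb)).
  assert (h0 : in11 0) by (split; lra).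
  assert (C1 : Wr (phiS al be A B z) (PhiS al be A B z) (t1 al be z) (T1 al be z) x = (- coefR2 al be A B z)%C).
  { destruct (sol_Wr_const al be z _ _ _ _ Hp (csol_t1 al be z (proj1 ha))) as [k Hk].
    unfold coefR2. rewrite (Hk x hx), (Hk 0 h0). ring. }
  assert (C2 : Wr (phiS al be A B z) (PhiS al be A B z) (t2 al be z) (T2 al be z) x = coefR1 al be A B z).
  { destruct (sol_Wr_const al be z _ _ _ _ Hp (csol_t2 al be z ha)) as [k Hk].
    unfold coefR1. rewrite (Hk x hx), (Hk 0 h0). reflexivity. }
  assert (k := Wr_right_basis al be z ha x hx).
  assert (E2 : coefR2 al be A B z = (- - coefR2 al be A B z)%C) by ring.
  unfold comb. rewrite E2, <- C1, <- C2. unfold Wr in *.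
  set (u := phiS al be A B z x). set (U := PhiS al be A B z x).
  set (a := t1 al be z x) in *. set (a' := T1 al be z x) in *.
  set (b := t2 al be z x) in *. set (b' := T2 al be z x) in *.
  split.
  - replace ((u * b' - U * b) * a + - (u * a' - U * a) * b)%C with (- (b * a' - b' * a) * u)%C by ring.
    rewrite k. ring.
  - replace ((u * b' - U * b) * a' + - (u * a' - U * a) * b')%C with (- (b * a' - b' * a) * U)%C by ring.
    rewrite k. ring.
Qed.

Definition leftS (x : R) : Prop := -1 < x <= 0.
Definition rightS (x : R) : Prop := 0 <= x < 1.

Section Bounds.
Variables (al be M : R).
Hypotheses (ha : -1 < al < 1) (hb : -1 < be < 1).

Lemma LB_v1 : LB M leftS (wtL be) (v1 al be).
Proof.
  destruct (basis_bound al be M hb) as [K [hK HK]]. exists K. split; [auto|].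
  intros z z1 x hz hz1 hx. destruct (HK z z1 x hz hz1 hx) as [[h1 h2] _].
  assert (w := wtL_ge1 be x hb hx). assert (p := Cmod_ge_0 (z - z1)).
  assert (0 <= K * Cmod (z - z1)) by (apply Rmult_le_pos; auto). split; nra.
Qed.

Lemma LB_v2 : LB M leftS (wtL be) (v2 al be).
Proof.
  destruct (basis_bound al be M hb) as [K [hK HK]]. exists K. split; [auto|].
  intros z z1 x hz hz1 hx. destruct (HK z z1 x hz hz1 hx) as [_ h]. exact h.
Qed.

Lemma LB_at0 (F : C -> R -> C) w (S : R -> Prop) : S 0 -> LB M S w F -> 0 < w 0 ->
  LB M (fun _ => True) (fun _ => 1) (fun z _ => F z 0).
Proof.
  intros h0 [K [hK HK]] hw. exists (K * w 0). split; [apply Rmult_le_pos; lra|].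
  intros z z1 x hz hz1 _. destruct (HK z z1 0 hz hz1 h0) as [a b]. rewrite !Rmult_1_r. split; [exact a|].
  apply Rle_trans with (1 := b). right. ring.
Qed.

Lemma LB_V1_0 : LB M (fun _ => True) (fun _ => 1) (fun z _ => V1 al be z 0).
Proof.
  destruct (basis_quasi_bound0 al be M hb) as [K [hK HK]]. exists K. split; [auto|].
  intros z z1 x hz hz1 _. rewrite !Rmult_1_r. apply (HK z z1 hz hz1).
Qed.

Lemma LB_V2_0 : LB M (fun _ => True) (fun _ => 1) (fun z _ => V2 al be z 0).
Proof.
  destruct (basis_quasi_bound0 al be M hb) as [K [hK HK]]. exists K. split; [auto|].
  intros z z1 x hz hz1 _. rewrite !Rmult_1_r. apply (HK z z1 hz hz1).
Qed.
End Bounds.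

Lemma LB_opp M S w F : LB M S w F -> LB M S w (fun z x => - F z x)%C.
Proof.
  intros [K [hK HK]]. exists K. split; [auto|]. intros z z1 x hz hz1 hx.
  replace (- F z x - - F z1 x)%C with (- (F z x - F z1 x))%C by ring. rewrite !Cmod_opp. auto.
Qed.

Lemma LB_reflect M S w F : LB M S w F -> LB M (fun x => S (- x)) (fun x => w (- x)) (fun z x => F z (- x)).
Proof. intros [K [hK HK]]. exists K. split; [auto|]. intros z z1 x hz hz1 hx. auto. Qed.

Lemma LB_sub M (S S' : R -> Prop) w F : (forall x, S' x -> S x) -> LB M S w F -> LB M S' w F.
Proof. intros h [K [hK HK]]. exists K. split; [auto|]. intros z z1 x hz hz1 hx. auto. Qed.

Lemma LB_scaled M S w (f : C -> C) F : LB M (fun _ => True) (fun _ => 1) (fun z _ => f z) -> LB M S w F ->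
  LB M S w (fun z x => f z * F z x)%C.
Proof.
  intros h1 h2. assert (h := LB_mult M S _ _ _ _ (LB_sub _ _ S _ _ (fun _ _ => I) h1) h2).
  destruct h as [K [hK HK]]. exists K. split; [auto|]. intros z z1 x hz hz1 hx.
  destruct (HK z z1 x hz hz1 hx) as [a b]. rewrite Rmult_1_l in a, b. auto.
Qed.

Section Families.
Variables (al be M : R) (A B : C).
Hypotheses (ha : -1 < al < 1) (hb : -1 < be < 1).

Lemma LB_cst (c : C) : LB M (fun _ => True) (fun _ => 1) (fun _ _ => c).
Proof. apply LB_const. Qed.

Lemma LB_phiS_left : LB M leftS (wtL be) (phiS al be A B).
Proof.
  apply (LB_plus M leftS (wtL be) (fun z x => A * v1 al be z x)%C (fun z x => B * v2 al be z x)%C).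
  - apply (LB_scaled M leftS (wtL be) (fun _ => A)); [apply LB_cst|apply LB_v1; auto].
  - apply (LB_scaled M leftS (wtL be) (fun _ => B)); [apply LB_cst|apply LB_v2; auto].
Qed.

Lemma LB_t1 : LB M rightS (fun x => wtL al (- x)) (t1 al be).
Proof.
  apply (LB_sub _ (fun x => leftS (- x))); [intros x [h1 h2]; unfold leftS; lra|].
  apply (LB_reflect M leftS (wtL al) (v1 be al)), LB_v1, ha.
Qed.

Lemma LB_t2 : LB M rightS (fun x => wtL al (- x)) (t2 al be).
Proof.
  apply (LB_sub _ (fun x => leftS (- x))); [intros x [h1 h2]; unfold leftS; lra|].
  apply (LB_reflect M leftS (wtL al) (v2 be al)), LB_v2, ha.
Qed.

Notation LB0 := (LB M (fun _ => True) (fun _ => 1)).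

Lemma LB0_mult f g : LB0 (fun z _ => f z) -> LB0 (fun z _ => g z) -> LB0 (fun z _ => f z * g z)%C.
Proof. intros h1 h2. apply (LB_scaled M (fun _ => True) (fun _ => 1) f (fun z _ => g z)); auto. Qed.

Lemma LB0_phi : LB0 (fun z _ => phiS al be A B z 0).
Proof. apply (LB_at0 M (phiS al be A B) (wtL be) leftS); [unfold leftS; lra|apply LB_phiS_left|apply wtL_pos]. Qed.

Lemma LB0_Phi : LB0 (fun z _ => PhiS al be A B z 0).
Proof.
  apply (LB_plus M _ _ (fun z _ => A * V1 al be z 0)%C (fun z _ => B * V2 al be z 0)%C).
  - apply (LB0_mult (fun _ => A)); [apply LB_cst|apply LB_V1_0, hb].
  - apply (LB0_mult (fun _ => B)); [apply LB_cst|apply LB_V2_0, hb].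
Qed.

Lemma LB0_coefR1 : LB0 (fun z _ => coefR1 al be A B z).
Proof.
  apply (LB_plus M _ _ (fun z _ => phiS al be A B z 0 * T2 al be z 0)%C
    (fun z _ => - (PhiS al be A B z 0 * t2 al be z 0))%C).
  - apply LB0_mult; [apply LB0_phi|]. unfold T2. rewrite Ropp_0. apply LB_opp, LB_V2_0, ha.
  - apply LB_opp, LB0_mult; [apply LB0_Phi|].
    apply (LB_at0 M (t2 al be) (fun x => wtL al (- x)) rightS); [unfold rightS; lra|apply LB_t2|apply wtL_pos].
Qed.

Lemma LB0_coefR2 : LB0 (fun z _ => coefR2 al be A B z).
Proof.
  apply LB_opp.
  apply (LB_plus M _ _ (fun z _ => phiS al be A B z 0 * T1 al be z 0)%C
    (fun z _ => - (PhiS al be A B z 0 * t1 al be z 0))%C).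
  - apply LB0_mult; [apply LB0_phi|]. unfold T1. rewrite Ropp_0. apply LB_opp, LB_V1_0, ha.
  - apply LB_opp, LB0_mult; [apply LB0_Phi|].
    apply (LB_at0 M (t1 al be) (fun x => wtL al (- x)) rightS); [unfold rightS; lra|apply LB_t1|apply wtL_pos].
Qed.

(** The basis at $-1$ serves the left half. On the right half the basis at $1$ takes over, with
    connection coefficients whose bounds come from the values at 0. *)
Lemma LB_phiS : LB M in11 (wt al be) (phiS al be A B).
Proof.
  assert (HL : LB M leftS (wt al be) (phiS al be A B)).
  { apply LB_weight with (wtL be); [|apply LB_phiS_left].
    intros x _. split; [left; apply wtL_pos|apply wt_ge_left]. }
  assert (HR : LB M (fun x => 0 < x < 1) (wt al be) (phiS al be A B)).
  { apply LB_weight with (fun x => wtL al (- x)).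
    - intros x _. split; [left; apply wtL_pos|apply wt_ge_right].
    - apply LB_ext with (fun z x => coefR1 al be A B z * t1 al be z x + coefR2 al be A B z * t2 al be z x)%C.
      + intros z x hx. symmetry. apply phiS_right; auto. split; lra.
      + apply (LB_sub _ rightS); [unfold rightS; intros; lra|].
        apply LB_plus; apply LB_scaled; [apply LB0_coefR1|apply LB_t1|apply LB0_coefR2|apply LB_t2]. }
  destruct HL as [K [hK HK]]. destruct HR as [L [hL HL]]. exists (K + L). split; [lra|].
  intros z z1 x hz hz1 hx. assert (hw := wt_ge1 al be x ha hb hx). assert (p := Cmod_ge_0 (z - z1)).
  assert (0 <= Cmod (z - z1) * wt al be x) by (apply Rmult_le_pos; lra).
  destruct hx as [x1 x2]. destruct (Rle_dec x 0) as [h|h].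
  - destruct (HK z z1 x hz hz1 ltac:(unfold leftS; lra)) as [a b]. split.
    + apply Rle_trans with (1 := a). apply Rmult_le_compat_r; lra.
    + apply Rle_trans with (1 := b). rewrite !Rmult_assoc. apply Rmult_le_compat_r; lra.
  - destruct (HL z z1 x hz hz1 ltac:(lra)) as [a b]. split.
    + apply Rle_trans with (1 := a). apply Rmult_le_compat_r; lra.
    + apply Rle_trans with (1 := b). rewrite !Rmult_assoc. apply Rmult_le_compat_r; lra.
Qed.
End Families.

Lemma sol_bound al be z u U : -1 < al < 1 -> -1 < be < 1 -> sol al be z u U ->
  exists K, 0 <= K /\ forall x, in11 x -> Cmod (u x) <= K * wt al be x.
Proof.
  intros ha hb Hu. destruct (sol_rep_left al be z u U hb Hu) as [A [B E]].
  destruct (LB_phiS al be (Cmod z) A B ha hb) as [K [hK HK]]. exists K. split; [auto|].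
  intros x hx. rewrite (proj1 (E x hx)). apply (HK z z x); auto; lra.
Qed.

(** * Square integrability of the solutions *)

Lemma Rpower_prod_le a b x : in11 x ->
  Rpower (1 + x) a * Rpower (1 - x) b
    <= (1 + Rpower 2 b) * Rpower (1 + x) a + (1 + Rpower 2 a) * Rpower (1 - x) b.
Proof.
  intros [h1 h2].
  assert (pa := Rpower_pos 2 a). assert (pb := Rpower_pos 2 b).
  assert (p1 := Rpower_pos (1 + x) a). assert (p2 := Rpower_pos (1 - x) b).
  destruct (Rle_dec x 0) as [h|h].
  - assert (k : Rpower (1 - x) b <= Rpower 1 b + Rpower 2 b) by (apply Rpower_exp_bounded; lra).
    rewrite Rpower_base_1 in k.
    assert (Rpower (1 + x) a * Rpower (1 - x) b <= Rpower (1 + x) a * (1 + Rpower 2 b)) by (apply Rmult_le_compat_l; lra).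
    assert (0 <= (1 + Rpower 2 a) * Rpower (1 - x) b) by (apply Rmult_le_pos; lra). lra.
  - assert (k : Rpower (1 + x) a <= Rpower 1 a + Rpower 2 a) by (apply Rpower_exp_bounded; lra).
    rewrite Rpower_base_1 in k.
    assert (Rpower (1 + x) a * Rpower (1 - x) b <= (1 + Rpower 2 a) * Rpower (1 - x) b) by (apply Rmult_le_compat_r; lra).
    assert (0 <= (1 + Rpower 2 b) * Rpower (1 + x) a) by (apply Rmult_le_pos; lra). lra.
Qed.

(** Integrability in elementary terms: a continuous majorant with a bounded primitive. It is usable
    both in classical estimates of increments and, by [integ11_of_primitive], for Lebesgue
    integrability. *)
Definition has_dominating_primitive (h : R -> R) : Prop :=
  exists (v V : R -> R) (C : R), (forall x, in11 x -> is_derive V x (v x)) /\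
    (forall x, in11 x -> continuity_pt v x) /\ (forall x, in11 x -> Rabs (V x) <= C) /\
    forall x, in11 x -> h x <= v x.

Lemma derive_pow_prim s x : -1 < s -> -1 < x ->
  is_derive (fun t => / (s + 1) * Rpower (1 + t) (s + 1)) x (Rpower (1 + x) s).
Proof.
  intros hs hx. replace (Rpower (1 + x) s) with (/ (s + 1) * ((s + 1) * Rpower (1 + x) (s + 1) / (1 + x)))
    by (rewrite Rpower_S by lra; field; lra).
  apply is_derive_scal, derive_pow_add, hx.
Qed.

Lemma derive_pow_prim_sub s x : -1 < s -> x < 1 ->
  is_derive (fun t => - / (s + 1) * Rpower (1 - t) (s + 1)) x (Rpower (1 - x) s).
Proof.
  intros hs hx. replace (Rpower (1 - x) s) with (- / (s + 1) * (- (s + 1) * Rpower (1 - x) (s + 1) / (1 - x)))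
    by (rewrite Rpower_S by lra; field; lra).
  apply is_derive_scal, derive_pow_sub, hx.
Qed.

Lemma dominating_pow_add a : -1 < a -> has_dominating_primitive (fun x => Rpower (1 + x) a).
Proof.
  intros h. exists (fun x => Rpower (1 + x) a), (fun x => / (a + 1) * Rpower (1 + x) (a + 1)), (/ (a + 1) * Rpower 2 (a + 1)).
  split; [|split; [|split]].
  - intros x [h1 h2]. apply derive_pow_prim; lra.
  - intros x [h1 h2]. apply derivable_continuous_pt. eexists. apply is_derive_Reals, derive_pow_add, h1.
  - intros x [h1 h2]. assert (p := Rpower_pos (1 + x) (a + 1)).
    assert (q : 0 < / (a + 1)) by (apply Rinv_0_lt_compat; lra).
    rewrite Rabs_pos_eq by nra. apply Rmult_le_compat_l; [lra|]. apply Rle_Rpower_l; lra.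
  - intros x _. lra.
Qed.

Lemma dominating_pow_sub a : -1 < a -> has_dominating_primitive (fun x => Rpower (1 - x) a).
Proof.
  intros h. exists (fun x => Rpower (1 - x) a), (fun x => - / (a + 1) * Rpower (1 - x) (a + 1)), (/ (a + 1) * Rpower 2 (a + 1)).
  split; [|split; [|split]].
  - intros x [h1 h2]. apply derive_pow_prim_sub; lra.
  - intros x [h1 h2]. apply derivable_continuous_pt. eexists. apply is_derive_Reals, derive_pow_sub, h2.
  - intros x [h1 h2]. assert (p := Rpower_pos (1 - x) (a + 1)).
    assert (q : 0 < / (a + 1)) by (apply Rinv_0_lt_compat; lra).
    rewrite Rabs_mult, Rabs_Ropp, !Rabs_pos_eq by lra. apply Rmult_le_compat_l; [lra|]. apply Rle_Rpower_l; lra.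
  - intros x _. lra.
Qed.

Lemma dominating_plus f g : has_dominating_primitive f -> has_dominating_primitive g ->
  has_dominating_primitive (fun x => f x + g x).
Proof.
  intros (v & V & C & h1 & h2 & h3 & h4) (w & W & D & k1 & k2 & k3 & k4).
  exists (fun x => v x + w x), (fun x => V x + W x), (C + D). split; [|split; [|split]].
  - intros x hx. exact (is_derive_plus V W x (v x) (w x) (h1 x hx) (k1 x hx)).
  - intros x hx. apply continuity_pt_plus; auto.
  - intros x hx. eapply Rle_trans; [apply Rabs_triang|]. specialize (h3 x hx). specialize (k3 x hx). lra.
  - intros x hx. specialize (h4 x hx). specialize (k4 x hx). lra.
Qed.

Lemma dominating_scal k f : 0 <= k -> has_dominating_primitive f -> has_dominating_primitive (fun x => k * f x).
Proof.
  intros hk (v & V & C & h1 & h2 & h3 & h4).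
  exists (fun x => k * v x), (fun x => k * V x), (k * C). split; [|split; [|split]].
  - intros x hx. apply is_derive_scal, h1, hx.
  - intros x hx. apply continuity_pt_mult; [apply continuity_pt_const; intros a b; reflexivity|auto].
  - intros x hx. rewrite Rabs_mult, (Rabs_pos_eq k) by lra. apply Rmult_le_compat_l; auto.
  - intros x hx. apply Rmult_le_compat_l; auto.
Qed.

Lemma dominating_le f g : (forall x, in11 x -> g x <= f x) -> has_dominating_primitive f -> has_dominating_primitive g.
Proof.
  intros hfg (v & V & C & h1 & h2 & h3 & h4). exists v, V, C. split; [|split; [|split]]; auto.
  intros x hx. specialize (h4 x hx). specialize (hfg x hx). lra.
Qed.

(** After $(a+b)^2\le2a^2+2b^2$ and separation of the endpoints only powers remain. Their exponents
    are $\beta$, $\beta-2\kappa$ with $\kappa$ the value of [kap be], and the analogues in $\alpha$,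
    all greater than $-1$. *)
Lemma dominating_wt al be : -1 < al < 1 -> -1 < be < 1 ->
  has_dominating_primitive (fun x => wt al be x ^ 2 * r_ab al be x).
Proof.
  intros ha hb. destruct (kap_props al ha) as [a1 [a2 a3]]. destruct (kap_props be hb) as [b1 [b2 b3]].
  apply dominating_le with (fun x =>
    (2 * ((1 + Rpower 2 al) * Rpower (1 + x) (be - 2 * kap be) + (1 + Rpower 2 (be - 2 * kap be)) * Rpower (1 - x) al))
    + (2 * ((1 + Rpower 2 (al - 2 * kap al)) * Rpower (1 + x) be + (1 + Rpower 2 be) * Rpower (1 - x) (al - 2 * kap al)))).
  - intros x hx. 
    assert (k1 := Rpower_prod_le (be - 2 * kap be) al x hx). assert (k2 := Rpower_prod_le be (al - 2 * kap al) x hx).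
    assert (e1 : Rpower (1 + x) (be - 2 * kap be) = wtL be x ^ 2 * Rpower (1 + x) be).
    { unfold wtL. replace (be - 2 * kap be) with (- kap be + (- kap be + be)) by ring. rewrite !Rpower_plus. ring. }
    assert (e2 : Rpower (1 - x) (al - 2 * kap al) = wtL al (- x) ^ 2 * Rpower (1 - x) al).
    { unfold wtL. replace (al - 2 * kap al) with (- kap al + (- kap al + al)) by ring. rewrite !Rpower_plus.
      replace (1 + - x) with (1 - x) by ring. ring. }
    assert (e : wt al be x ^ 2 * r_ab al be x <=
      2 * (Rpower (1 + x) (be - 2 * kap be) * Rpower (1 - x) al) + 2 * (Rpower (1 + x) be * Rpower (1 - x) (al - 2 * kap al))).
    { rewrite e1, e2. unfold wt, r_ab.
      assert (p1 := Rpower_pos (1 + x) be). assert (p2 := Rpower_pos (1 - x) al).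
      set (a := wtL be x). set (b := wtL al (- x)).
      replace (2 * (a ^ 2 * Rpower (1 + x) be * Rpower (1 - x) al) + 2 * (Rpower (1 + x) be * (b ^ 2 * Rpower (1 - x) al)))
        with ((2 * (a ^ 2 + b ^ 2)) * (Rpower (1 - x) al * Rpower (1 + x) be)) by ring.
      apply Rmult_le_compat_r; [nra|]. assert (h := pow2_ge_0 (a - b)). nra. }
    lra.
  - assert (q1 := Rpower_pos 2 al). assert (q2 := Rpower_pos 2 be).
    assert (q3 := Rpower_pos 2 (be - 2 * kap be)). assert (q4 := Rpower_pos 2 (al - 2 * kap al)).
    apply dominating_plus; apply dominating_scal; try lra; apply dominating_plus; apply dominating_scal; try lra;
      first [apply dominating_pow_add; lra | apply dominating_pow_sub; lra].
Qed.

(** * Lagrange identity *)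

Lemma primitive_real (g : R -> R) : (forall x, in11 x -> continuity_pt g x) ->
  exists G, forall x, in11 x -> is_derive G x (g x).
Proof.
  intros H. exists (fun x => RInt g 0 x). intros x [h1 h2].
  apply (is_derive_RInt g _ 0).
  - assert (hp : 0 < Rmin (x + 1) (1 - x)) by (apply Rmin_pos; lra).
    exists (mkposreal _ hp). intros y Hy.
    assert (Hy' : Rabs (y - x) < Rmin (x + 1) (1 - x)) by exact Hy.
    assert (m1 := Rmin_l (x + 1) (1 - x)). assert (m2 := Rmin_r (x + 1) (1 - x)). apply Rabs_def2 in Hy'.
    apply (RInt_correct (V := R_CompleteNormedModule)).
    apply (ex_RInt_continuous (V := R_CompleteNormedModule)). intros t ht.
    apply continuity_pt_filterlim, H.
    revert ht. unfold Rmin, Rmax. destruct (Rle_dec 0 y); intros; split; lra.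
  - apply continuity_pt_filterlim, H. split; auto.
Qed.

Lemma derive_continuity_pt (f : R -> R) x l : is_derive f x l -> continuity_pt f x.
Proof. intros H. apply derivable_continuous_pt. exists l. apply is_derive_Reals, H. Qed.

Lemma derive_unique_C (u : R -> C) x (l m : C) : is_derive u x l -> is_derive u x m -> l = m.
Proof.
  intros d1 d0. apply is_derive_ReIm in d1. apply is_derive_ReIm in d0. destruct d1 as [a1 a2]. destruct d0 as [b1 b2].
  apply is_derive_unique in a1. apply is_derive_unique in a2. apply is_derive_unique in b1. apply is_derive_unique in b2.
  apply injective_projections.
  - change (Re l = Re m). rewrite <- a1, <- b1. reflexivity.
  - change (Im l = Im m). rewrite <- a2, <- b2. reflexivity.
Qed.

Lemma primitive_complex (f df : R -> C) : (forall x, in11 x -> is_derive f x (df x)) ->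
  exists J, forall x, in11 x -> is_derive J x (f x).
Proof.
  intros H.
  destruct (primitive_real (fun x => Re (f x))) as [G1 H1].
  { intros x hx. apply derive_continuity_pt with (Re (df x)). apply is_derive_ReIm, H, hx. }
  destruct (primitive_real (fun x => Im (f x))) as [G2 H2].
  { intros x hx. apply derive_continuity_pt with (Im (df x)). apply is_derive_ReIm, H, hx. }
  exists (fun x => (G1 x, G2 x)). intros x hx. apply is_derive_ReIm. split; [apply H1, hx|apply H2, hx].
Qed.

Lemma r_ab_derive al be x : in11 x -> exists d, is_derive (r_ab al be) x d.
Proof.
  intros [h1 h2]. eexists.
  apply (Derive.is_derive_mult (fun t => Rpower (1 - t) al) (fun t => Rpower (1 + t) be));
    [apply derive_pow_sub, h2|apply derive_pow_add, h1].
Qed.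

(** Otherwise the nondecreasing [J] would be constant, against its positive derivative at [x0]. This
    is the strict positivity of an integral. *)
Lemma primitive_limits_lt (f J : R -> R) C x0 : (forall x, in11 x -> is_derive J x (f x)) ->
  (forall x, in11 x -> 0 <= f x) -> (forall x, in11 x -> Rabs (J x) <= C) -> in11 x0 -> 0 < f x0 ->
  exists l m, Clim (at_right (-1)) (fun x => RtoC (J x)) (RtoC l) /\
    Clim (at_left 1) (fun x => RtoC (J x)) (RtoC m) /\ l < m.
Proof.
  intros HJ Hf HC h0 hp.
  assert (mono : forall a b, -1 < a -> a <= b -> b < 1 -> J a <= J b).
  { intros a b h1 h2 h3. apply (nondecreasing_of_derive J f a b h2).
    - intros x hx. apply HJ. split; lra.
    - intros x hx. apply Hf. split; lra. }
  destruct (nondecreasing_bounded_limits J C mono HC) as (l & m & Hl & Hm & Hlm).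
  exists l, m. split; [exact Hl|split; [exact Hm|]].
  apply Rnot_le_lt. intros hle.
  assert (HJc : forall x, in11 x -> J x = l) by (intros x hx; specialize (Hlm x hx); lra).
  assert (d0 : is_derive (fun t => RtoC (J t)) x0 (RtoC (f x0))) by (apply dC_RtoC, HJ, h0).
  assert (d1 : is_derive (fun t => RtoC (J t)) x0 (RtoC 0)).
  { apply dC_ext_in11 with (fun _ => RtoC l); [exact h0| |apply dC_const].
    intros t ht. now rewrite HJc. }
  apply is_derive_ReIm in d0. apply is_derive_ReIm in d1. destruct d0 as [d0 _]. destruct d1 as [d1 _].
  apply is_derive_unique in d0. apply is_derive_unique in d1.
  rewrite d0 in d1. simpl in d1. lra.
Qed.

Lemma asyL_ext al be u U v V A B : (forall x, in11 x -> u x = v x /\ U x = V x) ->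
  asyL al be u U A B -> asyL al be v V A B.
Proof.
  intros E (h1 & h2 & h3). assert (FF : Filter (at_right (-1))) by (assert (h := at_right_proper); typeclasses eauto).
  split; [|split].
  - revert h1. apply Clim_ext_loc; auto. generalize in11_at_right. apply filter_imp. intros x hx.
    now rewrite (proj1 (E x hx)).
  - revert h2. apply Clim_ext_loc; auto. generalize in11_at_right. apply filter_imp. intros x hx.
    now rewrite (proj2 (E x hx)).
  - revert h3. apply Clim_ext_loc; auto. generalize in11_at_right. apply filter_imp. intros x hx.
    now rewrite (proj2 (E x hx)).
Qed.

Lemma in11_at_left : at_left 1 in11.
Proof.
  apply at_left_reflect. generalize in11_at_right. apply filter_imp. intros x hx. now apply in11_opp.
Qed.

Lemma limits_difference_le (g : R -> C) l m B : (forall a b, -1 < a -> a <= b -> b < 1 -> Cmod (g b - g a) <= B) ->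
  Clim (at_right (-1)) g l -> Clim (at_left 1) g m -> Cmod (m - l) <= B.
Proof.
  intros H Hl Hm. assert (P1 := at_right_proper). assert (P2 := at_left_proper).
  apply (Cmod_limit_le (at_right (-1)) g); [exact Hl|].
  generalize in11_at_right. apply filter_imp. intros a [a1 a2].
  rewrite Cmod_minus_sym. apply (Cmod_limit_le (at_left 1) g); [exact Hm|].
  assert (hp : 0 < 1 - a) by lra. exists (mkposreal _ hp). intros b Hb hlt.
  assert (Hb' : Rabs (b - 1) < 1 - a) by exact Hb. apply Rabs_def2 in Hb'.
  rewrite Cmod_minus_sym. apply H; lra.
Qed.

(* The [delta] boundary condition at [1] in terms of the coefficients of [t1] and [t2], and the
   coefficients of the solution [chi] satisfying it. *)
Definition Bd (al de : R) (A B : C) : C :=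
  (RtoC (cos de) * bvR0 al A B + RtoC (sin de) * bvR1 al A B)%C.
Definition chiC (al de : R) : R := if Rlt_dec al 0 then sin de else - cos de.
Definition chiD (al de : R) : R := if Rlt_dec al 0 then - cos de else - sin de.

(** The left side is the Wronskian at $1$ with the solution [chi], in terms of coefficients. The
    boundary form thus becomes accessible to Lagrange's identity. *)
Lemma Bd_chi al de A B : (A * RtoC (chiD al de) - RtoC (chiC al de) * B = - Bd al de A B)%C.
Proof.
  unfold Bd, chiC, chiD, bvR0, bvR1, bvL0, bvL1, sgnR. destruct (Rlt_dec al 0); rewrite ?RtoC_opp; ring.
Qed.

Lemma chi_norm al de : (RtoC (chiC al de) * RtoC (chiC al de) + RtoC (chiD al de) * RtoC (chiD al de) = 1)%C.
Proof.
  rewrite <- !RtoC_mult, <- RtoC_plus. f_equal. assert (h := sin2_cos2 de). unfold Rsqr in h.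
  unfold chiC, chiD. destruct (Rlt_dec al 0); lra.
Qed.

(** The condition says that $(A,B)$ is parallel to the real unit vector formed by [chiC] and [chiD];
    the factor is the scalar product with it. *)
Lemma Bd_zero al de A B : Bd al de A B = 0 -> exists k, A = (k * RtoC (chiC al de))%C /\ B = (k * RtoC (chiD al de))%C.
Proof.
  intros h. assert (e := Bd_chi al de A B). rewrite h in e. assert (n := chi_norm al de).
  set (c := RtoC (chiC al de)) in *. set (d := RtoC (chiD al de)) in *.
  assert (e' : (A * d = c * B)%C).
  { replace (A * d)%C with (A * d - c * B + c * B)%C by ring. rewrite e. ring. }
  exists (A * c + B * d)%C. split.
  - replace ((A * c + B * d) * c)%C with (A * (c * c) + d * (c * B))%C by ring. rewrite <- e'.
    replace (A * (c * c) + d * (A * d))%C with (A * (c * c + d * d))%C by ring. rewrite n. ring.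
  - replace ((A * c + B * d) * d)%C with (c * (A * d) + B * (d * d))%C by ring. rewrite e'.
    replace (c * (c * B) + B * (d * d))%C with (B * (c * c + d * d))%C by ring. rewrite n. ring.
Qed.

Definition chi (al be de : R) (z : C) : R -> C := comb (RtoC (chiC al de)) (RtoC (chiD al de)) (t1 al be z) (t2 al be z).
Definition Chi (al be de : R) (z : C) : R -> C := comb (RtoC (chiC al de)) (RtoC (chiD al de)) (T1 al be z) (T2 al be z).

Definition DD (al be de : R) (A B z : C) : C := Bd al de (coefR1 al be A B z) (coefR2 al be A B z).

Lemma csol_chi al be de z : -1 < al < 1 -> csol al be z (chi al be de z) (Chi al be de z).
Proof. intros ha. apply comb_csol; [apply csol_t1; lra|apply csol_t2, ha]. Qed.

Section Lagrange.
Variables (al be de : R) (A B : C).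
Hypotheses (ha : -1 < al < 1) (hb : -1 < be < 1).

Lemma Wr_phi_chi_right z z1 : Clim (at_left 1)
  (Wr (phiS al be A B z) (PhiS al be A B z) (chi al be de z1) (Chi al be de z1)) (- DD al be de A B z)%C.
Proof.
  assert (P2 := at_left_proper). assert (FF : Filter (at_left 1)) by typeclasses eauto.
  unfold DD. rewrite <- Bd_chi.
  refine (Clim_ext_loc _ _ _ _ _ (Wr_lim_right al be _ _ _ _ _ _ _ _
    (asyL_comb_right al be z _ _ ha) (asyL_comb_right al be z1 _ _ ha))).
  generalize in11_at_left. apply filter_imp. intros x hx.
  destruct (phiS_right al be A B z ha hb x hx) as [e1 e2]. unfold Wr. rewrite <- e1, <- e2. reflexivity.
Qed.

(** The limit depends only on the coefficients at $-1$, and those of [phiS] do not involve $z$. *)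
Lemma Wr_phi_left_const z1 u U : sol al be z1 u U -> exists L, forall z, Clim (at_right (-1))
  (Wr (phiS al be A B z) (PhiS al be A B z) u U) L.
Proof.
  intros Hu. destruct (sol_rep_left al be z1 u U hb Hu) as [A' [B' E]].
  exists (A' * B - A * B')%C. intros z. apply Wr_lim with al be; [apply asyL_comb, hb|].
  apply asyL_ext with (2 := asyL_comb al be z1 A' B' hb). intros x hx. destruct (E x hx). auto.
Qed.

(** [J] with its two limits stands for $\int ruv$. The limits exist because both factors are bounded
    by multiples of [wt]. *)
Lemma weighted_product_primitive z1 z2 u U v V : csol al be z1 u U -> csol al be z2 v V ->
  exists J l m, (exists Q, forall x, in11 x -> Cmod (J x) <= Q) /\ (forall x, in11 x -> is_derive J x (RtoC (r_ab al be x) * (u x * v x))%C) /\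
    Clim (at_right (-1)) J l /\ Clim (at_left 1) J m.
Proof.
  intros Hu Hv.
  destruct (sol_bound al be z1 u U ha hb (csol_sol _ _ _ _ _ Hu)) as [K [hK HK]].
  destruct (sol_bound al be z2 v V ha hb (csol_sol _ _ _ _ _ Hv)) as [L [hL HL]].
  destruct (dominating_wt al be ha hb) as (w & W & C & w1 & w2 & w3 & w4).
  destruct (primitive_complex (fun x => RtoC (r_ab al be x) * (u x * v x))%C
     (fun x => RtoC (Derive (r_ab al be) x) * (u x * v x) + RtoC (r_ab al be x) *
       ((RtoC (/ p_ab al be x) * U x) * v x + u x * (RtoC (/ p_ab al be x) * V x)))%C) as [J HJ].
  { intros x hx. apply (dC_mult (fun t => RtoC (r_ab al be t)) (fun t => u t * v t)%C).
    - destruct (r_ab_derive al be x hx) as [d Hd]. apply dC_RtoC.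
      rewrite (is_derive_unique _ _ _ Hd). exact Hd.
    - apply (dC_mult u v); [exact (proj1 (Hu x hx))|exact (proj1 (Hv x hx))]. }
  assert (Inc : forall a b, -1 < a -> a <= b -> b < 1 ->
    Cmod (J b - J a) <= 2 * (K * L * W b) - 2 * (K * L * W a)).
  { intros a b h1 h2 h3.
    replace (2 * (K * L * W b) - 2 * (K * L * W a)) with (2 * (K * L * W b - K * L * W a)) by ring.
    apply (increment_le_of_derive J _ (fun x => K * L * W x) (fun x => K * L * w x) a b h2
      (fun x hx => HJ x (conj (Rlt_le_trans _ _ _ h1 (proj1 hx)) (Rle_lt_trans _ _ _ (proj2 hx) h3)))).
    + intros x hx. apply is_derive_scal, w1. split; lra.
    + intros x hx. assert (ix : in11 x) by (split; lra).
      rewrite !Cmod_mult, Cmod_R, Rabs_pos_eq by (left; apply r_ab_pos).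
      apply Rle_trans with (r_ab al be x * ((K * wt al be x) * (L * wt al be x))).
      * apply Rmult_le_compat_l; [left; apply r_ab_pos|].
        apply Rmult_le_compat; try apply Cmod_ge_0; auto.
      * replace (r_ab al be x * (K * wt al be x * (L * wt al be x))) with
          (K * L * (wt al be x ^ 2 * r_ab al be x)) by ring.
        apply Rmult_le_compat_l; [apply Rmult_le_pos; auto|auto]. }
  assert (Bnd : forall x, in11 x -> Rabs (2 * (K * L * W x)) <= 2 * (K * L * C)).
  { intros x hx. rewrite !Rabs_mult, (Rabs_pos_eq 2), (Rabs_pos_eq K), (Rabs_pos_eq L) by lra.
    apply Rmult_le_compat_l; [lra|]. apply Rmult_le_compat_l; [apply Rmult_le_pos; auto|auto]. }
  destruct (limits_of_increment_le J (fun x => 2 * (K * L * W x)) (2 * (K * L * C)) Inc Bnd)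
    as (l & m & Hl & Hm).
  exists J, l, m. split; [|auto].
  exists (Cmod (J 0) + 2 * (2 * (K * L * C))). intros x hx.
  assert (k0 := Bnd 0 ltac:(split; lra)). assert (kx := Bnd x hx).
  apply Rabs_le_between in k0. apply Rabs_le_between in kx.
  assert (h : Cmod (J x - J 0) <= 2 * (2 * (K * L * C))).
  { destruct hx as [x1 x2]. destruct (Rle_dec 0 x).
    - eapply Rle_trans; [apply Inc; lra|lra].
    - rewrite Cmod_minus_sym. eapply Rle_trans; [apply Inc; lra|lra]. }
  replace (J x) with (J 0 + (J x - J 0))%C by ring. eapply Rle_trans; [apply Cmod_triangle|lra].
Qed.

(* Lagrange's identity between [phi(z)] and [chi(z1)]: the boundary term at [-1] does not depend
   on [z], so [DD] is differentiable at [z1] with derivative [- int r phi(z1) chi(z1)]. *)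
Lemma lagrange_expansion z1 J l m :
  (forall x, in11 x -> is_derive J x (RtoC (r_ab al be x) * (phiS al be A B z1 x * chi al be de z1 x))%C) ->
  Clim (at_right (-1)) J l -> Clim (at_left 1) J m ->
  exists C, 0 <= C /\ forall z, Cmod (z - z1) <= 1 ->
    Cmod (DD al be de A B z - DD al be de A B z1 - (z - z1) * (l - m)) <= C * Cmod (z - z1) ^ 2.
Proof.
  intros HJ Hl Hm.
  assert (P1 := at_right_proper). assert (P2 := at_left_proper).
  assert (FR : Filter (at_right (-1))) by typeclasses eauto.
  assert (FL : Filter (at_left 1)) by typeclasses eauto.
  assert (Hchi := csol_chi al be de z1 ha). assert (Hs := csol_sol _ _ _ _ _ Hchi).
  destruct (Wr_phi_left_const z1 _ _ Hs) as [L HL].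
  destruct (sol_bound al be z1 _ _ ha hb Hs) as [K' [hK' HK']].
  destruct (LB_phiS al be (Cmod z1 + 1) A B ha hb) as [K [hK HK]].
  destruct (dominating_wt al be ha hb) as (w & W & C & w1 & w2 & w3 & w4).
  assert (hC : 0 <= C) by (apply Rle_trans with (2 := w3 0 ltac:(split; lra)); apply Rabs_pos).
  assert (Main : forall z, Cmod (z - z1) <= 1 ->
    Cmod ((- DD al be de A B z - (z - z1) * m) - (L - (z - z1) * l))
      <= 4 * (K * Cmod (z - z1) ^ 2 * K' * C)).
  { intros z hz.
    assert (hz1 : Cmod z <= Cmod z1 + 1).
    { replace z with (z - z1 + z1)%C by ring. eapply Rle_trans; [apply Cmod_triangle|lra]. }
    set (kk := K * Cmod (z - z1) ^ 2 * K').
    assert (hkk : 0 <= kk) by (apply Rmult_le_pos; [apply Rmult_le_pos; [auto|apply pow2_ge_0]|auto]).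
    (* The derivative of this difference is $(z-z_1)\,r\,(\varphi(z)-\varphi(z_1))\,\chi(z_1)$, of
       second order in $z-z_1$ by the Lipschitz bound on $\varphi$. *)
    pose (g := fun x => (Wr (phiS al be A B z) (PhiS al be A B z) (chi al be de z1) (Chi al be de z1) x
       - (z - z1) * J x)%C).
    apply (limits_difference_le g).
    - intros a b h1 h2 h3.
      apply Rle_trans with (2 * (kk * W b - kk * W a)).
      + apply (increment_le_of_derive g (fun x => (z - z1) * (RtoC (r_ab al be x) * (phiS al be A B z x * chi al be de z1 x))
           - (z - z1) * (RtoC (r_ab al be x) * (phiS al be A B z1 x * chi al be de z1 x)))%C
           (fun x => kk * W x) (fun x => kk * w x) a b h2).
        * intros x hx. assert (ix : in11 x) by (split; lra).
          apply dC_minus; [apply (Wr_derive al be z z1); [apply csol_phiS, hb|exact Hchi|exact ix]|].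
          apply dC_scal, HJ, ix.
        * intros x hx. apply is_derive_scal, w1. split; lra.
        * intros x hx. assert (ix : in11 x) by (split; lra).
          destruct (HK z z1 x hz1 ltac:(lra) ix) as [_ h]. specialize (HK' x ix).
          match goal with |- Cmod ?e <= _ => replace e with
            ((z - z1) * (RtoC (r_ab al be x) * ((phiS al be A B z x - phiS al be A B z1 x) * chi al be de z1 x)))%C
            by ring end.
          rewrite !Cmod_mult, Cmod_R, Rabs_pos_eq by (left; apply r_ab_pos).
          assert (p := Cmod_ge_0 (z - z1)). assert (q := r_ab_pos al be x).
          apply Rle_trans with (Cmod (z - z1) * (r_ab al be x * ((K * Cmod (z - z1) * wt al be x) * (K' * wt al be x)))).
          -- apply Rmult_le_compat_l; [exact p|]. apply Rmult_le_compat_l; [lra|].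
             apply Rmult_le_compat; auto; apply Cmod_ge_0.
          -- replace (Cmod (z - z1) * (r_ab al be x * (K * Cmod (z - z1) * wt al be x * (K' * wt al be x)))) with
               (kk * (wt al be x ^ 2 * r_ab al be x)) by (unfold kk; ring).
             apply Rmult_le_compat_l; auto.
      + assert (a1 := w3 a ltac:(split; lra)). assert (b1 := w3 b ltac:(split; lra)).
        apply Rabs_le_between in a1. apply Rabs_le_between in b1.
        replace (2 * (kk * W b - kk * W a)) with (kk * (2 * (W b - W a))) by ring.
        replace (4 * (kk * C)) with (kk * (4 * C)) by ring.
        apply Rmult_le_compat_l; [exact hkk|lra].
    - apply Clim_minus; auto. apply Clim_scal; auto.
    - apply Clim_minus; auto; [apply Wr_phi_chi_right|]. apply Clim_scal; auto. }
  (* The case $z=z_1$ of the estimate identifies the boundary term at $-1$. *)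
  assert (EL : L = (- DD al be de A B z1)%C).
  { assert (h := Main z1). replace (z1 - z1)%C with (RtoC 0) in h by ring. rewrite Cmod_0 in h.
    specialize (h ltac:(lra)).
    assert (h0 : Cmod (- DD al be de A B z1 - 0 * m - (L - 0 * l)) = 0).
    { assert (p := Cmod_ge_0 (- DD al be de A B z1 - 0 * m - (L - 0 * l))). simpl in h. lra. }
    apply Cmod_eq_0 in h0. 
    replace L with (- DD al be de A B z1 - (- DD al be de A B z1 - 0 * m - (L - 0 * l)))%C by ring.
    rewrite h0. ring. }
  exists (4 * (K * K' * C)). split; [repeat (apply Rmult_le_pos; auto); lra|].
  intros z hz. specialize (Main z hz). rewrite EL in Main.
  replace (DD al be de A B z - DD al be de A B z1 - (z - z1) * (l - m))%C with
    (- ((- DD al be de A B z - (z - z1) * m) - (- DD al be de A B z1 - (z - z1) * l)))%C by ring.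
  rewrite Cmod_opp. apply Rle_trans with (1 := Main). right. ring.
Qed.

Lemma DD_differentiable z1 : exists d C, 0 <= C /\ forall z, Cmod (z - z1) <= 1 ->
    Cmod (DD al be de A B z - DD al be de A B z1 - (z - z1) * d) <= C * Cmod (z - z1) ^ 2.
Proof.
  destruct (weighted_product_primitive z1 z1 _ _ _ _ (csol_phiS al be A B z1 hb) (csol_chi al be de z1 ha))
    as (J & l & m & _ & HJ & Hl & Hm).
  exists (l - m)%C. apply (lagrange_expansion z1 J l m HJ Hl Hm).
Qed.
End Lagrange.

(** * Zeros of the boundary form *)

Lemma Cconj_RtoC r : Cconj (RtoC r) = RtoC r.
Proof. unfold Cconj, RtoC; simpl. f_equal. ring. Qed.

Lemma Cconj_mult a b : Cconj (a * b) = (Cconj a * Cconj b)%C.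
Proof. unfold Cconj, Cmult; simpl. f_equal; ring. Qed.

Lemma Cconj_plus a b : Cconj (a + b) = (Cconj a + Cconj b)%C.
Proof. unfold Cconj, Cplus; simpl. f_equal; ring. Qed.

Lemma Cconj_opp a : Cconj (- a) = (- Cconj a)%C.
Proof. reflexivity. Qed.

Lemma Cconj_minus a b : Cconj (a - b) = (Cconj a - Cconj b)%C.
Proof. unfold Cminus. now rewrite Cconj_plus, Cconj_opp. Qed.

Lemma csol_conj al be z u U : csol al be z u U ->
  csol al be (Cconj z) (fun x => Cconj (u x)) (fun x => Cconj (U x)).
Proof.
  intros H x hx. destruct (H x hx) as [h1 h2]. split.
  - eapply dC_eq; [apply dC_conj, h1|]. rewrite Cconj_mult, Cconj_RtoC. reflexivity.
  - eapply dC_eq; [apply dC_conj, h2|]. rewrite Cconj_opp, !Cconj_mult, Cconj_RtoC. reflexivity.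
Qed.

Lemma asyL_conj al be u U A B : asyL al be u U A B ->
  asyL al be (fun x => Cconj (u x)) (fun x => Cconj (U x)) (Cconj A) (Cconj B).
Proof.
  intros (h1 & h2 & h3). assert (FF : Filter (at_right (-1))) by (assert (h := at_right_proper); typeclasses eauto).
  split; [|split].
  - apply Clim_conj in h1; auto. rewrite Cconj_RtoC in h1. revert h1. apply Clim_ext; auto. intros x.
    rewrite Cconj_minus, Cconj_plus, Cconj_mult, Cconj_RtoC. reflexivity.
  - apply Clim_conj in h2; auto.
  - apply Clim_conj in h3; auto. rewrite Cconj_RtoC in h3. revert h3. apply Clim_ext; auto. intros x.
    rewrite Cconj_mult, Cconj_plus, Cconj_RtoC. reflexivity.
Qed.

Lemma comb_zero (f g : R -> C) x : comb 0 0 f g x = 0.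
Proof. unfold comb. ring. Qed.

Lemma phiS_nonzero al be A B z : -1 < be < 1 ->
  (forall x, in11 x -> phiS al be A B z x = 0 /\ PhiS al be A B z x = 0) -> A = 0 /\ B = 0.
Proof.
  intros hb H. apply (asyL_unique al be (phiS al be A B z) (PhiS al be A B z)).
  - apply asyL_comb, hb.
  - apply asyL_ext with (2 := asyL_comb al be z 0 0 hb). intros x hx. rewrite !comb_zero.
    destruct (H x hx) as [-> ->]. auto.
Qed.

Lemma csol_zero al be z u U : csol al be z u U -> (forall x, in11 x -> u x = 0) -> forall x, in11 x -> U x = 0.
Proof.
  intros H h x hx. assert (d1 := proj1 (H x hx)).
  assert (d0 : is_derive u x (RtoC 0)).
  { apply dC_ext_in11 with (fun _ => RtoC 0); [exact hx|intros t ht; symmetry; auto|apply dC_const]. }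
  assert (e := derive_unique_C _ _ _ _ d1 d0).
  assert (hp := p_ab_pos al be x).
  replace (U x) with (RtoC (p_ab al be x) * (RtoC (/ p_ab al be x) * U x))%C; [rewrite e; ring|].
  rewrite Cmult_assoc, (RtoC_mult_eq _ _ 1) by (field; lra). ring.
Qed.

Section Eigenvalue.
Variables (al be de A B : R) (z0 : C).
Hypotheses (ha : -1 < al < 1) (hb : -1 < be < 1) (hAB : A <> 0 \/ B <> 0)
  (hD : DD al be de (RtoC A) (RtoC B) z0 = 0).

Let u := phiS al be (RtoC A) (RtoC B) z0.
Let U := PhiS al be (RtoC A) (RtoC B) z0.

Lemma phi_multiple_of_chi : exists k, k <> RtoC 0 /\ forall x, in11 x ->
  u x = (k * chi al be de z0 x)%C /\ U x = (k * Chi al be de z0 x)%C.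
Proof.
  destruct (Bd_zero _ _ _ _ hD) as [k [e1 e2]].
  assert (E : forall x, in11 x -> u x = (k * chi al be de z0 x)%C /\ U x = (k * Chi al be de z0 x)%C).
  { intros x hx. destruct (phiS_right al be (RtoC A) (RtoC B) z0 ha hb x hx) as [f1 f2].
    unfold u, U. rewrite f1, f2, e1, e2. unfold comb, chi, Chi, comb. split; ring. }
  exists k. split; [|exact E]. intros hk.
  destruct (phiS_nonzero al be (RtoC A) (RtoC B) z0 hb) as [a b].
  - intros x hx. destruct (E x hx) as [f1 f2]. unfold u, U in *. rewrite f1, f2, hk. split; ring.
  - apply RtoC_inj in a. apply RtoC_inj in b. tauto.
Qed.

Lemma u_csol : csol al be z0 u U.
Proof. apply csol_phiS, hb. Qed.

Lemma Cmult_conj_re (w : C) : (w * Cconj w)%C = RtoC (Cmod w ^ 2).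
Proof. now rewrite <- Cmod2_conj. Qed.

(** [J] is a primitive of $r|u|^2$. Its limits differ because [u] could vanish identically only for
    $A=B=0$. *)
Lemma norm_primitive : exists J l m, (forall x, in11 x -> is_derive J x (RtoC (r_ab al be x) * (u x * Cconj (u x)))%C) /\
    Clim (at_right (-1)) J l /\ Clim (at_left 1) J m /\ l <> m.
Proof.
  destruct (weighted_product_primitive al be ha hb z0 (Cconj z0) _ _ _ _ u_csol (csol_conj _ _ _ _ _ u_csol))
    as (J & l & m & [Q HQ] & HJ & Hl & Hm).
  exists J, l, m. split; [exact HJ|split; [exact Hl|split; [exact Hm|]]].
  assert (N : exists x0, in11 x0 /\ u x0 <> RtoC 0).
  { apply NNPP. intros h. destruct (phiS_nonzero al be (RtoC A) (RtoC B) z0 hb) as [a b].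
    - assert (hu : forall x, in11 x -> u x = 0).
      { intros x hx. apply NNPP. intros n. apply h. exists x. auto. }
      intros x hx. split; [apply hu, hx|apply (csol_zero al be z0 u U u_csol hu x hx)].
    - apply RtoC_inj in a. apply RtoC_inj in b. tauto. }
  destruct N as [x0 [h0 n0]].
  destruct (primitive_limits_lt (fun x => r_ab al be x * Cmod (u x) ^ 2) (fun x => Re (J x)) Q x0) as (l' & m' & Hl' & Hm' & hlt).
  - intros x hx. assert (d := HJ x hx). apply is_derive_ReIm in d. destruct d as [d _].
    rewrite Cmult_conj_re, <- RtoC_mult in d. exact d.
  - intros x hx. apply Rmult_le_pos; [left; apply r_ab_pos|apply pow2_ge_0].
  - intros x hx. eapply Rle_trans; [apply Rabs_Re_le_Cmod|apply HQ, hx].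
  - exact h0.
  - apply Rmult_lt_0_compat; [apply r_ab_pos|]. apply pow_lt, Cmod_gt_0, n0.
  - intros e. subst m. assert (P1 := at_right_proper). assert (P2 := at_left_proper).
    assert (FR : Filter (at_right (-1))) by typeclasses eauto.
    assert (FL : Filter (at_left 1)) by typeclasses eauto.
    apply Clim_Re_Im in Hl; auto. apply Clim_Re_Im in Hm; auto.
    assert (e1 := Clim_unique _ _ _ _ Hl' (proj1 Hl)). assert (e2 := Clim_unique _ _ _ _ Hm' (proj1 Hm)).
    apply RtoC_inj in e1. apply RtoC_inj in e2. lra.
Qed.

(** Lagrange's identity for $u$ and $\bar u$ gives $(z_0-\bar z_0)\int r|u|^2=0$: at both endpoints
    the coefficients of $u$ are a multiple of a real vector, so the Wronskian of $u$ and $\bar u$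
    tends to 0 there. *)
Lemma eigenvalue_real : Cconj z0 = z0.
Proof.
  assert (P1 := at_right_proper). assert (P2 := at_left_proper).
  assert (FR : Filter (at_right (-1))) by typeclasses eauto.
  assert (FL : Filter (at_left 1)) by typeclasses eauto.
  destruct norm_primitive as (J & l & m & HJ & Hl & Hm & hlm).
  destruct phi_multiple_of_chi as [k [hk Ek]].
  assert (Wl : Clim (at_right (-1)) (Wr u U (fun x => Cconj (u x)) (fun x => Cconj (U x))) 0).
  { assert (a := asyL_comb al be z0 (RtoC A) (RtoC B) hb).
    assert (h := Wr_lim _ _ _ _ _ _ _ _ _ _ a (asyL_conj _ _ _ _ _ _ a)). rewrite !Cconj_RtoC in h.
    apply Clim_eq with (1 := h). ring. }
  assert (Wm : Clim (at_left 1) (Wr u U (fun x => Cconj (u x)) (fun x => Cconj (U x))) 0).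
  { assert (a : asyL be al (fun x => u (- x)) (fun x => - U (- x)%R)%C (k * RtoC (chiC al de)) (k * RtoC (chiD al de))).
    { apply asyL_ext with (2 := asyL_comb_right al be z0 (k * RtoC (chiC al de)) (k * RtoC (chiD al de)) ha).
      intros x hx. destruct (Ek (- x) (in11_opp x hx)) as [-> ->]. unfold comb, chi, Chi, comb. split; ring. }
    assert (h := Wr_lim_right _ _ _ _ (fun x => Cconj (u x)) (fun x => Cconj (U x)) _ _ _ _ a (asyL_conj _ _ _ _ _ _ a)).
    apply Clim_eq with (1 := h). rewrite !Cconj_mult, !Cconj_RtoC. ring. }
  pose (g := fun x => (Wr u U (fun x => Cconj (u x)) (fun x => Cconj (U x)) x - (z0 - Cconj z0) * J x)%C).
  assert (Hg : Cmod ((0 - (z0 - Cconj z0) * m) - (0 - (z0 - Cconj z0) * l)) <= 0).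
  { apply (limits_difference_le g).
    - intros a b h1 h2 h3.
      replace (g b) with (g a); [replace (g a - g a)%C with (RtoC 0) by ring; rewrite Cmod_0; lra|].
      apply (constant_of_derive0 g); [|split; lra|split; lra].
      intros x hx. eapply dC_eq; [apply dC_minus; [apply (Wr_derive al be z0 (Cconj z0) _ _ _ _ x u_csol (csol_conj _ _ _ _ _ u_csol) hx)
        |apply dC_scal, HJ, hx]|]. ring.
    - apply Clim_minus; auto. apply Clim_scal; auto.
    - apply Clim_minus; auto. apply Clim_scal; auto. }
  assert (e0 : (0 - (z0 - Cconj z0) * m - (0 - (z0 - Cconj z0) * l))%C = 0).
  { apply Cmod_eq_0. apply Rle_antisym; [exact Hg|apply Cmod_ge_0]. }
  assert (e : ((z0 - Cconj z0) * (l - m))%C = 0) by (rewrite <- e0; ring).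
  destruct (classic (z0 - Cconj z0 = 0)%C) as [h|h].
  - replace z0 with (z0 - Cconj z0 + Cconj z0)%C at 2 by ring. rewrite h. ring.
  - exfalso. apply hlm. assert (e' : (l - m)%C = 0).
    { replace (l - m)%C with (/ (z0 - Cconj z0) * ((z0 - Cconj z0) * (l - m)))%C by (field; exact h). rewrite e. ring. }
    replace l with (l - m + m)%C by ring. rewrite e'. ring.
Qed.

(** As $z_0$ is real, the conjugate solves the same equation with the same real coefficients at
    $-1$. *)
Lemma phi_real : forall x, in11 x -> Cconj (u x) = u x.
Proof.
  assert (Hc := csol_conj _ _ _ _ _ u_csol). rewrite eigenvalue_real in Hc.
  destruct (sol_rep_left al be z0 _ _ hb (csol_sol _ _ _ _ _ Hc)) as [A1 [B1 E]].
  assert (a := asyL_conj _ _ _ _ _ _ (asyL_comb al be z0 (RtoC A) (RtoC B) hb)). rewrite !Cconj_RtoC in a.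
  destruct (asyL_unique al be (fun x => Cconj (u x)) (fun x => Cconj (U x)) (RtoC A) (RtoC B) A1 B1 a) as [<- <-].
  - apply asyL_ext with (2 := asyL_comb al be z0 A1 B1 hb). intros x hx. destruct (E x hx) as [-> ->]. auto.
  - intros x hx. rewrite (proj1 (E x hx)). reflexivity.
Qed.

(** Here $\chi(z_0)=u/k$ and $u$ is real, so the derivative $-\int r\,u\,\chi(z_0)$ equals
    $-k^{-1}\int r|u|^2\ne0$. *)
Lemma DD_simple_zero : exists d C, d <> RtoC 0 /\ 0 <= C /\ forall z, Cmod (z - z0) <= 1 ->
  Cmod (DD al be de (RtoC A) (RtoC B) z - (z - z0) * d) <= C * Cmod (z - z0) ^ 2.
Proof.
  assert (FR : Filter (at_right (-1))) by (assert (h := at_right_proper); typeclasses eauto).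
  assert (FL : Filter (at_left 1)) by (assert (h := at_left_proper); typeclasses eauto).
  destruct norm_primitive as (J & l & m & HJ & Hl & Hm & hlm).
  destruct phi_multiple_of_chi as [k [hk Ek]].
  destruct (lagrange_expansion al be de (RtoC A) (RtoC B) ha hb z0 (fun x => / k * J x)%C (/ k * l)%C (/ k * m)%C)
    as [C [hC HC]].
  - intros x hx. eapply dC_eq; [apply dC_scal, HJ, hx|]. fold u. rewrite (phi_real x hx).
    rewrite (proj1 (Ek x hx)). field. exact hk.
  - apply Clim_scal; auto.
  - apply Clim_scal; auto.
  - exists (/ k * l - / k * m)%C, C. split; [|split; [exact hC|]].
    + intros h. apply hlm. replace l with (k * (/ k * l - / k * m) + m)%C by (field; exact hk). rewrite h. ring.
    + intros z hz. specialize (HC z hz). rewrite hD in HC.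
      replace (DD al be de (RtoC A) (RtoC B) z - 0 - (z - z0) * (/ k * l - / k * m))%C with
        (DD al be de (RtoC A) (RtoC B) z - (z - z0) * (/ k * l - / k * m))%C in HC by ring. exact HC.
Qed.
End Eigenvalue.

(** * Variation of constants *)

Definition contR (u : R -> C) : Prop := forall x, in11 x ->
  continuity_pt (fun t => Re (u t)) x /\ continuity_pt (fun t => Im (u t)) x.

Lemma derive_contR (u du : R -> C) : (forall x, in11 x -> is_derive u x (du x)) -> contR u.
Proof.
  intros H x hx. assert (d := H x hx). apply is_derive_ReIm in d. destruct d as [d1 d2].
  split; [apply (derive_continuity_pt _ _ _ d1)|apply (derive_continuity_pt _ _ _ d2)].
Qed.

Lemma ACloc_contR u : ACloc u -> contR u.
Proof.
  intros H x hx. split; apply continuity_pt_locally; intros eps;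
    destruct (ACloc_continuous u x H hx eps (cond_pos eps)) as [d [hd Hd]];
    exists (mkposreal d hd); intros y Hy.
  - change (Rabs (Re (u y - u x)) < eps). eapply Rle_lt_trans; [apply Rabs_Re_le_Cmod|apply Hd, Hy].
  - change (Rabs (Im (u y - u x)) < eps). eapply Rle_lt_trans; [apply Rabs_Im_le_Cmod|apply Hd, Hy].
Qed.

Lemma meas11_r_ab al be : LebR.meas11 (r_ab al be).
Proof.
  apply LebR.meas11_continuous. intros x hx. destruct (r_ab_derive al be x hx) as [d Hd].
  apply (derive_continuity_pt _ _ _ Hd).
Qed.

Lemma Cmod_sqr (w : C) : Cmod w ^ 2 = Re w * Re w + Im w * Im w.
Proof.
  unfold Cmod, Re, Im. rewrite pow2_sqrt; [ring|].
  assert (h1 := pow2_ge_0 (fst w)). assert (h2 := pow2_ge_0 (snd w)). lra.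
Qed.

Lemma meas11_Cmod_sqr al be (g : R -> C) : LebR.meas11 (fun x => Re (g x)) -> LebR.meas11 (fun x => Im (g x)) ->
  LebR.meas11 (fun x => Cmod (g x) ^ 2 * r_ab al be x).
Proof.
  intros h1 h2. apply LebR.meas11M; [|apply meas11_r_ab].
  apply LebR.meas11_eq with (fun x => Re (g x) * Re (g x) + Im (g x) * Im (g x)).
  - intros x _. symmetry. apply Cmod_sqr.
  - apply LebR.meas11D; apply LebR.meas11M; assumption.
Qed.

Lemma dominated_integ11 g : has_dominating_primitive g -> (forall x, in11 x -> 0 <= g x) ->
  exists v, MC.integ11 v /\ forall x, in11 x -> g x <= v x.
Proof.
  intros (v & V & C & h1 & h2 & h3 & h4) hg. exists v. split; [|exact h4].
  apply (LebR.integ11_of_primitive v v V C); auto.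
  - apply LebR.meas11_continuous, h2.
  - intros x hx. rewrite Rabs_pos_eq; [lra|]. eapply Rle_trans; [apply hg, hx|apply h4, hx].
Qed.

Lemma wt_sqr_r_integ11 al be : -1 < al < 1 -> -1 < be < 1 ->
  exists v, MC.integ11 v /\ forall x, in11 x -> wt al be x ^ 2 * r_ab al be x <= v x.
Proof.
  intros ha hb. apply dominated_integ11; [apply dominating_wt; auto|].
  intros x hx. apply Rmult_le_pos; [apply pow2_ge_0|left; apply r_ab_pos].
Qed.

Lemma L2w_of_bound al be u K : -1 < al < 1 -> -1 < be < 1 -> contR u ->
  (forall x, ~ in11 x -> u x = 0) -> (forall x, in11 x -> Cmod (u x) <= K * wt al be x) -> L2w al be u.
Proof.
  intros ha hb hc h0 hK.
  assert (m1 : LebR.meas11 (fun x => Re (u x))) by (apply LebR.meas11_continuous; intros x hx; apply hc, hx).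
  assert (m2 : LebR.meas11 (fun x => Im (u x))) by (apply LebR.meas11_continuous; intros x hx; apply hc, hx).
  split; [|split].
  - apply LebR.meas_extend0; auto. intros x hx. now rewrite h0.
  - apply LebR.meas_extend0; auto. intros x hx. now rewrite h0.
  - destruct (wt_sqr_r_integ11 al be ha hb) as [v [iv hv]].
    apply LebR.integ11_le with (fun x => K ^ 2 * v x).
    + apply meas11_Cmod_sqr; auto.
    + apply LebR.integ11_scal, iv.
    + intros x hx. assert (q := r_ab_pos al be x).
      rewrite Rabs_pos_eq by (apply Rmult_le_pos; [apply pow2_ge_0|lra]).
      apply Rle_trans with ((K * wt al be x) ^ 2 * r_ab al be x).
      * apply Rmult_le_compat_r; [lra|]. apply pow_incr. split; [apply Cmod_ge_0|auto].
      * rewrite Rpow_mult_distr, Rmult_assoc. apply Rmult_le_compat_l; [apply pow2_ge_0|auto].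
Qed.

Lemma L2w_plus al be f g : L2w al be f -> L2w al be g -> L2w al be (fun x => f x + g x)%C.
Proof.
  intros (f1 & f2 & f3) (g1 & g2 & g3). split; [|split].
  - exact (LebR.measD _ _ f1 g1).
  - exact (LebR.measD _ _ f2 g2).
  - apply LebR.integ11_le with (fun x => 2 * (Cmod (f x) ^ 2 * r_ab al be x) + 2 * (Cmod (g x) ^ 2 * r_ab al be x)).
    + apply (meas11_Cmod_sqr al be (fun x => f x + g x)%C).
      * exact (LebR.meas11D _ _ (LebR.meas11_meas _ f1) (LebR.meas11_meas _ g1)).
      * exact (LebR.meas11D _ _ (LebR.meas11_meas _ f2) (LebR.meas11_meas _ g2)).
    + apply LebR.integ11_plus; apply LebR.integ11_scal; assumption.
    + intros x hx. assert (q := r_ab_pos al be x).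
      rewrite Rabs_pos_eq by (apply Rmult_le_pos; [apply pow2_ge_0|lra]).
      replace (2 * (Cmod (f x) ^ 2 * r_ab al be x) + 2 * (Cmod (g x) ^ 2 * r_ab al be x))
        with ((2 * Cmod (f x) ^ 2 + 2 * Cmod (g x) ^ 2) * r_ab al be x) by ring.
      apply Rmult_le_compat_r; [lra|].
      apply Rle_trans with ((Cmod (f x) + Cmod (g x)) ^ 2).
      * apply pow_incr. split; [apply Cmod_ge_0|apply Cmod_triangle].
      * assert (h := pow2_ge_0 (Cmod (f x) - Cmod (g x))). nra.
Qed.

Lemma complex_primitive (h : R -> C) : MC.integ11 (fun x => Re (h x)) -> MC.integ11 (fun x => Im (h x)) ->
  exists H Q, ACloc H /\ (forall x, Cmod (H x) <= Q) /\ MC.ae11 (fun x => is_derive H x (h x)).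
Proof.
  intros i1 i2.
  destruct (LebR.integ11_primitive _ i1) as (H1 & Q1 & b1 & a1 & d1).
  destruct (LebR.integ11_primitive _ i2) as (H2 & Q2 & b2 & a2 & d2).
  exists (fun x => (H1 x, H2 x)), (Q1 + Q2). split; [|split].
  - apply ACloc_eq with (fun x => RtoC (H1 x) + Ci * RtoC (H2 x))%C.
    + intros x _. unfold Ci, RtoC, Cplus, Cmult; simpl. f_equal; ring.
    + apply ACloc_plus; [exact a1|apply ACloc_scal, a2].
  - intros x. eapply Rle_trans; [apply Cmod_le_ReIm|]. simpl. specialize (b1 x). specialize (b2 x). lra.
  - apply LebR.ae11_impl with (2 := LebR.ae11_and _ _ d1 d2). intros x hx [e1 e2].
    apply is_derive_ReIm. split; assumption.
Qed.

(** The product $ruf$ is integrable since $|uf|\le K^2\,\mathrm{wt}^2+|f|^2$. The limits at the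
    endpoints follow by comparing increments with those of a primitive of the resulting majorant. *)
Lemma product_primitive al be (u f : R -> C) K : -1 < al < 1 -> -1 < be < 1 -> contR u ->
  (forall x, in11 x -> Cmod (u x) <= K * wt al be x) -> L2w al be f ->
  exists H Q l m, ACloc H /\ (forall x, Cmod (H x) <= Q) /\
    MC.ae11 (fun x => is_derive H x (RtoC (r_ab al be x) * (u x * f x))%C) /\
    Clim (at_right (-1)) H l /\ Clim (at_left 1) H m.
Proof.
  intros ha hb hc hK (f1 & f2 & f3).
  destruct (wt_sqr_r_integ11 al be ha hb) as [v [iv hv]].
  set (h := fun x => (RtoC (r_ab al be x) * (u x * f x))%C).
  set (w := fun x => K ^ 2 * v x + Cmod (f x) ^ 2 * r_ab al be x).
  assert (iw : MC.integ11 w) by (apply LebR.integ11_plus; [apply LebR.integ11_scal, iv|exact f3]).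
  assert (hw : forall x, in11 x -> Cmod (h x) <= w x).
  { intros x hx. unfold h, w. assert (q := r_ab_pos al be x). specialize (hv x hx). specialize (hK x hx).
    rewrite !Cmod_mult, Cmod_R, Rabs_pos_eq by lra.
    assert (p1 := Cmod_ge_0 (u x)). assert (p2 := Cmod_ge_0 (f x)).
    assert (s : Cmod (u x) * Cmod (f x) <= (K * wt al be x) ^ 2 + Cmod (f x) ^ 2).
    { assert (Cmod (u x) * Cmod (f x) <= (K * wt al be x) * Cmod (f x)) by (apply Rmult_le_compat_r; lra).
      assert (t := pow2_ge_0 (K * wt al be x - Cmod (f x))).
      assert (t' := pow2_ge_0 (K * wt al be x + Cmod (f x))).
      set (a := K * wt al be x) in *. nra. }
    apply Rle_trans with (r_ab al be x * ((K * wt al be x) ^ 2 + Cmod (f x) ^ 2)).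
    - apply Rmult_le_compat_l; lra.
    - assert (K ^ 2 * (wt al be x ^ 2 * r_ab al be x) <= K ^ 2 * v x)
        by (apply Rmult_le_compat_l; [apply pow2_ge_0|lra]).
      rewrite Rpow_mult_distr. nra. }
  assert (cr : LebR.meas11 (fun x => Re (u x))) by (apply LebR.meas11_continuous; intros x hx; apply hc, hx).
  assert (ci : LebR.meas11 (fun x => Im (u x))) by (apply LebR.meas11_continuous; intros x hx; apply hc, hx).
  apply LebR.meas11_meas in f1. apply LebR.meas11_meas in f2.
  assert (i1 : MC.integ11 (fun x => Re (h x))).
  { apply LebR.integ11_le with w; [|exact iw|].
    - apply LebR.meas11_eq with (fun x => r_ab al be x * (Re (u x) * Re (f x) + (-1) * (Im (u x) * Im (f x)))).
      + intros x _. unfold h, Re, Im; simpl. ring.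
      + apply LebR.meas11M; [apply meas11_r_ab|]. apply LebR.meas11D; [apply LebR.meas11M; assumption|].
        apply (LebR.meas11M (fun _ => -1)); [|apply LebR.meas11M; assumption].
        apply LebR.meas11_continuous. intros x _. apply continuity_pt_const. intros a b. reflexivity.
    - intros x hx. eapply Rle_trans; [apply Rabs_Re_le_Cmod|auto]. }
  assert (i2 : MC.integ11 (fun x => Im (h x))).
  { apply LebR.integ11_le with w; [|exact iw|].
    - apply LebR.meas11_eq with (fun x => r_ab al be x * (Re (u x) * Im (f x) + Im (u x) * Re (f x))).
      + intros x _. unfold h, Re, Im; simpl. ring.
      + apply LebR.meas11M; [apply meas11_r_ab|]. apply LebR.meas11D; apply LebR.meas11M; assumption.
    - intros x hx. eapply Rle_trans; [apply Rabs_Im_le_Cmod|auto]. }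
  destruct (complex_primitive h i1 i2) as (H & Q & aH & bH & dH).
  destruct (LebR.integ11_primitive w iw) as (W & CW & bW & aW & dW).
  destruct (limits_of_increment_le H (fun x => 2 * W x) (2 * CW)) as (l & m & Hl & Hm).
  - intros a b h1 h2 h3. replace (2 * W b - 2 * W a) with (2 * (W b - W a)) by ring.
    apply (ac_increment_le H h W w a b); auto. apply LebR.ae11_all. intros x hx _. auto.
  - intros x hx. rewrite Rabs_mult, (Rabs_pos_eq 2) by lra. apply Rmult_le_compat_l; [lra|apply bW].
  - exists H, Q, l, m. auto.
Qed.

(* AM-GM in the form [|f| <= lam |f|^2 + 1 / lam]. *)
Lemma product_increment al be (u f H : R -> C) (E q Q : R -> R) K lam a b : 0 < lam -> 0 <= K ->
  ACloc H -> MC.ae11 (fun x => is_derive H x (RtoC (r_ab al be x) * (u x * f x))%C) ->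
  ACloc (fun x => RtoC (E x)) -> MC.ae11 (fun x => is_derive E x (Cmod (f x) ^ 2 * r_ab al be x)) ->
  ACloc (fun x => RtoC (Q x)) -> (forall x, in11 x -> is_derive Q x (q x)) ->
  -1 < a -> a <= b -> b < 1 -> (forall x, a <= x <= b -> Cmod (u x) <= K /\ r_ab al be x <= q x) ->
  Cmod (H b - H a) <= 2 * K * (lam * (E b - E a) + / lam * (Q b - Q a)).
Proof.
  intros hl hK aH dH aE dE aQ dQ h1 h2 h3 hb.
  replace (2 * K * (lam * (E b - E a) + / lam * (Q b - Q a))) with
    (2 * (K * (lam * E b + / lam * Q b) - K * (lam * E a + / lam * Q a))) by ring.
  apply (ac_increment_le H (fun x => RtoC (r_ab al be x) * (u x * f x))%C
    (fun x => K * (lam * E x + / lam * Q x)) (fun x => K * (lam * (Cmod (f x) ^ 2 * r_ab al be x) + / lam * q x))); auto.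
  - apply ACloc_eq with (fun x => RtoC K * (RtoC lam * RtoC (E x) + RtoC (/ lam) * RtoC (Q x)))%C.
    + intros x _. now rewrite <- !RtoC_mult, <- RtoC_plus, <- RtoC_mult.
    + apply ACloc_scal, ACloc_plus; apply ACloc_scal; assumption.
  - apply LebR.ae11_impl with (2 := dE). intros x hx dx.
    apply (is_derive_scal (fun t => lam * E t + / lam * Q t)).
    apply (is_derive_plus (fun t => lam * E t) (fun t => / lam * Q t) x (lam * (Cmod (f x) ^ 2 * r_ab al be x)) (/ lam * q x)).
    + apply is_derive_scal, dx.
    + apply is_derive_scal, dQ, hx.
  - apply LebR.ae11_all. intros x hx hab. destruct (hb x hab) as [k1 k2].
    assert (p := r_ab_pos al be x). assert (p1 := Cmod_ge_0 (u x)). assert (p2 := Cmod_ge_0 (f x)).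
    assert (il : 0 < / lam) by (apply Rinv_0_lt_compat, hl).
    rewrite !Cmod_mult, Cmod_R, Rabs_pos_eq by lra.
    assert (s : Cmod (f x) <= lam * Cmod (f x) ^ 2 + / lam).
    { assert (e : / lam * lam = 1) by (field; lra). set (t := Cmod (f x)) in *.
      assert (t0 : 0 <= / lam * (lam * t - 1) ^ 2) by (apply Rmult_le_pos; [lra|apply pow2_ge_0]).
      replace (/ lam * (lam * t - 1) ^ 2) with ((/ lam * lam) * (lam * t ^ 2) - 2 * (/ lam * lam) * t + / lam) in t0 by ring.
      rewrite e in t0. lra. }
    apply Rle_trans with (r_ab al be x * (K * (lam * Cmod (f x) ^ 2 + / lam))).
    + apply Rmult_le_compat_l; [lra|]. apply Rmult_le_compat; lra.
    + replace (r_ab al be x * (K * (lam * Cmod (f x) ^ 2 + / lam))) with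
        (K * (lam * (Cmod (f x) ^ 2 * r_ab al be x) + / lam * r_ab al be x)) by ring.
      apply Rmult_le_compat_l; [lra|]. apply Rplus_le_compat_l, Rmult_le_compat_l; lra.
Qed.

Lemma ACloc_of_derive_continuous (Q q : R -> R) : (forall x, in11 x -> is_derive Q x (q x)) ->
  (forall x, in11 x -> continuity_pt q x) -> ACloc (fun x => RtoC (Q x)).
Proof.
  intros dQ cq. apply (ACloc_of_C1 _ (fun x => RtoC (q x))).
  - intros x hx. apply dC_RtoC, dQ, hx.
  - intros a b h1 h2 h3.
    destruct (continuity_ab_maj (fun x => Rabs (q x)) a b h2) as [m [Hm _]].
    + intros c hc. apply (continuity_pt_comp q Rabs); [apply cq; split; lra|apply Rcontinuity_abs].
    + exists (Rabs (q m)). intros x hx. rewrite Cmod_R. apply Hm, hx.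
Qed.

(** This is the Cauchy-Schwarz bound $\|f\|\,(\int_{-1}^xr)^{1/2}$ with
    $\int_{-1}^xr=O((1+x)^{1+\beta})$, obtained from [product_increment]. *)
Lemma product_rate_left al be (u f H : R -> C) K l : -1 < al < 1 -> -1 < be < 1 -> L2w al be f -> 0 <= K ->
  (forall x, -1 < x <= 0 -> Cmod (u x) <= K) -> ACloc H ->
  MC.ae11 (fun x => is_derive H x (RtoC (r_ab al be x) * (u x * f x))%C) -> Clim (at_right (-1)) H l ->
  exists L, 0 <= L /\ forall x, -1 < x <= 0 -> Cmod (H x - l) <= L * Rpower (1 + x) ((1 + be) / 2).
Proof.
  intros ha hb (_ & _ & f3) hK hu aH dH Hl.
  destruct (LebR.integ11_primitive _ f3) as (E & CE & bE & aE & dE).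
  assert (hCE : 0 <= CE) by (apply Rle_trans with (2 := bE 0); apply Rabs_pos).
  assert (pal := Rpower_pos 2 al). assert (ib : 0 < / (be + 1)) by (apply Rinv_0_lt_compat; lra).
  set (c := (1 + Rpower 2 al)). assert (hc : 0 < c) by (unfold c; lra).
  exists (2 * K * (2 * CE + c * / (be + 1))). split.
  { apply Rmult_le_pos; [lra|]. assert (0 < c * / (be + 1)) by (apply Rmult_lt_0_compat; lra). lra. }
  (* This [lam] balances $\lambda\|f\|^2$ against $\lambda^{-1}(1+x)^{1+\beta}$. *)
  intros x hx. set (lam := Rpower (1 + x) ((1 + be) / 2)). assert (hl : 0 < lam) by apply Rpower_pos.
  assert (P1 := at_right_proper). apply (Cmod_limit_le (at_right (-1)) H); [exact Hl|].
  assert (hp : 0 < x + 1) by lra. exists (mkposreal _ hp). intros y Hy hlt.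
  assert (Hy' : Rabs (y - -1) < x + 1) by exact Hy. apply Rabs_def2 in Hy'.
  eapply Rle_trans.
  - apply (product_increment al be u f H E (fun t => c * Rpower (1 + t) be)
      (fun t => c * (/ (be + 1) * Rpower (1 + t) (be + 1))) K lam y x hl hK aH dH aE dE); try lra.
    + apply (ACloc_of_derive_continuous _ (fun t => c * Rpower (1 + t) be)).
      * intros t [t1 t2]. apply is_derive_scal, derive_pow_prim; lra.
      * intros t [t1 t2]. apply continuity_pt_mult; [apply continuity_pt_const; intros ? ?; reflexivity|].
        apply (derive_continuity_pt _ _ _ (derive_pow_add be t t1)).
    + intros t [t1 t2]. apply is_derive_scal, derive_pow_prim; lra.
    + intros t ht. split; [apply hu; lra|apply r_ab_le_left; lra].
  - replace (2 * K * (2 * CE + c * / (be + 1)) * lam) with (2 * K * (lam * (2 * CE) + c * / (be + 1) * lam)) by ring.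
    apply Rmult_le_compat_l; [lra|].
    assert (e1 := bE x). assert (e2 := bE y). apply Rabs_le_between in e1. apply Rabs_le_between in e2.
    apply Rplus_le_compat; [apply Rmult_le_compat_l; lra|].
    assert (sq : Rpower (1 + x) (be + 1) = lam * lam).
    { unfold lam. rewrite <- Rpower_plus. f_equal. field. }
    assert (py := Rpower_pos (1 + y) (be + 1)).
    apply Rle_trans with (/ lam * (c * (/ (be + 1) * (lam * lam)))).
    + apply Rmult_le_compat_l; [left; apply Rinv_0_lt_compat, hl|]. rewrite <- sq.
      assert (0 <= c * (/ (be + 1) * Rpower (1 + y) (be + 1))) by (repeat apply Rmult_le_pos; lra). lra.
    + right. field. lra.
Qed.

Lemma r_ab_le_right al be x : 0 <= x < 1 -> r_ab al be x <= (1 + Rpower 2 be) * Rpower (1 - x) al.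
Proof.
  intros hx. rewrite <- r_ab_reflect. replace (1 - x) with (1 + - x) by ring. apply r_ab_le_left. lra.
Qed.

(** The estimate at $1$, in the reflected variable in which [decay_of_rates] is applied there. *)
Lemma product_rate_right al be (u f H : R -> C) K m : -1 < al < 1 -> -1 < be < 1 -> L2w al be f -> 0 <= K ->
  (forall x, 0 <= x < 1 -> Cmod (u x) <= K) -> ACloc H ->
  MC.ae11 (fun x => is_derive H x (RtoC (r_ab al be x) * (u x * f x))%C) -> Clim (at_left 1) H m ->
  exists L, 0 <= L /\ forall x, -1 < x <= 0 -> Cmod (H (- x)%R - m) <= L * Rpower (1 + x) ((1 + al) / 2).
Proof.
  intros ha hb (_ & _ & f3) hK hu aH dH Hm.
  destruct (LebR.integ11_primitive _ f3) as (E & CE & bE & aE & dE).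
  assert (hCE : 0 <= CE) by (apply Rle_trans with (2 := bE 0); apply Rabs_pos).
  assert (pbe := Rpower_pos 2 be). assert (ib : 0 < / (al + 1)) by (apply Rinv_0_lt_compat; lra).
  set (c := (1 + Rpower 2 be)). assert (hc : 0 < c) by (unfold c; lra).
  exists (2 * K * (2 * CE + c * / (al + 1))). split.
  { apply Rmult_le_pos; [lra|]. assert (0 < c * / (al + 1)) by (apply Rmult_lt_0_compat; lra). lra. }
  intros x hx. set (lam := Rpower (1 + x) ((1 + al) / 2)). assert (hl : 0 < lam) by apply Rpower_pos.
  assert (P1 := at_left_proper). apply (Cmod_limit_le (at_left 1) H); [exact Hm|].
  assert (hp : 0 < x + 1) by lra. exists (mkposreal _ hp). intros y Hy hlt.
  assert (Hy' : Rabs (y - 1) < x + 1) by exact Hy. apply Rabs_def2 in Hy'.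
  rewrite Cmod_minus_sym. eapply Rle_trans.
  - apply (product_increment al be u f H E (fun t => c * Rpower (1 - t) al)
      (fun t => c * (- / (al + 1) * Rpower (1 - t) (al + 1))) K lam (- x) y hl hK aH dH aE dE); try lra.
    + apply (ACloc_of_derive_continuous _ (fun t => c * Rpower (1 - t) al)).
      * intros t [t1 t2]. apply is_derive_scal, derive_pow_prim_sub; lra.
      * intros t [t1 t2]. apply continuity_pt_mult; [apply continuity_pt_const; intros ? ?; reflexivity|].
        apply (derive_continuity_pt _ _ _ (derive_pow_sub al t t2)).
    + intros t [t1 t2]. apply is_derive_scal, derive_pow_prim_sub; lra.
    + intros t ht. split; [apply hu; lra|apply r_ab_le_right; lra].
  - replace (2 * K * (2 * CE + c * / (al + 1)) * lam) with (2 * K * (lam * (2 * CE) + c * / (al + 1) * lam)) by ring.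
    apply Rmult_le_compat_l; [lra|].
    assert (e1 := bE (- x)). assert (e2 := bE y). apply Rabs_le_between in e1. apply Rabs_le_between in e2.
    apply Rplus_le_compat; [apply Rmult_le_compat_l; lra|].
    assert (sq : Rpower (1 - - x) (al + 1) = lam * lam).
    { unfold lam. rewrite <- Rpower_plus. f_equal; field. }
    assert (py := Rpower_pos (1 - y) (al + 1)).
    apply Rle_trans with (/ lam * (c * (/ (al + 1) * (lam * lam)))).
    + apply Rmult_le_compat_l; [left; apply Rinv_0_lt_compat, hl|]. rewrite <- sq.
      assert (0 <= c * (/ (al + 1) * Rpower (1 - y) (al + 1))) by (repeat apply Rmult_le_pos; lra). lra.
    + right. field. lra.
Qed.

Lemma csol_contR al be z u U : csol al be z u U -> contR u.
Proof. intros H. apply (derive_contR u _ (fun x hx => proj1 (H x hx))). Qed.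

Lemma csol_wt_bound al be z u U : -1 < al < 1 -> -1 < be < 1 -> csol al be z u U ->
  exists K, 0 <= K /\ forall x, in11 x -> Cmod (u x) <= K * wt al be x.
Proof. intros ha hb H. apply (sol_bound al be z u U ha hb (csol_sol _ _ _ _ _ H)). Qed.

Definition isol (al be : R) (z : C) (f g G : R -> C) : Prop :=
  quasi al be g G /\ MC.ae11 (fun x => is_derive G x (- (RtoC (r_ab al be x) * (z * g x + f x)))%C).

(** [I] and [J] are primitives of $rbf$ and $raf$. The subtracted constants [i], [j] will be their
    limits at an endpoint, so that both coefficients vanish there. *)
Lemma variation_of_constants al be z f a a' b b' I J i j : csol al be z a a' -> csol al be z b b' ->
  (forall x, in11 x -> Wr a a' b b' x = 1) ->
  ACloc I -> MC.ae11 (fun x => is_derive I x (RtoC (r_ab al be x) * (b x * f x))%C) ->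
  ACloc J -> MC.ae11 (fun x => is_derive J x (RtoC (r_ab al be x) * (a x * f x))%C) ->
  isol al be z f (fun x => a x * (I x - i) - b x * (J x - j))%C (fun x => a' x * (I x - i) - b' x * (J x - j))%C.
Proof.
  intros Ha Hb W aI dI aJ dJ.
  destruct (csol_ACloc _ _ _ _ _ Ha) as [A1 A2]. destruct (csol_ACloc _ _ _ _ _ Hb) as [B1 B2].
  assert (kc : forall c : C, ACloc (fun _ => c)).
  { intros c e1 e2 _ _ _ eps he. exists 1. split; [lra|]. intros n s t _ _ _ _ _.
    rewrite (sum_n_ext _ (fun _ => 0)).
    - rewrite sum_n_const. lra.
    - intros k. replace (c - c)%C with (RtoC 0) by ring. apply Cmod_0. }
  assert (aIi : ACloc (fun x => I x - i)%C) by (apply ACloc_plus; auto).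
  assert (aJj : ACloc (fun x => J x - j)%C) by (apply ACloc_plus; auto).
  assert (dd := LebR.ae11_and _ _ dI dJ).
  assert (E : forall x, in11 x -> (a' x * b x - b' x * a x)%C = (- (1))%C).
  { intros x hx. rewrite <- (W x hx). unfold Wr. ring. }
  split; [split; [|split]|].
  - apply ACloc_plus; [apply ACloc_mult; auto|apply ACloc_opp, ACloc_mult; auto].
  - apply ACloc_plus; [apply ACloc_mult; auto|apply ACloc_opp, ACloc_mult; auto].
  - apply LebR.ae11_impl with (2 := dd). intros x hx [d1 d2].
    destruct (Ha x hx) as [p1 p2]. destruct (Hb x hx) as [q1 q2].
    assert (k1 : is_derive (fun t => I t - i)%C x (RtoC (r_ab al be x) * (b x * f x) - 0)%C)
      by (apply dC_minus; [exact d1|apply dC_const]).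
    assert (k2 : is_derive (fun t => J t - j)%C x (RtoC (r_ab al be x) * (a x * f x) - 0)%C)
      by (apply dC_minus; [exact d2|apply dC_const]).
    eapply dC_eq; [apply dC_minus; apply dC_mult; eassumption|]. cbv beta. ring.
  - apply LebR.ae11_impl with (2 := dd). intros x hx [d1 d2].
    destruct (Ha x hx) as [p1 p2]. destruct (Hb x hx) as [q1 q2].
    assert (k1 : is_derive (fun t => I t - i)%C x (RtoC (r_ab al be x) * (b x * f x) - 0)%C)
      by (apply dC_minus; [exact d1|apply dC_const]).
    assert (k2 : is_derive (fun t => J t - j)%C x (RtoC (r_ab al be x) * (a x * f x) - 0)%C)
      by (apply dC_minus; [exact d2|apply dC_const]).
    eapply dC_eq; [apply dC_minus; apply dC_mult; eassumption|].
    (* The last factor is minus the Wronskian, which leaves $-rf$. *)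
    cbv beta. transitivity (- (RtoC (r_ab al be x) * (z * (a x * (I x - i) - b x * (J x - j)))) + RtoC (r_ab al be x) * f x * (a' x * b x - b' x * a x))%C;
      [ring|]. rewrite (E x hx). ring.
Qed.

Lemma isol_minus al be z f g G h H : isol al be z f g G -> isol al be z f h H ->
  sol al be z (fun x => g x - h x)%C (fun x => G x - H x)%C.
Proof.
  intros [[g1 [g2 g3]] g4] [[h1 [h2 h3]] h4]. split; [split; [|split]|].
  - apply ACloc_plus; [exact g1|apply ACloc_opp, h1].
  - apply ACloc_plus; [exact g2|apply ACloc_opp, h2].
  - apply LebR.ae11_impl with (2 := LebR.ae11_and _ _ g3 h3). intros x hx [d1 d2].
    eapply dC_eq; [apply dC_minus; eassumption|]. ring.
  - apply LebR.ae11_impl with (2 := LebR.ae11_and _ _ g4 h4). intros x hx [d1 d2].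
    eapply dC_eq; [apply dC_minus; eassumption|]. ring.
Qed.

(* [a (I - i) - b (J - j) -> 0] when [a] may grow like the weight [wtL], [b] is bounded and [I -> i] at
   the rate [(1+x)^((1+be)/2)]. *)
Lemma decay_of_rates be (a b I J : R -> C) i j K L : -1 < be < 1 ->
  (forall x, -1 < x <= 0 -> Cmod (a x) <= K * wtL be x) -> (forall x, -1 < x <= 0 -> Cmod (b x) <= K) ->
  (forall x, -1 < x <= 0 -> Cmod (I x - i) <= L * Rpower (1 + x) ((1 + be) / 2)) ->
  Clim (at_right (-1)) J j ->
  Clim (at_right (-1)) (fun x => a x * (I x - i) - b x * (J x - j))%C 0.
Proof.
  intros hb ba bb rI lJ. destruct (kap_props be hb) as [k1 [k2 k3]].
  assert (PF := at_right_proper). assert (FF : Filter (at_right (-1))) by typeclasses eauto.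
  apply Clim_eq with (0 - 0)%C; [|ring]. apply Clim_minus; auto.
  - apply (Clim_pow_squeeze _ _ (K * L) ((1 + be) / 2 - kap be)); [lra|]. intros x hx.
    rewrite Cmod_minus_0, Cmod_mult.
    replace ((1 + be) / 2 - kap be) with (- kap be + (1 + be) / 2) by ring. rewrite Rpower_plus. fold (wtL be x).
    replace (K * L * (wtL be x * Rpower (1 + x) ((1 + be) / 2))) with
      ((K * wtL be x) * (L * Rpower (1 + x) ((1 + be) / 2))) by ring.
    apply Rmult_le_compat; try apply Cmod_ge_0; [apply ba|apply rI]; lra.
  - apply (Clim_mult_bounded _ b (fun x => J x - j)%C K).
    + generalize in10_at_right. apply filter_imp. intros x hx. apply bb. lra.
    + apply Clim_eq with (j - j)%C; [|ring]. apply Clim_minus; auto. apply Clim_const; auto.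
Qed.

Lemma Clim_mult_zero_r (F : (R -> Prop) -> Prop) {FF : Filter F} (a I : R -> C) l i : Clim F a l -> Clim F I i ->
  Clim F (fun x => a x * (I x - i))%C 0.
Proof.
  intros h1 h2. apply Clim_eq with (l * (i - i))%C; [|ring]. apply Clim_mult; auto. apply Clim_minus; auto.
  apply Clim_const; auto.
Qed.

(** [g] is built from the basis at $-1$ with coefficients vanishing there, and [h] likewise at $1$.
    Their difference solves the homogeneous equation, so the boundary values of [g] at $1$ are those
    of $g-h$, read off from its coefficients [A], [B]. *)
Lemma particular_solution al be z f : -1 < al < 1 -> -1 < be < 1 -> L2w al be f ->
  exists g G K A B, isol al be z f g G /\ (forall x, in11 x -> Cmod (g x) <= K * wt al be x) /\
    gbvL al be g G 0 0 /\ gbvR al be g G A B.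
Proof.
  intros ha hb hf.
  assert (PF := at_right_proper). assert (FF : Filter (at_right (-1))) by typeclasses eauto.
  assert (c1 := csol_v1 al be z (proj1 hb)). assert (c2 := csol_v2 al be z hb).
  assert (d1 := csol_t1 al be z (proj1 ha)). assert (d2 := csol_t2 al be z ha).
  destruct (csol_wt_bound _ _ _ _ _ ha hb c1) as [K1 [hK1 b1]].
  destruct (csol_wt_bound _ _ _ _ _ ha hb c2) as [K2 [hK2 b2]].
  destruct (csol_wt_bound _ _ _ _ _ ha hb d1) as [M1 [hM1 e1]].
  destruct (csol_wt_bound _ _ _ _ _ ha hb d2) as [M2 [hM2 e2]].
  destruct (product_primitive al be _ f K1 ha hb (csol_contR _ _ _ _ _ c1) b1 hf) as (I1 & Q1 & i1 & _ & aI1 & bI1 & dI1 & lI1 & _).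
  destruct (product_primitive al be _ f K2 ha hb (csol_contR _ _ _ _ _ c2) b2 hf) as (I2 & Q2 & i2 & _ & aI2 & bI2 & dI2 & lI2 & _).
  destruct (product_primitive al be _ f M1 ha hb (csol_contR _ _ _ _ _ d1) e1 hf) as (J1 & P1 & _ & j1 & aJ1 & bJ1 & dJ1 & _ & lJ1).
  destruct (product_primitive al be _ f M2 ha hb (csol_contR _ _ _ _ _ d2) e2 hf) as (J2 & P2 & _ & j2 & aJ2 & bJ2 & dJ2 & _ & lJ2).
  destruct (v1_bound al be z hb) as [K [hK HK]]. destruct (v1_bound be al z ha) as [M [hM HM]].
  (* [I1] multiplies the possibly unbounded [v2] and therefore needs a rate; its integrand contains
     the bounded [v1]. *)
  destruct (product_rate_left al be _ f I1 K i1 ha hb hf hK (fun x hx => proj1 (HK x hx)) aI1 dI1 lI1) as [L [hL HL]].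
  assert (hMr : forall x, 0 <= x < 1 -> Cmod (t1 al be z x) <= M) by (intros x hx; apply HM; lra).
  destruct (product_rate_right al be _ f J1 M j1 ha hb hf hM hMr aJ1 dJ1 lJ1) as [L' [hL' HL']].
  pose (g := fun x => (v2 al be z x * (I1 x - i1) - v1 al be z x * (I2 x - i2))%C).
  pose (G := fun x => (V2 al be z x * (I1 x - i1) - V1 al be z x * (I2 x - i2))%C).
  pose (h := fun x => (t1 al be z x * (J2 x - j2) - t2 al be z x * (J1 x - j1))%C).
  pose (H := fun x => (T1 al be z x * (J2 x - j2) - T2 al be z x * (J1 x - j1))%C).
  assert (sg : isol al be z f g G).
  { apply (variation_of_constants al be z f); auto. apply Wr_basis, hb. }
  assert (sh : isol al be z f h H).
  { apply (variation_of_constants al be z f); auto. intros x hx.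
    replace (Wr (t1 al be z) (T1 al be z) (t2 al be z) (T2 al be z) x) with
      (- Wr (t2 al be z) (T2 al be z) (t1 al be z) (T1 al be z) x)%C by (unfold Wr; ring).
    rewrite (Wr_right_basis al be z ha x hx). ring. }
  destruct (sol_rep_right al be z _ _ ha (isol_minus _ _ _ _ _ _ _ _ sg sh)) as [A [B E]].
  exists g, G, (K2 * (Q1 + Cmod i1) + K1 * (Q2 + Cmod i2)), (bvR0 al A B), (bvR1 al A B).
  split; [exact sg|split; [|split]].
  - intros x hx. unfold g, Cminus at 1. eapply Rle_trans; [apply Cmod_triangle|]. rewrite Cmod_opp, !Cmod_mult.
    assert (w := wt_ge1 al be x ha hb hx).
    assert (t1 : Cmod (I1 x - i1) <= Q1 + Cmod i1).
    { unfold Cminus. eapply Rle_trans; [apply Cmod_triangle|]. rewrite Cmod_opp. specialize (bI1 x). lra. }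
    assert (t2 : Cmod (I2 x - i2) <= Q2 + Cmod i2).
    { unfold Cminus. eapply Rle_trans; [apply Cmod_triangle|]. rewrite Cmod_opp. specialize (bI2 x). lra. }
    replace ((K2 * (Q1 + Cmod i1) + K1 * (Q2 + Cmod i2)) * wt al be x) with
      ((K2 * wt al be x) * (Q1 + Cmod i1) + (K1 * wt al be x) * (Q2 + Cmod i2)) by ring.
    apply Rplus_le_compat; apply Rmult_le_compat; try apply Cmod_ge_0; auto.
  - assert (gb : gbvL al be g G (bvL0 be 0 0) (bvL1 be 0 0)).
    2: { unfold bvL0, bvL1 in gb. destruct (Rlt_dec be 0); [|exact gb].
         replace (- 0)%C with (RtoC 0) in gb by ring. exact gb. }
    apply gbvL_of_asymptotics.
    + apply Clim_ext with g; auto; [intros x; ring|].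
      apply (decay_of_rates be _ _ I1 I2 i1 i2 K L hb); auto; intros x hx; apply (HK x hx).
    + apply Clim_eq with (0 - 0)%C; [|ring]. apply Clim_minus; auto.
      * apply Clim_mult_zero_r with (- (1))%C; auto. apply lim_V2, hb.
      * apply Clim_mult_zero_r with (RtoC 0); auto. apply lim_V1, hb.
  - destruct (asyL_comb_right al be z A B ha) as (a1 & a2 & _).
    assert (lJ1' := proj1 (Clim_reflect _ _) lJ1). assert (lJ2' := proj1 (Clim_reflect _ _) lJ2).
    apply gbvR_of_asymptotics.
    + assert (hh : Clim (at_right (-1)) (fun x => h (- x)%R) 0).
      { apply Clim_ext with (fun x => - (v2 be al z x * (J1 (- x)%R - j1) - v1 be al z x * (J2 (- x)%R - j2)))%C; auto.
        - intros x. unfold h, t1, t2. rewrite !Ropp_involutive. ring.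
        - apply Clim_eq with (- 0)%C; [|ring]. apply Clim_opp; auto.
          apply (decay_of_rates al _ _ (fun x => J1 (- x)) (fun x => J2 (- x)) j1 j2 M L' ha); auto; intros x hx; apply (HM x hx). }
      apply Clim_eq with (0 + 0)%C; [|ring].
      refine (Clim_ext_loc _ _ _ _ _ (Clim_plus _ _ _ _ _ a1 hh)).
      generalize in11_at_right. apply filter_imp. intros x hx.
      destruct (E (- x) (in11_opp x hx)) as [E1 _]. rewrite <- E1. ring.
    + assert (hh : Clim (at_right (-1)) (fun x => - H (- x)%R)%C 0).
      { apply Clim_ext with (fun x => V1 be al z x * (J2 (- x)%R - j2) - V2 be al z x * (J1 (- x)%R - j1))%C; auto.
        - intros x. unfold H, T1, T2. rewrite !Ropp_involutive. ring.
        - apply Clim_eq with (0 - 0)%C; [|ring]. apply Clim_minus; auto.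
          + apply (Clim_mult_zero_r _ _ (fun x => J2 (- x)) 0); auto. apply lim_V1, ha.
          + apply (Clim_mult_zero_r _ _ (fun x => J1 (- x)) (- (1))%C); auto. apply lim_V2, ha. }
      apply Clim_eq with (- B + 0)%C; [|ring].
      refine (Clim_ext_loc _ _ _ _ _ (Clim_plus _ _ _ _ _ a2 hh)).
      generalize in11_at_right. apply filter_imp. intros x hx.
      destruct (E (- x) (in11_opp x hx)) as [_ E2]. rewrite <- E2. ring.
Qed.

(** * Derivatives and poles in the complex plane *)

Lemma Cminus_eq_0 (a b : C) : (a - b)%C = 0 -> a = b.
Proof. intros h. replace a with (a - b + b)%C by ring. rewrite h. ring. Qed.

(** Neighbourhoods in the product structure are squares; they are compared with discs by
    $\max(|\mathrm{Re}\,z|,|\mathrm{Im}\,z|)\le|z|\le|\mathrm{Re}\,z|+|\mathrm{Im}\,z|$. *)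
Lemma punctured_iff (z0 : C) (P : C -> Prop) :
  locally' z0 P <-> exists d, 0 < d /\ forall z, 0 < Cmod (z - z0) < d -> P z.
Proof.
  split.
  - intros [e He]. exists e. split; [apply cond_pos|]. intros z [h1 h2]. apply He.
    + split; simpl; unfold ball; simpl; unfold AbsRing_ball, abs, minus, plus, opp; simpl.
      * eapply Rle_lt_trans; [|exact h2]. exact (Rabs_Re_le_Cmod (z - z0)).
      * eapply Rle_lt_trans; [|exact h2]. exact (Rabs_Im_le_Cmod (z - z0)).
    + intros e0. subst z. replace (z0 - z0)%C with (RtoC 0) in h1 by ring. rewrite Cmod_0 in h1. lra.
  - intros [d [hd Hd]]. assert (hp : 0 < d / 2) by lra. exists (mkposreal _ hp). intros z [h1 h2] hz. apply Hd. split.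
    + apply Cmod_gt_0. intros e. apply hz. exact (Cminus_eq_0 z z0 e).
    + change (Rabs (Re (z - z0)) < d / 2) in h1. change (Rabs (Im (z - z0)) < d / 2) in h2.
      eapply Rle_lt_trans; [apply Cmod_le_ReIm|lra].
Qed.

Lemma punctured_proper (z0 : C) : ProperFilter (locally' z0).
Proof.
  constructor.
  - intros P HP. apply (proj1 (punctured_iff _ _)) in HP. destruct HP as [d [hd Hd]].
    exists (z0 + RtoC (d / 2))%C. apply Hd. replace (z0 + RtoC (d / 2) - z0)%C with (RtoC (d / 2)) by ring.
    rewrite Cmod_R, Rabs_pos_eq; lra.
  - apply locally'_filter.
Qed.

Lemma punctured_ne (z0 : C) : locally' z0 (fun z => (z - z0)%C <> RtoC 0).
Proof. apply punctured_iff. exists 1. split; [lra|]. intros z [h _] e. rewrite e, Cmod_0 in h. lra. Qed.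

Lemma Clim_punctured_id (z0 : C) : Clim (locally' z0) (fun z => z - z0)%C 0.
Proof.
  intros e he. apply punctured_iff. exists e. split; [exact he|]. intros z [_ h].
  replace (z - z0 - 0)%C with (z - z0)%C by ring. exact h.
Qed.

Lemma Clim_slope (g : C -> C) z0 d K : (forall z, Cmod (z - z0) <= 1 ->
    Cmod (g z - g z0 - (z - z0) * d) <= K * Cmod (z - z0) ^ 2) ->
  Clim (locally' z0) (fun z => (g z - g z0) / (z - z0))%C d.
Proof.
  intros H e he. apply punctured_iff. assert (hK := Rabs_pos K).
  exists (Rmin 1 (e / (Rabs K + 1))). split; [apply Rmin_pos; [lra|apply Rdiv_lt_0_compat; lra]|].
  intros z [h1 h2]. assert (m1 := Rmin_l 1 (e / (Rabs K + 1))). assert (m2 := Rmin_r 1 (e / (Rabs K + 1))).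
  assert (nz : (z - z0)%C <> 0) by (apply Cmod_gt_0, h1).
  replace ((g z - g z0) / (z - z0) - d)%C with ((g z - g z0 - (z - z0) * d) * / (z - z0))%C by (field; exact nz).
  rewrite Cmod_mult, Cmod_inv by exact nz.
  specialize (H z ltac:(lra)). set (t := Cmod (z - z0)) in *.
  apply Rle_lt_trans with (Rabs K * t).
  - replace (Rabs K * t) with (Rabs K * t ^ 2 * / t) by (field; lra).
    apply Rmult_le_compat_r; [left; apply Rinv_0_lt_compat; lra|].
    eapply Rle_trans; [exact H|]. apply Rmult_le_compat_r; [apply pow2_ge_0|apply Rle_abs].
  - apply Rlt_le_trans with ((Rabs K + 1) * (e / (Rabs K + 1))).
    + apply Rle_lt_trans with ((Rabs K) * (e / (Rabs K + 1))).
      * apply Rmult_le_compat_l; lra.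
      * assert (0 < e / (Rabs K + 1)) by (apply Rdiv_lt_0_compat; lra). lra.
    + right. field. lra.
Qed.

Lemma ex_derive_of_slope (f : C -> C) z0 l : Clim (locally' z0) (fun z => (f z - f z0) / (z - z0))%C l ->
  @ex_derive C_AbsRing C_NormedModule f z0.
Proof.
  intros H. exists l. split; [apply (is_linear_scal_l (V := C_NormedModule))|].
  intros x Hx eps. 
  assert (ex : x = z0).
  { apply (is_filter_lim_locally_unique (K := C_AbsRing) (V := AbsRing_NormedModule C_AbsRing)) in Hx. now symmetry. }
  subst x.
  destruct (proj1 (punctured_iff _ _) (H eps (cond_pos eps))) as [d [hd Hd]]. exists (mkposreal d hd). intros z Hz.
  change (Cmod (f z - f z0 - (z - z0) * l) <= eps * Cmod (z - z0)).
  change (Cmod (z - z0) < d) in Hz.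
  destruct (Req_dec (Cmod (z - z0)) 0) as [e|e].
  - apply Cmod_eq_0 in e. assert (ez := Cminus_eq_0 z z0 e).
    subst z. replace (f z0 - f z0 - (z0 - z0) * l)%C with (RtoC 0) by ring. rewrite Cmod_0.
    apply Rmult_le_pos; [left; apply cond_pos|apply Cmod_ge_0].
  - assert (p := Cmod_ge_0 (z - z0)). assert (h1 : 0 < Cmod (z - z0)) by lra.
    assert (nz : (z - z0)%C <> 0) by (apply Cmod_gt_0, h1).
    specialize (Hd z (conj h1 Hz)).
    replace (f z - f z0 - (z - z0) * l)%C with (((f z - f z0) / (z - z0) - l) * (z - z0))%C by (field; exact nz).
    rewrite Cmod_mult. apply Rmult_le_compat_r; lra.
Qed.

Lemma Clim_of_slope (g : C -> C) z0 d : Clim (locally' z0) (fun z => (g z - g z0) / (z - z0))%C d ->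
  Clim (locally' z0) g (g z0).
Proof.
  intros H. assert (FF : Filter (locally' z0)) by (assert (h := punctured_proper z0); typeclasses eauto).
  apply Clim_ext_loc with (fun z => g z0 + (z - z0) * ((g z - g z0) / (z - z0)))%C; auto.
  - generalize (punctured_ne z0). apply filter_imp. intros z hz. field. exact hz.
  - apply Clim_eq with (g z0 + 0 * d)%C; [|ring]. apply Clim_plus; auto; [apply Clim_const; auto|].
    apply Clim_mult; auto. apply Clim_punctured_id.
Qed.

Lemma Clim_ne {T} (F : (T -> Prop) -> Prop) {FF : Filter F} (g : T -> C) l : Clim F g l -> l <> RtoC 0 -> F (fun x => g x <> RtoC 0).
Proof.
  intros H hl. assert (p : 0 < Cmod l) by (apply Cmod_gt_0, hl). generalize (H _ p). apply filter_imp.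
  intros x h e. rewrite e in h. replace (0 - l)%C with (- l)%C in h by ring. rewrite Cmod_opp in h. lra.
Qed.

Lemma Clim_slope_div (N D : C -> C) z0 n d : D z0 <> RtoC 0 ->
  Clim (locally' z0) (fun z => (N z - N z0) / (z - z0))%C n ->
  Clim (locally' z0) (fun z => (D z - D z0) / (z - z0))%C d ->
  exists l, Clim (locally' z0) (fun z => (N z / D z - N z0 / D z0) / (z - z0))%C l.
Proof.
  intros hD hn hd. assert (FF : Filter (locally' z0)) by (assert (h := punctured_proper z0); typeclasses eauto).
  assert (cD := Clim_of_slope _ _ _ hd).
  exists ((n * D z0 - N z0 * d) * (/ D z0 * / D z0))%C.
  apply Clim_ext_loc with (fun z => ((N z - N z0) / (z - z0) * D z0 - N z0 * ((D z - D z0) / (z - z0))) * (/ D z * / D z0))%C; auto.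
  - generalize (filter_and _ _ (punctured_ne z0) (Clim_ne _ _ _ cD hD)). apply filter_imp. intros z [h1 h2]. field. auto.
  - apply Clim_mult; auto.
    + apply Clim_minus; auto; [apply Clim_mult; auto; apply Clim_const; auto|apply Clim_scal; auto].
    + apply Clim_mult; auto; [apply Clim_inv; auto|apply Clim_const; auto].
Qed.

Lemma not_infinite_of_Clim (f : C -> C) z0 l : Clim (locally' z0) f l ->
  ~ filterlim (fun z => Cmod (f z)) (locally' z0) (Rbar_locally p_infty).
Proof.
  intros H h. assert (PF := punctured_proper z0). assert (FF : Filter (locally' z0)) by typeclasses eauto.
  assert (k : locally' z0 (fun z => Cmod l + 1 < Cmod (f z))).
  { apply (h (fun y => Cmod l + 1 < y)). exists (Cmod l + 1). auto. }
  destruct (filter_ex _ (filter_and _ _ k (Clim_bounded _ _ _ H))) as [z [h1 h2]]. lra.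
Qed.

Lemma infinite_of_Clim_mult (f : C -> C) z0 l : l <> RtoC 0 -> Clim (locally' z0) (fun z => (z - z0) * f z)%C l ->
  filterlim (fun z => Cmod (f z)) (locally' z0) (Rbar_locally p_infty).
Proof.
  intros hl H P [M HM]. assert (p : 0 < Cmod l) by (apply Cmod_gt_0, hl).
  assert (FF : Filter (locally' z0)) by (assert (h := punctured_proper z0); typeclasses eauto).
  assert (hM := Rabs_pos M). assert (hM' := Rle_abs M).
  assert (p2 : 0 < Cmod l / 2) by lra.
  assert (q : 0 < Cmod l / 2 / (Rabs M + 1)) by (apply Rdiv_lt_0_compat; lra).
  unfold filtermap. generalize (filter_and _ _ (punctured_ne z0) (filter_and _ _ (H _ p2) (Clim_punctured_id z0 _ q))).
  apply filter_imp. intros z [nz [h1 h2]]. apply HM.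
  replace (z - z0 - 0)%C with (z - z0)%C in h2 by ring.
  assert (t := Cmod_triangle_minus l ((z - z0) * f z)). rewrite Cmod_minus_sym in h1. rewrite Cmod_mult in t.
  assert (z1 : 0 < Cmod (z - z0)) by (apply Cmod_gt_0, nz).
  apply Rnot_le_lt. intros hle. assert (f0 := Cmod_ge_0 (f z)).
  assert (Cmod (z - z0) * Cmod (f z) <= Cmod l / 2 / (Rabs M + 1) * (Rabs M + 1)) by (apply Rmult_le_compat; lra).
  replace (Cmod l / 2 / (Rabs M + 1) * (Rabs M + 1)) with (Cmod l / 2) in * by (field; lra). lra.
Qed.

(** * The m-function *)

Lemma filterlim_lin (F : (R -> Prop) -> Prop) {FF : Filter F} (k : C) (f g h : R -> C) a b :
  (forall x, h x = k * f x + g x)%C -> filterlim f F (locally a) -> filterlim g F (locally b) ->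
  filterlim h F (locally (k * a + b)%C).
Proof.
  intros E h1 h2. apply Clim_filterlim in h1; auto. apply Clim_filterlim in h2; auto. apply Clim_filterlim; auto.
  apply Clim_ext with (fun x => k * f x + g x)%C; auto. apply Clim_plus; auto. apply Clim_scal; auto.
Qed.

Lemma gbvL_lin al be k u U v V a b a' b' : gbvL al be u U a b -> gbvL al be v V a' b' ->
  gbvL al be (fun x => k * u x + v x)%C (fun x => k * U x + V x)%C (k * a + a')%C (k * b + b')%C.
Proof.
  intros (h1 & h2 & h3) (k1 & k2 & k3). assert (PF := at_right_proper).
  assert (FF : Filter (at_right (-1))) by typeclasses eauto.
  split; [|split]; intros hb.
  - destruct (h1 hb), (k1 hb). split; eapply filterlim_lin; eauto; intros x; reflexivity.
  - destruct (h2 hb) as [p q], (k2 hb) as [p' q']. split.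
    + refine (filterlim_lin _ k _ _ _ _ _ _ p p'). intros x. ring.
    + refine (filterlim_lin _ k _ _ _ _ _ _ q q'). intros x. ring.
  - destruct (h3 hb) as [p q], (k3 hb) as [p' q']. split.
    + refine (filterlim_lin _ k _ _ _ _ _ _ p p'). intros x. ring.
    + refine (filterlim_lin _ k _ _ _ _ _ _ q q'). intros x. ring.
Qed.

Lemma gbvR_lin al be k u U v V a b a' b' : gbvR al be u U a b -> gbvR al be v V a' b' ->
  gbvR al be (fun x => k * u x + v x)%C (fun x => k * U x + V x)%C (k * a + a')%C (k * b + b')%C.
Proof.
  intros h h'. apply gbvR_reflect. apply (proj1 (gbvR_reflect _ _ _ _ _ _)) in h, h'.
  assert (g := gbvL_lin be al k _ _ _ _ _ _ _ _ h h').
  replace (sgnR al * (k * a + a'))%C with (k * (sgnR al * a) + sgnR al * a')%C by ring.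
  replace (- sgnR al * (k * b + b'))%C with (k * (- sgnR al * b) + - sgnR al * b')%C by ring.
  assert (E : (fun x => - (k * U (- x)%R + V (- x)%R))%C = (fun x => k * - U (- x)%R + - V (- x)%R)%C).
  { apply FunctionalExtensionality.functional_extensionality. intros x. ring. }
  rewrite E. exact g.
Qed.

Lemma bvL_inj be A B A' B' : bvL0 be A B = bvL0 be A' B' -> bvL1 be A B = bvL1 be A' B' -> A = A' /\ B = B'.
Proof.
  unfold bvL0, bvL1. destruct (Rlt_dec be 0); intros e1 e2; split; auto.
  replace B with (- - B)%C by ring. rewrite e2. ring.
Qed.

Lemma gbvL_phiS al be A B z : -1 < be < 1 ->
  gbvL al be (phiS al be A B z) (PhiS al be A B z) (bvL0 be A B) (bvL1 be A B).
Proof. apply gbvL_comb. Qed.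

Lemma gbvR_phiS al be A B z : -1 < al < 1 -> -1 < be < 1 ->
  gbvR al be (phiS al be A B z) (PhiS al be A B z)
    (bvR0 al (coefR1 al be A B z) (coefR2 al be A B z)) (bvR1 al (coefR1 al be A B z) (coefR2 al be A B z)).
Proof.
  intros ha hb. apply gbvR_ext with (2 := gbvR_comb al be z _ _ ha). intros x hx.
  destruct (phiS_right al be A B z ha hb x hx) as [-> ->]. auto.
Qed.

Lemma sol_determined al be z u U A B : -1 < be < 1 -> sol al be z u U ->
  gbvL al be u U (bvL0 be A B) (bvL1 be A B) ->
  forall x, in11 x -> u x = phiS al be A B z x /\ U x = PhiS al be A B z x.
Proof.
  intros hb Hu Hg. destruct (sol_rep_left al be z u U hb Hu) as (A' & B' & E).
  assert (g := gbvL_ext al be u U _ _ _ _ E Hg).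
  destruct (gbvL_unique _ _ _ _ _ _ _ _ g (gbvL_comb al be z A' B' hb)) as [e1 e2].
  destruct (bvL_inj _ _ _ _ _ e1 e2) as [-> ->]. exact E.
Qed.

Lemma DD_linear al be de A B z :
  DD al be de A B z = (A * DD al be de 1 0 z + B * DD al be de 0 1 z)%C.
Proof.
  unfold DD, Bd, bvR0, bvR1, bvL0, bvL1, coefR1, coefR2, Wr, phiS, PhiS, comb.
  destruct (Rlt_dec al 0); ring.
Qed.

Section MFunction.
Variables (al be ga de : R).
Hypotheses (ha : -1 < al < 1) (hb : -1 < be < 1).

(* Coefficients of [phi_gamma] and [theta_gamma] in the basis [v1], [v2]. *)
Definition Aphi : R := if Rlt_dec be 0 then - sin ga else cos ga.
Definition Bphi : R := if Rlt_dec be 0 then - cos ga else - sin ga.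
Definition Ath : R := if Rlt_dec be 0 then cos ga else sin ga.
Definition Bth : R := if Rlt_dec be 0 then - sin ga else cos ga.

Let D z := DD al be de (RtoC Aphi) (RtoC Bphi) z.
Let N z := DD al be de (RtoC Ath) (RtoC Bth) z.
Let ph z := phiS al be (RtoC Aphi) (RtoC Bphi) z.
Let Ph z := PhiS al be (RtoC Aphi) (RtoC Bphi) z.

Lemma bv_phi : bvL0 be (RtoC Aphi) (RtoC Bphi) = RtoC (- sin ga) /\ bvL1 be (RtoC Aphi) (RtoC Bphi) = RtoC (cos ga).
Proof. unfold Aphi, Bphi, bvL0, bvL1. destruct (Rlt_dec be 0); rewrite ?RtoC_opp; split; ring. Qed.

Lemma bv_theta : bvL0 be (RtoC Ath) (RtoC Bth) = RtoC (cos ga) /\ bvL1 be (RtoC Ath) (RtoC Bth) = RtoC (sin ga).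
Proof. unfold Ath, Bth, bvL0, bvL1. destruct (Rlt_dec be 0); rewrite ?RtoC_opp; split; ring. Qed.

Lemma phi_nontrivial : Aphi <> 0 \/ Bphi <> 0.
Proof.
  assert (h := sin2_cos2 ga). unfold Rsqr in h. unfold Aphi, Bphi.
  destruct (Rlt_dec be 0); (destruct (Req_dec (sin ga) 0) as [e|e]; destruct (Req_dec (cos ga) 0) as [e'|e']);
    try (left; lra); try (right; lra); rewrite e, e' in h; lra.
Qed.

(** The left side is the Wronskian of $\varphi_\gamma$ and $\vartheta_\gamma$ as computed by
    [Wr_lim]. *)
Lemma phi_theta_Wr : (RtoC Ath * RtoC Bphi - RtoC Aphi * RtoC Bth = - (1))%C.
Proof.
  assert (h := sin2_cos2 ga). unfold Rsqr in h.
  rewrite <- !RtoC_mult, <- RtoC_minus, <- RtoC_opp. f_equal.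
  unfold Aphi, Bphi, Ath, Bth. destruct (Rlt_dec be 0); lra.
Qed.

Lemma phi_spec_determined z u U : phi_spec ga al be z u U ->
  forall x, in11 x -> u x = ph z x /\ U x = Ph z x.
Proof.
  intros [h1 h2]. destruct bv_phi as [e1 e2]. rewrite <- e1, <- e2 in h2. exact (sol_determined _ _ _ _ _ _ _ hb h1 h2).
Qed.

Lemma theta_spec_determined z u U : theta_spec ga al be z u U -> forall x, in11 x ->
  u x = phiS al be (RtoC Ath) (RtoC Bth) z x /\ U x = PhiS al be (RtoC Ath) (RtoC Bth) z x.
Proof.
  intros [h1 h2]. destruct bv_theta as [e1 e2]. rewrite <- e1, <- e2 in h2. exact (sol_determined _ _ _ _ _ _ _ hb h1 h2).
Qed.

Lemma phi_spec_ph z : phi_spec ga al be z (ph z) (Ph z).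
Proof.
  split; [apply csol_sol, csol_phiS, hb|]. destruct bv_phi as [<- <-]. apply gbvL_phiS, hb.
Qed.

Lemma theta_spec_th z : theta_spec ga al be z (phiS al be (RtoC Ath) (RtoC Bth) z) (PhiS al be (RtoC Ath) (RtoC Bth) z).
Proof.
  split; [apply csol_sol, csol_phiS, hb|]. destruct bv_theta as [<- <-]. apply gbvL_phiS, hb.
Qed.

(** [is_m] holds for this value and for no other, because $\varphi_\gamma$, $\vartheta_\gamma$ and
    their boundary values at $1$ are unique; the choice operator therefore returns it. With total
    division this includes the zeros of [D]. *)
Lemma m_fun_eq z : m_fun ga de al be z = (- N z / D z)%C.
Proof.
  assert (Gp := gbvR_phiS al be (RtoC Aphi) (RtoC Bphi) z ha hb).
  assert (Gt := gbvR_phiS al be (RtoC Ath) (RtoC Bth) z ha hb).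
  assert (H : is_m ga de al be z (- N z / D z)%C).
  { split.
    - do 4 eexists. split; [apply phi_spec_ph|apply theta_spec_th].
    - intros u U v V hu hv. do 4 eexists. split; [|split].
      + apply gbvR_ext with (2 := Gp). intros x hx. destruct (phi_spec_determined z u U hu x hx) as [-> ->]. auto.
      + apply gbvR_ext with (2 := Gt). intros x hx. destruct (theta_spec_determined z v V hv x hx) as [-> ->]. auto.
      + reflexivity. }
  destruct (epsilon_spec (inhabits (RtoC 0)) (fun m => is_m ga de al be z m) (ex_intro _ _ H)) as [_ K].
  destruct (K _ _ _ _ (phi_spec_ph z) (theta_spec_th z)) as (a & b & a' & b' & h1 & h2 & E).
  destruct (gbvR_unique _ _ _ _ _ _ _ _ h1 Gp) as [e1 e2].
  destruct (gbvR_unique _ _ _ _ _ _ _ _ h2 Gt) as [e3 e4].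
  unfold m_fun. rewrite E, e1, e2, e3, e4. reflexivity.
Qed.

(** The condition makes the pair $(a,b)$ a multiple of $(-\sin\gamma,\cos\gamma)$, the boundary
    values of $\varphi_\gamma$, and boundary values at $-1$ determine a solution. *)
Lemma left_bc_multiple z u U a b : sol al be z u U -> gbvL al be u U a b ->
  (RtoC (sin ga) * b + RtoC (cos ga) * a = 0)%C ->
  exists k, forall x, in11 x -> u x = (k * ph z x)%C /\ U x = (k * Ph z x)%C.
Proof.
  intros hu hg bc. exists (b * RtoC (cos ga) - a * RtoC (sin ga))%C. set (k := (b * RtoC (cos ga) - a * RtoC (sin ga))%C).
  assert (sc : (RtoC (sin ga) * RtoC (sin ga) + RtoC (cos ga) * RtoC (cos ga) = 1)%C).
  { rewrite <- !RtoC_mult, <- RtoC_plus. f_equal. assert (h := sin2_cos2 ga). unfold Rsqr in h. lra. }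
  set (s := RtoC (sin ga)) in *. set (c := RtoC (cos ga)) in *.
  destruct bv_phi as [e1 e2]. rewrite RtoC_opp in e1. fold s in e1. fold c in e2.
  assert (ea : bvL0 be (k * RtoC Aphi) (k * RtoC Bphi) = a).
  { transitivity (k * bvL0 be (RtoC Aphi) (RtoC Bphi))%C; [unfold bvL0; destruct (Rlt_dec be 0); ring|].
    rewrite e1. unfold k. transitivity (a * (s * s + c * c) - c * (s * b + c * a))%C; [ring|]. rewrite sc, bc. ring. }
  assert (eb : bvL1 be (k * RtoC Aphi) (k * RtoC Bphi) = b).
  { transitivity (k * bvL1 be (RtoC Aphi) (RtoC Bphi))%C; [unfold bvL1; destruct (Rlt_dec be 0); ring|].
    rewrite e2. unfold k. transitivity (b * (s * s + c * c) - s * (s * b + c * a))%C; [ring|]. rewrite sc, bc. ring. }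
  rewrite <- ea, <- eb in hg. intros x hx.
  destruct (sol_determined _ _ _ _ _ _ _ hb hu hg x hx) as [-> ->].
  unfold ph, Ph, phiS, PhiS, comb. split; ring.
Qed.

Lemma right_bc_multiple z u U k a b : (forall x, in11 x -> u x = (k * ph z x)%C /\ U x = (k * Ph z x)%C) ->
  gbvR al be u U a b -> (RtoC (cos de) * a + RtoC (sin de) * b = k * D z)%C.
Proof.
  intros E hg.
  (* The zero solution enters as the second summand so that linearity gives the boundary values of a
     multiple. *)
  assert (G := gbvR_lin al be k _ _ _ _ _ _ _ _ (gbvR_phiS al be (RtoC Aphi) (RtoC Bphi) z ha hb)
     (gbvR_phiS al be 0 0 z ha hb)).
  assert (hg' : gbvR al be (fun x => k * phiS al be (RtoC Aphi) (RtoC Bphi) z x + phiS al be 0 0 z x)%C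
     (fun x => k * PhiS al be (RtoC Aphi) (RtoC Bphi) z x + PhiS al be 0 0 z x)%C a b).
  { apply gbvR_ext with (2 := hg). intros x hx. destruct (E x hx) as [-> ->].
    unfold ph, Ph, phiS, PhiS, comb. split; ring. }
  destruct (gbvR_unique _ _ _ _ _ _ _ _ hg' G) as [-> ->].
  unfold D, DD, Bd.
  assert (t : DD al be de 0 0 z = 0) by (rewrite DD_linear; ring). unfold DD, Bd in t.
  set (X := bvR0 al (coefR1 al be 0 0 z) (coefR2 al be 0 0 z)) in *.
  set (Y := bvR1 al (coefR1 al be 0 0 z) (coefR2 al be 0 0 z)) in *.
  match goal with |- _ = ?r => transitivity (r + (RtoC (cos de) * X + RtoC (sin de) * Y))%C; [ring|rewrite t; ring] end.
Qed.

(* Elements of [L^2] are functions on the whole line, so solutions are extended by zero. *)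
Definition ext0 (u : R -> C) (x : R) : C := if excluded_middle_informative (in11 x) then u x else RtoC 0.

Lemma ext0_in u x : in11 x -> ext0 u x = u x.
Proof. intros h. unfold ext0. destruct (excluded_middle_informative (in11 x)); tauto. Qed.

Lemma ext0_out u x : ~ in11 x -> ext0 u x = 0.
Proof. intros h. unfold ext0. destruct (excluded_middle_informative (in11 x)); tauto. Qed.

Lemma dom_max_of_isol z f w W K : isol al be z f w W -> L2w al be f ->
  (forall x, in11 x -> Cmod (w x) <= K * wt al be x) ->
  dom_max al be (ext0 w) W (fun x => z * ext0 w x + f x)%C.
Proof.
  intros [[q1 [q2 q3]] q4] hf hK.
  assert (aw : ACloc (ext0 w)) by (apply ACloc_eq with (2 := q1); intros x hx; symmetry; apply ext0_in, hx).
  split; [|split; [split; [|split]|split]]; auto.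
  - apply L2w_of_bound with K; auto; [apply ACloc_contR, aw|apply ext0_out|].
    intros x hx. rewrite ext0_in by exact hx. auto.
  - apply LebR.ae11_impl with (2 := q3). intros x hx d.
    apply dC_ext_in11 with (3 := d); [exact hx|]. intros t ht. symmetry. apply ext0_in, ht.
  - apply (L2w_plus al be (fun x => z * ext0 w x)%C f); [|exact hf].
    apply L2w_of_bound with (Cmod z * K); auto; [apply ACloc_contR, ACloc_scal, aw| |].
    + intros x hx. rewrite ext0_out by exact hx. ring.
    + intros x hx. rewrite ext0_in, Cmod_mult, Rmult_assoc by exact hx. apply Rmult_le_compat_l; [apply Cmod_ge_0|auto].
  - apply LebR.ae11_impl with (2 := q4). intros x hx d. rewrite ext0_in by exact hx. exact d.
Qed.

Lemma sol_of_domain z g1 G1 h1 g2 G2 h2 : dom_max al be g1 G1 h1 -> dom_max al be g2 G2 h2 ->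
  MC.ae11 (fun x => h1 x - z * g1 x = h2 x - z * g2 x)%C ->
  sol al be z (fun x => - (1) * g1 x + g2 x)%C (fun x => - (1) * G1 x + G2 x)%C.
Proof.
  intros (_ & (p1 & p2 & p3) & _ & p4) (_ & (q1 & q2 & q3) & _ & q4) E.
  split; [split; [|split]|].
  - apply ACloc_plus; [apply ACloc_scal, p1|exact q1].
  - apply ACloc_plus; [apply ACloc_scal, p2|exact q2].
  - apply LebR.ae11_impl with (2 := LebR.ae11_and _ _ p3 q3). intros x hx [d1 d2].
    eapply dC_eq; [apply dC_plus; [apply dC_scal|]; eassumption|]. cbv beta. ring.
  - apply LebR.ae11_impl with (2 := LebR.ae11_and _ _ E (LebR.ae11_and _ _ p4 q4)). intros x hx [e [d1 d2]].
    eapply dC_eq; [apply dC_plus; [apply dC_scal|]; eassumption|].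
    assert (e2 : h2 x = (h1 x - z * g1 x + z * g2 x)%C) by (rewrite e; ring). rewrite e2. ring.
Qed.

Lemma resolvent_of_DD z : D z <> RtoC 0 -> in_resolvent ga de al be z.
Proof.
  intros hD. split.
  - intros f hf. destruct (particular_solution al be z f ha hb hf) as (g & G & K & a & b & hs & hK & hl & hr).
    (* With this [k] the sum $k\varphi_\gamma+g$ satisfies the condition at $1$; at $-1$ both
       summands satisfy theirs. *)
    set (k := (- (RtoC (cos de) * a + RtoC (sin de) * b) / D z)%C).
    destruct (csol_wt_bound al be z (ph z) (Ph z) ha hb (csol_phiS al be _ _ z hb)) as [K' [hK' HK']].
    destruct (phi_spec_ph z) as [hp hpl].
    assert (hw : isol al be z f (fun x => k * ph z x + g x)%C (fun x => k * Ph z x + G x)%C).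
    { destruct hp as [[p1 [p2 p3]] p4]. destruct hs as [[q1 [q2 q3]] q4]. split; [split; [|split]|].
      - apply ACloc_plus; [apply ACloc_scal, p1|exact q1].
      - apply ACloc_plus; [apply ACloc_scal, p2|exact q2].
      - apply LebR.ae11_impl with (2 := LebR.ae11_and _ _ p3 q3). intros x hx [d1 d2].
        eapply dC_eq; [apply dC_plus; [apply dC_scal|]; eassumption|]. cbv beta. ring.
      - apply LebR.ae11_impl with (2 := LebR.ae11_and _ _ p4 q4). intros x hx [d1 d2].
        eapply dC_eq; [apply dC_plus; [apply dC_scal|]; eassumption|]. cbv beta. ring. }
    exists (ext0 (fun x => k * ph z x + g x)%C), (fun x => k * Ph z x + G x)%C,
      (fun x => z * ext0 (fun x => k * ph z x + g x) x + f x)%C.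
    assert (EE : forall x, in11 x -> (k * ph z x + g x)%C = ext0 (fun x => k * ph z x + g x)%C x /\
       (k * Ph z x + G x)%C = (k * Ph z x + G x)%C)
      by (intros x hx; split; [exact (eq_sym (ext0_in (fun x => (k * ph z x + g x)%C) x hx))|reflexivity]).
    split; [split; [|split]|].
    + apply dom_max_of_isol with (Cmod k * K' + K); auto. intros x hx.
      eapply Rle_trans; [apply Cmod_triangle|]. rewrite Cmod_mult. specialize (hK x hx). specialize (HK' x hx).
      assert (Cmod k * Cmod (ph z x) <= Cmod k * (K' * wt al be x)) by (apply Rmult_le_compat_l; [apply Cmod_ge_0|lra]). lra.
    + exists (k * RtoC (- sin ga) + 0)%C, (k * RtoC (cos ga) + 0)%C. split.
      * apply gbvL_ext with (1 := EE). apply gbvL_lin; assumption.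
      * rewrite RtoC_opp. ring.
    + do 2 eexists. split.
      * apply gbvR_ext with (1 := EE). apply gbvR_lin; [apply (gbvR_phiS al be (RtoC Aphi) (RtoC Bphi) z ha hb)|exact hr].
      * transitivity (k * D z + (RtoC (cos de) * a + RtoC (sin de) * b))%C; [unfold D, DD, Bd; ring|].
        unfold k. field. exact hD.
    + apply LebR.ae11_all. intros x hx. ring.
  (* The difference of two solutions is $k\varphi_\gamma$ by the condition at $-1$, and the
     condition at $1$ gives $kD(z)=0$. *)
  - intros g1 G1 h1 g2 G2 h2 (m1 & (a1 & b1 & l1 & c1) & (a1' & b1' & r1 & d1))
      (m2 & (a2 & b2 & l2 & c2) & (a2' & b2' & r2 & d2)) E.
    assert (hs := sol_of_domain z _ _ _ _ _ _ m1 m2 E).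
    destruct (left_bc_multiple z _ _ _ _ hs (gbvL_lin al be (- (1))%C _ _ _ _ _ _ _ _ l1 l2)) as [k hk].
    { transitivity (- (1) * (RtoC (sin ga) * b1 + RtoC (cos ga) * a1) + (RtoC (sin ga) * b2 + RtoC (cos ga) * a2))%C; [ring|].
      rewrite c1, c2. ring. }
    assert (e := right_bc_multiple z _ _ k _ _ hk (gbvR_lin al be (- (1))%C _ _ _ _ _ _ _ _ r1 r2)).
    assert (e' : (k * D z)%C = 0).
    { rewrite <- e. transitivity (- (1) * (RtoC (sin de) * b1' + RtoC (cos de) * a1') + (RtoC (sin de) * b2' + RtoC (cos de) * a2'))%C; [ring|].
      rewrite d1, d2. ring. }
    assert (k0 : k = 0).
    { replace k with (k * D z * / D z)%C by (field; exact hD). rewrite e'. ring. }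
    apply LebR.ae11_all. intros x hx. destruct (hk x hx) as [ex _]. rewrite k0 in ex.
    replace (g2 x) with (g1 x + (- (1) * g1 x + g2 x))%C by ring. rewrite ex. ring.
Qed.

Lemma eigenfun_multiple z g G h : eigenfun ga de al be z g G h ->
  D z = 0 /\ exists k, k <> RtoC 0 /\ forall x, in11 x -> g x = (k * ph z x)%C.
Proof.
  intros ((m1 & (a & b & l & c) & (a' & b' & r & d)) & nz & E).
  assert (hs : sol al be z g G).
  { destruct m1 as (_ & q & _ & p). split; [exact q|].
    apply LebR.ae11_impl with (2 := LebR.ae11_and _ _ E p). intros x hx [e dd]. rewrite <- e. exact dd. }
  destruct (left_bc_multiple z g G a b hs l c) as [k hk].
  assert (e := right_bc_multiple z g G k a' b' hk r).
  assert (k0 : k <> RtoC 0).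
  { intros k0. apply nz, LebR.ae11_all. intros x hx. rewrite (proj1 (hk x hx)), k0. ring. }
  split.
  - replace (D z) with (/ k * (k * D z))%C by (field; exact k0). rewrite <- e.
    transitivity (/ k * (RtoC (sin de) * b' + RtoC (cos de) * a'))%C; [ring|]. rewrite d. ring.
  - exists k. split; [exact k0|]. intros x hx. apply (hk x hx).
Qed.

(** A primitive of [u] has derivative zero almost everywhere, hence is constant; yet its derivative
    is [u] everywhere. *)
Lemma csol_ae_zero z u U : csol al be z u U -> MC.ae11 (fun x => u x = 0) -> forall x, in11 x -> u x = 0.
Proof.
  intros H E.
  destruct (primitive_complex u _ (fun x hx => proj1 (H x hx))) as [J HJ].
  assert (aJ : ACloc J).
  { apply ACloc_of_C1 with (1 := HJ). intros a b h1 h2 h3.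
    destruct (csol_continuous_bounded al be z u U a b H h1 h2 h3) as [B [_ HB]]. exists B. intros x hx. apply HB, hx. }
  assert (cJ : forall x y, in11 x -> in11 y -> J x = J y).
  { apply ac_constant; [exact aJ|]. apply LebR.ae11_impl with (2 := E). intros x hx e. rewrite <- e. apply HJ, hx. }
  intros x hx. apply (derive_unique_C J x); [apply HJ, hx|].
  apply dC_ext_in11 with (fun _ => J x); [exact hx| |apply dC_const]. intros t ht. apply cJ; auto.
Qed.

Lemma eigenvalue_of_DD z : D z = 0 -> is_eigenvalue ga de al be z.
Proof.
  intros hD. destruct (phi_spec_ph z) as [hp hpl].
  destruct (csol_wt_bound al be z (ph z) (Ph z) ha hb (csol_phiS al be _ _ z hb)) as [K [hK HK]].
  assert (h0 : L2w al be (fun _ => RtoC 0)).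
  { apply L2w_of_bound with 0; auto.
    - apply (derive_contR _ (fun _ => RtoC 0)). intros x _. apply dC_const.
    - intros x hx. rewrite Cmod_0. lra. }
  assert (hi : isol al be z (fun _ => RtoC 0) (ph z) (Ph z)).
  { destruct hp as [q p]. split; [exact q|]. apply LebR.ae11_impl with (2 := p). intros x hx d.
    eapply dC_eq; [exact d|]. ring. }
  assert (EE : forall x, in11 x -> ph z x = ext0 (ph z) x /\ Ph z x = Ph z x)
    by (intros x hx; split; [symmetry; apply (ext0_in _ x hx)|reflexivity]).
  exists (ext0 (ph z)), (Ph z), (fun x => z * ext0 (ph z) x + 0)%C. split; [split; [|split]|split].
  - apply dom_max_of_isol with K; auto.
  - do 2 eexists. split; [apply gbvL_ext with (1 := EE), hpl|]. rewrite RtoC_opp. ring.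
  - do 2 eexists. split; [apply gbvR_ext with (1 := EE); apply (gbvR_phiS al be (RtoC Aphi) (RtoC Bphi) z ha hb)|].
    rewrite Cplus_comm. exact hD.
  - intros E. assert (hc := csol_phiS al be (RtoC Aphi) (RtoC Bphi) z hb).
    assert (zz : forall x, in11 x -> ph z x = 0).
    { apply (csol_ae_zero z (ph z) (Ph z) hc). apply LebR.ae11_impl with (2 := E). intros x hx e.
      now rewrite ext0_in in e. }
    destruct (phiS_nonzero al be (RtoC Aphi) (RtoC Bphi) z hb) as [a b].
    + intros x hx. split; [apply zz, hx|apply (csol_zero al be z _ _ hc zz x hx)].
    + apply RtoC_inj in a. apply RtoC_inj in b. destruct phi_nontrivial; tauto.
  - apply LebR.ae11_all. intros x hx. ring.
Qed.

Lemma eigenvalue_iff z : is_eigenvalue ga de al be z <-> D z = 0.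
Proof.
  split; [|apply eigenvalue_of_DD]. intros (g & G & h & H). apply (eigenfun_multiple z g G h H).
Qed.

Lemma eigenvalue_simple z : is_eigenvalue ga de al be z -> simple_eigenvalue ga de al be z.
Proof.
  intros H. split; [exact H|]. intros g1 G1 h1 g2 G2 h2 H1 H2.
  destruct (eigenfun_multiple z _ _ _ H1) as (_ & k1 & n1 & E1).
  destruct (eigenfun_multiple z _ _ _ H2) as (_ & k2 & n2 & E2).
  exists (k2 / k1)%C. apply LebR.ae11_all. intros x hx. rewrite E1, E2 by exact hx. field. exact n1.
Qed.

(* [phi] and [theta] cannot both satisfy the boundary condition at [1]: both would be multiples of [chi],
   but their Wronskian is not zero. *)
Lemma numerator_nonzero z : D z = 0 -> N z <> RtoC 0.
Proof.
  intros hD hN. assert (PF := at_right_proper). assert (FF : Filter (at_right (-1))) by typeclasses eauto.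
  destruct (Bd_zero _ _ _ _ hD) as [k [e1 e2]]. destruct (Bd_zero _ _ _ _ hN) as [k' [f1 f2]].
  assert (l := Wr_lim _ _ _ _ _ _ _ _ _ _ (asyL_comb al be z (RtoC Aphi) (RtoC Bphi) hb)
    (asyL_comb al be z (RtoC Ath) (RtoC Bth) hb)). rewrite phi_theta_Wr in l.
  assert (l0 : Clim (at_right (-1)) (Wr (ph z) (Ph z) (phiS al be (RtoC Ath) (RtoC Bth) z) (PhiS al be (RtoC Ath) (RtoC Bth) z)) 0).
  { apply Clim_ext_loc with (fun _ => RtoC 0); auto; [|apply Clim_const; auto].
    generalize in11_at_right. apply filter_imp. intros x hx. unfold Wr, ph, Ph.
    destruct (phiS_right al be (RtoC Aphi) (RtoC Bphi) z ha hb x hx) as [-> ->].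
    destruct (phiS_right al be (RtoC Ath) (RtoC Bth) z ha hb x hx) as [-> ->].
    rewrite e1, e2, f1, f2. unfold comb. ring. }
  assert (e := Clim_unique _ _ _ _ l l0). rewrite <- RtoC_opp in e. apply RtoC_inj in e. lra.
Qed.

(** * Poles of the $m$-function *)

Lemma slope_D z0 : exists d, Clim (locally' z0) (fun z => (D z - D z0) / (z - z0))%C d.
Proof.
  destruct (DD_differentiable al be de (RtoC Aphi) (RtoC Bphi) ha hb z0) as (d & K & _ & H).
  exists d. apply (Clim_slope _ _ _ _ H).
Qed.

Lemma slope_N z0 : exists d, Clim (locally' z0) (fun z => (N z - N z0) / (z - z0))%C d.
Proof.
  destruct (DD_differentiable al be de (RtoC Ath) (RtoC Bth) ha hb z0) as (d & K & _ & H).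
  exists d. apply (Clim_slope _ _ _ _ H).
Qed.

Lemma slope_m z0 : D z0 <> RtoC 0 ->
  exists l, Clim (locally' z0) (fun z => (m_fun ga de al be z - m_fun ga de al be z0) / (z - z0))%C l.
Proof.
  intros hD. destruct (slope_D z0) as [d hd]. destruct (slope_N z0) as [n hn].
  assert (FF : Filter (locally' z0)) by (assert (h := punctured_proper z0); typeclasses eauto).
  destruct (Clim_slope_div N D z0 n d hD hn hd) as [l hl]. exists (- l)%C.
  apply Clim_opp in hl; auto. revert hl. apply Clim_ext; auto. intros z. rewrite !m_fun_eq. unfold Cdiv. ring.
Qed.

(** $(z-z_0)m(z)$ tends to $-N(z_0)/D'(z_0)$, which is finite because the zero of [D] is simple and
    nonzero because [N] does not vanish there. A simple zero is isolated, which gives the punctured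
    disc of resolvent points. *)
Lemma pole_of_DD z0 : D z0 = 0 -> simple_pole (m_fun ga de al be) (in_resolvent ga de al be) z0.
Proof.
  intros hD.
  assert (FF : Filter (locally' z0)) by (assert (h := punctured_proper z0); typeclasses eauto).
  destruct (DD_simple_zero al be de Aphi Bphi z0 ha hb phi_nontrivial hD) as (d & K & hd & hK & H).
  assert (sD : Clim (locally' z0) (fun z => (D z - D z0) / (z - z0))%C d).
  { apply (Clim_slope D z0 d K). intros z hz. rewrite hD.
    replace (D z - 0 - (z - z0) * d)%C with (D z - (z - z0) * d)%C by ring. apply H, hz. }
  destruct (slope_N z0) as [n hn].
  assert (nD : locally' z0 (fun z => D z <> RtoC 0)).
  { generalize (filter_and _ _ (punctured_ne z0) (Clim_ne _ _ _ sD hd)). apply filter_imp.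
    intros z [h1 h2] e. apply h2. rewrite e, hD. unfold Cdiv. ring. }
  assert (hl : (- N z0 * / d)%C <> RtoC 0).
  { apply Cmult_neq_0.
    - intros e. apply (numerator_nonzero z0 hD). replace (N z0) with (- - N z0)%C by ring. rewrite e. ring.
    - intros e. assert (e1 : (d * / d = 1)%C) by (field; exact hd). rewrite e in e1.
      apply (RtoC_neq0 1); [lra|]. rewrite <- e1. ring. }
  assert (lim : Clim (locally' z0) (fun z => (z - z0) * m_fun ga de al be z)%C (- N z0 * / d)%C).
  { apply Clim_ext_loc with (fun z => - N z * / ((D z - D z0) / (z - z0)))%C; auto.
    - generalize (filter_and _ _ (punctured_ne z0) nD). apply filter_imp. intros z [h1 h2].
      rewrite m_fun_eq, hD. field. repeat split; auto.
    - apply Clim_mult; auto; [apply Clim_opp; auto; apply Clim_of_slope with n, hn|apply Clim_inv; auto]. }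
  split; [split|].
  - destruct (proj1 (punctured_iff _ _) nD) as [e [he He]]. exists e. split; [exact he|]. intros z hz. split.
    + apply resolvent_of_DD, He, hz.
    + destruct (slope_m z (He z hz)) as [l h]. apply ex_derive_of_slope with l, h.
  - apply infinite_of_Clim_mult with (1 := hl) (2 := lim).
  - exists (- N z0 * / d)%C. split; [exact hl|]. apply Clim_filterlim; auto.
Qed.

(** Where [D] does not vanish, the difference quotients of $m$ converge; so $m$ has a finite limit
    and its modulus cannot tend to infinity. *)
Lemma DD_of_pole z0 : is_pole (m_fun ga de al be) (in_resolvent ga de al be) z0 -> D z0 = 0.
Proof.
  intros [_ h]. apply NNPP. intros hD. destruct (slope_m z0 hD) as [l hl].
  exact (not_infinite_of_Clim _ _ _ (Clim_of_slope _ _ _ hl) h).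
Qed.
End MFunction.

(** * The formula in terms of $y_1$ and $y_2$ *)

Definition scale2 (al be : R) : R :=
  if Req_EM_T be 0 then - Rpower 2 (al + 1) else be * Rpower 2 (al + 1).

Lemma scale2_neq0 al be : scale2 al be <> 0.
Proof.
  assert (h := Rpower_pos 2 (al + 1)). unfold scale2. destruct (Req_EM_T be 0); [lra|].
  apply Rmult_integral_contrapositive_currified; lra.
Qed.

Lemma y1_v1 al be z x : -1 < be -> y1 al be z x = v1 al be z x.
Proof. apply y1_CPS. Qed.

Lemma y2_v2 al be z x : -1 < be < 1 -> y2 al be z x = (RtoC (scale2 al be) * v2 al be z x)%C.
Proof.
  intros hb. assert (h := Rpower_pos 2 (al + 1)). unfold scale2, v2. destruct (Req_EM_T be 0) as [e|e].
  - subst be. rewrite y2_log_CPS, Cmult_assoc, (RtoC_mult_eq _ _ 1) by (field; lra). ring.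
  - rewrite y2_CPS by lra. rewrite Cmult_assoc. f_equal. symmetry. apply RtoC_mult_eq. field. lra.
Qed.

(** For $b=0$ both sides are 0 by the convention $/0=0$, so the formulas for $m$ follow whatever the
    value of the denominator. *)
Lemma Cdiv_cancel (k k' a b : C) : k <> RtoC 0 -> k' = (- k)%C -> ((k * a) / (k' * b) = - a / b)%C.
Proof.
  intros hk ->. destruct (classic (b = RtoC 0)) as [e|e].
  - subst b. replace (- k * 0)%C with (RtoC 0) by ring.
    assert (i0 : (/ 0)%C = RtoC 0) by (unfold Cinv; simpl; unfold RtoC, Rdiv; f_equal; ring).
    unfold Cdiv. rewrite i0. ring.
  - field. auto.
Qed.

Theorem theorem5p1 (al be ga de : R) :
  (-1 < al < 1)%R -> (-1 < be < 1)%R -> (0 <= ga < PI)%R -> (0 <= de < PI)%R ->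
  (forall z : C, in_resolvent ga de al be z ->
     exists (a1 b1 a2 b2 : C) (Q1 Q2 : R -> C),
       (forall x, in11 x ->
          is_derive (y1 al be z) x (RtoC (/ p_ab al be x) * Q1 x)%C) /\
       (forall x, in11 x ->
          is_derive (y2 al be z) x (RtoC (/ p_ab al be x) * Q2 x)%C) /\
       gbvR al be (y1 al be z) Q1 a1 b1 /\
       gbvR al be (y2 al be z) Q2 a2 b2 /\
       let Y1 := (RtoC (cos de) * a1 + RtoC (sin de) * b1)%C in
       let Y2 := (RtoC (cos de) * a2 + RtoC (sin de) * b2)%C in
       let c := RtoC (Rpower 2 (al + 1)) in
       let sg := RtoC (sin ga) in
       let cg := RtoC (cos ga) in
       ((be < 0)%R -> m_fun ga de al be z =
          ((RtoC be * c * cg * Y1 - sg * Y2) / (RtoC be * c * sg * Y1 + cg * Y2))%C) /\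
       (be = 0 -> m_fun ga de al be z =
          ((- c * sg * Y1 + cg * Y2) / (c * cg * Y1 + sg * Y2))%C) /\
       ((0 < be)%R -> m_fun ga de al be z =
          ((RtoC be * c * sg * Y1 + cg * Y2) / (- RtoC be * c * cg * Y1 + sg * Y2))%C)) /\
  (forall z0 : C,
     is_pole (m_fun ga de al be) (in_resolvent ga de al be) z0 <->
     is_eigenvalue ga de al be z0) /\
  (forall z0 : C,
     is_pole (m_fun ga de al be) (in_resolvent ga de al be) z0 ->
     simple_pole (m_fun ga de al be) (in_resolvent ga de al be) z0) /\
  (forall z0 : C, is_eigenvalue ga de al be z0 -> simple_eigenvalue ga de al be z0).
Proof.
  intros ha hb _ _. split; [|split; [|split]].
  - intros z _. set (k := RtoC (scale2 al be)).
    assert (hk : k <> RtoC 0) by apply RtoC_neq0, scale2_neq0.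
    (* In the basis $v_1,v_2$ the solutions $y_1$ and $y_2$ have coefficients $(1,0)$ and $(0,k)$,
       so they are instances of [phiS]. *)
    assert (g1 := gbvR_phiS al be 1 0 z ha hb). assert (g2 := gbvR_phiS al be 0 k z ha hb).
    exists (bvR0 al (coefR1 al be 1 0 z) (coefR2 al be 1 0 z)), (bvR1 al (coefR1 al be 1 0 z) (coefR2 al be 1 0 z)),
      (bvR0 al (coefR1 al be 0 k z) (coefR2 al be 0 k z)), (bvR1 al (coefR1 al be 0 k z) (coefR2 al be 0 k z)),
      (PhiS al be 1 0 z), (PhiS al be 0 k z).
    assert (E1 : forall x, phiS al be 1 0 z x = y1 al be z x).
    { intros x. rewrite y1_v1 by lra. unfold phiS, comb. ring. }
    assert (E2 : forall x, phiS al be 0 k z x = y2 al be z x).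
    { intros x. rewrite y2_v2 by exact hb. unfold phiS, comb. fold k. ring. }
    split; [|split; [|split; [|split]]].
    + intros x hx. apply dC_ext_in11 with (phiS al be 1 0 z); [exact hx|intros t _; apply E1|].
      exact (proj1 (csol_phiS al be 1 0 z hb x hx)).
    + intros x hx. apply dC_ext_in11 with (phiS al be 0 k z); [exact hx|intros t _; apply E2|].
      exact (proj1 (csol_phiS al be 0 k z hb x hx)).
    + apply gbvR_ext with (2 := g1). intros x _. auto.
    + apply gbvR_ext with (2 := g2). intros x _. auto.
    + cbv zeta. rewrite (m_fun_eq al be ga de ha hb z).
      fold (Bd al de (coefR1 al be 1 0 z) (coefR2 al be 1 0 z)). fold (DD al be de 1 0 z).
      fold (Bd al de (coefR1 al be 0 k z) (coefR2 al be 0 k z)). fold (DD al be de 0 k z).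
      (* Numerator and denominator become combinations of the boundary forms [X] of $v_1$ and [Y] of
         $v_2$; here $Y_1$ is [X] and $Y_2$ is [k] times [Y]. *)
      rewrite (DD_linear al be de 0 k z), (DD_linear al be de (RtoC (Ath be ga)) _ z), (DD_linear al be de (RtoC (Aphi be ga)) _ z).
      set (X := DD al be de 1 0 z). set (Y := DD al be de 0 1 z).
      assert (ck : RtoC (Rpower 2 (al + 1)) <> RtoC 0) by (apply RtoC_neq0, Rgt_not_eq, Rpower_pos).
      unfold Ath, Bth, Aphi, Bphi, k, scale2 in *.
      split; [|split]; intros h; (destruct (Rlt_dec be 0); [try lra|try lra]); (destruct (Req_EM_T be 0); [try lra|try lra]);
        rewrite ?RtoC_mult, ?RtoC_opp in *.
      (* In each of the three cases the stated fraction is $-N/D$ expanded by the scale of $y_2$: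
         the numerator is the scale times $N$, the denominator minus the scale times $D$. *)
      * symmetry. etransitivity; [|apply (Cdiv_cancel (RtoC be * RtoC (Rpower 2 (al + 1))) _ _ _ hk eq_refl)].
        f_equal; ring.
      * assert (hk' : (- RtoC (Rpower 2 (al + 1)))%C <> RtoC 0) by exact hk.
        symmetry. etransitivity; [|apply (Cdiv_cancel _ _ _ _ hk' eq_refl)]. f_equal; ring.
      * symmetry. etransitivity; [|apply (Cdiv_cancel (RtoC be * RtoC (Rpower 2 (al + 1))) _ _ _ hk eq_refl)].
        f_equal; ring.
  - intros z0. rewrite (eigenvalue_iff al be ga de ha hb z0). split.
    + apply (DD_of_pole al be ga de ha hb z0).
    + intros h. exact (proj1 (pole_of_DD al be ga de ha hb z0 h)).
  - intros z0 h. apply (pole_of_DD al be ga de ha hb z0), (DD_of_pole al be ga de ha hb z0 h).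
  - intros z0. apply (eigenvalue_simple al be ga de ha hb z0).
Qed.
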